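(* Let $(\xi_t)_{t\ge0}$, $\xi_0=e$, be the wrapped (shifted) Brownian motion on $G$. Then under $P$ the law of $\xi_t$ has density, with respect to normalised Haar measure $dg$ on $G$, $$\sum_{\lambda\in\Lambda^+}d_\lambda\,\chi_\lambda(g)\,e^{-(\|\lambda+\rho\|^2-\|\rho\|^2)t/2},\qquad t>0,\ g\in G;$$ that is, for every $f\in C^\infty(G)$ and $t>0$, $$\mathbb E^P[f(\xi_t)]=\int_G f(g)\sum_{\lambda\in\Lambda^+}d_\lambda\,\chi_\lambda(g)\,e^{-(\|\lambda+\rho\|^2-\|\rho\|^2)t/2}\,dg .$$
   Context: $G$ is a compact, connected, simply connected Lie group of dimension $n$ with identity $e$ and Lie algebra $\mathfrak g$, $T$ a maximal torus with Lie algebra $\mathfrak t$. $\mathfrak g$ carries the $\mathrm{Ad}$-invariant inner product given by minus the Killing form, which identifies $\mathfrak g$ with Euclidean $\mathbb R^n$ and defines norms on $\mathfrak g^*$ and $\mathfrak t^*$. Roots and weights are taken real-valued on $\mathfrak t$; $\Sigma^+$ is a choice of positive roots, $\rho=\tfrac12\sum_{\alpha\in\Sigma^+}\alpha$, and $\Lambda^+\subset\mathfrak t^*$ is the set of dominant integral weights. For $\lambda\in\Lambda^+$, $\chi_\lambda$ and $d_\lambda$ are the character and dimension of the irreducible representation of $G$ with highest weight $\lambda$. Haar measure $dg$ has total mass $1$. Let $X_1,\dots,X_n$ be the left-invariant vector fields on $G$ of an orthonormal basis of $\mathfrak g$. Under the probability measure $P$, the process $(\tilde\xi_t)$ with $\tilde\xi_0=e$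 is Brownian motion on $G$: for every $f\in C^\infty(G)$ $$f(\tilde\xi_t)=f(e)+\sum_{i=1}^n\int_0^t (X_if)(\tilde\xi_s)\,dB^{(i)}_s+\tfrac12\sum_{i=1}^n\int_0^t (X_i^2f)(\tilde\xi_s)\,ds,$$ with $(B_t)$ a standard Brownian motion on $\mathfrak g\cong\mathbb R^n$. The wrapped (shifted) Brownian motion $\xi_t$ is this process considered together with the killed (Feynman–Kac) measure $d\tilde P=e^{-Ct}\,dP$ at time $t$, $C=\tfrac12\|\rho\|^2$; thus $\mathbb E^P[f(\xi_t)]=e^{\|\rho\|^2t/2}\,\mathbb E^{\tilde P}[f(\xi_t)]=\mathbb E^P[f(\tilde\xi_t)]$. *)

(* Defs.v *)
From HB Require Import structures.
From mathcomp Require Import all_boot all_order all_algebra finmap.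
From mathcomp Require Import complex.
From mathcomp Require Import all_classical all_reals all_analysis.
From mathcomp Require summability.

Set Implicit Arguments.
Unset Strict Implicit.
Unset Printing Implicit Defensive.

Import Order.TTheory GRing.Theory Num.Theory.
Import numFieldNormedType.Exports.

Local Open Scope classical_set_scope.
Local Open Scope ring_scope.

(** * Smooth manifolds and Lie groups *)

(* [f] has iterated directional derivatives of all orders up to [k], all of
   them continuous, at every point of the open set [U]; for finite-dimensional
   [V] this is the usual class C^k. *)
Fixpoint Ck_on (R : realType) (V W : normedModType R) (k : nat) (U : set V)
    (f : V -> W) : Prop :=
  (forall x, U x -> {for x, continuous f}) /\
  match k with
  | 0 => True
  | k'.+1 => forall v : V,
      (forall x, U x -> derivable f x v) /\ Ck_on k' U (fun x => 'D_v f x)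
  end.

Definition smooth_on (R : realType) (V W : normedModType R) (U : set V)
  (f : V -> W) : Prop := forall k, Ck_on k U f.

(* [chart_map] and [chart_inv] are total functions; only their values on
   [chart_dom] and [chart_cod] are meaningful. *)
Record chart (R : realType) (n : nat) (M : Type) := Chart {
  chart_dom : set M;
  chart_map : M -> 'rV[R]_n;
  chart_inv : 'rV[R]_n -> M }.

Definition chart_cod (R : realType) (n : nat) (M : Type) (c : chart R n M) :
  set 'rV[R]_n := chart_map c @` chart_dom c.

Definition is_chart (R : realType) (n : nat) (M : topologicalType)
    (c : chart R n M) : Prop :=
  [/\ open (chart_dom c), open (chart_cod c),
      forall x, chart_dom c x -> chart_inv c (chart_map c x) = x,
      forall x, chart_dom c x -> {for x, continuous (chart_map c)} &
      forall u, chart_cod c u -> {for u, continuous (chart_inv c)}].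

(* The point provided by [PointedTopological] plays no role; it is only there
   because the library puts sigma-algebras on pointed types. *)
HB.mixin Record isLieGroup (R : realType) (n : nat) G of Group G &
    PointedTopological G := {
  atlas : set (chart R n G);
  lie_hausdorff : hausdorff_space G;
  lie_second_countable : @second_countable G;
  atlas_chart : forall c, atlas c -> is_chart c;
  atlas_cover : forall x : G, exists2 c, atlas c & chart_dom c x;
  atlas_compatible : forall c1 c2, atlas c1 -> atlas c2 ->
    smooth_on (chart_map c1 @` (chart_dom c1 `&` chart_dom c2))
      (chart_map c2 \o chart_inv c1);
  lie_mul_continuous : continuous (fun p : G * G => (p.1 * p.2)%g);
  lie_inv_continuous : continuous (fun x : G => x^-1%g);
  lie_mul_smooth : forall c1 c2 c3, atlas c1 -> atlas c2 -> atlas c3 ->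
    smooth_on
      [set u : 'rV[R]_n * 'rV[R]_n | [/\ chart_cod c1 u.1, chart_cod c2 u.2 &
         chart_dom c3 (chart_inv c1 u.1 * chart_inv c2 u.2)%g]]
      (fun u : 'rV[R]_n * 'rV[R]_n =>
         chart_map c3 (chart_inv c1 u.1 * chart_inv c2 u.2)%g);
  lie_inv_smooth : forall c1 c2, atlas c1 -> atlas c2 ->
    smooth_on
      [set u | chart_cod c1 u /\ chart_dom c2 (chart_inv c1 u)^-1%g]
      (fun u => chart_map c2 (chart_inv c1 u)^-1%g) }.

#[short(type="lieGroupType")]
HB.structure Definition LieGroup (R : realType) (n : nat) :=
  {G of isLieGroup R n G & Group G & PointedTopological G}.

Definition borel (T : topologicalType) := g_sigma_algebraType (@open T).
HB.instance Definition _ (T : ptopologicalType) :=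
  Measurable.copy (borel T) (g_sigma_algebraType (@open T)).

Definition simply_connected (R : realType) (M : topologicalType) : Prop :=
  forall gamma : R -> M,
    {within `[0, 1], continuous gamma} -> gamma 0 = gamma 1 ->
  exists2 H : R * R -> M,
    {within [set` `[0 : R, 1]] `*` [set` `[0 : R, 1]], continuous H} &
    forall s : R, s \in `[0, 1] ->
      [/\ H (s, 0) = gamma s, H (s, 1) = gamma 0,
          H (0, s) = gamma 0 & H (1, s) = gamma 0].

Section LieTheory.
Context {R : realType} {n : nat} {G : lieGroupType R n}.
Implicit Types (f : G -> R) (D : (G -> R) -> (G -> R)) (v w : 'rV[R]_n).

Definition smooth_fun f : Prop :=
  forall c : chart R n G, atlas c ->
    smooth_on (chart_cod c) (f \o chart_inv c : 'rV[R]_n -> R^o).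

(** * The Lie algebra, as left-invariant derivations of C^oo(G) *)

(* The values of [D] on functions that are not smooth are irrelevant. *)
Definition left_invariant_vf D : Prop :=
  [/\ forall f, smooth_fun f -> smooth_fun (D f),
      forall (a : R) f g, smooth_fun f -> smooth_fun g ->
        D (fun x => a * f x + g x) = (fun x => a * D f x + D g x),
      forall f g, smooth_fun f -> smooth_fun g ->
        D (fun x => f x * g x) = (fun x => D f x * g x + f x * D g x) &
      forall (h : G) f, smooth_fun f ->
        D (fun x => f (h * x)%g) = (fun x => D f (h * x)%g)].

(* A basis X of the Lie algebra identifies it with R^n: the row vector [v]
   stands for the left-invariant vector field \sum_i v_i X_i. *)
Definition frame_vf (X : 'I_n -> (G -> R) -> (G -> R)) v : (G -> R) -> (G -> R) :=
  fun f x => \sum_(i < n) v 0 i * X i f x.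

Definition lie_basis (X : 'I_n -> (G -> R) -> (G -> R)) : Prop :=
  (forall i, left_invariant_vf (X i)) /\
  (forall D, left_invariant_vf D ->
     exists! v, forall f, smooth_fun f -> D f = frame_vf X v f).

Section Coordinates.
Variable X : 'I_n -> (G -> R) -> (G -> R).

Definition lie_bracket v w : 'rV[R]_n :=
  xget 0 [set u | forall f, smooth_fun f -> frame_vf X u f =
    (fun x => frame_vf X v (frame_vf X w f) x -
              frame_vf X w (frame_vf X v f) x)].

(* Acts on row vectors from the right: w *m ad v = [v, w]. *)
Definition ad_mx v : 'M[R]_n := lin1_mx (lie_bracket v).

Definition killing v w : R := \tr (ad_mx v *m ad_mx w).

Definition lie_inner v w : R := - killing v w.

Definition orthonormal_basis : Prop :=
  lie_basis X /\
  forall i j : 'I_n, lie_inner (delta_mx 0 i) (delta_mx 0 j) = (i == j)%:R.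

(* gamma(s) = exp(s v), as the integral curve of the left-invariant vector
   field v through the identity. *)
Definition one_parameter_subgroup v (gamma : R -> G) : Prop :=
  [/\ gamma 0 = 1%g, continuous gamma &
      forall f, smooth_fun f -> forall s : R,
        is_derive (s : R^o) 1 (f \o gamma : R^o -> R^o)
          (frame_vf X v f (gamma s))].

(** * Maximal tori, roots and weights *)

Definition is_torus (T : set G) : Prop :=
  [/\ T 1%g, forall x y, T x -> T y -> T (x * y^-1)%g,
      forall x y, T x -> T y -> (x * y = y * x)%g,
      compact T & connected T].

Definition maximal_torus (T : set G) : Prop :=
  is_torus T /\ forall T', is_torus T' -> T `<=` T' -> T' = T.

Definition lie_algebra_of (T : set G) (t : {vspace 'rV[R]_n}) : Prop :=
  forall v, v \in t <->
    exists2 gamma, one_parameter_subgroup v gamma & forall s, T (gamma s).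

Definition dual (t : {vspace 'rV[R]_n}) := 'Hom(subvs_of t, R^o).

Section Dual.
Variable t : {vspace 'rV[R]_n}.
Implicit Types (al be la mu : dual t) (S : set (dual t)).

(* The element of t representing [la] for the inner product. *)
Definition sharp la : subvs_of t :=
  xget 0 [set h | forall x : subvs_of t, la x = lie_inner (vsval h) (vsval x)].

Definition dual_inner la mu : R :=
  lie_inner (vsval (sharp la)) (vsval (sharp mu)).

Definition dual_normsq la : R := dual_inner la la.

(* Roots are real-valued on t: [H, Z] = i al(H) Z for some nonzero Z in the
   complexified Lie algebra. *)
Definition is_root al : Prop :=
  al != 0 /\
  exists2 Z : 'rV[R[i]]_n, Z != 0 &
    forall H : subvs_of t,
      Z *m map_mx (real_complex R) (ad_mx (vsval H)) = (0 +i* al H)%C *: Z.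

Definition positive_roots S : Prop :=
  [/\ S `<=` is_root,
      forall al, is_root al -> S al \/ S (- al),
      forall al, S al -> ~ S (- al) &
      forall al be, S al -> S be -> is_root (al + be) -> S (al + be)].

Definition rho S : dual t := 2^-1 *: \sum_(al \in S) al.

Definition dominant_integral S : set (dual t) :=
  [set la | forall al, S al ->
     exists k : nat, 2 * dual_inner la al / dual_inner al al = k%:R].

(** * Irreducible representations *)

Definition representation (d : nat) (p : G -> 'M[R[i]]_d) : Prop :=
  [/\ p 1%g = 1%:M, forall x y, p (x * y)%g = p x *m p y &
      forall i j, continuous (fun x => complex.Re (p x i j)) /\
                  continuous (fun x => complex.Im (p x i j))].

(* Subspaces of C^d are encoded by the row space of U; the transpose makes
   them subspaces of column vectors, on which p acts from the left. *)
Definition irreducible_representation (d : nat) (p : G -> 'M[R[i]]_d) : Prop :=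
  [/\ representation p, (0 < d)%N &
      forall U : 'M[R[i]]_d, (forall x, (U *m (p x)^T <= U)%MS) ->
        \rank U = 0%N \/ \rank U = d].

Definition is_weight (d : nat) (p : G -> 'M[R[i]]_d) la : Prop :=
  exists2 v : 'cV[R[i]]_d, v != 0 &
    forall (H : subvs_of t) (gamma : R -> G),
      one_parameter_subgroup (vsval H) gamma ->
      p (gamma 1) *m v = (cos (la H) +i* sin (la H))%C *: v.

Definition highest_weight S (d : nat) (p : G -> 'M[R[i]]_d) la : Prop :=
  is_weight p la /\
  forall mu, is_weight p mu ->
    exists m : dual t -> nat, la - mu = \sum_(al \in S) (al *+ m al).

(* The irreducible representation of highest weight [la], unique up to
   isomorphism. The zero-dimensional default is only used when there is none,
   which does not happen for dominant integral weights when G is compact,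
   connected and simply connected. *)
Definition irrep S la : {d : nat & G -> 'M[R[i]]_d} :=
  match pselect (exists q : {d : nat & G -> 'M[R[i]]_d},
    irreducible_representation (projT2 q) /\
    highest_weight S (projT2 q) la) with
  | left ex => projT1 (cid ex)
  | right _ => existT _ 0%N (fun=> 0)
  end.

Definition irrep_dim S la : nat := projT1 (irrep S la).

Definition irrep_char S la (g : G) : R[i] := \tr (projT2 (irrep S la) g).

Definition heat_term S (s : R) (g : G) la : R[i] :=
  (irrep_dim S la)%:R * irrep_char S la g *
  real_complex R
    (expR (- (dual_normsq (la + rho S) - dual_normsq (rho S)) * s / 2)).

End Dual.
End Coordinates.
End LieTheory.

(* Unconditional convergence: limit of the partial sums along the directed
   set of finite subsets. *)
Definition has_sum (R : realType) (I : choiceType) (D : set I) (a : I -> R)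
    (s : R) : Prop :=
  (fun A : {fset I} => \sum_(i <- A | i \in D) a i)
    @ @summability.totally I --> s.

Definition has_csum (R : realType) (I : choiceType) (D : set I)
    (a : I -> R[i]) (s : R[i]) : Prop :=
  has_sum D (fun i => complex.Re (a i)) (complex.Re s) /\
  has_sum D (fun i => complex.Im (a i)) (complex.Im s).

(** * Probability *)

Definition haar_probability (R : realType) (n : nat) (G : lieGroupType R n)
    (mu : probability (borel G) R) : Prop :=
  forall (g : G) (A : set (borel G)), measurable A ->
    mu [set (g * x : G)%g | x in (A : set G)] = mu A.

Section Stochastic.
Context {R : realType} {d : measure_display} {Omega : measurableType d}.
Variable P : probability Omega R.

(* Time is [0, +oo[; families indexed by R are only constrained there. *)
Definition is_filtration (F : R -> set (set Omega)) : Prop :=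
  (forall s, 0 <= s -> sigma_algebra setT (F s) /\ F s `<=` measurable) /\
  (forall r s, 0 <= r -> r <= s -> F r `<=` F s).

Definition meas_wrt (F : set (set Omega)) (Y : Omega -> R) : Prop :=
  forall A : set R, measurable A -> F (Y @^-1` A).

(* The third clause says that B_s - B_r is independent of F_r with law
   N(0, (s - r) I_n). *)
Definition standard_brownian_motion (n : nat) (F : R -> set (set Omega))
    (B : 'I_n -> R -> Omega -> R) : Prop :=
  [/\ forall i s, 0 <= s -> meas_wrt (F s) (B i s),
      forall i, {ae P, forall w, B i 0 w = 0 /\
                       {within `[0, +oo[, continuous (fun s => B i s w)}} &
      forall r s, 0 <= r -> r < s ->
        forall (C : set Omega) (A : 'I_n -> set R),
          F r C -> (forall i, measurable (A i)) ->
          P (C `&` [set w | forall i, A i (B i s w - B i r w)]) =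
          (P C * \prod_(i < n) normal_prob 0 (Num.sqrt (s - r)) (A i))%E].

(* The process \sum_(j < m) e_j 1_[t_j, t_(j+1)[ on [0, s[. *)
Record simple_process := SimpleProcess {
  sp_size : nat;
  sp_time : nat -> R;
  sp_coef : nat -> Omega -> R }.

Definition is_simple_process (F : R -> set (set Omega)) (s : R)
    (phi : simple_process) : Prop :=
  [/\ sp_time phi 0%N = 0, sp_time phi (sp_size phi) = s &
      forall j, (j < sp_size phi)%N ->
        [/\ sp_time phi j <= sp_time phi j.+1,
            meas_wrt (F (sp_time phi j)) (sp_coef phi j) &
            exists K : R, forall w, `|sp_coef phi j w| <= K]].

Definition sp_val (phi : simple_process) (r : R) (w : Omega) : R :=
  \sum_(j < sp_size phi)
    sp_coef phi j w * \1_[set` `[sp_time phi j, sp_time phi j.+1[] r.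

Definition sp_integral (phi : simple_process) (b : R -> Omega -> R)
    (w : Omega) : R :=
  \sum_(j < sp_size phi)
    sp_coef phi j w * (b (sp_time phi j.+1) w - b (sp_time phi j) w).

(* [I] is a version of the Ito integral of [H] against [b] over [0, s]: the
   L^2 limit of the integrals of simple processes converging to [H] in
   L^2([0, s] x Omega). *)
Definition ito_integral (F : R -> set (set Omega)) (b H : R -> Omega -> R)
    (s : R) (I : Omega -> R) : Prop :=
  measurable_fun setT I /\
  exists phi : nat -> simple_process,
    [/\ forall k, is_simple_process F s (phi k),
        (\int[lebesgue_measure]_(r in [set` `[0%R : R, s]])
            'E_P[fun w => ((H r w - sp_val (phi k) r w) ^+ 2)%R])%E
          @[k --> \oo] --> 0%E &
        ('E_P[fun w => ((I w - sp_integral (phi k) b w) ^+ 2)%R])%E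
          @[k --> \oo] --> 0%E].

Section OnGroup.
Context {n : nat} {G : lieGroupType R n}.
Variable X : 'I_n -> (G -> R) -> (G -> R).

Definition group_brownian_motion (xi : R -> Omega -> G) : Prop :=
  exists (F : R -> set (set Omega)) (B : 'I_n -> R -> Omega -> R),
  [/\ is_filtration F /\ standard_brownian_motion F B,
      forall s, 0 <= s -> forall A : set (borel G), measurable A ->
        F s (xi s @^-1` A),
      {ae P, forall w, xi 0 w = 1%g /\
         {within `[0, +oo[, continuous (fun s => xi s w)}} &
      forall f, smooth_fun f -> forall s, 0 <= s ->
        exists I : 'I_n -> Omega -> R,
          (forall i, ito_integral F (B i) (fun r w => X i f (xi r w)) s (I i)) /\
          {ae P, forall w, f (xi s w) = f 1%g + \sum_(i < n) I i w
             + 2^-1 * \sum_(i < n)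
                 \int[lebesgue_measure]_(r in [set` `[0%R : R, s]])
                   (X i (X i f) (xi r w))}].

(* The Brownian motion together with its killed measures: at time s,
   Pkill s = e^(- C s) P. *)
Definition wrapped_brownian_motion (C : R)
    (Pkill : R -> {measure set Omega -> \bar R}) (xi : R -> Omega -> G) : Prop :=
  group_brownian_motion xi /\
  forall s, 0 <= s -> forall A, measurable A ->
    Pkill s A = ((expR (- C * s))%:E * P A)%E.

End OnGroup.
End Stochastic.

(* Main.v *)
Require Import Defs.
From HB Require Import structures.
From mathcomp Require Import all_boot all_order all_algebra finmap.
From mathcomp Require Import complex ring lra zify.
From mathcomp Require Import all_classical all_reals all_analysis.
From mathcomp Require Import measurable_realfun.

Set Implicit Arguments.
Unset Strict Implicit.
Unset Printing Implicit Defensive.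

Import Order.TTheory GRing.Theory Num.Theory.
Import numFieldNormedType.Exports.

Local Open Scope classical_set_scope.
Local Open Scope ring_scope.

(** Let p be an irreducible unitary representation with highest weight lambda.
The Laplacian [\sum_i X_i^2] acts on the matrix coefficients of p as the Casimir
element, that is, as the scalar -(|lambda + rho|^2 - |rho|^2). The stochastic
integrals in Dynkin's formula have mean zero, so u(s) = E p(xi_s) solves
u' = -(|lambda + rho|^2 - |rho|^2) u / 2 with u(0) = 1. These are also the Fourier
coefficients of the series, which converges uniformly because
[\sum d_lambda^2 exp(-c_lambda s / 2)] is finite; by the Peter-Weyl theorem the law
of xi_s and the series define the same functional on continuous functions.

Distinct dominant weights have inequivalent representations, and every irreducible
representation has a dominant highest weight. That every dominant weight occurs is
not needed: by the convention on [irrep], weights that do not occur contribute 0. *)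

Local Notation toC := (real_complex _).
Local Notation Re := (@complex.Re _).
Local Notation Im := (@complex.Im _).
Local Notation irr := irreducible_representation.
Local Notation tv := (map_mx toC).
Local Notation leb := (@lebesgue_measure _).

(** The obstacle is that tori, weights and representations enter through their bare definitions: a
    representation is only continuous, a torus is only a compact connected abelian subgroup, and its
    Lie algebra consists of the directions of one-parameter subgroups contained in it.
    Representations become differentiable after convolution with smooth functions. One-parameter
    subgroups are limits, along an ultrafilter on the naturals, of powers of elements tending to the
    identity; the same construction extracts directions in [t] from points of [T]. All root theory
    rests on [t] being abelian and equal to its own centralizer, the latter being the one place
    where maximality of [T] enters. Identities in the group or in its Lie algebra are checked in
    irreducible unitary representations, which separate both by Peter-Weyl; connectedness carries
    identities of derivatives back to the group. Peter-Weyl itself comes from power iteration on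
    invariant kernels, and the growth of dimensions from counting translates of a small ball, since
    characters stay large near the identity. *)

Lemma le_of_eq (R : realType) (x y : R) : x = y -> x <= y.
Proof. by move=> ->. Qed.

Lemma row_comb (R : pzRingType) (n : nat) (v : 'rV[R]_n) (A : 'M[R]_n) (h g : 'I_n -> R) :
  (forall k, h k = \sum_j A k j * g j) ->
  \sum_k v 0 k * h k = \sum_j (v *m A) 0 j * g j.
Proof.
move=> hE; transitivity (\sum_k \sum_j v 0 k * (A k j * g j)).
  by apply: eq_bigr => k _; rewrite hE mulr_sumr.
rewrite exchange_big; apply: eq_bigr => j _.
by rewrite mxE mulr_suml; apply: eq_bigr => k _; rewrite mulrA.
Qed.

Lemma mulmx_deltaE (R : comPzRingType) (m n p q : nat) (A : 'M[R]_(m, n)) (B : 'M[R]_(p, q)) i j l k :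
  (A *m delta_mx j l *m B) i k = A i j * B l k.
Proof.
rewrite mxE (bigD1 l)//= big1 ?addr0 => [|a al].
  rewrite !mxE (bigD1 j)//= big1 ?addr0 => [|b bj]; first by rewrite mxE !eqxx mulr1.
  by rewrite mxE (negPf bj) mulr0.
rewrite !mxE (bigD1 j)//= big1 ?addr0 => [|b bj]; first by rewrite mxE (negPf al) andbF mulr0 mul0r.
by rewrite mxE (negPf bj) mulr0.
Qed.

(** * Differential calculus in normed spaces and functions of class C^k *)

Lemma near_normP (R : realType) (V : normedModType R) (x : V) (P : V -> Prop) :
  (\forall y \near x, P y) <->
  exists2 d : R, 0 < d & forall h, `|h| < d -> P (x + h).
Proof.
split=> [/nbhs_normP[d /= d0 H]|[d d0 H]].
  by exists d => // h hd; apply: H => /=; rewrite opprD addrA subrr sub0r normrN.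
apply/nbhs_normP; exists d => // y /= yd.
by rewrite -[y](subrK x) addrC; apply: H; rewrite distrC.
Qed.

Lemma near_closedball (R : realType) (V : normedModType R) (x : V) (P : V -> Prop) :
  (\forall u \near x, P u) -> exists2 e : R, 0 < e & forall u, `|u - x| <= e -> P u.
Proof.
move=> /near_normP[d d0 Hd]; exists (d / 2) => [|u ud]; first by rewrite divr_gt0.
have := Hd (u - x); rewrite (addrC x) subrK; apply.
by apply: le_lt_trans ud _; rewrite ltr_pdivrMr// mulr_natr mulr2n ltrDl.
Qed.

Lemma is_derive_line (R : realType) (V W : normedModType R) (f : V -> W)
  (a v : V) (t : R) :
  derivable f (a + t *: v) v ->
  is_derive (t : R^o) 1 (fun s : R^o => f (a + s *: v)) ('D_v f (a + t *: v)).
Proof.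
move=> df.
have E : (fun h : R => h^-1 *: (f (a + (h *: (1 : R^o) + t) *: v) - f (a + t *: v)))
  = (fun h : R => h^-1 *: (f (h *: v + (a + t *: v)) - f (a + t *: v))).
  by apply/funext => h; rewrite [h *: (1 : R^o)]mulr1 scalerDl addrCA.
by apply: DeriveDef; rewrite /derivable /derive /= ?E.
Qed.

(** Allowing the whole symmetric interval [|t| <= |c|] spares the callers any distinction on the
    sign of [c]. *)
Lemma MVT_dir (R : realType) (V : normedModType R) (f : V -> R^o)
  (a v : V) (c : R) :
  (forall t : R, `|t| <= `|c| -> derivable f (a + t *: v) v) ->
  exists2 x : R, `|x| <= `|c| & f (a + c *: v) - f a = 'D_v f (a + x *: v) * c.
Proof.
move=> df.
have key (p q : R) : p <= q ->
    (forall t, p <= t <= q -> derivable f (a + t *: v) v) ->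
    exists2 x, p <= x <= q & f (a + q *: v) - f (a + p *: v) = 'D_v f (a + x *: v) * (q - p).
  move=> pq dpq.
  have [||x xpq E] := @MVT_segment R (fun s : R => f (a + s *: v))
      (fun t => 'D_v f (a + t *: v)) p q pq.
  - by move=> x /itvP xpq; apply: is_derive_line; apply: dpq; rewrite !xpq.
  - apply: derivable_within_continuous => x /itvP xpq.
    by have /is_derive_line[] := dpq x ltac:(by rewrite !xpq).
  - by exists x; [rewrite !(itvP xpq)|exact: E].
have [c0|c0] := leP 0 c.
- have [|x /andP[x0 xc]] := key _ _ c0.
    move=> t /andP[t0 tc]; apply: df.
    by rewrite ger0_norm// ger0_norm.
  rewrite scale0r addr0 subr0 => E; exists x => //.
  by rewrite ger0_norm// ger0_norm.
- have [|x /andP[x0 xc]] := key _ _ (ltW c0).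
    move=> t /andP[t0 tc]; apply: df.
    by rewrite ler0_norm// ltr0_norm// lerN2.
  rewrite scale0r addr0 sub0r mulrN => E; exists x.
    by rewrite ler0_norm// ltr0_norm// lerN2.
  by rewrite -[RHS]opprK -E opprB.
Qed.

Lemma differentiable_of_eps (R : realType) (V W : normedModType R) (f : V -> W)
  (df : {linear V -> W}) (x : V) :
  continuous df ->
  (forall e : R, 0 < e ->
   \forall h \near (0 : V), `|f (x + h) - f x - df h| <= e * `|h|) ->
  differentiable f x.
Proof.
move=> dfc H.
have key : f \o shift x = cst (f x) + df +o_ 0 id.
  apply/eqaddoP => _/posnumP[e].
  apply: filterS (H e%:num ltac:(by [])) => h.
  rewrite (_ : (f \o shift x - (cst (f x) + df)) h = f (x + h) - f x - df h)//.
  by rewrite [x + h]addrC -addrA -opprD.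
have dE := diff_unique dfc key.
by apply/diff_locallyP; rewrite dE; split.
Qed.

Lemma differentiable_of_partials (R : realType) (n : nat) (f : 'rV[R]_n -> R^o)
  (x : 'rV[R]_n) :
  (forall k : 'I_n, \forall y \near x, derivable f y (delta_mx 0 k)) ->
  (forall k : 'I_n, {for x, continuous ('D_(delta_mx 0 k) f)}) ->
  differentiable f x.
Proof.
move=> df cf.
pose L (h : 'rV[R]_n) : R^o := \sum_(k < n) h 0 k * 'D_(delta_mx 0 k) f x.
have Llin : linear L.
  move=> c h h'; rewrite /L scaler_sumr -big_split /=; apply: eq_bigr => k _.
  by rewrite !mxE mulrDl /GRing.scale /= mulrA.
pose LL := HB.pack L (GRing.isLinear.Build _ _ _ _ L Llin) : {linear 'rV[R]_n -> R^o}.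
have Lc : continuous LL.
  move=> h; rewrite /LL /= /L; apply: cvg_big; first exact: add_continuous.
    exact: (@nbhs_filter _ h).
  move=> k _; apply: (@cvgM _ _ _ (@nbhs_filter _ h)).
    exact: coord_continuous.
  exact: cvg_cst.
apply: (differentiable_of_eps Lc) => e e0.
  (* Each of the [n] coordinate steps will cost at most [e' * |h|]; dividing by [n.+1] keeps the
     case [n = 0] legal. *)
  pose e' : R := e / (n.+1)%:R.
  have e'0 : 0 < e' by rewrite divr_gt0.
  have near1 : exists2 d : R, 0 < d & forall h : 'rV[R]_n, `|h| < d -> forall k : 'I_n,
      derivable f (x + h) (delta_mx 0 k) /\
      `|'D_(delta_mx 0 k) f (x + h) - 'D_(delta_mx 0 k) f x| < e'.
    apply/(near_normP x (fun y => forall k : 'I_n, derivable f y (delta_mx 0 k) /\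
      `|'D_(delta_mx 0 k) f y - 'D_(delta_mx 0 k) f x| < e')).
    apply: (@filter_forall _ _ (fun k y => derivable f y (delta_mx 0 k) /\
      `|'D_(delta_mx 0 k) f y - 'D_(delta_mx 0 k) f x| < e') _ (nbhs_filter x)) => k.
    have /cvgr_distC_lt/(_ _ e'0) := cf k.
    by move: (df k); apply: filterS2.
  have [d d0 Hd] := near1.
  apply/(near_normP 0 (fun h => `|f (x + h) - f x - LL h| <= e * `|h|)).
  exists d => // h hd; rewrite add0r.
  (* [P k] keeps the first [k] coordinates of [h]. The increment of [f] telescopes along these
     points, and each difference moves along one coordinate axis, where the mean value theorem
     applies. *)
  pose P (k : nat) : 'rV[R]_n := \row_j (if (j < k)%N then h 0 j else 0).
  have Psmall (k : 'I_n) (s : R) : `|s| <= `|h 0 k| -> `|P k + s *: delta_mx 0 k| <= `|h|.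
    move=> sh; rewrite [X in X <= _]/Num.Def.normr /= mx_normrE.
    apply/bigmax_leP; split=> [|[i j] _]; first exact: normr_ge0.
    rewrite !mxE /= (ord1 i) eqxx /=.
    have hj (l : 'I_n) : `|h 0 l| <= `|h|.
      rewrite [X in _ <= X]/Num.Def.normr /= mx_normrE.
      by apply: (@le_bigmax _ _ _ _ _ (0, l)).
    have [->|jk] := eqVneq j k.
      by rewrite ltnn add0r mulr1; apply: le_trans sh (hj k).
    by rewrite mulr0 addr0; case: ifP => // _; rewrite normr0.
  have PS (k : 'I_n) : P k.+1 = P k + h 0 k *: delta_mx 0 k.
    apply/rowP => j; rewrite !mxE eqxx /= ltnS leq_eqVlt.
    have [->|jk] := eqVneq j k; first by rewrite eqxx ltnn /= mulr1 add0r.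
    by rewrite (negPf (jk : (j : nat) != k)) /= mulr0 addr0.
  have tele : f (x + h) - f x = \sum_(k < n) (f (x + P k.+1) - f (x + P k)).
    rewrite -(big_mkord xpredT (fun k => f (x + P k.+1) - f (x + P k))).
    rewrite telescope_sumr// ; congr (f (x + _) - f _).
      by apply/rowP => j; rewrite mxE ltn_ord.
    by apply/rowP => j; rewrite !mxE addr0.
  rewrite (_ : _ - _ = \sum_(k < n) (f (x + P k.+1) - f (x + P k) - h 0 k * 'D_(delta_mx 0 k) f x)); last first.
    by rewrite sumrB -tele.
  apply: le_trans (ler_norm_sum _ _ _) _.
  have Hk (k : 'I_n) : `|f (x + P k.+1) - f (x + P k) - h 0 k * 'D_(delta_mx 0 k) f x| <= e' * `|h|.
    have Pd (s : R) : `|s| <= `|h 0 k| -> `|P k + s *: delta_mx 0 k| < d.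
      by move=> sh; exact: le_lt_trans (Psmall _ _ sh) hd.
    have [|s sh E] := @MVT_dir R _ f (x + P k) (delta_mx 0 k) (h 0 k).
      move=> s sh; rewrite -addrA.
      by have [] := Hd _ (Pd s sh) k.
    rewrite PS addrA E -addrA [h 0 k * _]mulrC -mulrBl normrM.
    apply: ler_pM => //.
      by have [_ /ltW] := Hd _ (Pd s sh) k.
    rewrite [X in _ <= X]/Num.Def.normr /= mx_normrE.
    by apply: (@le_bigmax _ _ _ _ _ (0, k)).
  apply: le_trans (ler_sum _ (fun k _ => Hk k)) _.
  rewrite sumr_const card_ord -mulr_natl mulrA ler_wpM2r// /e' mulrA ler_pdivrMr//.
  by rewrite mulrC ler_pM2l// ler_nat.
Qed.

(** Only the outer function has to be Frechet differentiable: restricted to the line through [x],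
    the inner one depends on a single real variable, for which derivability and differentiability
    agree. *)
Lemma is_derive_comp_dir (R : realType) (U V W : normedModType R)
  (g : V -> W) (f : U -> V) (x v : U) :
  differentiable g (f x) -> derivable f x v ->
  is_derive x v (g \o f) ('d g (f x) ('D_v f x)).
Proof.
move=> dg df.
have /is_derive_line[dl dE] : derivable f (x + 0 *: v) v by rewrite scale0r addr0.
have dl' := dl.
move/derivable1_diffP: dl' => dl'.
have dg' : differentiable g (f (x + (0 : R^o) *: v)) by rewrite scale0r addr0.
have dc := differentiable_comp dl' dg'.
have := @diff_derivable _ _ _ _ _ (1 : R^o) dc.
have E : (fun h : R => h^-1 *: ((g \o (fun s : R^o => f (x + s *: v))) (h *: (1 : R^o) + 0)
            - (g \o (fun s : R^o => f (x + s *: v))) (0 : R^o)))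
  = (fun h : R => h^-1 *: ((g \o f) (h *: v + x) - (g \o f) x)).
  by apply/funext => h /=; rewrite [h *: (1 : R^o)]mulr1 scale0r !addr0 [x + _]addrC.
rewrite /derivable /= E => d1.
apply: DeriveDef => //.
have := @deriveE _ _ _ _ _ (1 : R^o) dc.
rewrite /derive /= E => ->.
have dE' : 'd (fun s : R^o => f (x + s *: v)) (0 : R^o) 1 = 'D_v f x.
  by rewrite -deriveE// dE scale0r addr0.
by rewrite diff_comp//= dE' scale0r addr0.
Qed.

Lemma Ck_on_cont (R : realType) (V W : normedModType R) k (U : set V) (f : V -> W) :
  Ck_on k U f -> forall x, U x -> {for x, continuous f}.
Proof. by case: k => [|k] []. Qed.

Lemma Ck_on_derivable (R : realType) (V W : normedModType R) k (U : set V)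
  (f : V -> W) v x : Ck_on k.+1 U f -> U x -> derivable f x v.
Proof. by move=> [_ /(_ v)[H _]] /H. Qed.

Lemma Ck_on_derive (R : realType) (V W : normedModType R) k (U : set V)
  (f : V -> W) v : Ck_on k.+1 U f -> Ck_on k U (fun x => 'D_v f x).
Proof. by move=> [_ /(_ v)[]]. Qed.

Lemma Ck_onS (R : realType) (V W : normedModType R) k (U : set V) (f : V -> W) :
  Ck_on k.+1 U f -> Ck_on k U f.
Proof.
elim: k f => [|k IH] f [cf df]; first by split.
by split=> // v; have [d1 d2] := df v; split=> //; exact: IH.
Qed.

Lemma Ck_on_sub (R : realType) (V W : normedModType R) k (U U' : set V)
  (f : V -> W) : U' `<=` U -> Ck_on k U f -> Ck_on k U' f.
Proof.
move=> UU; elim: k f => [|k IH] f [cf df]; split => //.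
- by move=> x /UU /cf.
- by move=> x /UU /cf.
- by move=> v; have [d1 d2] := df v; split; [move=> x /UU /d1|exact: IH].
Qed.

(** Regularity is local: near each point [f] may be replaced by whatever expression is available
    there, a formula in another chart or the zero function. *)
Lemma Ck_on_loc (R : realType) (V W : normedModType R) k (U : set V) (f : V -> W) :
  (forall x, U x -> exists O : set V, exists g : V -> W,
   [/\ open O, O x, Ck_on k O g & forall y, O y -> g y = f y]) ->
  Ck_on k U f.
Proof.
have cont (k' : nat) (f' : V -> W) (U' : set V) :
   (forall x, U' x -> exists O : set V, exists g : V -> W,
     [/\ open O, O x, Ck_on k' O g & forall y, O y -> g y = f' y]) ->
   forall x, U' x -> {for x, continuous f'}.
  move=> H x /H [N [g [oO Ox Cg gf]]].
  have gfx : {near x, g =1 f'} by apply: (filterS gf); exact: open_nbhs_nbhs.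
  rewrite /prop_for /continuous_at -(gf _ Ox).
  apply: cvg_trans (Ck_on_cont Cg Ox).
  exact: near_eq_cvg.
elim: k U f => [|k IH] U f H; first by split=> //; exact: cont H.
split; first exact: cont H.
move=> v; split.
  move=> x /H [N [g [oO Ox Cg gf]]].
  apply: (near_eq_derivable _ (Ck_on_derivable (v := v) Cg Ox)).
  by apply: (filterS gf); exact: open_nbhs_nbhs.
apply: IH => x /H [N [g [oO Ox Cg gf]]].
exists N, (fun x => 'D_v g x); split => //; first exact: Ck_on_derive.
move=> y Oy; apply: near_eq_derive.
by apply: (filterS gf); exact: open_nbhs_nbhs.
Qed.

Lemma Ck_on_eq (R : realType) (V W : normedModType R) k (U : set V) (f g : V -> W) :
  open U -> (forall y, U y -> g y = f y) -> Ck_on k U g -> Ck_on k U f.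
Proof. by move=> oU gf Cg; apply: Ck_on_loc => x Ux; exists U, g. Qed.

Lemma Ck_on_cst (R : realType) (V W : normedModType R) k (U : set V) (c : W) :
  Ck_on k U (fun=> c).
Proof.
elim: k c => [|k IH] c; split => //; try by move=> x _; exact: cvg_cst.
move=> v; split; first by move=> x _; exact: derivable_cst.
have -> : (fun x => 'D_v (fun=> c) x) = (fun=> (0 : W)).
  by apply/funext => x; rewrite derive_cst.
exact: IH.
Qed.

Lemma Ck_onD (R : realType) (V W : normedModType R) k (U : set V) (f g : V -> W) :
  open U -> Ck_on k U f -> Ck_on k U g -> Ck_on k U (fun x => f x + g x).
Proof.
move=> oU; elim: k f g => [|k IH] f g Cf Cg; split => //;
  try by move=> x Ux; apply: cvgD; [exact: Ck_on_cont Cf _ Ux|exact: Ck_on_cont Cg _ Ux].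
move=> v; split.
  by move=> x Ux; apply: derivableD; [exact: Ck_on_derivable Cf Ux|exact: Ck_on_derivable Cg Ux].
apply: (@Ck_on_eq _ _ _ _ _ _ (fun x => 'D_v f x + 'D_v g x)) => //.
  move=> x Ux; rewrite -deriveD//; first exact: Ck_on_derivable Cf Ux.
  exact: Ck_on_derivable Cg Ux.
by apply: IH; exact: Ck_on_derive.
Qed.

Lemma Ck_onM (R : realType) (V : normedModType R) k (U : set V) (f g : V -> R^o) :
  open U -> Ck_on k U f -> Ck_on k U g -> Ck_on k U (fun x => f x * g x : R^o).
Proof.
move=> oU; elim: k f g => [|k IH] f g Cf Cg; split => //;
  try by move=> x Ux; apply: cvgM; [exact: Ck_on_cont Cf _ Ux|exact: Ck_on_cont Cg _ Ux].
move=> v; split.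
  by move=> x Ux; apply: derivableM; [exact: Ck_on_derivable Cf Ux|exact: Ck_on_derivable Cg Ux].
apply: (@Ck_on_eq _ _ _ _ _ _ (fun x => f x * 'D_v g x + g x * 'D_v f x : R^o)) => //.
  move=> x Ux; rewrite -[LHS]deriveM//; first exact: Ck_on_derivable Cf Ux.
  exact: Ck_on_derivable Cg Ux.
by apply: Ck_onD => //; apply: IH; try exact: Ck_onS; exact: Ck_on_derive.
Qed.

Lemma Ck_onN (R : realType) (V : normedModType R) k (U : set V) (f : V -> R^o) :
  open U -> Ck_on k U f -> Ck_on k U (fun x => - f x).
Proof.
move=> oU Cf; have := @Ck_onM _ _ k U (fun=> (-1 : R^o)) f oU (Ck_on_cst _ _ _) Cf.
by apply: Ck_on_eq => // y _; rewrite mulN1r.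
Qed.

Lemma Ck_on_sum (R : realType) (V W : normedModType R) (I : Type) (r : seq I)
  (P : pred I) k (U : set V) (f : I -> V -> W) :
  open U -> (forall i, P i -> Ck_on k U (f i)) ->
  Ck_on k U (fun x => \sum_(i <- r | P i) f i x).
Proof.
move=> oU Cf; elim: r => [|i r IH].
  by apply: (Ck_on_eq oU _ (Ck_on_cst _ _ 0)) => y _; rewrite big_nil.
have [Pi|Pi] := boolP (P i).
  apply: (Ck_on_eq oU _ (Ck_onD oU (Cf i Pi) IH)) => y _.
  by rewrite big_cons Pi.
by apply: (Ck_on_eq oU _ IH) => y _; rewrite big_cons (negPf Pi).
Qed.

Lemma Ck_on_prod (R : realType) (V : normedModType R) (I : Type) (r : seq I)
  (P : pred I) k (U : set V) (f : I -> V -> R^o) :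
  open U -> (forall i, P i -> Ck_on k U (f i)) ->
  Ck_on k U (fun x => \prod_(i <- r | P i) f i x : R^o).
Proof.
move=> oU Cf; elim: r => [|i r IH].
  by apply: (Ck_on_eq oU _ (Ck_on_cst _ _ (1 : R^o))) => y _; rewrite big_nil.
have [Pi|Pi] := boolP (P i).
  apply: (Ck_on_eq oU _ (Ck_onM oU (Cf i Pi) IH)) => y _.
  by rewrite big_cons Pi.
by apply: (Ck_on_eq oU _ IH) => y _; rewrite big_cons (negPf Pi).
Qed.

Lemma Ck_onV (R : realType) (V : normedModType R) k (U : set V) (f : V -> R^o) :
  open U -> (forall x, U x -> f x != 0) -> Ck_on k U f ->
  Ck_on k U (fun x => (f x)^-1 : R^o).
Proof.
move=> oU f0; elim: k => [|k IH] Cf; split => //;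
  try by move=> x Ux; apply: cvgV; [exact: f0|exact: Ck_on_cont Cf _ Ux].
move=> v; split.
  by move=> x Ux; apply: derivableV; [exact: f0|exact: Ck_on_derivable Cf Ux].
have IH' := IH (Ck_onS Cf).
apply: (@Ck_on_eq _ _ _ _ _ _
    (fun x => - ((f x)^-1 * (f x)^-1 * 'D_v f x) : R^o)) => //.
  move=> x Ux; rewrite deriveV; [|exact: f0|exact: Ck_on_derivable Cf Ux].
  by rewrite scaleNr expr2 invfM.
apply: Ck_onN => //; apply: (Ck_onM oU (Ck_onM oU IH' IH')).
exact: Ck_on_derive.
Qed.

Lemma Ck_on_coord (R : realType) (V : normedModType R) m n k (U : set V)
  (f : V -> 'M[R]_(m, n)) i j : open U -> Ck_on k U f ->
  Ck_on k U (fun x => f x i j : R^o).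
Proof.
move=> oU; elim: k f => [|k IH] f Cf; split => //;
  try by move=> x Ux; apply: (@continuous_comp _ _ _ f (fun M : 'M[R]_(m, n) => M i j) x (Ck_on_cont Cf Ux)); exact: coord_continuous.
move=> v; split.
  by move=> x Ux; move/derivable_mxP: (Ck_on_derivable (v := v) Cf Ux); exact.
apply: (@Ck_on_eq _ _ _ _ _ _ (fun x => 'D_v f x i j : R^o)) => //.
  by move=> x Ux; rewrite derive_mx ?mxE//; exact: Ck_on_derivable Cf Ux.
exact/IH/Ck_on_derive.
Qed.

Lemma Ck1_differentiable (R : realType) (n : nat) (U : set 'rV[R]_n)
  (f : 'rV[R]_n -> R^o) x :
  open U -> U x -> Ck_on 1 U f -> differentiable f x.
Proof.
move=> oU Ux Cf; apply: differentiable_of_partials => k.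
  have : \forall y \near x, U y by exact: open_nbhs_nbhs.
  by apply: filterS => y Uy; exact: Ck_on_derivable Cf Uy.
exact: Ck_on_cont (Ck_on_derive (delta_mx 0 k) Cf) _ Ux.
Qed.

Lemma derive_partials (R : realType) (n : nat) (f : 'rV[R]_n -> R^o) x v :
  differentiable f x ->
  'D_v f x = \sum_(k < n) v 0 k * 'D_(delta_mx 0 k) f x.
Proof.
move=> df; rewrite deriveE// {1}[v]row_sum_delta linear_sum; apply: eq_bigr => k _.
by rewrite linearZ /= deriveE.
Qed.

(** Induction through the coordinate form of the chain rule: the derivative is a sum of products of
    a derivative of [f] and a partial of [g] composed with [f], to which the hypothesis for the
    lower order applies. The coordinates are those of the middle space. *)
Lemma Ck_on_comp (R : realType) (V : normedModType R) (n k : nat) (U : set V)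
  (O : set 'rV[R]_n) (g : 'rV[R]_n -> R^o) (f : V -> 'rV[R]_n) :
  open U -> open O -> (forall x, U x -> O (f x)) ->
  Ck_on k O g -> Ck_on k U f -> Ck_on k U (g \o f).
Proof.
move=> oU oO fUO; elim: k g => [|k IH] g Cg Cf; split => //;
  try by move=> x Ux; apply: continuous_comp;
    [exact: Ck_on_cont Cf _ Ux|exact: Ck_on_cont Cg _ (fUO _ Ux)].
have dg x : U x -> differentiable g (f x).
  move=> Ux; apply: (@Ck1_differentiable _ _ O) => //; first exact: fUO.
  by clear -Cg; elim: k Cg => // k IHk /Ck_onS.
have D v x : U x -> is_derive x v (g \o f) ('d g (f x) ('D_v f x)).
  by move=> Ux; apply: is_derive_comp_dir; [exact: dg|exact: Ck_on_derivable Cf Ux].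
move=> v; split; first by move=> x /(D v)[].
apply: (@Ck_on_eq _ _ _ _ _ _ (fun x =>
   \sum_(i < n) 'D_v f x 0 i * ((fun y => 'D_(delta_mx 0 i) g y) \o f) x : R^o)) => //.
  move=> x Ux; have [_ ->] := D v x Ux.
  by rewrite /= -(derive_partials _ (dg x Ux)) deriveE//; exact: dg.
apply: Ck_on_sum => // i _; apply: Ck_onM => //.
  by apply: Ck_on_coord => //; exact: Ck_on_derive.
by apply: IH; [exact: Ck_on_derive|exact: Ck_onS].
Qed.

Lemma derive_slice1 (R : realType) (V1 V2 W : normedModType R)
  (f : V1 * V2 -> W) a x v :
  (derivable (fun u => f (u, a)) x v = derivable f (x, a) (v, 0)) *
  ('D_v (fun u => f (u, a)) x = 'D_(v, 0) f (x, a)).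
Proof.
have E : (fun h : R => h^-1 *: (f (h *: v + x, a) - f (x, a)))
  = (fun h : R => h^-1 *: (f (h *: (v, 0) + (x, a)) - f (x, a))).
  apply/funext => h; congr (_ *: (f _ - _)).
  by rewrite [RHS]surjective_pairing /= scaler0 add0r.
by rewrite /derivable /derive /= E.
Qed.

Lemma derive_slice2 (R : realType) (V1 V2 W : normedModType R)
  (f : V1 * V2 -> W) a x v :
  (derivable (fun u => f (a, u)) x v = derivable f (a, x) (0, v)) *
  ('D_v (fun u => f (a, u)) x = 'D_(0, v) f (a, x)).
Proof.
have E : (fun h : R => h^-1 *: (f (a, h *: v + x) - f (a, x)))
  = (fun h : R => h^-1 *: (f (h *: (0, v) + (a, x)) - f (a, x))).
  apply/funext => h; congr (_ *: (f _ - _)).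
  by rewrite [RHS]surjective_pairing /= scaler0 add0r.
by rewrite /derivable /derive /= E.
Qed.

Lemma Ck_on_slice1 (R : realType) (V1 V2 W : normedModType R) k
  (U : set (V1 * V2)) (f : V1 * V2 -> W) a :
  Ck_on k U f -> Ck_on k [set u | U (u, a)] (fun u => f (u, a)).
Proof.
elim: k f => [|k IH] f Cf; split => //;
  try by move=> x Ux; apply: (@continuous_comp _ _ _ (fun u => (u, a)) f);
    [apply: cvg_pair; [exact: cvg_id|exact: cvg_cst]|exact: Ck_on_cont Cf _ Ux].
move=> v; split; first by move=> x Ux; rewrite derive_slice1; exact: Ck_on_derivable Cf Ux.
rewrite (_ : (fun x => _) = (fun x => 'D_(v, 0) f (x, a))); last first.
  by apply/funext => x; rewrite derive_slice1.
exact: (IH (fun x => 'D_(v, 0) f x)) (Ck_on_derive _ Cf).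
Qed.

Lemma Ck_on_slice2 (R : realType) (V1 V2 W : normedModType R) k
  (U : set (V1 * V2)) (f : V1 * V2 -> W) a :
  Ck_on k U f -> Ck_on k [set u | U (a, u)] (fun u => f (a, u)).
Proof.
elim: k f => [|k IH] f Cf; split => //;
  try by move=> x Ux; apply: (@continuous_comp _ _ _ (fun u => (a, u)) f);
    [apply: cvg_pair; [exact: cvg_cst|exact: cvg_id]|exact: Ck_on_cont Cf _ Ux].
move=> v; split; first by move=> x Ux; rewrite derive_slice2; exact: Ck_on_derivable Cf Ux.
rewrite (_ : (fun x => _) = (fun x => 'D_(0, v) f (a, x))); last first.
  by apply/funext => x; rewrite derive_slice2.
exact: (IH (fun x => 'D_(0, v) f x)) (Ck_on_derive _ Cf).
Qed.

(** * Coordinate norms, flat functions and smooth bumps *)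

Lemma coord_le_norm (R : realType) n (u : 'rV[R]_n) i : `|u 0 i| <= `|u|.
Proof.
rewrite [X in _ <= X]/Num.Def.normr /= mx_normrE.
by apply: (@le_bigmax _ _ _ _ _ (0, i)).
Qed.

Lemma norm_le_coord (R : realType) n (u : 'rV[R]_n) (e : R) : 0 <= e ->
  (forall i, `|u 0 i| <= e) -> `|u| <= e.
Proof.
move=> e0 H; rewrite [X in X <= _]/Num.Def.normr /= mx_normrE.
by apply/bigmax_leP; split=> [|[i j] _]//=; rewrite (ord1 i).
Qed.

(** The flat function exp(-1/t), extended by 0 to t <= 0. The extra power of 1/t makes the family
    closed under differentiation, so smoothness follows by induction on the order for all [m] at
    once. *)
Definition flat_exp (R : realType) (m : nat) (t : R) : R :=
  if 0 < t then t ^- m * expR (- t^-1) else 0.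

Lemma flat_exp_ge0 (R : realType) m (t : R) : 0 <= flat_exp m t.
Proof.
rewrite /flat_exp; case: ifP => // t0.
by rewrite mulr_ge0 ?expR_ge0// invr_ge0 exprn_ge0// ltW.
Qed.

Lemma flat_exp0_gt0 (R : realType) (t : R) : (0 < flat_exp 0 t) = (0 < t).
Proof.
by rewrite /flat_exp; case: ifP => // t0; rewrite ?ltxx// expr0 invr1 mul1r expR_gt0.
Qed.

(** The term of order [m.+2] of the exponential series at 1/t beats [t ^- m] by a factor t^2. A
    quadratic bound is what makes the derivative at 0 vanish. *)
Lemma flat_exp_le (R : realType) m (t : R) :
  `|flat_exp m t| <= (m.+2)`!%:R * `|t| ^+ 2.
Proof.
rewrite ger0_norm ?flat_exp_ge0// /flat_exp; case: ifP => t0; last first.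
  by rewrite mulr_ge0// exprn_ge0.
rewrite (gtr0_norm t0).
have := @expR_ge1Dxn R t^-1 m.+1; rewrite invr_ge0 => /(_ (ltW t0)) H.
have H2 : t^-1 ^+ m.+2 / (m.+2)`!%:R <= expR t^-1 by apply: le_trans H; rewrite lerDr.
rewrite expRN.
have f0 : (0 : R) < (m.+2)`!%:R by rewrite ltr0n fact_gt0.
rewrite ler_pdivrMr ?expR_gt0//.
apply: le_trans (ler_wpM2l _ H2); last by rewrite mulr_ge0 ?exprn_ge0// ltW.
rewrite -exprVn -(addn2 m) exprD addn2.
have : t != 0 by rewrite gt_eqF.
move: f0; set F := (_ `!)%:R => /lt0r_neq0 f0 tn0.
rewrite (_ : F * t ^+ 2 * (t^-1 ^+ m * t^-1 ^+ 2 / F) = t^-1 ^+ m)//.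
move: (t^-1 ^+ m) => q; field.
by rewrite f0 tn0.
Qed.

Lemma is_derive_flat_exp (R : realType) m (t : R) :
  is_derive (t : R^o) 1 (flat_exp m : R^o -> R^o)
  (flat_exp m.+2 t - m%:R * flat_exp m.+1 t).
Proof.
have [t0|t0|<-] := ltgtP 0 t.
- have nearE : \forall s \near (t : R^o), s ^- m * expR (- s^-1) = flat_exp m s.
    have : \forall s \near (t : R^o), 0 < s by exact: lt_nbhsr.
    by apply: filterS => s s0; rewrite /flat_exp s0.
  apply: (near_eq_is_derive nearE).
  have tn0 : t != 0 by rewrite gt_eqF.
  have d1 : is_derive (t : R^o) 1 (fun s : R^o => s^-1 : R^o) (- t ^- 2).
    apply: DeriveDef; first by apply: derivableV => //; exact: derivable_id.
    by rewrite deriveV// ?derive_id ?[_ *: _]mulr1//; exact: derivable_id.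
  have d2 : is_derive (t : R^o) 1 (fun s : R^o => expR (- s^-1) : R^o) (t ^- 2 * expR (- t^-1)).
    have d : is_derive (t : R^o) 1 (fun s : R^o => - s^-1 : R^o) (t ^- 2).
      by rewrite -[t ^- 2]opprK; apply: is_deriveN.
    have := @is_derive1_comp R expR (fun s : R => - s^-1) t _ _ _ d.
    by rewrite mulrC; apply.
  have d3 : is_derive (t : R^o) 1 (fun s : R^o => s ^- m : R^o) (- (m%:R * t ^- m.+1)).
    apply: DeriveDef.
      by apply: derivableV; [rewrite expf_neq0|exact: exprn_derivable].
    rewrite deriveV ?expf_neq0//; last exact: exprn_derivable.
    rewrite exp_derive [(_ *: 1)]mulr1 [LHS]mulNr; congr (- _).
    case: m {nearE} => [|m]; first by rewrite [0%:R *: _]mul0r mulr0 mul0r.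
    rewrite (_ : (m.+1%:R : R) *: (t ^+ m : R^o) = m.+1%:R * t ^+ m)// !exprS expr0.
    have : t ^+ m != 0 by rewrite expf_neq0.
    by move: (t ^+ m) tn0 => q tn0 qn0; field; rewrite tn0 qn0.
  have := @is_deriveM R _ _ _ (t : R^o) 1 _ _ d3 d2.
  rewrite /flat_exp t0 => D; apply: (is_derive_eq D).
  rewrite (_ : t ^- m *: _ = t ^- m * (t ^- 2 * expR (- t^-1)))//.
  rewrite (_ : expR (- t^-1) *: _ = expR (- t^-1) * - (m%:R / t ^+ m.+1))//.
  rewrite -!exprVn !exprS; move: (t^-1 ^+ m) => q.
  by ring.
- have nearE : \forall s \near (t : R^o), (cst 0 : R^o -> R^o) s = flat_exp m s.
    have : \forall s \near (t : R^o), s < 0 by exact: lt_nbhsl.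
    by apply: filterS => s s0; rewrite /flat_exp ltNge (ltW s0).
  apply: (near_eq_is_derive nearE).
  by rewrite /flat_exp ltNge (ltW t0) /= mulr0 subr0; exact: is_derive_cst.
- rewrite {2 3}/flat_exp ltxx mulr0 subr0.
  have H : (h^-1 *: (flat_exp m (h *: (1 : R^o) + 0) - flat_exp m (0 : R))) @[h --> (0 : R)^'] --> (0 : R^o).
    apply/cvgr0Pnorm_le => e e0.
    have F0 : (0 : R) < (m.+2)`!%:R by rewrite ltr0n fact_gt0.
    have ep : 0 < e / (m.+2)`!%:R by rewrite divr_gt0.
    near=> h.
    have hn0 : h != 0 by near: h; exact: nbhs_dnbhs_neq.
    have hs : `|h| < e / (m.+2)`!%:R.
      by near: h; exact: dnbhs0_lt.
    rewrite [h *: _]mulr1 addr0 {2}/flat_exp ltxx subr0 normrZ normfV.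
    rewrite mulrC ler_pdivrMr ?normr_gt0//.
    apply: le_trans (flat_exp_le _ _) _.
    rewrite expr2 mulrA ler_pM2r ?normr_gt0//.
    by rewrite mulrC -ler_pdivlMr// ltW.
  apply: DeriveDef; first by apply/cvg_ex; exists 0; exact: H.
  exact: cvg_lim H.
Unshelve. all: by end_near. Qed.

Lemma is_derive_comp1 (R : realType) (V : normedModType R) (f : V -> R^o)
  (g : R^o -> R^o) (x v : V) (df dg : R^o) :
  is_derive (f x : R^o) 1 g dg -> is_derive x v f df ->
  is_derive x v (g \o f) (df * dg).
Proof.
move=> [g1 g2] [f1 f2].
have gd : differentiable g (f x) := (derivable1_diffP g (f x)).1 g1.
have E : 'd g (f x) (df *: (1 : R^o)) = df *: 'd g (f x) (1 : R^o) := linearZ _ _.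
rewrite -(deriveE (1 : R^o) gd) g2 [df *: (1 : R^o)]mulr1 in E.
have [p1 p2] := is_derive_comp_dir gd f1.
by apply: DeriveDef p1 _; rewrite p2 f2.
Qed.

Lemma Ck_on_id (R : realType) (V : normedModType R) k (U : set V) :
  Ck_on k U (fun u : V => u).
Proof.
case: k => [|k]; split=> //; try by move=> x _; exact: cvg_id.
move=> v; split; first by move=> x _; exact: derivable_id.
rewrite (_ : (fun x => _) = fun=> v); first exact: Ck_on_cst.
by apply/funext => x; rewrite derive_id.
Qed.

Lemma Ck_on_flat_exp (R : realType) (V : normedModType R) k m (U : set V)
  (f : V -> R^o) : open U -> Ck_on k U f ->
  Ck_on k U (fun u => flat_exp m (f u) : R^o).
Proof.
move=> oU; elim: k m => [|k IH] m Cf; split => //.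
- move=> x Ux; apply: continuous_comp; first exact: Ck_on_cont Cf _ Ux.
  apply: differentiable_continuous; apply/derivable1_diffP.
  by have [] := is_derive_flat_exp m (f x).
- move=> x Ux; apply: continuous_comp; first exact: Ck_on_cont Cf _ Ux.
  apply: differentiable_continuous; apply/derivable1_diffP.
  by have [] := is_derive_flat_exp m (f x).
move=> v.
have D x : U x -> is_derive x v (fun u => flat_exp m (f u) : R^o)
    ('D_v f x * (flat_exp m.+2 (f x) - m%:R * flat_exp m.+1 (f x))).
  move=> Ux; apply: (is_derive_comp1 (is_derive_flat_exp m (f x))).
  by apply: DeriveDef => //; exact: Ck_on_derivable Cf Ux.
split; first by move=> x /D[].
apply: (@Ck_on_eq _ _ _ _ _ _ (fun x => 'D_v f x * (flat_exp m.+2 (f x) + (- m%:R) * flat_exp m.+1 (f x)) : R^o)) => //.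
  by move=> x /D[_ ->]; rewrite mulNr.
have Cf' := Ck_onS Cf.
apply: Ck_onM => //; first exact: Ck_on_derive.
apply: Ck_onD => //; first exact: IH.
by apply: Ck_onM => //; [exact: Ck_on_cst|exact: IH].
Qed.

(** For [e > 0] this is positive exactly on the open ball of radius [e] around [a]: row vectors
    carry the sup norm, whose balls are cubes, hence the product over coordinates. *)
Definition cube_bump (R : realType) (n : nat) (a : 'rV[R]_n) (e : R)
  (u : 'rV[R]_n) : R :=
  \prod_(i < n) (flat_exp 0 (e - (u 0 i - a 0 i)) * flat_exp 0 (e + (u 0 i - a 0 i))).

Lemma cube_bump_ge0 (R : realType) n (a : 'rV[R]_n) e u : 0 <= cube_bump a e u.
Proof. by apply: prodr_ge0 => i _; rewrite mulr_ge0 ?flat_exp_ge0. Qed.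

Lemma cube_bump_gt0 (R : realType) n (a : 'rV[R]_n) e u :
  `|u - a| < e -> 0 < cube_bump a e u.
Proof.
move=> ua; apply: prodr_gt0 => i _.
have : `|u 0 i - a 0 i| < e.
  by apply: le_lt_trans ua; have := coord_le_norm (u - a) i; rewrite !mxE.
rewrite ltr_norml => /andP[h1 h2].
by rewrite mulr_gt0// flat_exp0_gt0; [rewrite subr_gt0|rewrite -ltrBlDl sub0r].
Qed.

Lemma cube_bump_eq0 (R : realType) n (a : 'rV[R]_n) e u :
  0 < e -> e <= `|u - a| -> cube_bump a e u = 0.
Proof.
move=> e0; rewrite [X in _ <= X]/Num.Def.normr /= mx_normrE.
case/bigmax_geP => [|[[j i] _ /=]]; first by rewrite leNgt e0.
rewrite (ord1 j) !mxE => h; rewrite /cube_bump (bigD1 i)//=.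
have [h0|h0] := leP 0 (u 0 i - a 0 i).
  by rewrite {1}/flat_exp subr_gt0 -(ger0_norm h0) ltNge h /= !mul0r.
rewrite ler0_norm ?(ltW h0)// in h.
by rewrite {2}/flat_exp -ltrBlDl sub0r ltNge -lerNr h /= mulr0 mul0r.
Qed.

Lemma Ck_on_cube_bump (R : realType) n k (U : set 'rV[R]_n) (a : 'rV[R]_n) e :
  open U -> Ck_on k U (cube_bump a e : _ -> R^o).
Proof.
move=> oU; apply: Ck_on_prod => // i _.
have Ci : Ck_on k U (fun u : 'rV[R]_n => u 0 i : R^o).
  by apply: Ck_on_coord => //; exact: Ck_on_id.
have Cd : Ck_on k U (fun u : 'rV[R]_n => u 0 i + - a 0 i : R^o).
  by apply: Ck_onD => //; exact: Ck_on_cst.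
apply: Ck_onM => //; apply: Ck_on_flat_exp => //; apply: Ck_onD => //;
  try exact: Ck_on_cst.
exact: Ck_onN.
Qed.

(** * Charts and left-invariant frames *)

Section GroupCharts.
Context {R : realType} {n : nat} {G : lieGroupType R n}.
Implicit Types (c : chart R n G) (x y : G) (f : G -> R).

Lemma cod_inv c u : atlas c -> chart_cod c u ->
  chart_dom c (chart_inv c u) /\ chart_map c (chart_inv c u) = u.
Proof.
move=> /atlas_chart[_ _ ic _ _] [x dx <-].
by rewrite ic.
Qed.

Lemma dom_map c x : atlas c -> chart_dom c x ->
  chart_cod c (chart_map c x) /\ chart_inv c (chart_map c x) = x.
Proof.
by move=> /atlas_chart[_ _ ic _ _] dx; split; [exists x|exact: ic].
Qed.

Lemma open_cod c : atlas c -> open (chart_cod c).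
Proof. by move=> /atlas_chart[]. Qed.

Lemma open_dom c : atlas c -> open (chart_dom c).
Proof. by move=> /atlas_chart[]. Qed.

Lemma cont_map c x : atlas c -> chart_dom c x -> {for x, continuous (chart_map c)}.
Proof. by move=> /atlas_chart[_ _ _ H _]; exact: H. Qed.

Lemma cont_inv c u : atlas c -> chart_cod c u -> {for u, continuous (chart_inv c)}.
Proof. by move=> /atlas_chart[_ _ _ _ H]; exact: H. Qed.

Lemma near_cod c u : atlas c -> chart_cod c u -> \forall v \near u, chart_cod c v.
Proof. by move=> ac cu; apply: open_nbhs_nbhs; split => //; exact: open_cod. Qed.

Lemma near_dom c x : atlas c -> chart_dom c x -> \forall y \near x, chart_dom c y.
Proof. by move=> ac cu; apply: open_nbhs_nbhs; split => //; exact: open_dom. Qed.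

Lemma open_chart_preimage c (T : topologicalType) (h : G -> T) (A : set T) :
  atlas c -> continuous h -> open A ->
  open [set u | chart_cod c u /\ A (h (chart_inv c u))].
Proof.
move=> ac ch oA; rewrite openE => u /= [cu Au].
have H1 : \forall v \near u, A (h (chart_inv c v)).
  have /= := continuous_comp (cont_inv ac cu) (ch (chart_inv c u)).
  by apply; apply: open_nbhs_nbhs.
by move: (near_cod ac cu) H1; apply: filterS2.
Qed.

Lemma cont_lmul (g : G) : continuous (fun x => g * x)%g.
Proof.
move=> x; apply: (@continuous_comp _ _ _ (fun x => (g, x)) (fun p : G * G => (p.1 * p.2)%g)).
  by apply: cvg_pair; [exact: cvg_cst|exact: cvg_id].
exact: lie_mul_continuous.
Qed.

Lemma cont_rmul (g : G) : continuous (fun x => x * g)%g.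
Proof.
move=> x; apply: (@continuous_comp _ _ _ (fun x => (x, g)) (fun p : G * G => (p.1 * p.2)%g)).
  by apply: cvg_pair; [exact: cvg_id|exact: cvg_cst].
exact: lie_mul_continuous.
Qed.

Lemma open_mul_domain c1 c2 c3 : atlas c1 -> atlas c2 -> atlas c3 ->
  open [set u : 'rV[R]_n * 'rV[R]_n | [/\ chart_cod c1 u.1, chart_cod c2 u.2 &
       chart_dom c3 (chart_inv c1 u.1 * chart_inv c2 u.2)%g]].
Proof.
move=> a1 a2 a3; rewrite openE => -[u1 u2] /= [h1 h2 h3].
have H3 : \forall v \near (u1, u2), chart_dom c3 (chart_inv c1 v.1 * chart_inv c2 v.2)%g.
  have H : {for (u1, u2), continuous (fun v : 'rV[R]_n * 'rV[R]_n =>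
      (chart_inv c1 v.1 * chart_inv c2 v.2)%g)}.
    apply: (@continuous_comp _ _ _ (fun v : 'rV[R]_n * 'rV[R]_n =>
      (chart_inv c1 v.1, chart_inv c2 v.2)) (fun p : G * G => (p.1 * p.2)%g)).
      apply: cvg_pair; (apply: continuous_comp; first by [exact: cvg_fst|exact: cvg_snd]).
        exact: cont_inv.
      exact: cont_inv.
    exact: lie_mul_continuous.
  by apply: H; exact: near_dom.
have H1 : \forall v \near (u1, u2), chart_cod c1 v.1.
  by have := @cvg_fst _ _ (nbhs u1) (nbhs u2) _; apply; exact: near_cod.
have H2 : \forall v \near (u1, u2), chart_cod c2 v.2.
  by have := @cvg_snd _ _ (nbhs u1) (nbhs u2) _; apply; exact: near_cod.
by near=> v; split; near: v.
Unshelve. all: by end_near. Qed.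

Lemma smooth_cont f : smooth_fun f -> continuous f.
Proof.
move=> sf x; have [c ac dx] := atlas_cover x.
have [cx ix] := dom_map ac dx.
have C := Ck_on_cont (sf c ac 0%N) cx.
have H : {for x, continuous ((f \o chart_inv c) \o chart_map c)}.
  by apply: continuous_comp => //; exact: cont_map.
rewrite /prop_for /continuous_at /= ix in H.
apply: cvg_trans H; apply: near_eq_cvg.
by apply: filterS (near_dom ac dx) => y dy; have [_ /= ->] := dom_map ac dy.
Qed.

Lemma smooth_cst (a : R) : smooth_fun (fun _ : G => a).
Proof. by move=> c ac k; exact: Ck_on_cst. Qed.

Lemma smoothD f1 f2 : smooth_fun f1 -> smooth_fun f2 ->
  smooth_fun (fun x => f1 x + f2 x).
Proof. by move=> s1 s2 c ac k; apply: Ck_onD; [exact: open_cod|exact: s1|exact: s2]. Qed.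

Lemma smoothM f1 f2 : smooth_fun f1 -> smooth_fun f2 ->
  smooth_fun (fun x => f1 x * f2 x).
Proof. by move=> s1 s2 c ac k; apply: Ck_onM; [exact: open_cod|exact: s1|exact: s2]. Qed.

Lemma smoothZ (a : R) f : smooth_fun f -> smooth_fun (fun x => a * f x).
Proof. by move=> sf; apply: smoothM => //; exact: smooth_cst. Qed.

Lemma smooth_sum (I : Type) (r : seq I) (P : pred I) (F : I -> G -> R) :
  (forall i, P i -> smooth_fun (F i)) -> smooth_fun (fun x => \sum_(i <- r | P i) F i x).
Proof.
move=> sF c ac k; apply: (Ck_on_eq (open_cod ac) (g := fun u => \sum_(i <- r | P i) F i (chart_inv c u) : R^o)) => //.
by apply: Ck_on_sum; [exact: open_cod|move=> i Pi; exact: sF].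
Qed.

(** Multiplication is jointly smooth; freezing its first factor at [g], in a chart around [g], gives
    smoothness of a left translation. *)
Lemma Ck_mul_slice2 (g : G) c c3 k : atlas c -> atlas c3 ->
  Ck_on k [set u | chart_cod c u /\ chart_dom c3 (g * chart_inv c u)%g]
  (fun u => chart_map c3 (g * chart_inv c u)%g).
Proof.
move=> ac a3; have [c1 a1 d1] := atlas_cover g.
have [cg ig] := dom_map a1 d1.
have := Ck_on_slice2 (chart_map c1 g) (lie_mul_smooth _ _ _ a1 ac a3 k) => /=.
by rewrite ig; apply: Ck_on_sub => u [cu du] /=; split.
Qed.

Lemma smooth_comp_chart (h : G -> G) f : continuous h -> smooth_fun f ->
  (forall c c3 k, atlas c -> atlas c3 ->
  Ck_on k [set u | chart_cod c u /\ chart_dom c3 (h (chart_inv c u))]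
    (fun u => chart_map c3 (h (chart_inv c u)))) ->
  smooth_fun (f \o h).
Proof.
move=> ch sf sh c ac k; apply: Ck_on_loc => u cu.
have [c3 a3 d3] := atlas_cover (h (chart_inv c u)).
have oO := open_chart_preimage ac ch (open_dom a3).
exists [set u | chart_cod c u /\ chart_dom c3 (h (chart_inv c u))].
exists ((f \o chart_inv c3) \o (fun u => chart_map c3 (h (chart_inv c u)))).
split => //.
  apply: (Ck_on_comp oO (open_cod a3)); last exact: sh.
    by move=> v /= [_ dv]; have [] := dom_map a3 dv.
  exact: sf.
by move=> v /= [_ dv]; have [_ ->] := dom_map a3 dv.
Qed.

Lemma smooth_lmul (g : G) f : smooth_fun f -> smooth_fun (fun x => f (g * x)%g).
Proof.
move=> sf; apply: (smooth_comp_chart (cont_lmul (g := g)) sf) => c c3 k ac a3.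
exact: Ck_mul_slice2.
Qed.

End GroupCharts.

Lemma derive_lin (R : realType) (V : normedModType R) (f g : V -> R^o) a x v :
  derivable f x v -> derivable g x v ->
  'D_v (fun u => a * f u + g u : R^o) x = a * 'D_v f x + 'D_v g x.
Proof.
move=> df dg; have := deriveD (derivableZ (k := a) df) dg.
by rewrite deriveZ.
Qed.

Lemma derive_mul (R : realType) (V : normedModType R) (f g : V -> R^o) x v :
  derivable f x v -> derivable g x v ->
  'D_v (fun u => f u * g u : R^o) x = 'D_v f x * g x + f x * 'D_v g x.
Proof.
move=> df dg; have E := deriveM df dg.
by rewrite [LHS]E addrC; congr (_ + _); rewrite [LHS]mulrC.
Qed.

Lemma derive_coord (R : realType) n (x w : 'rV[R]_n) k :
  is_derive x w (fun u : 'rV[R]_n => u 0 k : R^o) (w 0 k).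
Proof.
have d := @derivable_id R _ x w.
apply: DeriveDef; first by move/derivable_mxP: d => d'; exact: d'.
by have := derive_mx d; rewrite derive_id => /rowP/(_ k) ->; rewrite mxE.
Qed.

Section Frame.
Context {R : realType} {n : nat} {G : lieGroupType R n}.
Implicit Types (c : chart R n G) (x y : G) (f : G -> R).

Lemma open_mul_slice (g : G) c c3 : atlas c -> atlas c3 ->
  open [set u | chart_cod c u /\ chart_dom c3 (g * chart_inv c u)%g].
Proof.
by move=> ac a3; apply: (open_chart_preimage ac (cont_lmul (g := g))); exact: open_dom.
Qed.

Lemma Ck_on_det (V : normedModType R) k (U : set V) m (B : V -> 'M[R]_m) :
  open U -> (forall i j, Ck_on k U (fun u => B u i j : R^o)) ->
  Ck_on k U (fun u => \det (B u) : R^o).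
Proof.
move=> oU CB; apply: Ck_on_sum => // s _; apply: Ck_onM => //; first exact: Ck_on_cst.
by apply: Ck_on_prod.
Qed.

(** Cramer's rule: each entry of the inverse is a cofactor divided by the determinant. *)
Lemma Ck_on_invmx (V : normedModType R) k (U : set V) m (B : V -> 'M[R]_m) :
  open U -> (forall u, U u -> B u \in unitmx) ->
  (forall i j, Ck_on k U (fun u => B u i j : R^o)) ->
  forall i j, Ck_on k U (fun u => invmx (B u) i j : R^o).
Proof.
move=> oU uB CB i j.
apply: (@Ck_on_eq _ _ _ _ _ _ (fun u => (\det (B u))^-1 *
    ((-1) ^+ (j + i) * \det (row' j (col' i (B u)))) : R^o)) => //.
  by move=> u Uu; rewrite /invmx uB// !mxE.
apply: Ck_onM => //.
  apply: Ck_onV => //; last exact: Ck_on_det.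
  by move=> u Uu; have := uB u Uu; rewrite unitmxE unitfE.
apply: Ck_onM => //; first exact: Ck_on_cst.
apply: Ck_on_det => // p q.
by apply: (Ck_on_eq oU _ (CB (lift j p) (lift i q))) => u Uu; rewrite !mxE.
Qed.

Section AtIdentity.
Context (c0 : chart R n G) (ac0 : atlas c0) (d0 : chart_dom c0 1%g).
Local Notation u0 := (chart_map c0 1%g).

Let cod_u0 : chart_cod c0 u0. Proof. by have [] := dom_map ac0 d0. Qed.
Let inv_u0 : chart_inv c0 u0 = 1%g. Proof. by have [] := dom_map ac0 d0. Qed.

(* The left-invariant vector field whose value at the identity is w in the chart c0. *)
Definition cdir (w : 'rV[R]_n) f x : R :=
  'D_w (fun u => f (x * chart_inv c0 u)%g : R^o) u0.

Lemma cdir_Ck f x k : smooth_fun f ->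
  Ck_on k (chart_cod c0) (fun u => f (x * chart_inv c0 u)%g : R^o).
Proof. by move=> sf; exact: (smooth_lmul x sf ac0). Qed.

Lemma cdir_derivable w f x : smooth_fun f ->
  derivable (fun u => f (x * chart_inv c0 u)%g : R^o) u0 w.
Proof. by move=> sf; exact: Ck_on_derivable (cdir_Ck x 1 sf) _. Qed.

Lemma cdir_lin w f x : smooth_fun f ->
  cdir w f x = \sum_(j < n) w 0 j * cdir (delta_mx 0 j) f x.
Proof.
move=> sf; apply: (@derive_partials R n (fun u => f (x * chart_inv c0 u)%g)).
exact: (Ck1_differentiable (open_cod ac0) cod_u0 (cdir_Ck x 1 sf)).
Qed.

(** The coordinates in the chart [c], at the point of coordinates [u], of the left-invariant field
    with value [w] at the identity, that is, the differential of left translation by [chart_inv c u]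
    applied to [w]. *)
Definition frame_b c (u w : 'rV[R]_n) : 'rV[R]_n :=
  'D_w (fun u2 => chart_map c (chart_inv c u * chart_inv c0 u2)%g) u0.

Lemma frame_b_dom c u : atlas c -> chart_cod c u ->
  chart_cod c0 u0 /\ chart_dom c (chart_inv c u * chart_inv c0 u0)%g.
Proof. by move=> ac cu; rewrite inv_u0 mulg1; have [] := cod_inv ac cu. Qed.

Lemma Ck_frame_b c w j k : atlas c ->
  Ck_on k (chart_cod c) (fun u => frame_b c u w 0 j : R^o).
Proof.
move=> ac; pose m (p : 'rV[R]_n * 'rV[R]_n) := chart_map c (chart_inv c p.1 * chart_inv c0 p.2)%g.
have C1 := Ck_on_derive (0, w) (lie_mul_smooth _ _ _ ac ac0 ac k.+1).
have C2 := Ck_on_coord 0 j (open_mul_domain ac ac0 ac) C1.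
have C3 := Ck_on_slice1 u0 C2.
apply: (Ck_on_eq (open_cod ac)); last first.
  by apply: Ck_on_sub C3 => u cu /=; have [] := frame_b_dom ac cu.
by move=> u cu; rewrite /frame_b (@derive_slice2 _ _ _ _ m).
Qed.

Lemma frame_b_derivable c u w : atlas c -> chart_cod c u ->
  derivable (fun u2 => chart_map c (chart_inv c u * chart_inv c0 u2)%g) u0 w.
Proof.
move=> ac cu.
exact: Ck_on_derivable (Ck_mul_slice2 (chart_inv c u) 1 ac0 ac) (frame_b_dom ac cu).
Qed.

Lemma frame_b_lin c u w : atlas c -> chart_cod c u ->
  frame_b c u w = \sum_(j < n) w 0 j *: frame_b c u (delta_mx 0 j).
Proof.
move=> ac cu; apply/rowP => k; rewrite summxE.
rewrite /frame_b derive_mx ?mxE; last exact: frame_b_derivable.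
have oU := open_mul_slice (g := (chart_inv c u)) ac0 ac.
have C := Ck_on_coord 0 k oU (Ck_mul_slice2 (chart_inv c u) 1 ac0 ac).
rewrite (derive_partials _ (Ck1_differentiable oU (frame_b_dom ac cu) C)).
by apply: eq_bigr => j _; rewrite mxE derive_mx ?mxE//; exact: frame_b_derivable.
Qed.

Lemma cdir_chart w f c u : atlas c -> chart_cod c u -> smooth_fun f ->
  cdir w f (chart_inv c u) =
  \sum_(k < n) frame_b c u w 0 k * 'D_(delta_mx 0 k) (f \o chart_inv c : _ -> R^o) u.
Proof.
move=> ac cu sf.
have mu : chart_map c (chart_inv c u * chart_inv c0 u0)%g = u.
  by rewrite inv_u0 mulg1; have [] := cod_inv ac cu.
have df : differentiable (f \o chart_inv c : _ -> R^o) u.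
  exact: (Ck1_differentiable (open_cod ac) cu (sf c ac 1)).
have df' : differentiable (f \o chart_inv c : _ -> R^o)
  ((fun u2 => chart_map c (chart_inv c u * chart_inv c0 u2)%g) u0) by rewrite mu.
have [_] := is_derive_comp_dir df' (frame_b_derivable (w := w) ac cu).
rewrite mu -(deriveE _ df) => E.
rewrite -(derive_partials _ df) -[RHS]E; apply: near_eq_derive.
have := open_mul_slice (g := (chart_inv c u)) ac0 ac.
rewrite openE => /(_ u0 (frame_b_dom ac cu)).
by apply: filterS => v [_ dv] /=; have [_ ->] := dom_map ac dv.
Qed.

Definition frame_mx c u : 'M[R]_n := \matrix_(j, k) frame_b c u (delta_mx 0 j) 0 k.

(** Translation by [x] followed by translation by [x^-1] is the identity near [u0], so by the chain
    rule a vector killed by the first differential is killed by the identity map. *)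
Lemma frame_mx_unit c u : atlas c -> chart_cod c u -> frame_mx c u \in unitmx.
Proof.
move=> ac cu; rewrite -row_free_unit -kermx_eq0.
apply/eqP/row_matrixP => i; rewrite row0; move: (row i _) (row_sub i (kermx (frame_mx c u))) => w.
move=> /sub_kermxP wB.
have b0 : frame_b c u w = 0.
  rewrite frame_b_lin//; apply/rowP => k; rewrite mxE summxE.
  have /rowP/(_ k) := wB; rewrite !mxE => {2}<-.
  by apply: eq_bigr => j _; rewrite !mxE.
pose x := chart_inv c u.
have [dx mx] := cod_inv ac cu.
have Du : chart_cod c u /\ chart_dom c0 (x^-1 * chart_inv c u)%g by rewrite mulVg.
have oU := open_mul_slice (g := x^-1%g) ac ac0.
apply/rowP => k; rewrite mxE.
have C := Ck_on_coord 0 k oU (Ck_mul_slice2 x^-1%g 1 ac ac0).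
have dpsi := Ck1_differentiable oU Du C.
have mu : chart_map c (chart_inv c u * chart_inv c0 u0)%g = u by rewrite inv_u0 mulg1.
have dpsi' : differentiable (fun v => chart_map c0 (x^-1 * chart_inv c v)%g 0 k : R^o)
   ((fun u2 => chart_map c (chart_inv c u * chart_inv c0 u2)%g) u0) by rewrite mu.
have [_] := is_derive_comp_dir dpsi' (frame_b_derivable (w := w) ac cu).
rewrite -[X in 'd _ _ X]/(frame_b c u w) b0 linear0 => <-.
have /near_eq_derive -> : \forall v \near u0, (((fun v => chart_map c0 (x^-1 * chart_inv c v)%g 0 k : R^o) \o
   (fun u2 => chart_map c (chart_inv c u * chart_inv c0 u2)%g)) v) = (v 0 k : R^o).
  have o1 := open_mul_slice (g := x) ac0 ac; rewrite openE in o1.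
  have N := near_cod ac0 cod_u0.
  have := o1 u0 (frame_b_dom ac cu); move: N; apply: filterS2 => v cv [_ dv] /=.
  have [_ ->] := dom_map ac dv; rewrite mulgA mulVg mul1g.
  by have [_ ->] := cod_inv ac0 cv.
by have [_ ->] := derive_coord u0 w k.
Qed.

(** The inverse of the frame matrix writes coordinate partials as smooth combinations of
    left-invariant fields. Bounds and vanishing known for the fields thus pass to chart
    coordinates. *)
Lemma frame_partials c : atlas c -> exists A : 'rV[R]_n -> 'M[R]_n,
  (forall k i j, Ck_on k (chart_cod c) (fun u => A u i j : R^o)) /\
  (forall f u k, smooth_fun f -> chart_cod c u ->
   'D_(delta_mx 0 k) (f \o chart_inv c : _ -> R^o) u =
   \sum_(j < n) A u k j * cdir (delta_mx 0 j) f (chart_inv c u)).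
Proof.
move=> ac; exists (fun u => invmx (frame_mx c u)); split.
  move=> k i j; apply: (Ck_on_invmx (open_cod ac)) => [u|p q]; first exact: frame_mx_unit.
  apply: (Ck_on_eq (open_cod ac) _ (Ck_frame_b (delta_mx 0 p) q k ac)) => u _.
  by rewrite mxE.
move=> f u k sf cu.
pose D : 'cV[R]_n := \col_k 'D_(delta_mx 0 k) (f \o chart_inv c : _ -> R^o) u.
pose E : 'cV[R]_n := \col_j cdir (delta_mx 0 j) f (chart_inv c u).
have BD : frame_mx c u *m D = E.
  apply/colP => j; rewrite !mxE cdir_chart//; apply: eq_bigr => i _.
  by rewrite !mxE.
have /colP/(_ k) : D = invmx (frame_mx c u) *m E.
  by rewrite -BD mulKmx//; exact: frame_mx_unit.
by rewrite !mxE => ->; apply: eq_bigr => j _; rewrite !mxE.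
Qed.

Lemma cdir_left_invariant w : left_invariant_vf (cdir w).
Proof.
split.
- move=> f sf c ac k.
  apply: (Ck_on_eq (open_cod ac) (g := fun u => \sum_(i < n) frame_b c u w 0 i *
      'D_(delta_mx 0 i) (f \o chart_inv c : _ -> R^o) u : R^o)).
    by move=> u cu /=; rewrite cdir_chart.
  apply: Ck_on_sum; first exact: open_cod.
  move=> i _; apply: Ck_onM; [exact: open_cod|exact: Ck_frame_b|].
  by apply: Ck_on_derive; exact: sf.
- move=> a f g sf sg; apply/funext => x; rewrite /cdir.
  have d1 := cdir_derivable (w := w) (x := x) sf; have d2 := cdir_derivable (w := w) (x := x) sg.
  exact: derive_lin.
- move=> f g sf sg; apply/funext => x; rewrite /cdir.
  have d1 := cdir_derivable (w := w) (x := x) sf; have d2 := cdir_derivable (w := w) (x := x) sg.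
  by rewrite (derive_mul d1 d2) inv_u0 mulg1.
- move=> h f sf; apply/funext => x; rewrite /cdir.
  have -> : (fun u => f (h * (x * chart_inv c0 u))%g : R^o) = (fun u => f (h * x * chart_inv c0 u)%g : R^o).
    by apply/funext => u; rewrite mulgA.
  by [].
Qed.

(** The level set through the identity is closed by continuity, and open by the mean value theorem
    in a chart, where all partials are combinations of the vanishing fields. *)
Lemma smooth_locally_const f : connected [set: G] -> smooth_fun f ->
  (forall j x, cdir (delta_mx 0 j) f x = 0) -> forall x, f x = f 1%g.
Proof.
move=> cG sf D0.
suff : [set x | f x = f 1%g] = setT by move=> E x; have : [set: G] x by []; rewrite -E.
apply: cG; first by exists 1%g.
  exists [set x | f x = f 1%g]; last by rewrite setTI.
  rewrite openE => x /= fx.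
  have [c ac dx] := atlas_cover x; have [cx ix] := dom_map ac dx.
  have [A [_ HA]] := frame_partials ac.
  have [d dgt0 Hd] := (near_normP _ _).1 (near_cod ac cx).
  have N : \forall y \near x, `|chart_map c y - chart_map c x| < d.
    exact: (@cvgr_distC_lt _ _ _ (nbhs x) _ _ _ (cont_map ac dx) _ dgt0).
  near=> y.
  have dy : chart_dom c y by near: y; exact: near_dom.
  have yd : `|chart_map c y - chart_map c x| < d by near: y.
  have [_ iy] := dom_map ac dy.
  have dd (t : R) : `|t| <= `|1 : R| ->
      chart_cod c (chart_map c x + t *: (chart_map c y - chart_map c x)).
    move=> t1; apply: Hd; apply: le_lt_trans yd; rewrite normrZ ler_piMl//.
    by rewrite normr1 in t1.
  have [|t t1] := @MVT_dir R _ (f \o chart_inv c : _ -> R^o) (chart_map c x)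
      (chart_map c y - chart_map c x) 1.
    by move=> t t1; exact: Ck_on_derivable (sf c ac 1) (dd t t1).
  rewrite mulr1 scale1r (addrC (chart_map c x)) subrK /= ix iy derive_partials; last first.
    exact: (Ck1_differentiable (open_cod ac) (dd t t1) (sf c ac 1)).
  rewrite big1; last first.
    move=> k _; rewrite HA//; last exact: dd.
    by rewrite big1 ?mulr0// => j _; rewrite D0 mulr0.
  by move/eqP; rewrite subr_eq0 fx => /eqP.
exists [set x | f x = f 1%g]; last by rewrite setTI.
rewrite (_ : mkset _ = f @^-1` [set f 1%g])//.
by apply: closed_comp => [x _|]; [exact: smooth_cont|exact: closed_eq].
Unshelve. all: by end_near. Qed.

Lemma cdir_chart_ext phi w : (forall k, Ck_on k (chart_cod c0) (phi : _ -> R^o)) ->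
  forall f, (forall u, chart_cod c0 u -> f (chart_inv c0 u) = phi u) ->
  cdir w f 1%g = 'D_w (phi : _ -> R^o) u0.
Proof.
move=> Cphi f fphi; rewrite /cdir; apply: near_eq_derive.
by apply: filterS (near_cod ac0 cod_u0) => u cu; rewrite mul1g fphi.
Qed.

End AtIdentity.

Lemma compact_cube (a : 'rV[R]_n) (e : R) : 0 <= e -> compact [set u | `|u - a| <= e].
Proof.
move=> e0; rewrite (_ : [set u | `|u - a| <= e] = [set v : 'rV[R]_n | forall i, `[a 0 i - e, a 0 i + e]%classic (v 0 i)]).
  apply: (@rV_compact R n (fun i => `[a 0 i - e, a 0 i + e]%classic)) => i.
  exact: segment_compact.
apply/seteqP; split=> v /=.
  move=> va i; rewrite in_itv /= -ler_distlC distrC.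
  by apply: le_trans va; have := coord_le_norm (v - a) i; rewrite !mxE.
move=> H; apply: norm_le_coord => // i; rewrite !mxE.
by have := H i; rewrite in_itv /= -ler_distlC distrC.
Qed.

(** The support lies in the image of a closed cube, which is compact and hence closed because the
    group is Hausdorff. A point outside the chart therefore has a neighbourhood on which the
    extension is zero. *)
Lemma smooth_extend c (phi : 'rV[R]_n -> R) (a : 'rV[R]_n) (e : R) :
  atlas c -> 0 <= e -> (forall u, `|u - a| <= e -> chart_cod c u) ->
  (forall k, Ck_on k (chart_cod c) (phi : _ -> R^o)) ->
  (forall u, e <= `|u - a| -> phi u = 0) ->
  smooth_fun (fun x : G => if `[< chart_dom c x >] then phi (chart_map c x) else 0).
Proof.
move=> ac e0 ecod Cphi phi0; set F := (fun x => _).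
pose B := [set u : 'rV[R]_n | `|u - a| <= e].
have cK : closed (chart_inv c @` B).
  apply: compact_closed; first exact: lie_hausdorff.
  apply: continuous_compact; last exact: compact_cube.
  apply: continuous_in_subspaceT => u; rewrite inE => Bu.
  by apply: cont_inv => //; exact: ecod.
move=> c' ac' k; apply: Ck_on_loc => u cu.
have [du|du] := pselect (chart_dom c (chart_inv c' u)).
  exists (chart_map c' @` (chart_dom c' `&` chart_dom c)).
  exists (phi \o (chart_map c \o chart_inv c')).
  have E : chart_map c' @` (chart_dom c' `&` chart_dom c) =
     [set u | chart_cod c' u /\ chart_dom c (chart_inv c' u)].
    apply/seteqP; split=> v /=.
      by move=> [x [dx dx'] <-]; have [? ->] := dom_map ac' dx.
    by move=> [cv dv]; exists (chart_inv c' v); have [] := cod_inv ac' cv.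
  have oO : open (chart_map c' @` (chart_dom c' `&` chart_dom c)).
    rewrite E; apply: (open_chart_preimage ac' (h := id)); last exact: open_dom.
    by move=> x; exact: cvg_id.
  split => //; first by rewrite E.
    apply: (Ck_on_comp oO (open_cod ac)); last exact: atlas_compatible.
      by move=> v; rewrite E => -[_ dv] /=; have [] := dom_map ac dv.
    exact: Cphi.
  by move=> v; rewrite E => -[_ dv] /=; rewrite /F asboolT.
exists [set v | chart_cod c' v /\ (~` (chart_inv c @` B)) (chart_inv c' v)], (fun=> (0 : R^o)).
split.
- apply: (open_chart_preimage ac' (h := id)); last exact: closed_openC.
  by move=> x; exact: cvg_id.
- split => // -[v Bv E]; apply: du; rewrite -E.
  by have [] := cod_inv ac (ecod _ Bv).
- exact: Ck_on_cst.
- move=> v [_ nB] /=; rewrite /F; case: asboolP => // dv.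
  rewrite phi0// leNgt; apply/negP => lt; apply: nB.
  by exists (chart_map c (chart_inv c' v)); [exact: ltW|have [] := dom_map ac dv].
Qed.

Lemma smooth_bump (x : G) (A : set G) : nbhs x A ->
  exists phi : G -> R, [/\ smooth_fun phi, forall y, 0 <= phi y, 0 < phi x &
  forall y, ~ A y -> phi y = 0].
Proof.
move=> nA; have [c ac dx] := atlas_cover x; have [cx ix] := dom_map ac dx.
have N : \forall u \near chart_map c x, chart_cod c u /\ A (chart_inv c u).
  apply: filterI; first exact: near_cod.
  by apply: (cont_inv ac cx); rewrite ix.
have [e e0 He] := near_closedball N.
exists (fun y => if `[< chart_dom c y >] then cube_bump (chart_map c x) e (chart_map c y) else 0).
split.
- apply: (smooth_extend (a := chart_map c x) (e := e) ac (ltW e0)).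
  + by move=> u /He[].
  + by move=> k; apply: Ck_on_cube_bump; exact: open_cod.
  + by move=> u; apply: cube_bump_eq0.
- by move=> y; case: ifP => // _; exact: cube_bump_ge0.
- by rewrite asboolT// cube_bump_gt0// subrr normr0.
- move=> y nAy; case: asboolP => // dy; apply: cube_bump_eq0 => //.
  rewrite leNgt; apply/negP => /ltW/He[_].
  by have [_ ->] := dom_map ac dy.
Qed.

(** Globally defined substitutes for coordinates at the identity: coordinates multiplied by a bump
    still have independent differentials at 1, but they also vanish far away. The additional index
    [None] carries the difference between the bump's value at 1 and the bump, which excludes points
    outside the support. *)
Lemma coord_family (c : chart R n G) :
  atlas c -> chart_dom c 1%g ->
  exists F : option 'I_n -> G -> R, [/\ forall j, smooth_fun (F j), forall j, F j 1%g = 0,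
  forall x, (forall j, F j x = 0) -> x = 1%g &
  forall w, (forall j, cdir c w (F j) 1%g = 0) -> w = 0].
Proof.
move=> ac d0; have [cx ix] := dom_map ac d0.
have [e e0 He] := near_closedball (near_cod ac cx).
set u0 := chart_map c 1%g in cx ix He *.
pose be := cube_bump u0 e.
have b0 : 0 < be u0 by rewrite cube_bump_gt0// subrr normr0.
have Cb k : Ck_on k (chart_cod c) (be : _ -> R^o).
  by apply: Ck_on_cube_bump; exact: open_cod.
have Cl i k : Ck_on k (chart_cod c) (fun u : 'rV[R]_n => u 0 i + - u0 0 i : R^o).
  apply: Ck_onD; [exact: open_cod| |exact: Ck_on_cst].
  by apply: Ck_on_coord; [exact: open_cod|exact: Ck_on_id].
pose phi i (u : 'rV[R]_n) : R^o := be u * (u 0 i + - u0 0 i).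
have Cphi i k : Ck_on k (chart_cod c) (phi i) by apply: Ck_onM => //; exact: open_cod.
have far u : e <= `|u - u0| -> be u = 0 by move=> ue; rewrite /be cube_bump_eq0.
pose ext (h : 'rV[R]_n -> R) := fun x : G => if `[< chart_dom c x >] then h (chart_map c x) else 0.
have sb : smooth_fun (ext be) by apply: (smooth_extend ac (ltW e0) He Cb).
have sphi i : smooth_fun (ext (phi i)).
  by apply: (smooth_extend ac (ltW e0) He (Cphi i)) => u /far; rewrite /phi => ->; rewrite mul0r.
exists (fun j => if j is Some i then ext (phi i) else fun x => be u0 + -1 * ext be x); split.
- by move=> [i|]//; apply: smoothD; [exact: smooth_cst|exact: smoothZ].
- move=> [i|]; rewrite /ext asboolT//; first by rewrite /phi -/u0 subrr mulr0.
  by rewrite -/u0; ring.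
- move=> x Hx; have E : ext be x = be u0 by have := Hx None; lra.
  have dx : chart_dom c x.
    by apply: contrapT => nd; move: E b0; rewrite /ext asboolF// => <-; rewrite ltxx.
  have bx : be (chart_map c x) != 0 by move: E; rewrite /ext asboolT// => ->; rewrite gt_eqF.
  have [_ <-] := dom_map ac dx; rewrite -ix; congr (chart_inv c _); apply/rowP => i.
  have := Hx (Some i); rewrite /ext asboolT// /phi => /eqP.
  by rewrite mulf_eq0 (negPf bx) /= subr_eq0 => /eqP.
- move=> w Hw; apply/rowP => i; rewrite mxE; have := Hw (Some i).
  rewrite (cdir_chart_ext ac d0 (phi := phi i))//; last first.
    by move=> u cu; have [du mu] := cod_inv ac cu; rewrite /ext asboolT// mu.
  have -> : 'D_w (phi i) u0 = be u0 * w 0 i.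
    rewrite (@derive_mul R _ (be : _ -> R^o) (fun u : 'rV[R]_n => u 0 i + - u0 0 i : R^o)).
    + rewrite subrr mulr0 add0r; congr (_ * _).
      have [d1 d2] := derive_coord u0 w i.
      have [_ ->] := @is_deriveD R _ _ _ (fun=> (- u0 0 i : R^o)) u0 w _ _
          (DeriveDef d1 d2) (is_derive_cst _ _ _).
      by rewrite addr0.
    + exact: Ck_on_derivable (Cb 1%N) cx.
    + exact: Ck_on_derivable (Cl i 1%N) cx.
  by move/eqP; rewrite mulf_eq0 gt_eqF//= => /eqP.
Qed.

Lemma cdir_inj c0 w : atlas c0 -> chart_dom c0 1%g ->
  (forall f, smooth_fun f -> cdir c0 w f 1%g = 0) -> w = 0.
Proof.
by move=> ac0 d0 H; have [F [sF _ _ FD]] := coord_family ac0 d0; apply: FD => j; exact: H.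
Qed.

(** Each chart field is left-invariant, so the basis property of [X] supplies its row of
    coordinates; since a left-invariant field is determined by its value at 1, the resulting matrix
    is invertible. *)
Lemma cdir_frame c0 (X : 'I_n -> (G -> R) -> G -> R) :
  atlas c0 -> chart_dom c0 1%g -> lie_basis X ->
  exists2 M : 'M[R]_n, M \in unitmx &
  forall w f x, smooth_fun f -> cdir c0 w f x = frame_vf X (w *m M) f x.
Proof.
move=> ac0 d0 [lX bX].
have ex j : exists v : 'rV[R]_n, forall f, smooth_fun f ->
    cdir c0 (delta_mx 0 j) f = frame_vf X v f.
  have [v [Hv _]] := bX _ (cdir_left_invariant ac0 d0 (delta_mx 0 j)).
  by exists v.
pose M : 'M[R]_n := \matrix_j xget 0 [set v | forall f, smooth_fun f ->
    cdir c0 (delta_mx 0 j) f = frame_vf X v f].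
have HM w f x : smooth_fun f -> cdir c0 w f x = frame_vf X (w *m M) f x.
  move=> sf; rewrite (cdir_lin ac0 d0)// /frame_vf.
  have Mj j : cdir c0 (delta_mx 0 j) f x = \sum_(i < n) M j i * X i f x.
    have [v Hv] := ex j.
    have := @xgetPex _ (0 : 'rV[R]_n) [set v | forall f, smooth_fun f ->
      cdir c0 (delta_mx 0 j) f = frame_vf X v f] (ex_intro _ v Hv) f sf.
    by move=> ->; apply: eq_bigr => i _; rewrite mxE.
  under eq_bigr => j _ do rewrite Mj mulr_sumr.
  rewrite exchange_big /=; apply: eq_bigr => i _; rewrite mxE mulr_suml.
  by apply: eq_bigr => j _; rewrite mulrA.
exists M => //; rewrite -row_free_unit -kermx_eq0.
apply/eqP/row_matrixP => i; rewrite row0; move: (row i _) (row_sub i (kermx M)) => w.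
move=> /sub_kermxP wM; apply: (cdir_inj ac0 d0) => f sf.
by rewrite HM// wM /frame_vf big1// => j _; rewrite mxE mul0r.
Qed.

End Frame.

(** * Integration on the group *)

Section Integration.
Context {R : realType} {n : nat} {G : lieGroupType R n} (cG : compact [set: G]).
Implicit Types (f h : G -> R) (mu : probability (borel G) R).

Lemma measurable_open (U : set G) : open U -> measurable (U : set (borel G)).
Proof. by move=> oU; exact: sub_sigma_algebra. Qed.

Lemma cont_measurable f : continuous f -> measurable_fun setT (f : borel G -> R).
Proof.
move=> /continuousP cf; apply: (measurability _ (RGenOpens.measurableE R)).
move=> _ [_ [a [b ->] <-]]; rewrite setTI; apply: measurable_open.
exact/cf/interval_open.
Qed.

Lemma cont_measurable_map (h : G -> G) : continuous h ->
  measurable_fun setT (h : borel G -> borel G).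
Proof.
move=> /continuousP ch; apply: (@measurability _ _ (borel G) (borel G) _ _ (@open G)) => //.
by move=> _ [U oU <-]; rewrite setTI; apply: measurable_open; exact: ch.
Qed.

Lemma cont_bounded f : continuous f -> exists2 K : R, 0 <= K & forall x, `|f x| <= K.
Proof.
move=> cf; have [||c _ H] := @compact_EVT_max G R (fun x => `|f x|) setT _ cG.
- by exists 1%g.
- apply: continuous_subspaceT => x; apply: continuous_comp; first exact: cf.
  exact: norm_continuous.
- by exists `|f c| => // x; apply: H; rewrite inE.
Qed.

Lemma probT mu : mu setT = 1%E.
Proof. exact: probability_setT. Qed.

Lemma cont_integrable mu f : continuous f -> mu.-integrable setT (EFin \o (f : borel G -> R)).
Proof.
move=> cf; have [K K0 HK] := cont_bounded cf.
apply: measurable_bounded_integrable => //.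
- by rewrite [X in (X < _)%E](_ : _ = 1%E) ?ltry//; exact: probT.
- exact: cont_measurable.
- exists K; split; first exact: num_real.
  by move=> M KM x _; apply: le_trans (HK x) (ltW KM).
Qed.

Definition gint mu f : R := \int[mu]_x (f x : R).

Lemma gintE mu f : continuous f -> (gint mu f)%:E = (\int[mu]_x (f x)%:E)%E.
Proof.
move=> cf; rewrite /gint /Rintegral fineK//.
exact: (integrable_fin_num measurableT (cont_integrable mu cf)).
Qed.

Lemma eq_gint mu f h : f =1 h -> gint mu f = gint mu h.
Proof. by move=> fg; congr gint; apply/funext. Qed.

Lemma gintD mu f h : continuous f -> continuous h ->
  gint mu (fun x => f x + h x) = gint mu f + gint mu h.
Proof. by move=> cf cg; apply: RintegralD => //; exact: cont_integrable. Qed.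

Lemma gintB mu f h : continuous f -> continuous h ->
  gint mu (fun x => f x - h x) = gint mu f - gint mu h.
Proof. by move=> cf cg; apply: RintegralB => //; exact: cont_integrable. Qed.

Lemma gintZ mu (a : R) f : continuous f -> gint mu (fun x => a * f x) = a * gint mu f.
Proof. by move=> cf; apply: RintegralZl => //; exact: cont_integrable. Qed.

Lemma gint_cst mu (a : R) : gint mu (fun=> a) = a.
Proof.
rewrite /gint Rintegral_cst// [X in fine X](_ : _ = 1%E) ?mulr1//.
exact: probT.
Qed.

Lemma cont_sum (T : topologicalType) (I : Type) (r : seq I) (F : I -> T -> R) :
  (forall i, continuous (F i)) -> continuous (fun x => \sum_(i <- r) F i x).
Proof.
move=> cF; elim: r => [|i r IH].
  rewrite (_ : (fun x => _) = fun=> (0 : R)); first by move=> x; exact: cvg_cst.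
  by apply/funext => x; rewrite big_nil.
rewrite (_ : (fun x => _) = fun x => F i x + \sum_(j <- r) F j x).
  by move=> x; apply: cvgD; [exact: cF|exact: IH].
by apply/funext => x; rewrite big_cons.
Qed.

Lemma gint_sum mu (I : Type) (r : seq I) (F : I -> G -> R) :
  (forall i, continuous (F i)) ->
  gint mu (fun x => \sum_(i <- r) F i x) = \sum_(i <- r) gint mu (F i).
Proof.
move=> cF; elim: r => [|i r IH].
  rewrite big_nil -[RHS](gint_cst mu); apply: eq_gint => x; by rewrite big_nil.
rewrite big_cons -IH -gintD//; last exact: cont_sum.
by apply: eq_gint => x; rewrite big_cons.
Qed.
Lemma gint_ge0 mu f : (forall x, 0 <= f x) -> 0 <= gint mu f.
Proof. by move=> f0; apply: Rintegral_ge0. Qed.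

Lemma gint_le mu f h : continuous f -> continuous h -> (forall x, f x <= h x) ->
  gint mu f <= gint mu h.
Proof.
by move=> cf cg fg; apply: le_Rintegral => //; exact: cont_integrable.
Qed.

Lemma gint_norm_le mu f (K : R) : continuous f -> (forall x, `|f x| <= K) ->
  `|gint mu f| <= K.
Proof.
move=> cf fK; have c (a : R) : continuous (fun _ : G => a) by move=> x; exact: cvg_cst.
rewrite ler_norml -(gint_cst mu (- K)) -(gint_cst mu K) !gint_cst; apply/andP; split.
  rewrite -[leLHS](gint_cst mu); apply: gint_le => // x.
  by have := fK x; rewrite ler_norml => /andP[].
rewrite -[leRHS](gint_cst mu); apply: gint_le => // x.
by have := fK x; rewrite ler_norml => /andP[].
Qed.

(** Fubini works with the product sigma-algebra, continuity with the product topology. By second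
    countability an open set is a countable union of rectangles with sides in a countable base,
    which reconciles the two. *)
Lemma open_prod_measurable (U : set (G * G)) : open U ->
  measurable (U : set (borel G * borel G)).
Proof.
move=> oU; have [B cB [Bo Bb]] := @lie_second_countable R n G.
pose D := [set A : set G * set G | [/\ B A.1, B A.2 & A.1 `*` A.2 `<=` U]].
have cD : countable D.
  by apply: (sub_countable _ (countableX cB cB)); apply: subset_card_le => A [].
have /countable_injP[f fi] := cD.
have -> : U = \bigcup_k \bigcup_(A in [set A | D A /\ f A = k]) (A.1 `*` A.2).
  apply/seteqP; split; last by move=> x [k _ [A [[_ _ AU] _] Ax]]; exact: AU.
  move=> [x y] Uxy.
  have : nbhs (x, y) U by exact: open_nbhs_nbhs.
  move=> [[V1 V2] /= [n1 n2] V12].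
  have [A1 [BA1 A1x] A1V] := Bb x V1 n1.
  have [A2 [BA2 A2y] A2V] := Bb y V2 n2.
  exists (f (A1, A2)) => //; exists (A1, A2) => //; split => //; split => //.
  by move=> -[a b] /= [aa bb]; apply: V12; split; [exact: A1V|exact: A2V].
apply: bigcupT_measurable => k.
have [[A [DA fA]]|nA] := pselect (exists A, D A /\ f A = k); last first.
  rewrite (_ : \bigcup_(A in _) _ = set0)//.
  by apply/seteqP; split=> x// -[A DA _]; apply: nA; exists A.
rewrite (_ : \bigcup_(A in _) _ = A.1 `*` A.2).
  by case: DA => B1 B2 _; apply: measurableX; apply: measurable_open; exact: Bo.
apply/seteqP; split=> x; last by move=> Ax; exists A.
move=> [A' [DA' fA'] A'x]; rewrite -(fi A' A) ?inE//.
by rewrite fA fA'.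
Qed.

Lemma cont2_measurable (F : G * G -> R) : continuous F ->
  measurable_fun setT (F : borel G * borel G -> R).
Proof.
move=> /continuousP cF; apply: (measurability _ (RGenOpens.measurableE R)).
move=> _ [_ [a [b ->] <-]]; rewrite setTI; apply: open_prod_measurable.
exact/cF/interval_open.
Qed.

Lemma cont_slice1 (F : G * G -> R) y : continuous F -> continuous (fun x => F (x, y)).
Proof.
move=> cF x; apply: (@continuous_comp _ _ _ (fun x => (x, y)) F); last exact: cF.
by apply: cvg_pair; [exact: cvg_id|exact: cvg_cst].
Qed.

Lemma cont_slice2 (F : G * G -> R) x : continuous F -> continuous (fun y => F (x, y)).
Proof.
move=> cF y; apply: (@continuous_comp _ _ _ (fun y => (x, y)) F); last exact: cF.
by apply: cvg_pair; [exact: cvg_cst|exact: cvg_id].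
Qed.

Lemma cont2_bounded (F : G * G -> R) : continuous F ->
  exists2 K : R, 0 <= K & forall x, `|F x| <= K.
Proof.
move=> cF; have [||c _ H] := @compact_EVT_max _ R (fun x => `|F x|) (setT `*` setT) _ (compact_setX cG cG).
- by exists (1%g, 1%g).
- apply: continuous_subspaceT => x; apply: continuous_comp; first exact: cF.
  exact: norm_continuous.
- by exists `|F c| => // x; apply: H; rewrite inE.
Qed.

(** Compactness of the group makes [F (x, y)] tend to [F (x0, y)] uniformly in [y]. *)
Lemma cont_param (T : topologicalType) (F : T * G -> R) mu : continuous F ->
  continuous (fun x => gint mu (fun y => F (x, y))).
Proof.
move=> cF x0; apply/cvgrPdist_le => e e0.
have /(_ _ (nbhs x0) (fun x y => `|F (x0, y) - F (x, y)| <= e)) := (compact_near_coveringP setT).1 cG.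
have H (y : G) : setT y -> \forall y' \near y & x \near nbhs x0, `|F (x0, y') - F (x, y')| <= e.
  move=> _.
  have e2 : 0 < e / 2 by rewrite divr_gt0.
  have /(_ _ _ e2)/= N := @cvgr_dist_lt _ _ _ (nbhs (x0, y)) _ _ _ (cF (x0, y)).
  case: N => -[V1 V2] /= [n1 n2] V12.
  exists (V2, V1) => // -[y' x] /= [h1 h2].
  rewrite -(subrKA (F (x0, y))) (splitr e); apply: le_trans (ler_normD _ _) _.
  apply: lerD; last by apply: ltW; exact: (V12 (x, y')).
  by rewrite distrC; apply: ltW; apply: (V12 (x0, y')); split => //; exact: nbhs_singleton n1.
move=> /(_ _ H); apply: filterS => x Hx.
have cs x' : continuous (fun y => F (x', y)).
  move=> y; apply: (@continuous_comp _ _ _ (fun y => (x', y)) F); last exact: cF.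
  by apply: cvg_pair; [exact: cvg_cst|exact: cvg_id].
rewrite -gintB//; apply: gint_norm_le => [|y]; last exact: Hx.
by move=> y; apply: cvgB; exact: cs.
Qed.

Lemma gint_fubini mu1 mu2 (F : G * G -> R) : continuous F ->
  gint mu1 (fun x => gint mu2 (fun y => F (x, y))) =
  gint mu2 (fun y => gint mu1 (fun x => F (x, y))).
Proof.
move=> cF.
have iF : (mu1 \x mu2)%E.-integrable setT (EFin \o (F : borel G * borel G -> R)).
  have [K K0 HK] := cont2_bounded cF.
  apply: measurable_bounded_integrable => //.
  - have E : (mu1 \x mu2)%E (setT `*` setT) = 1%E.
      rewrite product_measure1E// [X in (X * _)%E](_ : _ = 1%E) ?mul1e; exact: probT.
    by rewrite [X in (X < _)%E](_ : _ = 1%E) ?ltry// -E setXTT.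
  - exact: cont2_measurable.
  - exists K; split; first exact: num_real.
    by move=> M KM x _; apply: le_trans (HK x) (ltW KM).
have cF' : continuous (fun p : G * G => F (p.2, p.1)).
  move=> p; apply: (@continuous_comp _ _ _ (fun p : G * G => (p.2, p.1)) F); last exact: cF.
  by apply: cvg_pair; [exact: cvg_snd|exact: cvg_fst].
apply: EFin_inj; rewrite (gintE mu1 (cont_param (mu := mu2) cF)) (gintE mu2 (cont_param (mu := mu1) cF')).
transitivity (\int[mu1]_x \int[mu2]_y (F (x, y))%:E)%E.
  by apply: eq_integral => x _; rewrite gintE//; exact: cont_slice2.
rewrite (Fubini iF); apply: eq_integral => x _; rewrite gintE//.
exact: cont_slice1.
Qed.

Context (haar : probability (borel G) R) (haarP : haar_probability haar).

Lemma gint_lmul (g : G) f : continuous f ->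
  gint haar (fun x => f (g * x)%g) = gint haar f.
Proof.
move=> cf.
have cfg : continuous (fun x => f (g * x)%g).
  by move=> x; apply: continuous_comp; [exact: cont_lmul|exact: cf].
apply: EFin_inj; rewrite !gintE//.
have mg : measurable_fun setT ((fun x => (g * x)%g) : borel G -> borel G).
  by apply: cont_measurable_map; exact: cont_lmul.
rewrite -(@integral_pushforward _ _ _ _ _ _ mg haar setT (fun y => (f y)%:E))//.
- apply: eq_measure_integral => A mA _; rewrite /pushforward.
  transitivity (haar [set (g * x : G)%g | x in ((fun x => (g * x)%g) @^-1` A : set G)]).
    symmetry; apply: haarP.
    by rewrite -[X in measurable X]setTI; exact: mg.
  congr (haar _); apply/seteqP; split => [_ [x Ax <-] //|x Ax].
  by exists (g^-1 * x)%g; rewrite /= mulgA mulgV mul1g.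
- by apply/measurable_EFinP; exact: cont_measurable.
- exact: (cont_integrable haar cfg).
Qed.

(** Finitely many translates of the open set where [f] is positive cover the compact group. The sum
    of these translates of [f] has a positive minimum, while each of them has the same integral as
    [f]. *)
Lemma gint_gt0 f x0 : continuous f -> (forall x, 0 <= f x) -> 0 < f x0 ->
  0 < gint haar f.
Proof.
move=> cf f0 fx0.
pose U (g : G) : set G := [set x | 0 < f (g * x)%g].
have cfg (g : G) : continuous (fun x => f (g * x)%g).
  by move=> x; apply: continuous_comp; [exact: cont_lmul|exact: cf].
have oU (g : G) : open (U g).
  have := @open_comp G R (fun x => f (g * x)%g) [set y | 0 < y].
  by apply => [x _|]; [exact: cfg|exact: open_gt].
have := cG; rewrite compact_cover => /(_ _ setT U) [||D _ HD].
- by move=> g _; exact: oU.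
- by move=> x _; exists (x0 * x^-1)%g => //; rewrite /U /= -mulgA mulVg mulg1.
pose F x := \sum_(g <- D) f (g * x)%g.
have cF : continuous F by apply: cont_sum.
have Fgt x : 0 < F x.
  have [g gD Ug] := HD x I.
  rewrite /F (big_fsetD1 g)//=; apply: ltr_wpDr => //.
  by apply: sumr_ge0 => h _; exact: f0.
have [||c _ Hc] := @compact_EVT_min G R F setT _ cG.
- by exists 1%g.
- exact: continuous_subspaceT.
have : F c <= gint haar F.
  rewrite -[leLHS](gint_cst haar); apply: gint_le => //; first by move=> x; exact: cvg_cst.
  by move=> x; apply: Hc; rewrite inE.
have -> : gint haar F = \sum_(g <- D) gint haar f.
  rewrite /F gint_sum//; apply: eq_bigr => g _; exact: (@gint_lmul g).
move=> H; rewrite lt_neqAle gint_ge0// andbT; apply/eqP => E.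
by have := lt_le_trans (Fgt c) H; rewrite -E big1 ?ltxx.
Qed.

Lemma gint_eq0 f : continuous f -> (forall x, 0 <= f x) -> gint haar f = 0 ->
  forall x, f x = 0.
Proof.
move=> cf f0 I0 x; apply/eqP; rewrite eq_le f0 andbT leNgt; apply/negP => fx.
by have := gint_gt0 cf f0 fx; rewrite I0 ltxx.
Qed.

End Integration.

Lemma sqr_le_norm (R : realType) (a b : R) : 0 <= b -> a ^+ 2 <= b ^+ 2 -> `|a| <= b.
Proof.
move=> b0 h; rewrite -(@ler_pXn2r _ 2) ?nnegrE//.
by rewrite real_normK ?num_real.
Qed.

(** Log-convexity makes the successive ratios increase and submultiplicativity bounds them by [b 0];
    [r] is their supremum. The lower bound 1 comes from [rat i ^+ j.+1 * b i <= b (i + j).+1 <= b i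
    * b j] as [i] grows. In the application [b j] is the trace of the power 2 (j + 1) of an
    operator, which explains the exponent [j.+1]. *)
Lemma ratio_limit (R : realType) (b : nat -> R) :
  (forall j, 0 < b j) -> (forall j, b j.+1 ^+ 2 <= b j * b j.+2) ->
  (forall i j, b (i + j).+1 <= b i * b j) ->
  exists r : R, [/\ 0 < r, nonincreasing_seq (fun j => b j / r ^+ j.+1) &
  forall j, 1 <= b j / r ^+ j.+1].
Proof.
move=> b_gt0 b_logconvex b_submul; pose rat j := b j.+1 / b j.
have rat_nd : nondecreasing_seq rat.
  apply/nondecreasing_seqP => j; rewrite /rat ler_pdivrMr// mulrAC.
  by rewrite ler_pdivlMr// -expr2 mulrC b_logconvex.
have rat_ub : has_ubound (range rat).
  exists (b 0) => _ [j _ <-]; rewrite /rat ler_pdivrMr//.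
  by have := b_submul 0 j; rewrite add0n.
pose r := sup (range rat).
have rat_le j : rat j <= r by apply: ub_le_sup; [exact: rat_ub|exists j].
have r0 : 0 < r by apply: lt_le_trans (rat_le 0); rewrite divr_gt0.
exists r; split => //.
  apply/nonincreasing_seqP => j; rewrite ler_pdivrMr ?exprn_gt0//.
  rewrite mulrAC ler_pdivlMr ?exprn_gt0//.
  have := rat_le j; rewrite /rat ler_pdivrMr// => H.
  by rewrite [r ^+ j.+2]exprS mulrA ler_pM2r ?exprn_gt0// mulrC.
move=> j; rewrite ler_pdivlMr ?exprn_gt0// mul1r.
have c : (fun i => rat i ^+ j.+1) @ \oo --> r ^+ j.+1.
  apply: (@continuous_cvg _ _ _ \oo _ rat (fun x : R => x ^+ j.+1) r).
    exact: exprn_continuous.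
  exact: nondecreasing_cvgn rat_nd rat_ub.
apply: (@closed_cvg _ _ \oo _ (fun i => rat i ^+ j.+1) (fun x => x <= b j) _ _ _ c).
  exact: closed_le.
apply: nearW => i.
have H k : rat i ^+ k * b i <= b (i + k)%N.
  elim: k => [|k IH]; first by rewrite expr0 mul1r addn0.
  rewrite exprS -mulrA; apply: le_trans (ler_wpM2l _ IH) _.
    by rewrite divr_ge0// ltW.
  rewrite addnS -[b (i + k).+1](divfK (x := b (i + k)%N)) ?gt_eqF//.
  by rewrite ler_pM2r//; apply: rat_nd; exact: leq_addr.
have := le_trans (H j.+1) _; rewrite addnS => /(_ _ (b_submul i j)).
by rewrite mulrC ler_pM2l.
Qed.

Lemma unif_cauchy_limit (R : realType) (T : topologicalType) (u : nat -> T -> R) :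
  (forall j, continuous (u j)) ->
  (forall e : R, 0 < e -> exists N, forall i j x, (N <= i)%N -> (N <= j)%N ->
   `|u i x - u j x| <= e) ->
  exists2 f : T -> R, continuous f &
  forall e : R, 0 < e -> exists N, forall i x, (N <= i)%N -> `|u i x - f x| <= e.
Proof.
move=> cu uc; pose f x : R := lim (u ^~ x @ \oo).
have fcvg x : u ^~ x @ \oo --> f x.
  apply/cauchy_cvgP/cauchy_exP => e e0.
  have e2 : 0 < e / 2 by rewrite divr_gt0.
  have [N HN] := uc _ e2; exists (u N x); exists N => // j /= Nj.
  rewrite -ball_normE /=; apply: le_lt_trans (HN N j x (leqnn _) Nj) _.
  by rewrite ltr_pdivrMr// mulr_natr mulr2n ltrDl.
have fu (e : R) : 0 < e -> exists N, forall i x, (N <= i)%N -> `|u i x - f x| <= e.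
  move=> e0; have [N HN] := uc _ e0; exists N => i x Ni.
  have c : (fun j => `|u i x - u j x|) @ \oo --> `|u i x - f x|.
    by apply: cvg_norm; apply: cvgB; [exact: cvg_cst|exact: fcvg].
  by apply: (cvgr_to_le c); exists N => // j /= Nj; exact: HN.
exists f => // x; apply/cvgrPdist_le => e e0.
have e3 : 0 < e / 3 by rewrite divr_gt0.
have [N HN] := fu _ e3.
have /(_ _ _ e3) := @cvgr_dist_le _ _ _ (nbhs x) _ _ _ (cu N x).
apply: filterS => y Hy.
have h1 := HN N x (leqnn _); have h2 := HN N y (leqnn _).
move: h1 h2 Hy; rewrite !ler_norml => /andP[? ?] /andP[? ?] /andP[? ?].
by apply/andP; split; lra.
Qed.

(** * The Peter-Weyl theorem *)

Section Kernels.
Context {R : realType} {n : nat} {G : lieGroupType R n} (cG : compact [set: G])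
 (haar : probability (borel G) R) (haarP : haar_probability haar).
Local Notation I := (gint haar).
Implicit Types (f h : G -> R) (K L : G * G -> R).

Lemma contM (T : topologicalType) (f h : T -> R) :
  continuous f -> continuous h -> continuous (fun x => f x * h x).
Proof. by move=> cf ch x; apply: cvgM; [exact: cf|exact: ch]. Qed.

Lemma contD (T : topologicalType) (f h : T -> R) :
  continuous f -> continuous h -> continuous (fun x => f x + h x).
Proof. by move=> cf ch x; apply: cvgD; [exact: cf|exact: ch]. Qed.

Lemma contB (T : topologicalType) (f h : T -> R) :
  continuous f -> continuous h -> continuous (fun x => f x - h x).
Proof. by move=> cf ch x; apply: cvgB; [exact: cf|exact: ch]. Qed.

Lemma contZ (T : topologicalType) (a : R) (f : T -> R) :
  continuous f -> continuous (fun x => a * f x).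
Proof. by move=> cf; apply: contM => // x; exact: cvg_cst. Qed.

Lemma contC (T U V : topologicalType) (f : T -> U) (h : U -> V) :
  continuous f -> continuous h -> continuous (fun x => h (f x)).
Proof. by move=> cf ch x; apply: continuous_comp; [exact: cf|exact: ch]. Qed.

Lemma contP (T U V : topologicalType) (f : T -> U) (h : T -> V) :
  continuous f -> continuous h -> continuous (fun x => (f x, h x)).
Proof. by move=> cf ch x; apply: cvg_pair; [exact: cf|exact: ch]. Qed.

Lemma cont1 (T U : topologicalType) : continuous (fun p : T * U => p.1).
Proof. by move=> x; exact: cvg_fst. Qed.

Lemma cont2 (T U : topologicalType) : continuous (fun p : T * U => p.2).
Proof. by move=> x; exact: cvg_snd. Qed.

Lemma contI (T : topologicalType) : continuous (fun x : T => x).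
Proof. by move=> x; exact: cvg_id. Qed.

Lemma contK (T U : topologicalType) (a : U) : continuous (fun _ : T => a).
Proof. by move=> x; exact: cvg_cst. Qed.

Lemma contmul (T : topologicalType) (f h : T -> G) :
  continuous f -> continuous h -> continuous (fun x => f x * h x)%g.
Proof. by move=> cf ch; exact: (contC (contP cf ch) lie_mul_continuous). Qed.

Lemma continv (T : topologicalType) (f : T -> G) :
  continuous f -> continuous (fun x => (f x)^-1)%g.
Proof. by move=> cf; exact: (contC cf lie_inv_continuous). Qed.

Lemma gint_CS f h : continuous f -> continuous h ->
  I (fun x => f x * h x) ^+ 2 <= I (fun x => f x ^+ 2) * I (fun x => h x ^+ 2).
Proof.
move=> cf ch.
pose a := I (fun x => h x ^+ 2); pose c := I (fun x => f x * h x).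
have cff : continuous (fun x => f x ^+ 2) by apply: contM.
have chh : continuous (fun x => h x ^+ 2) by apply: contM.
have cfh : continuous (fun x => f x * h x) by apply: contM.
have [a0|a0] := eqVneq a 0.
  have h0 x : h x = 0.
    have := gint_eq0 cG haarP chh (fun x => sqr_ge0 _) a0 x.
    by move/eqP; rewrite sqrf_eq0 => /eqP.
  rewrite -/a a0 mulr0 (@eq_gint _ _ _ haar _ (fun=> 0)); last by move=> x; rewrite h0 mulr0.
  by rewrite gint_cst// expr0n.
have ap : 0 < a by rewrite lt_neqAle eq_sym a0 gint_ge0// => x; exact: sqr_ge0.
have : 0 <= I (fun x => (a * f x - c * h x) ^+ 2).
  by apply: gint_ge0 => x; exact: sqr_ge0.
have -> : I (fun x => (a * f x - c * h x) ^+ 2) =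
   a * (a * I (fun x => f x ^+ 2) - c ^+ 2).
  rewrite (@eq_gint _ _ _ haar _ (fun x => a ^+ 2 * f x ^+ 2 + (- (2 * a * c)) * (f x * h x) + c ^+ 2 * h x ^+ 2)); last by move=> x; ring.
  rewrite gintD//; [|by apply: contD; exact: contZ|exact: contZ].
  rewrite gintD//; [|exact: contZ|exact: contZ].
  by rewrite !gintZ// -/a -/c; ring.
by rewrite pmulr_rge0// subr_ge0 mulrC.
Qed.

(** Kernels of self-adjoint operators that commute with left translations. Invariance makes the
    diagonal constant and the eigenspaces translation-invariant. *)
Definition inv_kernel K := [/\ continuous K,
  forall (g x y : G), K (g * x, g * y)%g = K (x, y) & forall x y, K (x, y) = K (y, x)].

Definition kcomp K L (p : G * G) : R := I (fun z => K (p.1, z) * L (z, p.2)).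

Lemma kcomp_cont K L : continuous K -> continuous L -> continuous (kcomp K L).
Proof.
move=> cK cL.
apply: (@cont_param _ _ _ cG _ (fun q : (G * G) * G => K (q.1.1, q.2) * L (q.2, q.1.2))).
apply: contM.
  apply: (contC (f := fun q : (G * G) * G => (q.1.1, q.2)) _ cK).
  by apply: contP; [exact: (contC (@cont1 _ _) (@cont1 _ _))|exact: cont2].
apply: (contC (f := fun q : (G * G) * G => (q.2, q.1.2)) _ cL).
by apply: contP; [exact: cont2|exact: (contC (@cont1 _ _) (@cont2 _ _))].
Qed.

Lemma slice1 K y : continuous K -> continuous (fun x => K (x, y)).
Proof. by move=> cK; apply: (contC _ cK); apply: contP; [exact: contI|exact: contK]. Qed.

Lemma slice2 K x : continuous K -> continuous (fun y => K (x, y)).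
Proof. by move=> cK; apply: (contC _ cK); apply: contP; [exact: contK|exact: contI]. Qed.

Lemma kcomp_inv K L : inv_kernel K -> inv_kernel L ->
  forall g x y : G, kcomp K L (g * x, g * y)%g = kcomp K L (x, y).
Proof.
move=> [cK iK _] [cL iL _] g x y; rewrite /kcomp /=.
rewrite -(gint_lmul cG haarP g); last by apply: contM; [exact: slice2|exact: slice1].
by apply: eq_gint => z; rewrite iK iL.
Qed.

Lemma kcompA K L M : continuous K -> continuous L -> continuous M ->
  kcomp K (kcomp L M) = kcomp (kcomp K L) M.
Proof.
move=> cK cL cM; apply/funext => -[x y]; rewrite /kcomp /=.
pose F (q : G * G) := K (x, q.1) * L (q.1, q.2) * M (q.2, y).
have cF : continuous F.
  apply: contM; first apply: contM.
  - by apply: (contC (f := fun q : G * G => q.1) (h := fun z => K (x, z))); [exact: cont1|exact: slice2].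
  - by apply: (contC _ cL); apply: contP; [exact: cont1|exact: cont2].
  - by apply: (contC (f := fun q : G * G => q.2) (h := fun z => M (z, y))); [exact: cont2|exact: slice1].
transitivity (I (fun z => I (fun w => F (z, w)))).
  apply: eq_gint => z; rewrite -gintZ//; last by apply: contM; [exact: slice2|exact: slice1].
  by apply: eq_gint => w; rewrite /F /= mulrA.
rewrite gint_fubini//; apply: eq_gint => w.
rewrite mulrC -gintZ//; last by apply: contM; [exact: slice2|exact: slice1].
by apply: eq_gint => z; rewrite /F /= mulrC.
Qed.

Lemma gint_sum2 (I J : finType) (a : I -> R) (B : I -> J -> R) (f : J -> G -> R) :
  (forall j, continuous (f j)) ->
  gint haar (fun x => \sum_i \sum_j (a i * B i j) * f j x) =
  \sum_i a i * \sum_j B i j * gint haar (f j).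
Proof.
move=> cf; rewrite gint_sum//; last by move=> i; apply: cont_sum => j; exact: contZ.
apply: eq_bigr => i _; rewrite gint_sum//; last by move=> j; exact: contZ.
by rewrite mulr_sumr; apply: eq_bigr => j _; rewrite gintZ// mulrA.
Qed.

Section Powers.
Context (K : G * G -> R) (kK : inv_kernel K) (K11 : 0 < K (1%g, 1%g)).

(** Off by one: [kpow j] is the kernel of the power [j + 1] of the operator, so composing [kpow i]
    and [kpow j] gives [kpow (i + j).+1]. *)
Definition kpow j := iter j (kcomp K) K.

Lemma kpow_cont j : continuous (kpow j).
Proof. by have [cK _ _] := kK; elim: j => //= j IH; exact: kcomp_cont. Qed.

Lemma kpowD i j : kcomp (kpow i) (kpow j) = kpow (i + j).+1.
Proof.
have [cK _ _] := kK; elim: i => //= i IH.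
by rewrite -kcompA ?IH//; exact: kpow_cont.
Qed.

Lemma kpow_ker j : inv_kernel (kpow j).
Proof.
have [cK iK sK] := kK; elim: j => //= j IH; split.
- by apply: kcomp_cont => //; exact: kpow_cont.
- by move=> g x y; apply: kcomp_inv.
- move=> x y; have E := kpowD j 0; rewrite addn0 in E.
  transitivity (kcomp (kpow j) (kpow 0) (x, y)); first by rewrite E.
  rewrite /kcomp /=; apply: eq_gint => z.
  by have [_ _ s] := IH; rewrite mulrC (s x) (sK y).
Qed.

(** The diagonal of an invariant kernel is constant and the measure has mass 1, so the value at the
    identity is the trace of the operator. *)
Let tr j := kpow j (1%g, 1%g).

Lemma kpow_dot i j (y : G) :
  I (fun z => kpow i (y, z) * kpow j (y, z)) = tr (i + j).+1.
Proof.
have [_ _ s] := kpow_ker j; have [_ iv _] := kpow_ker (i + j).+1.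
have -> : tr (i + j).+1 = kpow (i + j).+1 (y, y).
  by rewrite -(iv y^-1%g y y) mulVg.
by rewrite -kpowD /kcomp /=; apply: eq_gint => z; rewrite (s z).
Qed.

Let b j := tr (j + j).+1.

Lemma kpow_sq j y : I (fun z => kpow j (y, z) ^+ 2) = b j.
Proof. exact: kpow_dot. Qed.

Lemma b_gt0_of j : kpow j (1%g, 1%g) != 0 -> 0 < b j.
Proof.
move=> p0; rewrite -(kpow_sq j 1%g).
have cs := slice2 (x := 1%g) (@kpow_cont j).
apply: (gint_gt0 cG haarP (x0 := 1%g)); first exact: contM.
  by move=> x; exact: sqr_ge0.
by rewrite lt_neqAle sqr_ge0 andbT eq_sym sqrf_eq0.
Qed.

Lemma b_logconvex j : b j.+1 ^+ 2 <= b j * b j.+2.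
Proof.
have cs i := slice2 (x := 1%g) (@kpow_cont i).
have := gint_CS (cs j) (cs j.+2); rewrite kpow_dot !kpow_sq.
by rewrite /b (_ : (j + j.+2).+1 = (j.+1 + j.+1).+1)// addSn addnS.
Qed.

Lemma b_gt0 j : 0 < b j.
Proof.
have b0 : 0 < b 0 by apply: b_gt0_of; rewrite gt_eqF.
have b1 : 0 < b 1 by apply: b_gt0_of; rewrite -[kpow 1 _]/(b 0) gt_eqF.
suff : 0 < b j /\ 0 < b j.+1 by case.
elim: j => [|j [h1 h2]]; split; [exact: b0|exact: b1|exact: h2|].
by have := lt_le_trans (exprn_gt0 2 h2) (b_logconvex j); rewrite pmulr_rgt0.
Qed.

Lemma kcomp_bound i j x y : kpow (i + j).+1 (x, y) ^+ 2 <= b i * b j.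
Proof.
rewrite -kpowD /kcomp /= -(kpow_sq i x) -(kpow_sq j y).
have := gint_CS (slice2 (x := x) (@kpow_cont i)) (slice1 (y := y) (@kpow_cont j)).
congr (_ <= _ * _); apply: eq_gint => z; by have [_ _ ->] := kpow_ker j.
Qed.

Lemma b_submul i j : b (i + j).+1 <= b i * b j.
Proof.
rewrite -(kpow_sq _ 1%g) -[leRHS](gint_cst haar).
apply: gint_le => //; [|exact: contK|by move=> z; exact: kcomp_bound].
by have cs := slice2 (x := 1%g) (@kpow_cont (i + j).+1); exact: contM.
Qed.

(** Eigenfunctions of the square of the operator, whose kernel is [kpow 1]: even powers have
    positive traces and do not see the sign of an eigenvalue of [K]. *)
Definition eigenfun (r : R) f :=
  continuous f /\ forall x, I (fun z => kpow 1 (x, z) * f z) = r * f x.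

(* Power iteration: the ratios of the squared L^2 norms b_j of the iterated kernels
   increase to some r > 0, and [kpow (2 * j) / r ^+ j] is uniformly Cauchy; its limit
   is fixed by K^2 / r. *)
Lemma kernel_eigenfun : exists2 r : R, 0 < r &
  exists2 f, eigenfun r f & exists x, f x != 0.
Proof.
have [r [r0 Bni B1]] := ratio_limit b_gt0 b_logconvex b_submul.
pose B j := b j / r ^+ j.+1.
exists r => //.
have rn0 k : r ^+ k != 0 by rewrite expf_neq0// gt_eqF.
(* The section through the identity of the power 2j + 2, normalised so that all scalar products
   [dotu] are values of the convergent sequence [B]. *)
pose u j (x : G) := kpow (j + j).+1 (1%g, x) / r ^+ j.+1.
have cu j : continuous (u j).
  rewrite (_ : u j = fun x => (r ^+ j.+1)^-1 * kpow (j + j).+1 (1%g, x)).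
    by apply: contZ; apply: slice2; exact: kpow_cont.
  by apply/funext => x; rewrite mulrC.
have dotu i j : I (fun x => u i x * u j x) = B (i + j).+1.
  rewrite /u (@eq_gint _ _ _ haar _ (fun z => (r ^+ i.+1 * r ^+ j.+1)^-1 * (kpow (i + i).+1 (1%g, z) * kpow (j + j).+1 (1%g, z)))); last first.
    by move=> z; rewrite invfM mulrACA mulrC.
  rewrite gintZ//; last by apply: contM; apply: slice2; exact: kpow_cont.
  rewrite kpow_dot mulrC -exprD.
  have -> : (i.+1 + j.+1 = (i + j).+2)%N by lia.
  by have -> : (((i + i).+1 + (j + j).+1).+1 = ((i + j).+1 + (i + j).+1).+1)%N by lia.
have cuu i j : continuous (fun x => u i x - u j x) by apply: contB.
have dist i j : I (fun x => (u i x - u j x) ^+ 2) = B (i + i).+1 - 2 * B (i + j).+1 + B (j + j).+1.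
  rewrite -!dotu (@eq_gint _ _ _ haar _ (fun x => u i x * u i x + (- 2) * (u i x * u j x) + u j x * u j x)); last first.
    by move=> x; ring.
  rewrite gintD//; [|by apply: contD; [exact: contM|apply: contZ; exact: contM]|exact: contM].
  rewrite gintD//; [|exact: contM|by apply: contZ; exact: contM].
  by rewrite gintZ ?mulNr//; exact: contM.
have recu j x : u j.+1 x = r^-1 * I (fun z => kpow 1 (x, z) * u j z).
  have E : kpow (j.+1 + j.+1).+1 (1%g, x) = I (fun z => kpow 1 (x, z) * kpow (j + j).+1 (1%g, z)).
    have [_ _ s] := kpow_ker (j.+1 + j.+1).+1; rewrite s.
    have -> : (j.+1 + j.+1).+1 = (1 + (j + j).+1).+1 by lia.
    rewrite -kpowD {1}/kcomp; apply: eq_gint => z.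
    have [_ _ s'] := kpow_ker (j + j).+1.
    exact: (f_equal (fun q => kpow 1 (x, z) * q) (s' z 1%g)).
  rewrite /u E (@eq_gint _ _ _ haar (fun z => kpow 1 (x, z) * (_ / _)) (fun z => (r ^+ j.+1)^-1 * (kpow 1 (x, z) * kpow (j + j).+1 (1%g, z)))); last first.
    by move=> z; rewrite mulrA mulrC.
  rewrite gintZ//; last by apply: contM; apply: slice2; exact: kpow_cont.
  by move: (I _) => q; rewrite [RHS]mulrA -invfM -exprS [RHS]mulrC.
pose S f (x : G) := I (fun z => kpow 1 (x, z) * f z).
have Sb f x : continuous f -> S f x ^+ 2 <= b 1 * I (fun z => f z ^+ 2).
  move=> cf; rewrite -(kpow_sq 1 x); apply: gint_CS => //.
  by apply: slice2; exact: kpow_cont.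
have SB f h x : continuous f -> continuous h -> S f x - S h x = S (fun z => f z - h z) x.
  move=> cf ch; rewrite /S -gintB//; [|by apply: contM => //; apply: slice2; exact: kpow_cont..].
  by apply: eq_gint => z; rewrite mulrBr.
have Bcvg : B @ \oo --> inf (range B).
  apply: nonincreasing_cvgn Bni _.
  by exists 0 => _ [j _ <-]; apply: le_trans (B1 j).
have Bcauchy (e : R) : 0 < e -> exists N, forall i j, (N <= i)%N -> (N <= j)%N ->
   B (i + i).+1 - 2 * B (i + j).+1 + B (j + j).+1 <= e.
  move=> e0; have e4 : 0 < e / 4 by rewrite divr_gt0.
  have /(_ _ _ e4)[N _ HN] := (cvgrPdist_le _ _).1 Bcvg.
  exists N => i j iN jN.
  have H k l : (N <= k)%N -> `|inf (range B) - B (k + l).+1| <= e / 4.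
    by move=> kN; apply: HN => /=; apply: leq_trans kN _; rewrite -addnS leq_addr.
  have /= := (H i i iN, H i j iN, H j j jN).
  by rewrite !ler_norml => -[[/andP[] ? ? /andP[] ? ?] /andP[] ? ?]; lra.
(* One application of the squared operator, which is bounded from L^2 to the sup norm by the square
   root of [b 1], upgrades the L^2 Cauchy property to a uniform one; this costs one index. *)
have ucauchy (e : R) : 0 < e -> exists N, forall i j x, (N <= i)%N -> (N <= j)%N ->
   `|u i x - u j x| <= e.
  move=> e0; have e1 : 0 < (r * e) ^+ 2 / b 1 by rewrite divr_gt0 ?exprn_gt0 ?mulr_gt0 ?b_gt0.
  have [N HN] := Bcauchy _ e1; exists N.+1 => -[//|i] [//|j] x iN jN.
  rewrite !recu -mulrBr SB// normrM gtr0_norm ?invr_gt0// ler_pdivrMl//.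
  apply: sqr_le_norm; first by rewrite mulr_ge0// ltW.
  apply: le_trans (Sb _ _ (cuu i j)) _.
  rewrite dist mulrC -ler_pdivlMr ?b_gt0//; exact: HN.
have [f cf uf] := unif_cauchy_limit cu ucauchy.
exists f.
  split => // x.
  have -> : r * f x = S f x; last by [].
  apply/eqP; rewrite -subr_eq0 -normr_eq0; apply/eqP/le_anti; rewrite normr_ge0 andbT.
  apply/ler_addgt0Pl => e e0; rewrite addr0.
  have e1 : 0 < e / (2 * r) by rewrite divr_gt0 ?mulr_gt0.
  have [K1 K10 HK1] := cont2_bounded cG (@kpow_cont 1).
  have e2 : 0 < e / (2 * (K1 + 1)) by rewrite divr_gt0// mulr_gt0// ltr_wpDl.
  have [N1 H1] := uf _ e1; have [N2 H2] := uf _ e2.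
  pose N := maxn N1 N2.
  have h1 := H1 N.+1 x ltac:(rewrite /N; lia).
  have h2 : `|S (u N) x - S f x| <= e / 2.
    rewrite SB//; apply: gint_norm_le => //.
      by apply: contM; [apply: slice2; exact: kpow_cont|exact: contB].
    move=> z; rewrite normrM.
    apply: le_trans (ler_pM (normr_ge0 _) (normr_ge0 _) (HK1 (x, z)) (H2 N z ltac:(rewrite /N; lia))) _.
    rewrite mulrA ler_pdivrMr; last by rewrite mulr_gt0// ltr_wpDl.
    have -> : e / 2 * (2 * (K1 + 1)) = (K1 + 1) * e by field.
    by rewrite ler_pM2r// lerDl.
  have E : r * f x - S f x = - (r * (u N.+1 x - f x)) + (S (u N) x - S f x).
    by rewrite recu mulrBr mulrA mulfV ?gt_eqF// mul1r /S; ring.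
  rewrite E; apply: le_trans (ler_normD _ _) _.
  rewrite normrN normrM (gtr0_norm r0) (splitr e); apply: lerD => //.
  rewrite mulrC -ler_pdivlMr//; apply: le_trans h1 _.
  by apply: le_of_eq; field; rewrite gt_eqF.
(* The limit is not zero because the squared L^2 norm of every [u N] is a value of [B], hence at
   least 1. *)
apply/not_existsP => f0.
have {}f0 x : f x = 0 by apply/eqP/negPn/negP; exact: f0.
have h : (0 : R) < 1 / 2 by rewrite divr_gt0.
have [N HN] := uf _ h.
have : I (fun x => u N x * u N x) <= 1 / 4.
  rewrite -[leRHS](gint_cst haar); apply: gint_le => //; [exact: contM|exact: contK|].
  move=> x; have := HN N x (leqnn _); rewrite f0 subr0 ler_norml => /andP[? ?]; nra.
rewrite dotu => H; have := le_trans (B1 _) H.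
by lra.
Qed.

Lemma eigenfun_lmul r f (g : G) : eigenfun r f -> eigenfun r (fun x => f (g * x)%g).
Proof.
move=> [cf ef]; split.
  by apply: (contC (f := fun x => (g * x)%g) _ cf); exact: cont_lmul.
move=> x; rewrite -ef -[RHS](gint_lmul cG haarP g); last first.
  by apply: contM => //; apply: slice2; exact: kpow_cont.
by apply: eq_gint => z; have [_ -> _] := kpow_ker 1.
Qed.

(** Bessel's inequality for the section [kpow 1 (x, .)], integrated over x. The inverse Gram matrix
    stands in for an orthonormal basis, and the trace of [Gm *m invmx Gm] counts the functions:
    eigenspaces are finite-dimensional. *)
Lemma eigenfun_bound r (N : nat) (f : 'I_N -> G -> R) :
  (forall i, eigenfun r (f i)) ->
  (forall c : 'rV[R]_N, (forall x, \sum_i c 0 i * f i x = 0) -> c = 0) ->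
  N%:R * r ^+ 2 <= b 1.
Proof.
move=> ef indep.
have cf i : continuous (f i) by case: (ef i).
pose Gm : 'M[R]_N := \matrix_(i, j) I (fun x => f i x * f j x).
have cff i j : continuous (fun x => f i x * f j x) by exact: contM.
have csum (c : 'I_N -> R) : continuous (fun x => \sum_i c i * f i x).
  by apply: cont_sum => i; exact: contZ.
have quad (c : 'rV[R]_N) : I (fun x => (\sum_i c 0 i * f i x) ^+ 2) = (c *m Gm *m c^T) 0 0.
  rewrite mxE (@eq_gint _ _ _ haar _ (fun x => \sum_j \sum_i c 0 i * c 0 j * (f i x * f j x))); last first.
    move=> x; rewrite expr2 mulr_sumr; apply: eq_bigr => j _; rewrite mulr_suml.
    by apply: eq_bigr => i _; ring.
  rewrite gint_sum//; last by move=> j; apply: cont_sum => i; exact: contZ.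
  apply: eq_bigr => j _; rewrite gint_sum//; last by move=> i; exact: contZ.
  rewrite !mxE mulr_suml; apply: eq_bigr => i _; rewrite gintZ// !mxE.
  by rewrite mulrAC.
have Gu : Gm \in unitmx.
  rewrite -row_free_unit -kermx_eq0; apply/eqP/row_matrixP => i; rewrite row0.
  move: (row i _) (row_sub i (kermx Gm)) => c /sub_kermxP cG0.
  apply: indep => x; apply/eqP; rewrite -sqrf_eq0; apply/eqP.
  apply: (gint_eq0 cG haarP (f := fun x => (\sum_i c 0 i * f i x) ^+ 2)).
  - exact: contM.
  - by move=> y; exact: sqr_ge0.
  - by rewrite quad cG0 mul0mx mxE.
have GT : Gm^T = Gm.
  by apply/matrixP => i j; rewrite !mxE; apply: eq_gint => x; rewrite mulrC.
have GiT : (invmx Gm)^T = invmx Gm by rewrite trmx_inv GT.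
have ck x : continuous (fun z => kpow 1 (x, z)) by apply: slice2; exact: kpow_cont.
pose v (x : G) : 'rV[R]_N := \row_i f i x.
have bessel x : r ^+ 2 * (v x *m invmx Gm *m (v x)^T) 0 0 <= b 1.
  pose be : 'rV[R]_N := r *: (v x *m invmx Gm).
  have : 0 <= I (fun z => (kpow 1 (x, z) - \sum_i be 0 i * f i z) ^+ 2).
    by apply: gint_ge0 => z; exact: sqr_ge0.
  rewrite (@eq_gint _ _ _ haar _ (fun z => (kpow 1 (x, z) ^+ 2 + (-2) * (kpow 1 (x, z) * \sum_i be 0 i * f i z)) + (\sum_i be 0 i * f i z) ^+ 2)); last by move=> z; ring.
  have cs := csum (be 0).
  have ck2 := contM (ck x) (ck x).
  have cm := contM (ck x) cs.
  rewrite gintD//; [|by apply: contD; [exact: ck2|exact: contZ]|exact: (contM cs cs)].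
  rewrite gintD//; [|exact: contZ].
  rewrite gintZ// kpow_sq quad.
  have -> : I (fun z => kpow 1 (x, z) * \sum_i be 0 i * f i z) = r * (be *m (v x)^T) 0 0.
    rewrite (@eq_gint _ _ _ haar _ (fun z => \sum_i be 0 i * (kpow 1 (x, z) * f i z))); last first.
      by move=> z; rewrite mulr_sumr; apply: eq_bigr => i _; ring.
    rewrite gint_sum//; last by move=> i; apply: contZ; exact: contM.
    rewrite mxE mulr_sumr; apply: eq_bigr => i _; rewrite gintZ//; last exact: contM.
    have [_ ->] := ef i; rewrite !mxE; ring.
  rewrite /be -!scalemxAl mulmxKV// linearZ /= -scalemxAr scalerA.
  rewrite trmx_mul GiT mulmxA !mxE.
  by move: (\sum_j _) => q; rewrite expr2 => H; lra.
have : I (fun x => r ^+ 2 * (v x *m invmx Gm *m (v x)^T) 0 0) <= b 1.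
  rewrite -[leRHS](gint_cst haar); apply: gint_le => //; last exact: contK.
  apply: contZ; rewrite (_ : (fun x => _) = fun x => \sum_j \sum_i (invmx Gm i j) * (f i x * f j x)).
    by apply: cont_sum => j; apply: cont_sum => i; exact: contZ.
  apply/funext => x; rewrite mxE; apply: eq_bigr => j _; rewrite !mxE mulr_suml.
  by apply: eq_bigr => i _; rewrite !mxE; ring.
rewrite (@eq_gint _ _ _ haar _ (fun x => \sum_j \sum_i (r ^+ 2 * invmx Gm i j) * (f i x * f j x))); last first.
  move=> x; rewrite mxE mulr_sumr; apply: eq_bigr => j _; rewrite !mxE mulr_suml mulr_sumr.
  by apply: eq_bigr => i _; rewrite !mxE; ring.
rewrite gint_sum//; last by move=> j; apply: cont_sum => i; exact: contZ.
rewrite (eq_bigr (fun=> r ^+ 2)); last first.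
  move=> j _; rewrite gint_sum//; last by move=> i; exact: contZ.
  transitivity (r ^+ 2 * (Gm *m invmx Gm) j j); last by rewrite mulmxV// mxE eqxx mulr1.
  rewrite mxE mulr_sumr; apply: eq_bigr => i _; rewrite gintZ// [Gm j i]mxE.
  rewrite (@eq_gint _ _ _ haar (fun x => f i x * f j x) (fun x => f j x * f i x)); last by move=> x; rewrite mulrC.
  by move: (I _) => q; ring.
by rewrite sumr_const card_ord mulr_natl.
Qed.

End Powers.
End Kernels.

(** * Complex-valued functions and their integrals *)

Section ComplexFunctions.
Context {R : realType}.
Local Notation C := R[i].

Lemma ReD (x y : C) : Re (x + y) = Re x + Re y. Proof. by case: x; case: y. Qed.
Lemma ImD (x y : C) : Im (x + y) = Im x + Im y. Proof. by case: x; case: y. Qed.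
Lemma ReN (x : C) : Re (- x) = - Re x. Proof. by case: x. Qed.
Lemma ImN (x : C) : Im (- x) = - Im x. Proof. by case: x. Qed.
Lemma ReM (x y : C) : Re (x * y) = Re x * Re y - Im x * Im y.
Proof. by case: x; case: y. Qed.
Lemma ImM (x y : C) : Im (x * y) = Re x * Im y + Im x * Re y.
Proof. by case: x; case: y. Qed.
Lemma ReJ (x : C) : Re (x^*) = Re x. Proof. by case: x. Qed.
Lemma ImJ (x : C) : Im (x^*) = - Im x. Proof. by case: x. Qed.
Lemma Re_toC (a : R) : Re (toC a) = a. Proof. by []. Qed.
Lemma Im_toC (a : R) : Im (toC a) = 0. Proof. by []. Qed.
Lemma C_eq (x y : C) : Re x = Re y -> Im x = Im y -> x = y.
Proof. by case: x y => a b [c d] /= -> ->. Qed.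
Lemma Re_sum (I : Type) (r : seq I) (P : pred I) (F : I -> C) :
  Re (\sum_(i <- r | P i) F i) = \sum_(i <- r | P i) Re (F i).
Proof. by elim/big_rec2: _ => // i x y _ <-; rewrite ReD. Qed.
Lemma Im_sum (I : Type) (r : seq I) (P : pred I) (F : I -> C) :
  Im (\sum_(i <- r | P i) F i) = \sum_(i <- r | P i) Im (F i).
Proof. by elim/big_rec2: _ => // i x y _ <-; rewrite ImD. Qed.

Definition ccont (T : topologicalType) (f : T -> C) :=
  continuous (fun x => Re (f x)) /\ continuous (fun x => Im (f x)).

Lemma ccont_eq (T : topologicalType) (f g : T -> C) : f =1 g -> ccont f -> ccont g.
Proof. by move=> /funext ->. Qed.

Lemma ccont_cst (T : topologicalType) (a : C) : ccont (fun _ : T => a).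
Proof. by split; exact: contK. Qed.

Lemma ccontD (T : topologicalType) (f g : T -> C) :
  ccont f -> ccont g -> ccont (fun x => f x + g x).
Proof.
move=> [f1 f2] [g1 g2]; split.
  by under eq_fun do rewrite ReD; exact: contD.
by under eq_fun do rewrite ImD; exact: contD.
Qed.

Lemma ccontM (T : topologicalType) (f g : T -> C) :
  ccont f -> ccont g -> ccont (fun x => f x * g x).
Proof.
move=> [f1 f2] [g1 g2]; split.
  by under eq_fun do rewrite ReM; apply: contB; exact: contM.
by under eq_fun do rewrite ImM; apply: contD; exact: contM.
Qed.

Lemma ccontZ (T : topologicalType) (a : C) (f : T -> C) :
  ccont f -> ccont (fun x => a * f x).
Proof. by move=> cf; apply: ccontM => //; exact: ccont_cst. Qed.

Lemma ccontJ (T : topologicalType) (f : T -> C) : ccont f -> ccont (fun x => (f x)^*).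
Proof.
move=> [f1 f2]; split; first by under eq_fun do rewrite ReJ.
by under eq_fun do rewrite ImJ; move=> x; apply: cvgN; exact: f2.
Qed.

Lemma ccont_sum (T : topologicalType) (I : Type) (r : seq I) (F : I -> T -> C) :
  (forall i, ccont (F i)) -> ccont (fun x => \sum_(i <- r) F i x).
Proof.
move=> cF; split.
  by under eq_fun do rewrite Re_sum; apply: cont_sum => i; case: (cF i).
by under eq_fun do rewrite Im_sum; apply: cont_sum => i; case: (cF i).
Qed.

Lemma ccont_comp (T U : topologicalType) (h : T -> U) (f : U -> C) :
  continuous h -> ccont f -> ccont (fun x => f (h x)).
Proof.
move=> ch [f1 f2]; split.
  exact: (contC ch f1).
exact: (contC ch f2).
Qed.

Lemma ccont_real (T : topologicalType) (f : T -> R) : continuous f -> ccont (fun x => toC (f x)).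
Proof. by move=> cf; split => //=; exact: contK. Qed.

Section Int.
Context {n : nat} {G : lieGroupType R n} (cG : compact [set: G]).
Implicit Types (mu : probability (borel G) R) (f g : G -> C).

Definition cint mu f : C := Complex (gint mu (fun x => Re (f x))) (gint mu (fun x => Im (f x))).

Lemma eq_cint mu f g : f =1 g -> cint mu f = cint mu g.
Proof. by move=> /funext ->. Qed.

Lemma cintD mu f g : ccont f -> ccont g ->
  cint mu (fun x => f x + g x) = cint mu f + cint mu g.
Proof.
move=> [f1 f2] [g1 g2]; apply: C_eq; rewrite ?ReD ?ImD /=.
  by rewrite -gintD//; apply: eq_gint => x; rewrite ReD.
by rewrite -gintD//; apply: eq_gint => x; rewrite ImD.
Qed.

Lemma cintZ mu (a : C) f : ccont f -> cint mu (fun x => a * f x) = a * cint mu f.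
Proof.
move=> [f1 f2]; apply: C_eq; rewrite ?ReM ?ImM /=.
  rewrite -!gintZ// -gintB//; try exact: contZ.
  by apply: eq_gint => x; rewrite ReM.
rewrite -!gintZ// -gintD//; try exact: contZ.
by apply: eq_gint => x; rewrite ImM.
Qed.

Lemma cint_cst mu (a : C) : cint mu (fun=> a) = a.
Proof. by apply: C_eq; rewrite /= gint_cst. Qed.

Lemma cint_sum mu (I : Type) (r : seq I) (F : I -> G -> C) :
  (forall i, ccont (F i)) ->
  cint mu (fun x => \sum_(i <- r) F i x) = \sum_(i <- r) cint mu (F i).
Proof.
move=> cF; elim: r => [|i r IH].
  by rewrite big_nil -[RHS](cint_cst mu); apply: eq_cint => x; rewrite big_nil.
rewrite big_cons -IH -cintD//; last exact: ccont_sum.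
by apply: eq_cint => x; rewrite big_cons.
Qed.

Lemma cintJ mu f : ccont f -> cint mu (fun x => (f x)^*) = (cint mu f)^*.
Proof.
move=> [f1 f2]; apply: C_eq; rewrite ?ReJ ?ImJ /=.
  by apply: eq_gint => x; rewrite ReJ.
rewrite -mulN1r -gintZ//; apply: eq_gint => x; by rewrite ImJ mulN1r.
Qed.

Lemma cint_fubini mu1 mu2 (F : G * G -> C) : ccont F ->
  cint mu1 (fun x => cint mu2 (fun y => F (x, y))) =
  cint mu2 (fun y => cint mu1 (fun x => F (x, y))).
Proof.
move=> [F1 F2]; apply: C_eq => /=.
  exact: (gint_fubini cG mu1 mu2 F1).
exact: (gint_fubini cG mu1 mu2 F2).
Qed.

Lemma ccont_param (T : topologicalType) (F : T * G -> C) mu : ccont F ->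
  ccont (fun x => cint mu (fun y => F (x, y))).
Proof.
move=> [F1 F2]; split => /=.
  exact: (cont_param cG (mu := mu) F1).
exact: (cont_param cG (mu := mu) F2).
Qed.

Context (haar : probability (borel G) R) (haarP : haar_probability haar).

Lemma cint_lmul (k : G) f : ccont f -> cint haar (fun x => f (k * x)%g) = cint haar f.
Proof.
move=> [f1 f2]; apply: C_eq => /=.
  exact: (gint_lmul cG haarP k f1).
exact: (gint_lmul cG haarP k f2).
Qed.

End Int.
End ComplexFunctions.

(** Greedy choice: as long as the vectors found do not span, some annihilating row is nonzero, and
    independence yields a point whose value lies outside their span. An invertible matrix of values
    later recovers [p] from relations such as [F (x * y) = p x *m F y]. *)
Lemma indep_points (K : fieldType) (T : Type) (d : nat) (F : T -> 'cV[K]_d) :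
  (forall c : 'rV_d, (forall y, c *m F y = 0) -> c = 0) ->
  exists y : 'I_d -> T, (\matrix_(i, j) F (y j) i 0) \in unitmx.
Proof.
move=> indep.
suff H k : (k <= d)%N -> exists y : 'I_k -> T, \rank (\matrix_(j < k) (F (y j))^T) = k.
  have [y ry] := H d (leqnn d); exists y.
  rewrite -unitmx_tr -row_free_unit /row_free.
  rewrite (_ : _^T = \matrix_(j < d) (F (y j))^T) ?ry//.
  by apply/matrixP => i j; rewrite !mxE.
elim: k => [_|k IH kd].
  have y0 : 'I_0 -> T by case.
  by exists y0; apply/eqP; rewrite -leqn0 rank_leq_row.
have [y ry] := IH (ltnW kd).
set Psi := \matrix_(j < k) (F (y j))^T in ry.
have [t Ht] : exists t, ~~ ((F t)^T <= Psi)%MS.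
  apply/not_existsP => Hn.
  have {}Hn t : ((F t)^T <= Psi)%MS by apply/negPn/negP; exact: Hn.
  have r0 : \rank (cokermx Psi) != 0%N by rewrite mxrank_coker ry subn_eq0 -ltnNge.
  have := r0; rewrite -mxrank_tr mxrank_eq0 => /eqP; apply.
  apply/row_matrixP => i; rewrite row0; apply: indep => t.
  have := Hn t; rewrite submxE => /eqP E.
  apply/trmx_inj; rewrite trmx_mul trmx0 tr_row trmxK.
  by rewrite colE mulmxA E mul0mx.
exists (fun j => if unlift ord0 j is Some i then y i else t).
set M := \matrix_(j < k.+1) _.
have tM : ((F t)^T <= M)%MS.
  have := row_sub ord0 M; rewrite rowK.
  by case: unliftP => [i' E|_//]; have := neq_lift ord0 i'; rewrite -E eqxx.
have PM : (Psi <= M)%MS.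
  by apply/row_subP => i; rewrite rowK; have := row_sub (lift ord0 i) M; rewrite rowK liftK.
have : (Psi < M)%MS.
  by rewrite ltmxE PM /=; apply: contra Ht => MP; exact: submx_trans tM MP.
move=> /rank_ltmx; rewrite ry => lt; apply/eqP; rewrite eqn_leq lt andbT.
exact: rank_leq_row.
Qed.

Section PeterWeyl.
Context {R : realType} {n : nat} {G : lieGroupType R n}.
Local Notation C := R[i].
Context (cG : compact [set: G]) (haar : probability (borel G) R)
 (haarP : haar_probability haar).

Lemma rep_ccont d (p : G -> 'M[C]_d) : representation p -> forall i j, ccont (fun x => p x i j).
Proof. by move=> [_ _ c] i j; exact: c. Qed.

Section Eigen.
Context (K : G * G -> R) (kK : inv_kernel K) (K11 : 0 < K (1%g, 1%g)) (r : R).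
Local Notation eig := (eigenfun haar K r).

Lemma eigenfun_lin (a b : R) f1 f2 : eig f1 -> eig f2 -> eig (fun x => a * f1 x + b * f2 x).
Proof.
move=> [c1 e1] [c2 e2]; split; first by apply: contD; exact: contZ.
move=> x; have ck : continuous (fun z => kpow haar K 1 (x, z)).
  by apply: slice2; exact: kpow_cont.
have c1' := contM ck c1; have c2' := contM ck c2.
rewrite (@eq_gint _ _ _ haar _ (fun z => a * (kpow haar K 1 (x, z) * f1 z) + b * (kpow haar K 1 (x, z) * f2 z))).
  by rewrite gintD ?gintZ ?e1 ?e2//; [ring|exact: contZ|exact: contZ].
by move=> z; move: (kpow _ _ _ _) => q; ring.
Qed.

Lemma eigenfun0 : eig (fun=> 0).
Proof.
split; first exact: contK.
move=> x; rewrite mulr0 (@eq_gint _ _ _ haar _ (fun=> 0)) ?gint_cst//.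
by move=> z; rewrite mulr0.
Qed.

Definition ceig (f : G -> C) := eig (fun x => Re (f x)) /\ eig (fun x => Im (f x)).

Lemma ceig_eq f g : f =1 g -> ceig f -> ceig g.
Proof. by move=> /funext ->. Qed.

Lemma ceigZD (a : C) f g : ceig f -> ceig g -> ceig (fun x => a * f x + g x).
Proof.
have eqf (f1 f2 : G -> R) : f1 =1 f2 -> eig f1 -> eig f2 by move=> /funext ->.
move=> [f1 f2] [g1 g2]; split.
  apply: (eqf (fun x => 1 * (Re a * Re (f x) + (- Im a) * Im (f x)) + 1 * Re (g x))).
    by move=> x; rewrite ReD ReM; ring.
  by apply: eigenfun_lin => //; exact: eigenfun_lin.
apply: (eqf (fun x => 1 * (Re a * Im (f x) + Im a * Re (f x)) + 1 * Im (g x))).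
  by move=> x; rewrite ImD ImM; ring.
by apply: eigenfun_lin => //; exact: eigenfun_lin.
Qed.

Lemma ceig_sum (I : Type) (s : seq I) (a : I -> C) (f : I -> G -> C) :
  (forall i, ceig (f i)) -> ceig (fun x => \sum_(i <- s) a i * f i x).
Proof.
move=> ef; elim: s => [|i s IH].
  apply: (@ceig_eq (fun=> 0)); first by move=> x; rewrite big_nil.
  by split; exact: eigenfun0.
apply: (@ceig_eq (fun x => a i * f i x + \sum_(i <- s) a i * f i x)).
  by move=> x; rewrite big_cons.
exact: ceigZD.
Qed.

(** A nonzero finite-dimensional space of eigenfunctions stable under left translation, given by a
    basis arranged as the column [F]; [p] collects the matrices of the translations. *)
Definition eigen_family d := (0 < d)%N /\ exists F : G -> 'cV[C]_d,
  [/\ forall i, ceig (fun x => F x i 0),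
    forall c : 'rV_d, (forall y, c *m F y = 0) -> c = 0 &
    exists p : G -> 'M[C]_d, forall x y, F (x * y)%g = p x *m F y].

(** Translates of an eigenfunction are eigenfunctions for the same eigenvalue, so only boundedly
    many are independent. A maximal independent set of translates spans all of them, hence a
    translation-invariant space. *)
Lemma eigen_family_exists f0 x0 : 0 < r -> eig f0 -> f0 x0 != 0 -> exists d, eigen_family d.
Proof.
move=> r0 ef0 fx0.
pose indep N (x : 'I_N -> G) := forall c : 'rV[R]_N,
  (forall y, \sum_i c 0 i * f0 (x i * y)%g = 0) -> c = 0.
pose P N := `[< exists x : 'I_N -> G, indep N x >].
have P1 : P 1%N.
  apply/asboolP; exists (fun=> 1%g) => c /(_ x0).
  rewrite big_ord1 mul1g => /eqP; rewrite mulf_eq0 (negPf fx0) orbF => /eqP c0.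
  by apply/rowP => i; rewrite (ord1 i) c0 mxE.
have eft (g : G) : eig (fun x => f0 (g * x)%g) by apply: eigenfun_lmul.
pose b1 := kpow haar K 3 (1%g, 1%g).
have Pb N : P N -> (N <= Num.bound (b1 / r ^+ 2))%N.
  move=> /asboolP[x ix].
  have := eigenfun_bound cG haarP kK (f := fun i y => f0 (x i * y)%g) (fun i => eft (x i)) ix.
  rewrite -ler_pdivlMr ?exprn_gt0// => H; apply: ltnW; rewrite -(ltr_nat R).
  apply: le_lt_trans H _; apply: archi_boundP; rewrite divr_ge0 ?exprn_ge0 ?(ltW r0)//.
  (* The empty family yields [0 <= b1]. *)
  have := eigenfun_bound cG haarP kK (f := fun (i : 'I_0) y => f0 y) (fun i => ef0).
  move=> H; apply: le_trans (H _); first by rewrite mulr_ge0// exprn_ge0// ltW.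
  by move=> c _; apply/rowP => -[].
case: (ex_maxnP (ex_intro _ 1%N P1) Pb) => N /asboolP[x ix] Nmax.
have span (g : G) : exists a : 'rV[R]_N, forall y, f0 (g * y)%g = \sum_i a 0 i * f0 (x i * y)%g.
  apply/not_existsP => nspan.
  have : P N.+1; last by move/Nmax; rewrite ltnn.
  apply/asboolP; exists (fun i => if unlift ord0 i is Some j then x j else g) => c Hc.
  have {}Hc y : c 0 ord0 * f0 (g * y)%g + \sum_i c 0 (lift ord0 i) * f0 (x i * y)%g = 0.
    have E := Hc y; rewrite big_ord_recl unlift_none in E; rewrite -[RHS]E.
    by congr (_ + _); apply: eq_bigr => i _; rewrite liftK.
  have [c0|c0] := eqVneq (c 0 ord0) 0; last first.
    exfalso; apply: (nspan (\row_i (- (c 0 (lift ord0 i)) / c 0 ord0))) => y.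
    apply: (mulfI c0); have /eqP := Hc y; rewrite addr_eq0 => /eqP ->.
    rewrite mulr_sumr -sumrN; apply: eq_bigr => i _; rewrite mxE.
    by field.
  have /ix E : forall y, \sum_i (\row_i c 0 (lift ord0 i)) 0 i * f0 (x i * y)%g = 0.
    move=> y; have E := Hc y; rewrite c0 mul0r add0r in E; rewrite -[RHS]E.
    by apply: eq_bigr => i _; rewrite mxE.
  apply/rowP => i; rewrite mxE; case: (unliftP ord0 i) => [j ->|-> //].
  by have /rowP/(_ j) := E; rewrite !mxE.
have [a Ha] := choice span.
exists N; split.
  by apply: leq_trans (Nmax _ P1).
exists (fun y => \col_i toC (f0 (x i * y)%g)); split.
- move=> i; apply: (@ceig_eq (fun y => toC (f0 (x i * y)%g))); first by move=> y; rewrite mxE.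
  by split; [exact: eft|exact: eigenfun0].
- move=> c Hc.
  have Hy y : \sum_i c 0 i * toC (f0 (x i * y)%g) = 0.
    have /rowP/(_ 0) E := Hc y; rewrite !mxE in E; rewrite -[RHS]E.
    by apply: eq_bigr => i _; rewrite mxE.
  have /ix E1 : forall y, \sum_i (\row_i Re (c 0 i)) 0 i * f0 (x i * y)%g = 0.
    move=> y; have E := congr1 Re (Hy y); rewrite Re_sum in E; rewrite -[RHS]E.
    by apply: eq_bigr => i _; rewrite mxE ReM Re_toC Im_toC mulr0 subr0.
  have /ix E2 : forall y, \sum_i (\row_i Im (c 0 i)) 0 i * f0 (x i * y)%g = 0.
    move=> y; have E := congr1 Im (Hy y); rewrite Im_sum in E; rewrite -[RHS]E.
    by apply: eq_bigr => i _; rewrite mxE ImM Re_toC Im_toC mulr0 add0r.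
  apply/rowP => i; rewrite mxE; apply: C_eq.
    by have /rowP/(_ i) := E1; rewrite !mxE.
  by have /rowP/(_ i) := E2; rewrite !mxE.
- exists (fun g => \matrix_(i, j) toC (a (x i * g)%g 0 j)) => g y.
  apply/colP => i; rewrite !mxE mulgA Ha rmorph_sum.
  by apply: eq_bigr => j _; rewrite rmorphM !mxE.
Qed.

(* A translation-invariant family of eigenfunctions of least dimension carries an
   irreducible representation. *)
Lemma eigen_family_irr : (exists d, eigen_family d) ->
  exists d, [/\ (0 < d)%N & exists F : G -> 'cV[C]_d, exists p : G -> 'M[C]_d,
  [/\ forall i, ceig (fun x => F x i 0),
    forall c : 'rV_d, (forall y, c *m F y = 0) -> c = 0,
    forall x y, F (x * y)%g = p x *m F y & irr p]].
Proof.
move=> [d0 Q0]; have ex : exists d, `[< eigen_family d >] by exists d0; apply/asboolP.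
case: (ex_minnP ex) => d /asboolP[d_gt0 [F [cF iF [p Hp]]]] dmin {d0 Q0 ex}.
exists d; split=> //; exists F, p.
have [y uy] := indep_points iF.
set Phi := \matrix_(i, j) _ in uy.
have pPhi x : p x *m Phi = \matrix_(i, j) F (x * y j)%g i 0.
  apply/matrixP => i j; rewrite [RHS]mxE Hp !mxE; apply: eq_bigr => k _.
  by rewrite mxE.
have pE x : p x = (\matrix_(i, j) F (x * y j)%g i 0) *m invmx Phi.
  by rewrite -pPhi mulmxK.
have prep : representation p.
  split.
  - rewrite pE; rewrite (_ : (\matrix_(i, j) _) = Phi) ?mulmxV//.
    by apply/matrixP => i j; rewrite !mxE mul1g.
  - move=> x x'; rewrite pE [in RHS](pE x') mulmxA; congr (_ *m _).
    apply/matrixP => i j; rewrite mxE -mulgA Hp !mxE.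
    by apply: eq_bigr => k _; rewrite !mxE.
  - move=> i j; have : ccont (fun x => p x i j); last by [].
    apply: (@ccont_eq _ _ (fun x => \sum_k F (x * y k)%g i 0 * invmx Phi k j)).
      by move=> x; rewrite pE mxE; apply: eq_bigr => k _; rewrite mxE.
    apply: ccont_sum => k; apply: ccontM; last exact: ccont_cst.
    apply: (ccont_comp (h := fun x => (x * y k)%g) (f := fun x => F x i 0)).
      exact: cont_rmul.
    by case: (cF i) => -[? _] [? _]; split.
split => //; split => // U HU.
have [r0|r0] := eqVneq (\rank U) 0%N; [by left|right].
apply/eqP; rewrite eqn_leq rank_leq_row /= leqNgt; apply/negP => rd.
pose B := row_base (kermx U^T).
have kp x : (kermx U^T *m p x <= kermx U^T)%MS.
  apply/sub_kermxP; have /submxP[D HD] := HU x.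
  have -> : kermx U^T *m p x *m U^T = kermx U^T *m (U *m (p x)^T)^T.
    by rewrite trmx_mul trmxK mulmxA.
  by rewrite HD trmx_mul mulmxA mulmx_ker mul0mx.
have Bp x : (B *m p x <= B)%MS.
  by rewrite eq_row_base; apply: submx_trans (kp x); apply: submxMr; rewrite eq_row_base.
have rk : \rank (kermx U^T) = (d - \rank U)%N by rewrite mxrank_ker mxrank_tr.
have : eigen_family (\rank (kermx U^T)).
  split; first by rewrite rk subn_gt0.
  exists (fun z => B *m F z); split.
  - move=> i; apply: (@ceig_eq (fun z => \sum_k B i k * F z k 0)).
      by move=> z; rewrite mxE.
    exact: ceig_sum.
  - move=> c Hc; have /iF/eqP : forall z, (c *m B) *m F z = 0 by move=> z; rewrite -mulmxA.
    by rewrite mulmx_free_eq0 ?row_base_free// => /eqP.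
  - exists (fun x => B *m p x *m pinvmx B) => x z.
    have E := mulmxKpV (Bp x).
    by rewrite Hp [RHS]mulmxA E mulmxA.
move=> /asboolP/dmin; rewrite rk leq_subRL// ?(ltnW rd)//.
by move: r0; lia.
Qed.

End Eigen.

(** If [h] were nonzero, the invariant kernel [K], an averaged product of translates of [h], would
    be positive at the identity and would have an eigenfunction. Its translates span an irreducible
    representation, whose coefficients are orthogonal to [h] by hypothesis. So [K], and with it its
    square, annihilates these eigenfunctions although the eigenvalue is positive. *)
Theorem peter_weyl (h : G -> R) : continuous h ->
  (forall d (p : G -> 'M[C]_d), irr p ->
     forall i j, cint haar (fun x => toC (h x) * p x i j) = 0) ->
  forall x, h x = 0.
Proof.
move=> ch Hh x0; apply/eqP/negPn/negP => hx0.
pose K (q : G * G) := gint haar (fun z => h (z^-1 * q.1)%g * h (z^-1 * q.2)%g).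
have chz : continuous (fun q : (G * G) * G => h (q.2^-1 * q.1.1)%g * h (q.2^-1 * q.1.2)%g).
  apply: contM.
    apply: (contC (f := fun q : (G * G) * G => (q.2^-1 * q.1.1)%g) _ ch).
    apply: contmul; first by apply: continv; exact: cont2.
    exact: (contC (@cont1 _ _) (@cont1 _ _)).
  apply: (contC (f := fun q : (G * G) * G => (q.2^-1 * q.1.2)%g) _ ch).
  apply: contmul; first by apply: continv; exact: cont2.
  exact: (contC (@cont1 _ _) (@cont2 _ _)).
have kK : inv_kernel K.
  split.
  - exact: (cont_param cG (mu := haar) chz).
  - move=> g x y; rewrite /K /= -(gint_lmul cG haarP g)//; last first.
      exact: (contC (contP (@contK _ _ ((g * x)%g, (g * y)%g)) (@contI _)) chz).
    by apply: eq_gint => z; rewrite invgM -!mulgA !(mulgA g^-1%g) mulVg !mul1g.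
  - by move=> x y; apply: eq_gint => z; rewrite mulrC.
have K11 : 0 < K (1%g, 1%g).
  rewrite /K /=; apply: (gint_gt0 cG haarP (x0 := x0^-1%g)).
  - exact: (contC (contP (@contK _ _ (1%g, 1%g)) (@contI _)) chz).
  - by move=> z; rewrite -expr2 sqr_ge0.
  - by rewrite invgK mulg1 -expr2 lt_neqAle sqr_ge0 andbT eq_sym sqrf_eq0.
have [r r0 [f0 ef0 [x1 fx1]]] := kernel_eigenfun cG haarP kK K11.
have [d [d_gt0 [F [p [cF iF Hp ip]]]]] :=
  eigen_family_irr kK K11 (eigen_family_exists kK r0 ef0 fx1).
have prep : representation p by case: ip.
have pc := rep_ccont prep.
have [_ pM _] := prep.
have cC := ccont_real ch.
have F0 x i : cint haar (fun z => toC (h z) * F (x * z)%g i 0) = 0.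
  rewrite (@eq_cint _ _ _ haar _ (fun z =>
    \sum_k \sum_l (p x i l * F 1%g k 0) * (toC (h z) * p z l k))).
    rewrite cint_sum// => [|k]; last first.
      by apply: ccont_sum => l; apply: ccontZ; exact: ccontM.
    rewrite big1// => k _; rewrite cint_sum// => [|l]; last first.
      by apply: ccontZ; exact: ccontM.
    rewrite big1// => l _; rewrite cintZ//; last exact: ccontM.
    by rewrite Hh// mulr0.
  move=> z; rewrite -[(x * z)%g]mulg1 Hp pM mxE mulr_sumr.
  apply: eq_bigr => k _; rewrite mxE mulr_suml mulr_sumr.
  by apply: eq_bigr => l _; ring.
have zero f : eigenfun haar K r f -> (forall x, gint haar (fun z => h z * f (x * z)%g) = 0) ->
    forall x, f x = 0.
  move=> [cf ef] Hf x; apply: (mulfI (lt0r_neq0 r0)); rewrite -ef mulr0.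
  (* Fubini and the substitution [y -> z * y] turn the integral of [K] against [f] into an integral
     over [z] of the pairings of [h] with translates of [f]. *)
  have Kf x' : gint haar (fun y => K (x', y) * f y) = 0.
    rewrite (@eq_gint _ _ _ haar _ (fun y => gint haar (fun z =>
        h (z^-1 * x')%g * h (z^-1 * y)%g * f y))); last first.
      move=> y; rewrite mulrC -gintZ//; last first.
        exact: (contC (contP (@contK _ _ (x', y)) (@contI _)) chz).
      by apply: eq_gint => z; rewrite /= mulrC.
    rewrite (gint_fubini cG haar haar (F := fun q : G * G =>
       h (q.2^-1 * x')%g * h (q.2^-1 * q.1)%g * f q.1)); last first.
      apply: contM; last exact: (contC (@cont1 _ _) cf).
      exact: (contC (contP (contP (@contK _ _ x') (@cont1 _ _)) (@cont2 _ _)) chz).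
    rewrite (@eq_gint _ _ _ haar _ (fun=> 0)) ?gint_cst// => z.
    rewrite -(gint_lmul cG haarP z); last first.
      apply: contM => //.
      exact: (contC (contP (contP (@contK _ _ x') (@contI _)) (@contK _ _ z)) chz).
    rewrite (@eq_gint _ _ _ haar _ (fun y => h (z^-1 * x')%g * (h y * f (z * y)%g))).
      rewrite gintZ ?Hf ?mulr0//; apply: contM => //.
      by apply: (contC (f := fun x => (z * x)%g) _ cf); exact: cont_lmul.
    by move=> y; rewrite /= mulgA mulVg mul1g mulrA.
  have [cK _ _] := kK.
  rewrite (@eq_gint _ _ _ haar _ (fun y => gint haar (fun w =>
     K (x, w) * K (w, y) * f y))); last first.
    move=> y; rewrite mulrC -gintZ//; last first.
      by apply: contM; [exact: slice2|exact: slice1].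
    by apply: eq_gint => z; rewrite /= mulrC.
  rewrite (gint_fubini cG haar haar (F := fun q : G * G =>
     K (x, q.2) * K (q.2, q.1) * f q.1)); last first.
    apply: contM; last exact: (contC (@cont1 _ _) cf).
    apply: contM; first exact: (contC (contP (@contK _ _ x) (@cont2 _ _)) cK).
    exact: (contC (contP (@cont2 _ _) (@cont1 _ _)) cK).
  rewrite (@eq_gint _ _ _ haar _ (fun=> 0)) ?gint_cst// => w.
  rewrite (@eq_gint _ _ _ haar _ (fun y => K (x, w) * (K (w, y) * f y))).
    by rewrite gintZ ?Kf ?mulr0//; apply: contM => //; exact: slice2.
  by move=> y; rewrite /= mulrA.
have FE i x : F x i 0 = 0.
  have [e1 e2] := cF i; apply: C_eq.
    apply: (zero _ e1) => y; have := congr1 Re (F0 y i); rewrite [RHS]/= => <-.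
    by apply: eq_gint => z; rewrite ReM Re_toC Im_toC mul0r subr0.
  apply: (zero _ e2) => y; have := congr1 Im (F0 y i); rewrite [RHS]/= => <-.
  by apply: eq_gint => z; rewrite ImM Re_toC Im_toC mul0r addr0.
have /rowP/(_ (Ordinal d_gt0)) : const_mx 1 = 0 :> 'rV[C]_d.
  apply: iF => y; apply/matrixP => i j.
  by rewrite mxE [RHS]mxE big1// => k _; rewrite (ord1 j) FE mulr0.
by rewrite !mxE => /eqP; rewrite oner_eq0.
Qed.

End PeterWeyl.

(** * Representations: smoothness, Schur orthogonality, differentials *)

Section RepSmooth.
Context {R : realType} {n : nat} {G : lieGroupType R n}.
Local Notation C := R[i].
Hypothesis cG : compact [set: G].

(** Continuity is requested only on the slice over [t0], because chart inverses are continuous only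
    on the chart's range. *)
Lemma cont_unif (T : topologicalType) (F : T * G -> R) (t0 : T) (e : R) : 0 < e ->
  (forall y, {for (t0, y), continuous F}) ->
  \forall t \near t0, forall y, `|F (t0, y) - F (t, y)| <= e.
Proof.
move=> e0 cF.
have /(_ _ (nbhs t0) (fun x y => `|F (t0, y) - F (x, y)| <= e)) := (compact_near_coveringP setT).1 cG.
have H (y : G) : setT y -> \forall y' \near y & x \near nbhs t0, `|F (t0, y') - F (x, y')| <= e.
  move=> _.
  have e2 : 0 < e / 2 by rewrite divr_gt0.
  have /(_ _ _ e2)/= N := @cvgr_dist_lt _ _ _ (nbhs (t0, y)) _ _ _ (cF y).
  case: N => -[V1 V2] /= [n1 n2] V12.
  exists (V2, V1) => // -[y' x] /= [h1 h2].
  rewrite -(subrKA (F (t0, y))) (splitr e); apply: le_trans (ler_normD _ _) _.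
  apply: lerD; last by apply: ltW; exact: (V12 (x, y')).
  by rewrite distrC; apply: ltW; apply: (V12 (t0, y')); split => //; exact: nbhs_singleton n1.
by move=> /(_ _ H); apply: filterS => x Hx y; exact: Hx.
Qed.

Context (haar : probability (borel G) R) (haarP : haar_probability haar).

Lemma conv_cont (phi q : G -> R) : continuous phi -> continuous q ->
  continuous (fun g => gint haar (fun x => phi (x^-1 * g)%g * q x)).
Proof.
move=> cphi cq.
apply: (cont_param cG (F := fun p : G * G => phi (p.2^-1 * p.1)%g * q p.2)).
apply: contM; last exact: (contC (@cont2 _ _) cq).
apply: (contC (f := fun p : G * G => (p.2^-1 * p.1)%g) _ cphi).
by apply: contmul; [apply: continv; exact: cont2|exact: cont1].
Qed.

Lemma cont_for_sum (T : topologicalType) (x : T) (I : Type) (r : seq I) (F : I -> T -> R) :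
  (forall i, {for x, continuous (F i)}) -> {for x, continuous (fun x => \sum_(i <- r) F i x)}.
Proof.
move=> cF; elim: r => [|i r IH].
  rewrite (_ : (fun x => _) = fun=> (0 : R)); first exact: cvg_cst.
  by apply/funext => y; rewrite big_nil.
rewrite (_ : (fun x => _) = fun x => F i x + \sum_(j <- r) F j x).
  by apply: cvgD; [exact: cF|exact: IH].
by apply/funext => y; rewrite big_cons.
Qed.

(** Differentiation under the integral sign. Expressing chart derivatives through left-invariant
    fields, which commute with the translation by [x^-1], shows that a derivative of a convolution
    is a smooth combination of convolutions with the same [q]; higher orders then follow by
    induction. *)
Lemma conv_main c0 c (q : G -> R) : atlas c0 -> chart_dom c0 1%g -> atlas c -> continuous q ->
  exists A : 'rV[R]_n -> 'M[R]_n,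
  [/\ forall k i j, Ck_on k (chart_cod c) (fun u => A u i j : R^o),
   forall phi v u x, smooth_fun phi -> chart_cod c u ->
  'D_v ((fun g => phi (x^-1 * g)%g) \o chart_inv c : _ -> R^o) u =
  \sum_i v 0 i * \sum_j A u i j * cdir c0 'e_j phi (x^-1 * chart_inv c u)%g &
   forall phi v u, smooth_fun phi -> chart_cod c u -> is_derive u v
  ((fun g => gint haar (fun x => phi (x^-1 * g)%g * q x)) \o chart_inv c : _ -> R^o)
  (\sum_i v 0 i * \sum_j A u i j *
    gint haar (fun x => cdir c0 'e_j phi (x^-1 * chart_inv c u)%g * q x))].
Proof.
move=> ac0 d0 ac cq.
have [A [sA HA]] := frame_partials ac0 d0 ac.
pose W := chart_cod c; have oW : open W := open_cod ac.
have [Kq Kq0 HKq] := cont_bounded cG cq.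
pose psi phi j := cdir c0 'e_j phi.
have spsi phi j : smooth_fun phi -> smooth_fun (psi phi j).
  by have [s _ _ _] := cdir_left_invariant ac0 d0 'e_j; exact: s.
exists A.
pose H phi v (p : 'rV[R]_n * G) :=
  \sum_k (v : 'rV[R]_n) 0 k * \sum_j A p.1 k j * psi phi j (p.2^-1 * chart_inv c p.1)%g.
have HD phi v u x : smooth_fun phi -> W u ->
    'D_v ((fun g => phi (x^-1 * g)%g) \o chart_inv c : _ -> R^o) u = H phi v (u, x).
  move=> sphi Wu.
  have sl : smooth_fun (fun g => phi (x^-1 * g)%g) by exact: smooth_lmul.
  rewrite derive_partials; last exact: (Ck1_differentiable oW Wu (sl c ac 1%N)).
  apply: eq_bigr => i _; congr (_ * _); rewrite HA//; apply: eq_bigr => j _; congr (_ * _).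
  have [_ _ _ inv] := cdir_left_invariant ac0 d0 'e_j.
  by rewrite inv.
split=> // phi v u sphi; rewrite -/W => Wu.
have cH x : {for (u, x), continuous (H phi v)}.
  apply: cont_for_sum => i; apply: cvgM; first exact: cvg_cst.
  apply: cont_for_sum => j; apply: cvgM.
    apply: (@continuous_comp _ _ _ fst (fun u => A u i j)); first exact: cvg_fst.
    exact: (Ck_on_cont (sA 0%N i j) Wu).
  apply: (@continuous_comp _ _ _ (fun p : 'rV[R]_n * G => (p.2^-1 * chart_inv c p.1)%g)).
    apply: (@continuous_comp _ _ _ (fun p : 'rV[R]_n * G => (p.2^-1%g, chart_inv c p.1))
      (fun p : G * G => (p.1 * p.2)%g)).
      apply: cvg_pair.
        by apply: (@continuous_comp _ _ _ snd (fun x : G => x^-1%g)); [exact: cvg_snd|exact: lie_inv_continuous].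
      by apply: (@continuous_comp _ _ _ fst (chart_inv c)); [exact: cvg_fst|exact: (cont_inv ac Wu)].
    exact: lie_mul_continuous.
  exact: (smooth_cont (spsi phi j sphi)).
have cHu : continuous (fun x => H phi v (u, x)).
  move=> x; apply: (@continuous_comp _ _ _ (fun x => (u, x)) (H phi v)); last exact: cH.
  exact: (contP (@contK _ _ u) (@contI _)).
pose F := gint haar (fun x => H phi v (u, x) * q x).
have cvgF : (fun h : R => h^-1 *: ((((fun g => gint haar (fun x => phi (x^-1 * g)%g * q x)) \o
    chart_inv c) \o shift u) (h *: v) - ((fun g => gint haar (fun x =>
      phi (x^-1 * g)%g * q x)) \o chart_inv c) u) : R^o) @ 0^' --> (F : R^o).
  apply/cvgrPdist_le => e e0.
  have e1 : 0 < e / (Kq + 1) by rewrite divr_gt0// ltr_wpDl.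
  have N1 := cont_unif e1 (fun x => cH x).
  have [d d_gt0 Hd] := (near_normP _ _).1 (filterI N1 (near_cod ac Wu)).
  have v1 : 0 < `|v| + 1 by rewrite ltr_wpDl.
  exists (d / (`|v| + 1)) => /=; first by rewrite divr_gt0.
  move=> h /=; rewrite sub0r normrN => hd h0.
  have small (s : R) : `|s| <= `|h| -> `|s *: v| < d.
    move=> sh; rewrite normrZ; apply: le_lt_trans (ler_wpM2r (normr_ge0 v) sh) _.
    rewrite ltr_pdivlMr// in hd; apply: le_lt_trans hd.
    by rewrite ler_wpM2l// lerDl.
  have Wh : W (h *: v + u) by rewrite addrC; have [] := Hd _ (small h (lexx _)).
  have cphi w : continuous (fun x => phi (x^-1 * chart_inv c w)%g * q x).
    apply: contM => //; apply: (contC (f := fun x => (x^-1 * chart_inv c w)%g) _ (smooth_cont sphi)).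
    by apply: contmul; [apply: continv; exact: contI|exact: contK].
  have -> : h^-1 *: ((((fun g => gint haar (fun x => phi (x^-1 * g)%g * q x)) \o
    chart_inv c) \o shift u) (h *: v) - ((fun g => gint haar (fun x =>
      phi (x^-1 * g)%g * q x)) \o chart_inv c) u) = gint haar (fun x =>
      h^-1 * (phi (x^-1 * chart_inv c (h *: v + u))%g * q x - phi (x^-1 * chart_inv c u)%g * q x)).
    by rewrite gintZ ?gintB//; exact: contB.
  rewrite /F -gintB//; [|by apply: contM => //; exact: cHu|by apply: contZ; exact: contB].
  apply: gint_norm_le => //.
    by apply: contB; [by apply: contM => //; exact: cHu|by apply: contZ; exact: contB].
  move=> x.
  (* For each [x] the difference quotient is the value of [H] at an intermediate point of the
     segment, so it is close to its value at [u] uniformly in [x]. *)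
  have [|s sh Es] := @MVT_dir R _ ((fun g => phi (x^-1 * g)%g) \o chart_inv c : _ -> R^o) u v h.
    move=> s sh; apply: (Ck_on_derivable (@smooth_lmul _ _ _ x^-1%g _ sphi c ac 1%N)).
    by have [] := Hd _ (small s sh).
  have [Hs Ws] := Hd _ (small s sh).
  rewrite HD//= in Es; rewrite -mulrBl (addrC (h *: v)) Es.
  rewrite (_ : h^-1 * _ = H phi v (u + s *: v, x) * q x); last by field.
  rewrite -mulrBl normrM.
  apply: (@le_trans _ _ (e / (Kq + 1) * Kq)); first by apply: ler_pM.
  by rewrite mulrAC ler_pdivrMr ?ltr_wpDl// ler_wpM2l ?(ltW e0)// lerDl.
have EF : F = \sum_i v 0 i * \sum_j A u i j *
    gint haar (fun x => psi phi j (x^-1 * chart_inv c u)%g * q x).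
  rewrite /F.
  rewrite (@eq_gint _ _ _ haar _ (fun x => \sum_i \sum_j (v 0 i * A u i j) *
     (psi phi j (x^-1 * chart_inv c u)%g * q x))); last first.
    move=> x; rewrite /H mulr_suml; apply: eq_bigr => i _.
    by rewrite mulr_sumr mulr_suml; apply: eq_bigr => j _; rewrite !mulrA.
  have cpsi j : continuous (fun x => psi phi j (x^-1 * chart_inv c u)%g * q x).
    apply: contM => //; apply: (contC (f := fun x => (x^-1 * chart_inv c u)%g) _ (smooth_cont (spsi phi j sphi))).
    by apply: contmul; [apply: continv; exact: contI|exact: contK].
  exact: gint_sum2.
rewrite -EF; split; first exact: (cvgP _ cvgF).
exact: (cvg_lim _ cvgF).
Qed.

Lemma conv_smooth (phi q : G -> R) : smooth_fun phi -> continuous q ->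
  smooth_fun (fun g => gint haar (fun x => phi (x^-1 * g)%g * q x)).
Proof.
move=> sphi cq c ac k.
have [c0 ac0 d0] := atlas_cover (1%g : G).
have [A [sA _ main]] := conv_main ac0 d0 ac cq.
pose W := chart_cod c; have oW : open W := open_cod ac.
have conv0 f : smooth_fun f -> forall u, W u -> {for u, continuous
    ((fun g => gint haar (fun x => f (x^-1 * g)%g * q x)) \o chart_inv c)}.
  move=> sf u Wu; apply: continuous_comp; first exact: cont_inv.
  exact: (conv_cont (smooth_cont sf) cq).
elim: k phi sphi => [|k IH] phi sphi /=; first by split => //; exact: conv0.
split; first exact: conv0.
move=> v; pose psi j := cdir c0 'e_j phi.
have spsi j : smooth_fun (psi j).
  by have [s _ _ _] := cdir_left_invariant ac0 d0 'e_j; exact: s.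
split=> [u Wu|]; first by have [] := main phi v u sphi Wu.
apply: (Ck_on_eq oW (g := fun u => \sum_k v 0 k * \sum_j A u k j *
   gint haar (fun x => psi j (x^-1 * chart_inv c u)%g * q x))).
  by move=> u Wu; have [_ ->] := main phi v u sphi Wu.
have H1 i j : Ck_on k W (fun u => A u i j *
    gint haar (fun x => psi j (x^-1 * chart_inv c u)%g * q x) : R^o).
  by apply: (Ck_onM oW); [exact: sA|exact: IH].
have H2 i := @Ck_on_sum _ _ _ _ (index_enum 'I_n) xpredT k W _ oW (fun j _ => H1 i j).
have H3 i := Ck_onM oW (Ck_on_cst k W (v 0 i : R^o)) (H2 i).
exact (@Ck_on_sum _ _ _ _ (index_enum 'I_n) xpredT k W _ oW (fun i _ => H3 i)).
Qed.

Lemma cdir_conv c0 w (phi q : G -> R) : atlas c0 -> chart_dom c0 1%g ->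
  smooth_fun phi -> continuous q ->
  cdir c0 w (fun g => gint haar (fun x => phi (x^-1 * g)%g * q x)) 1%g =
  gint haar (fun x => cdir c0 w phi x^-1%g * q x).
Proof.
move=> ac0 d0 sphi cq.
have [A [sA HD main]] := conv_main ac0 d0 ac0 cq.
have [cx ix] := dom_map ac0 d0.
rewrite /cdir; under eq_fun do rewrite mul1g.
have [_ ->] := main phi w _ sphi cx; rewrite ix.
have cpsi j : continuous (fun x => cdir c0 'e_j phi (x^-1 * 1)%g * q x).
  have [s _ _ _] := cdir_left_invariant ac0 d0 'e_j.
  apply: contM => //; apply: (contC (f := fun x => (x^-1 * 1)%g) _ (smooth_cont (s _ sphi))).
  by apply: contmul; [apply: continv; exact: contI|exact: contK].
rewrite [RHS](@eq_gint _ _ _ haar _ (fun x => \sum_i \sum_j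
   (w 0 i * A (chart_map c0 1%g) i j) * (cdir c0 'e_j phi (x^-1 * 1)%g * q x))); last first.
  move=> x; have E := HD phi w _ x sphi cx; rewrite ix in E; rewrite [X in X * _]E.
  rewrite mulr_suml; apply: eq_bigr => i _.
  by rewrite mulr_sumr mulr_suml; apply: eq_bigr => j _; rewrite !mulrA.
by rewrite gint_sum2.
Qed.

(** Otherwise a bump concentrated where [q] has the sign of [q 1%g] gives a nonzero integral. The
    inverse in [phi x^-1%g] matches the convolutions evaluated at the identity. *)
Lemma smooth_test (q : G -> R) : continuous q ->
  (forall phi, smooth_fun phi -> gint haar (fun x => phi x^-1%g * q x) = 0) -> q 1%g = 0.
Proof.
move=> cq Hq; apply/eqP/negPn/negP => q1.
pose A := [set x : G | 0 < q 1%g * q x^-1%g].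
have cqi : continuous (fun x : G => q 1%g * q x^-1%g).
  by apply: contZ; exact: (contC (@lie_inv_continuous _ _ _) cq).
have A1 : nbhs (1%g : G) A.
  apply: (cvgr_gt (q 1%g * q 1^-1%g) (cqi 1%g)).
  by rewrite invg1 -expr2 lt_neqAle sqr_ge0 eq_sym sqrf_eq0 q1.
have [phi [sphi phi0 phi1 phiA]] := smooth_bump A1.
have cphi : continuous (fun x => phi x^-1%g).
  exact: (contC (@lie_inv_continuous _ _ _) (smooth_cont sphi)).
have : 0 < gint haar (fun x => q 1%g * (phi x^-1%g * q x)).
  apply: (gint_gt0 cG haarP (x0 := 1%g)).
  - by apply: contZ; exact: contM.
  - move=> x; have [Ax|nA] := pselect (A x^-1%g); last by rewrite phiA// mul0r mulr0.
    by rewrite mulrCA mulr_ge0//; move: Ax; rewrite /A /= invgK => /ltW.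
  - rewrite invg1 mulrCA mulr_gt0// -expr2 lt_neqAle sqr_ge0 eq_sym sqrf_eq0.
    by rewrite q1.
by rewrite gintZ ?Hq ?mulr0 ?ltxx//; exact: contM.
Qed.

Definition csmooth (f : G -> C) :=
  smooth_fun (fun x => Re (f x)) /\ smooth_fun (fun x => Im (f x)).

Lemma csmooth_eq (f g : G -> C) : f =1 g -> csmooth f -> csmooth g.
Proof. by move=> /funext ->. Qed.

Lemma csmooth_cst (a : C) : csmooth (fun=> a).
Proof. by split; exact: smooth_cst. Qed.

Lemma csmoothM f g : csmooth f -> csmooth g -> csmooth (fun x => f x * g x).
Proof.
move=> [f1 f2] [g1 g2]; split.
  under eq_fun do rewrite ReM -mulN1r; apply: smoothD; first exact: smoothM.
  by apply: smoothZ; exact: smoothM.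
by under eq_fun do rewrite ImM; apply: smoothD; exact: smoothM.
Qed.

Lemma csmoothZ (a : C) f : csmooth f -> csmooth (fun x => a * f x).
Proof. by move=> sf; apply: csmoothM => //; exact: csmooth_cst. Qed.

Lemma csmoothJ f : csmooth f -> csmooth (fun x => (f x)^*).
Proof.
move=> [f1 f2]; split; first by under eq_fun do rewrite ReJ.
by under eq_fun do rewrite ImJ -mulN1r; exact: smoothZ.
Qed.

Lemma csmooth_sum (I : Type) (r : seq I) (F : I -> G -> C) :
  (forall i, csmooth (F i)) -> csmooth (fun x => \sum_(i <- r) F i x).
Proof.
move=> sF; split.
  by under eq_fun do rewrite Re_sum; apply: smooth_sum => i _; case: (sF i).
by under eq_fun do rewrite Im_sum; apply: smooth_sum => i _; case: (sF i).
Qed.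

(** The substitution [x -> g * x] and multiplicativity pull the matrix [p g] out of the
    convolution. *)
Lemma rep_conv d (p : G -> 'M[C]_d) (f : G -> R) (g : G) i j : representation p -> continuous f ->
  cint haar (fun x => toC (f (x^-1 * g)%g) * p x i j) =
  \sum_l p g i l * cint haar (fun x => toC (f x^-1%g) * p x l j).
Proof.
move=> rp cf; have pc := rep_ccont rp; have [p1 pM _] := rp.
have cI : ccont (fun x => toC (f x^-1%g)).
  by apply: ccont_real; exact: (contC (@lie_inv_continuous _ _ _) cf).
rewrite -(cint_lmul cG haarP g); last first.
  apply: ccontM => //; apply: ccont_real.
  apply: (contC (f := fun x => (x^-1 * g)%g) _ cf).
  by apply: contmul; [apply: continv; exact: contI|exact: contK].
rewrite (@eq_cint _ _ _ haar _ (fun x => \sum_l p g i l * (toC (f x^-1%g) * p x l j))).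
  rewrite cint_sum//; last by move=> l; apply: ccontZ; exact: ccontM.
  by apply: eq_bigr => l _; rewrite cintZ//; exact: ccontM.
move=> x; rewrite invgM -mulgA mulVg mulg1 pM mxE mulr_sumr.
by apply: eq_bigr => l _; rewrite mulrCA.
Qed.

(** Garding's argument: the averages of the columns of [p] against smooth functions span the whole
    space, so finitely many form an invertible matrix [Phi]. The entries of [p g *m Phi] are
    convolutions with smooth functions, hence smooth, and [Phi] can be cancelled. *)
Lemma rep_smooth d (p : G -> 'M[C]_d) : representation p ->
  forall i j, csmooth (fun x => p x i j).
Proof.
move=> rp; have pc := rep_ccont rp; have [p1 pM _] := rp.
have cI (f : G -> R) : smooth_fun f -> ccont (fun x => toC (f x^-1%g)).
  move=> sf; apply: ccont_real.
  exact: (contC (@lie_inv_continuous _ _ _) (smooth_cont sf)).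
pose F (t : {f : G -> R | smooth_fun f} * 'I_d) : 'cV[C]_d :=
  \col_i cint haar (fun x => toC (projT1 t.1 x^-1%g) * p x i t.2).
have iF (c : 'rV_d) : (forall t, c *m F t = 0) -> c = 0.
  move=> Hc; apply/rowP => k.
  pose q x := \sum_i c 0 i * p x i k.
  have cq : ccont q by apply: ccont_sum => i; exact: ccontZ.
  have q1 : q 1%g = c 0 k.
    rewrite /q p1 (bigD1 k)//= big1 ?addr0 ?mxE ?eqxx ?mulr1// => i ik.
    by rewrite mxE (negPf ik) mulr0.
  have Hq f : smooth_fun f -> cint haar (fun x => toC (f x^-1%g) * q x) = 0.
    move=> sf; have /matrixP/(_ 0 0) := Hc (exist _ f sf, k); rewrite mxE [RHS]mxE => E.
    rewrite -[RHS]E /q (@eq_cint _ _ _ haar _ (fun x => \sum_i c 0 i * (toC (f x^-1%g) * p x i k))).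
      rewrite cint_sum//; last by move=> i; apply: ccontZ; apply: ccontM => //; exact: cI.
      by apply: eq_bigr => i _; rewrite cintZ// ?mxE//; apply: ccontM => //; exact: cI.
    by move=> x; rewrite mulr_sumr; apply: eq_bigr => i _; rewrite mulrCA.
  rewrite -q1 mxE; apply: C_eq.
    apply: (smooth_test (q := fun x => Re (q x))); first by case: cq.
    move=> f sf; have := congr1 Re (Hq f sf); rewrite [RHS]/= => E; rewrite -[RHS]E.
    by apply: eq_gint => x; rewrite ReM Re_toC Im_toC mul0r subr0.
  apply: (smooth_test (q := fun x => Im (q x))); first by case: cq.
  move=> f sf; have := congr1 Im (Hq f sf); rewrite [RHS]/= => E; rewrite -[RHS]E.
  by apply: eq_gint => x; rewrite ImM Re_toC Im_toC mul0r addr0.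
have [y uy] := indep_points iF.
set Phi := \matrix_(i, j) _ in uy.
pose M g : 'M[C]_d := \matrix_(i, j)
  cint haar (fun x => toC (projT1 (y j).1 (x^-1 * g)%g) * p x i (y j).2).
have pM' g : p g *m Phi = M g.
  apply/matrixP => i j; rewrite mxE [RHS]mxE; under eq_bigr do rewrite !mxE; move: (y j) => [[f sf] k] /=.
  by rewrite rep_conv//; exact: smooth_cont.
move=> i j; apply: (@csmooth_eq (fun g => \sum_k M g i k * invmx Phi k j)).
  by move=> g; rewrite -[p g](mulmxK uy) pM' mxE.
apply: csmooth_sum => k; apply: csmoothM; last exact: csmooth_cst.
have Re_eq (f1 f2 : G -> R) : smooth_fun f1 -> f1 =1 f2 -> smooth_fun f2 by move=> + /funext <-.
case Ey: (y k) => [[f sf] l]; have [cr ci] := pc i l; split.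
  apply: (Re_eq _ _ (conv_smooth sf cr)) => g; rewrite mxE; apply: eq_gint => x.
  by rewrite Ey ReM Re_toC Im_toC mul0r subr0.
apply: (Re_eq _ _ (conv_smooth sf ci)) => g; rewrite mxE; apply: eq_gint => x.
by rewrite Ey ImM Re_toC Im_toC mul0r addr0.
Qed.

End RepSmooth.

Local Open Scope sesquilinear_scope.

Section MatrixInt.
Context {R : realType} {n : nat} {G : lieGroupType R n}.
Local Notation C := R[i].
Hypothesis cG : compact [set: G].

Definition mcont (T : topologicalType) m k (F : T -> 'M[C]_(m, k)) :=
  forall i j, ccont (fun x => F x i j).

Lemma mcont_cst (T : topologicalType) m k (A : 'M[C]_(m, k)) : mcont (fun _ : T => A).
Proof. by move=> i j; exact: ccont_cst. Qed.

Lemma mcontM (T : topologicalType) m k l (F : T -> 'M[C]_(m, k)) (H : T -> 'M[C]_(k, l)) :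
  mcont F -> mcont H -> mcont (fun x => F x *m H x).
Proof.
move=> cF cH i j; apply: (@ccont_eq _ _ (fun x => \sum_a F x i a * H x a j)).
  by move=> x; rewrite mxE.
by apply: ccont_sum => a; exact: ccontM.
Qed.

Lemma mcontJ (T : topologicalType) m k (F : T -> 'M[C]_(m, k)) : mcont F -> mcont (fun x => (F x)^t*).
Proof.
move=> cF i j; apply: (@ccont_eq _ _ (fun x => (F x j i)^*)); first by move=> x; rewrite !mxE.
exact: ccontJ.
Qed.

Lemma mcont_comp (T U : topologicalType) m k (h : T -> U) (F : U -> 'M[C]_(m, k)) :
  continuous h -> mcont F -> mcont (fun x => F (h x)).
Proof. by move=> ch cF i j; exact: (ccont_comp ch (cF i j)). Qed.

Lemma mcont_tr (T : topologicalType) m (F : T -> 'M[C]_m) : mcont F -> ccont (fun x => \tr (F x)).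
Proof. by move=> cF; apply: ccont_sum => i; exact: cF. Qed.

Variable mu : probability (borel G) R.

Definition mint m k (F : G -> 'M[C]_(m, k)) : 'M[C]_(m, k) :=
  \matrix_(i, j) cint mu (fun x => F x i j).

Lemma eq_mint m k (F H : G -> 'M[C]_(m, k)) : F =1 H -> mint F = mint H.
Proof. by move=> /funext ->. Qed.

Lemma mint_mull m k l (A : 'M[C]_(m, k)) (F : G -> 'M[C]_(k, l)) : mcont F ->
  mint (fun x => A *m F x) = A *m mint F.
Proof.
move=> cF; apply/matrixP => i j; rewrite !mxE.
rewrite (@eq_cint _ _ _ mu _ (fun x => \sum_a A i a * F x a j)); last by move=> x; rewrite mxE.
rewrite cint_sum// => [|a]; last exact: ccontZ.
by apply: eq_bigr => a _; rewrite cintZ// mxE.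
Qed.

Lemma mint_mulr m k l (A : 'M[C]_(k, l)) (F : G -> 'M[C]_(m, k)) : mcont F ->
  mint (fun x => F x *m A) = mint F *m A.
Proof.
move=> cF; apply/matrixP => i j; rewrite !mxE.
rewrite (@eq_cint _ _ _ mu _ (fun x => \sum_a A a j * F x i a)); last first.
  by move=> x; rewrite mxE; apply: eq_bigr => a _; rewrite mulrC.
rewrite cint_sum// => [|a]; last exact: ccontZ.
by apply: eq_bigr => a _; rewrite cintZ// mxE mulrC.
Qed.

Lemma mintJ m k (F : G -> 'M[C]_(m, k)) : mcont F -> mint (fun x => (F x)^t*) = (mint F)^t*.
Proof.
move=> cF; apply/matrixP => i j; rewrite !mxE -cintJ//.
by apply: eq_cint => x; rewrite !mxE.
Qed.

Lemma mint_tr m (F : G -> 'M[C]_m) : mcont F -> \tr (mint F) = cint mu (fun x => \tr (F x)).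
Proof.
by move=> cF; rewrite cint_sum//; apply: eq_bigr => i _; rewrite mxE.
Qed.

End MatrixInt.

Lemma conjtrM (C : numClosedFieldType) m k l (A : 'M[C]_(m, k)) (B : 'M[C]_(k, l)) :
  (A *m B)^t* = B^t* *m A^t*.
Proof. by rewrite trmx_mul map_mxM. Qed.

Lemma conjtr1 (C : numClosedFieldType) m : (1%:M : 'M[C]_m)^t* = 1%:M.
Proof. by rewrite trmx1 map_mx1. Qed.

Lemma posdef_factor (C : numClosedFieldType) d (A : 'M[C]_d) : A^t* = A ->
  (forall v : 'rV[C]_d, v != 0 -> 0 < (v *m A *m v^t*) 0 0) ->
  exists2 S : 'M[C]_d, S \in unitmx & A = S^t* *m S.
Proof.
move=> hA pA.
have nA : A \is normalmx by apply/normalmxP; rewrite hA.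
have /orthomx_spectralP := nA; set P := spectralmx A; set s := spectral_diag A => EA.
have uP : P \is unitarymx := spectral_unitarymx A.
have PP := unitarymxP uP.
have s0 i : 0 < s 0 i.
  pose e : 'rV[C]_d := delta_mx 0 i.
  have r0 : e *m P != 0.
    apply/eqP => E; have /rowP/(_ i) := congr1 (fun u => u *m P^t*) E.
    by rewrite -mulmxA PP mulmx1 mul0mx !mxE !eqxx => /eqP; rewrite oner_eq0.
  have := pA _ r0; rewrite EA invmx_unitary// conjtrM !mulmxA -(mulmxA e) PP mulmx1.
  rewrite -(mulmxA (e *m _)) PP mulmx1 -rowE mxE (bigD1 i)//= big1 ?addr0.
    by rewrite !mxE !eqxx mulr1n conjC1 mulr1.
  by move=> j ji; rewrite !mxE (negPf ji) conjC0 mulr0.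
(* A square root of [A]: the spectral unitary followed by the roots of the eigenvalues, which
   positivity makes real and nonzero. *)
pose S := diag_mx (map_mx sqrtC s) *m P.
exists S.
  rewrite unitmx_mul (unitarymx_unit uP) andbT unitmxE det_diag unitfE.
  by apply/prodf_neq0 => i _; rewrite mxE sqrtC_eq0 gt_eqF.
rewrite EA invmx_unitary// /S conjtrM !mulmxA; congr (_ *m _); rewrite -!mulmxA; congr (_ *m _).
apply/matrixP => i j; rewrite mul_mx_diag !mxE.
have [->|ij] := eqVneq i j; last by rewrite !mulr0n conjC0 mul0r.
by rewrite !mulr1n conj_Creal ?ger0_real ?sqrtC_ge0 ?(ltW (s0 _))// -expr2 sqrtCK.
Qed.

Section Reps.
Context {R : realType} {n : nat} {G : lieGroupType R n}.
Local Notation C := R[i].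
Context (cG : compact [set: G]) (haar : probability (borel G) R)
 (haarP : haar_probability haar).

Lemma rep_mcont d (p : G -> 'M[C]_d) : representation p -> mcont p.
Proof. by move=> rp i j; exact: rep_ccont. Qed.

Lemma rep_mulV d (p : G -> 'M[C]_d) x : representation p -> p x *m p x^-1%g = 1%:M.
Proof. by move=> [p1 pM _]; rewrite -pM mulgV. Qed.

Lemma rep_Vmul d (p : G -> 'M[C]_d) x : representation p -> p x^-1%g *m p x = 1%:M.
Proof. by move=> [p1 pM _]; rewrite -pM mulVg. Qed.

Definition unitary_rep d (p : G -> 'M[C]_d) := representation p /\ forall x, p x^-1%g = (p x)^t*.

Lemma rep_conj d (p : G -> 'M[C]_d) (S : 'M[C]_d) : S \in unitmx ->
  representation p -> representation (fun x => S *m p x *m invmx S).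
Proof.
move=> uS rp; have [p1 pM _] := rp; split.
- by rewrite p1 mulmx1 mulmxV.
- by move=> x y; rewrite pM !mulmxA mulmxKV.
- apply: mcontM; last exact: mcont_cst.
  by apply: mcontM; [exact: mcont_cst|exact: rep_mcont].
Qed.

Lemma irr_conj d (p : G -> 'M[C]_d) (S : 'M[C]_d) : S \in unitmx ->
  irr p -> irr (fun x => S *m p x *m invmx S).
Proof.
move=> uS [rp d0 ip]; split=> // [|U HU]; first exact: rep_conj.
have uST : S^T \in unitmx by rewrite unitmx_tr.
have [x||] := ip (U *m invmx S^T).
- have := HU x; rewrite !trmx_mul trmx_inv => H.
  have := submxMr (invmx S^T) H.
  rewrite !mulmxA => H2.
  have E : U *m invmx S^T *m (p x)^T = U *m invmx S^T *m (p x)^T *m S^T *m invmx S^T.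
    by rewrite mulmxK.
  by rewrite E.
- by rewrite mxrankMfree ?row_free_unit ?unitmx_inv//; left.
- by rewrite mxrankMfree ?row_free_unit ?unitmx_inv//; right.
Qed.

Lemma mint_lmul m k (g : G) (F : G -> 'M[C]_(m, k)) : mcont F ->
  mint haar (fun x => F (g * x)%g) = mint haar F.
Proof.
move=> cF; apply/matrixP => i j; rewrite mxE [RHS]mxE.
exact: (cint_lmul cG haarP g (cF i j)).
Qed.

(** Weyl's averaging trick: [A] is an invariant Hermitian form and its factor [S] changes the basis.
    The form is pulled back along [x^-1] so that left invariance of the measure is the invariance
    required. *)
Lemma unitarize d (p : G -> 'M[C]_d) : representation p ->
  exists2 S : 'M[C]_d, S \in unitmx & unitary_rep (fun x => S *m p x *m invmx S).
Proof.
move=> rp; have [p1 pM _] := rp; have pc := rep_mcont rp.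
pose H x := (p x^-1%g)^t* *m p x^-1%g.
have cpi : mcont (fun x => p x^-1%g).
  exact: (mcont_comp (@lie_inv_continuous _ _ _) pc).
have cH : mcont H by apply: mcontM => //; exact: mcontJ.
pose A := mint haar H.
have Aadj : A^t* = A.
  by rewrite -mintJ//; apply: eq_mint => x; rewrite conjtrM trmxCK.
have Ainv g : (p g)^t* *m A *m p g = A.
  rewrite -(mint_mull cG haar _ cH) -(mint_mulr cG haar); last first.
    by apply: mcontM => //; exact: mcont_cst.
  rewrite (@eq_mint _ _ _ _ _ _ _ (fun x => H (g^-1 * x)%g)); last first.
    by move=> x; rewrite /H invgM invgK pM conjtrM !mulmxA.
  exact: mint_lmul.
have Apos (v : 'rV[C]_d) : v != 0 -> 0 < (v *m A *m v^t*) 0 0.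
  move=> v0; pose w x := v *m (p x^-1%g)^t*.
  have cw : mcont w by apply: mcontM; [exact: mcont_cst|exact: mcontJ].
  have -> : (v *m A *m v^t*) 0 0 = toC (gint haar (fun x => \sum_i
      (Re (w x 0 i) ^+ 2 + Im (w x 0 i) ^+ 2))).
    rewrite -(mint_mull cG haar _ cH) -(mint_mulr cG haar); last first.
      by apply: mcontM => //; exact: mcont_cst.
    have Ew x : (v *m H x *m v^t*) 0 0 = toC (\sum_i (Re (w x 0 i) ^+ 2 + Im (w x 0 i) ^+ 2)).
      have -> : v *m H x *m v^t* = w x *m (w x)^t* by rewrite /w /H conjtrM trmxCK !mulmxA.
      rewrite mxE rmorph_sum; apply: eq_bigr => i _; rewrite !mxE.
      by apply: C_eq; rewrite ?ReM ?ImM ReJ ImJ /=; ring.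
    rewrite mxE; apply: C_eq => /=.
      by apply: eq_gint => x; rewrite Ew.
    by rewrite -[RHS](gint_cst haar); apply: eq_gint => x; rewrite Ew.
  rewrite ltcR; apply: (gint_gt0 cG haarP (x0 := 1%g)).
  - apply: cont_sum => i; have [c1 c2] := cw 0 i.
    by apply: contD; exact: contM.
  - by move=> x; apply: sumr_ge0 => i _; rewrite addr_ge0// sqr_ge0.
  - rewrite lt_neqAle sumr_ge0 ?andbT; last by move=> i _; rewrite addr_ge0// sqr_ge0.
    rewrite eq_sym; apply: contra v0 => /eqP E; apply/eqP/rowP => i.
    have := psumr_eq0P (P := xpredT) _ E => /(_ _ i isT).
    rewrite /w invg1 p1 conjtr1 mulmx1 mxE => Ei.
    have /eqP : Re (v 0 i) ^+ 2 + Im (v 0 i) ^+ 2 = 0.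
      by apply: Ei => j _; rewrite addr_ge0// sqr_ge0.
    rewrite paddr_eq0 ?sqr_ge0// !sqrf_eq0 => /andP[/eqP e1 /eqP e2].
    exact: C_eq.
have [S uS AS] := posdef_factor Aadj Apos.
exists S => //; split; first exact: rep_conj.
move=> x.
have uSa : S^t* \in unitmx by rewrite map_unitmx unitmx_tr.
have E : (S *m p x *m invmx S)^t* *m (S *m p x *m invmx S) = 1%:M.
  have -> : (S *m p x *m invmx S)^t* *m (S *m p x *m invmx S) =
      (invmx S)^t* *m ((p x)^t* *m S^t* *m S *m p x) *m invmx S by rewrite !conjtrM !mulmxA.
  have E1 := Ainv x; rewrite AS mulmxA in E1.
  by rewrite E1 mulmxA -conjtrM mulmxV// conjtr1 mul1mx mulmxV.
have E2 := rep_mulV x (rep_conj uS rp).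
move: (S *m p x *m invmx S) (S *m p x^-1%g *m invmx S) E E2 => a b E E2.
by rewrite -[LHS]mul1mx -E -mulmxA E2 mulmx1.
Qed.

Definition intertwines d1 d2 (p1 : G -> 'M[C]_d1) (p2 : G -> 'M[C]_d2) (M : 'M[C]_(d2, d1)) :=
  forall x, M *m p1 x = p2 x *m M.

Lemma schur d1 d2 (p1 : G -> 'M[C]_d1) (p2 : G -> 'M[C]_d2) (M : 'M[C]_(d2, d1)) :
  irr p1 -> irr p2 ->
  intertwines p1 p2 M -> M != 0 -> d1 = d2 /\ \rank M = d1.
Proof.
move=> [r1 d1_gt0 i1] [r2 d2_gt0 i2] HM M0.
have [x||] := i1 (kermx M^T).
- apply/sub_kermxP; rewrite -mulmxA -trmx_mul HM trmx_mul mulmxA mulmx_ker mul0mx//.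
- rewrite mxrank_ker mxrank_tr => k0.
  have [|r0|r0] := i2 (genmx M^T).
  + move=> x; rewrite !(eqmxMr _ (genmxE _)) genmxE -trmx_mul -HM trmx_mul.
    exact: submxMl.
  + by move: M0; rewrite -mxrank_eq0 -mxrank_tr -genmxE r0 eqxx.
  + by move: r0 k0 (rank_leq_col M); rewrite genmxE mxrank_tr => -> k0 H; split; lia.
- rewrite mxrank_ker mxrank_tr => E; exfalso; move: M0; rewrite -mxrank_eq0.
  have := rank_leq_col M; lia.
Qed.

Lemma schur_scalar d (p : G -> 'M[C]_d) (M : 'M[C]_d) : irr p ->
  intertwines p p M -> exists a : C, M = a%:M.
Proof.
move=> ip HM; have [_ d0 _] := ip.
have [a /eigenvalueP[v Hv v0]] := eigenvalue_closed M d0; exists a.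
apply/eqP; rewrite -subr_eq0; apply/negPn/negP => N0.
have [] := schur ip ip (M := M - a%:M) _ N0.
  by move=> x; rewrite mulmxBl mulmxBr HM scalar_mxC.
move=> _ rk; have : v *m (M - a%:M) = 0 by rewrite mulmxBr Hv mul_mx_scalar subrr.
move/eqP; rewrite mulmx_free_eq0 ?(negPf v0)// /row_free rk//.
Qed.

Section Orth.
Context (d1 d2 : nat) (p1 : G -> 'M[C]_d1) (p2 : G -> 'M[C]_d2) (u1 : unitary_rep p1)
 (u2 : unitary_rep p2).

Lemma average_intertwines (M : 'M[C]_(d1, d2)) :
  intertwines p2 p1 (mint haar (fun x => p1 x *m M *m (p2 x)^t*)).
Proof.
have [[[_ pM1 _] U1] [[_ pM2 _] U2]] := (u1, u2).
have c1 := rep_mcont u1.1; have c2 := rep_mcont u2.1.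
have cF : mcont (fun x => p1 x *m M *m (p2 x)^t*).
  apply: mcontM; last exact: mcontJ.
  by apply: mcontM => //; exact: mcont_cst.
move=> g; rewrite -(mint_mulr cG haar _ cF) -(mint_mull cG haar _ cF).
rewrite -(mint_lmul g); last by apply: (mcontM cF); exact: mcont_cst.
apply: eq_mint => x.
rewrite pM1 pM2 conjtrM !mulmxA -[LHS]mulmxA -(U2 g) rep_Vmul ?mulmx1//.
by case: u2.
Qed.

Lemma orthogonality : irr p1 -> irr p2 ->
  (forall M, intertwines p2 p1 M -> M = 0) ->
  forall i j k l, cint haar (fun x => p1 x i j * (p2 x k l)^*) = 0.
Proof.
move=> i1 i2 noM i j k l.
have /noM/matrixP/(_ i k) := average_intertwines (delta_mx j l).
rewrite !mxE => E; rewrite -[RHS]E; apply: eq_cint => x.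
by rewrite mulmx_deltaE !mxE.
Qed.
End Orth.

(** The averaged elementary matrix is scalar by Schur's lemma; its trace, unchanged by the
    averaging, determines the scalar. *)
Lemma orthogonality_self d (p : G -> 'M[C]_d) : unitary_rep p -> irr p ->
  forall i j k l, cint haar (fun x => p x i j * (p x k l)^*) = ((i == k) && (j == l))%:R / d%:R.
Proof.
move=> up ip i j k l; have [_ d0 _] := ip; have c := rep_mcont up.1.
have cF : mcont (fun x => p x *m delta_mx j l *m (p x)^t*).
  apply: mcontM; last exact: mcontJ.
  by apply: mcontM => //; exact: mcont_cst.
have [a Ha] := schur_scalar ip (average_intertwines up up (delta_mx j l)).
have := congr1 mxtrace Ha; rewrite mint_tr// mxtrace_scalar.
rewrite (@eq_cint _ _ _ haar _ (fun=> (j == l)%:R)); last first.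
  move=> x; rewrite mxtrace_mulC mulmxA -up.2 rep_Vmul ?mul1mx; last by case: up.
  rewrite /mxtrace (bigD1 j)//= big1 ?addr0 => [|b bj]; first by rewrite mxE eqxx.
  by rewrite mxE (negPf bj).
rewrite cint_cst => Ea.
have {}Ea : a = (j == l)%:R / d%:R.
  by rewrite Ea -(mulr_natr a) mulfK// pnatr_eq0 -lt0n.
have := congr1 (fun A : 'M[C]_d => A i k) Ha; rewrite !mxE Ea -mulrnAl => E.
rewrite (_ : _ / _ = (j == l)%:R *+ (i == k) / d%:R); last first.
  by case: (i == k); case: (j == l); rewrite /= ?mulr0n ?mulr1n.
rewrite -E; apply: eq_cint => x.
by rewrite mulmx_deltaE !mxE.
Qed.

End Reps.

Section Differential.
Context {R : realType} {n : nat} {G : lieGroupType R n}.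
Local Notation C := R[i].
Context (X : 'I_n -> (G -> R) -> (G -> R)) (bX : lie_basis X).
Local Notation D := (frame_vf X).
Implicit Types (v w : 'rV[R]_n).

Lemma frame_smooth v (f : G -> R) : smooth_fun f -> smooth_fun (D v f).
Proof.
move=> sf; apply: smooth_sum => i _; apply: smoothZ.
by have [s _ _ _] := bX.1 i; exact: s.
Qed.

Lemma frame_lin v (a : R) (f g : G -> R) : smooth_fun f -> smooth_fun g ->
  D v (fun x => a * f x + g x) = (fun x => a * D v f x + D v g x).
Proof.
move=> sf sg; apply/funext => x; rewrite /frame_vf mulr_sumr -big_split /=.
apply: eq_bigr => i _; have [_ l _ _] := bX.1 i.
by rewrite l//; ring.
Qed.

Lemma frame_mul v (f g : G -> R) : smooth_fun f -> smooth_fun g ->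
  D v (fun x => f x * g x) = (fun x => D v f x * g x + f x * D v g x).
Proof.
move=> sf sg; apply/funext => x; rewrite /frame_vf mulr_sumr mulr_suml -big_split /=.
apply: eq_bigr => i _; have [_ _ l _] := bX.1 i.
by rewrite l//; ring.
Qed.

Lemma frame_lmul v (h : G) (f : G -> R) : smooth_fun f ->
  D v (fun x => f (h * x)%g) = (fun x => D v f (h * x)%g).
Proof.
move=> sf; apply/funext => x; rewrite /frame_vf; apply: eq_bigr => i _.
by have [_ _ _ l] := bX.1 i; rewrite l.
Qed.

Lemma frame_li v : left_invariant_vf (D v).
Proof.
split; [exact: frame_smooth|move=> *; exact: frame_lin|move=> *; exact: frame_mul|].
by move=> *; exact: frame_lmul.
Qed.

Lemma frame_add v (f g : G -> R) : smooth_fun f -> smooth_fun g ->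
  D v (fun x => f x + g x) = (fun x => D v f x + D v g x).
Proof.
move=> sf sg; have := frame_lin v 1 sf sg.
rewrite (_ : (fun x => 1 * f x + g x) = fun x => f x + g x) => [->|].
  by apply/funext => x; rewrite mul1r.
by apply/funext => x; rewrite mul1r.
Qed.

Lemma frame_combo v w (a : R) (f : G -> R) x : D (a *: v + w) f x = a * D v f x + D w f x.
Proof.
rewrite /frame_vf mulr_sumr -big_split; apply: eq_bigr => i _.
by rewrite !mxE mulrDl mulrA.
Qed.

Lemma frame_cst v (a : R) : D v (fun _ : G => a) = fun=> 0.
Proof.
have E : D v (fun _ : G => 0) = fun=> 0.
  have := frame_lin v (-1) (smooth_cst (G := G) 0) (smooth_cst 0).
  rewrite (_ : (fun x : G => -1 * 0 + 0) = fun=> 0) => [E|]; last by apply/funext => x; ring.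
  by rewrite E; apply/funext => x; ring.
have := frame_mul v (smooth_cst (G := G) 1) (smooth_cst 1).
rewrite (_ : (fun x : G => 1 * 1) = fun=> 1) => [E1|]; last by apply/funext => x; ring.
have {}E1 x : D v (fun _ : G => 1) x = 0.
  have := congr1 (fun f => f x) E1; rewrite /= mulr1 mul1r => /eqP.
  by rewrite -subr_eq0 opprD addrA subrr sub0r oppr_eq0 => /eqP.
have := frame_lin v a (smooth_cst (G := G) 1) (smooth_cst 0).
rewrite (_ : (fun x : G => a * 1 + 0) = fun=> a) => [->|]; last by apply/funext => x; ring.
by apply/funext => x; rewrite E1 E; ring.
Qed.

Lemma frame_delta i (f : G -> R) x : D 'e_i f x = X i f x.
Proof.
rewrite /frame_vf (bigD1 i)//= big1 ?addr0 ?mxE ?eqxx ?mul1r// => j ji.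
by rewrite mxE (negPf ji) andbF mul0r.
Qed.

Lemma frame_eq v w : (forall f, smooth_fun f -> D v f = D w f) -> v = w.
Proof.
have [u [Hu uniq]] := bX.2 _ (frame_li w) => H.
transitivity u; last exact: uniq.
by symmetry; apply: uniq => f sf; rewrite H.
Qed.

Lemma frame_cdir c0 : atlas c0 -> chart_dom c0 1%g -> exists2 M : 'M[R]_n, M \in unitmx &
  forall v f x, smooth_fun f -> D v f x = cdir c0 (v *m M) f x.
Proof.
move=> ac0 d0; have [M uM HM] := cdir_frame ac0 d0 bX.
exists (invmx M); first by rewrite unitmx_inv.
by move=> v f x sf; rewrite HM// mulmxKV.
Qed.

Lemma frame_const (f : G -> R) : connected [set: G] -> smooth_fun f ->
  (forall v x, D v f x = 0) -> forall x, f x = f 1%g.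
Proof.
move=> cn sf D0; have [c0 ac0 d0] := atlas_cover (1%g : G).
apply: (smooth_locally_const ac0 d0 cn sf) => j x.
have [M uM HM] := cdir_frame ac0 d0 bX.
by rewrite HM// D0.
Qed.

(** The commutator of two left-invariant fields is again a left-invariant derivation, so it has
    coordinates in the basis. This ensures that [xget] in [lie_bracket] returns a genuine bracket
    and not its default. *)
Lemma bracketE v w (f : G -> R) : smooth_fun f ->
  D (lie_bracket X v w) f = (fun x => D v (D w f) x - D w (D v f) x).
Proof.
pose B (f : G -> R) x := D v (D w f) x - D w (D v f) x.
have sm := frame_smooth.
have liB : left_invariant_vf B.
  split.
  - move=> f' sf; rewrite /B; under eq_fun do rewrite addrC -mulN1r.
    by apply: smoothD; [apply: smoothZ|]; do 2 apply: frame_smooth.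
  - move=> a f1 f2 s1 s2; apply/funext => x; rewrite /B.
    rewrite (frame_lin w a s1 s2) (frame_lin v a s1 s2).
    rewrite (frame_lin v a (sm w _ s1) (sm w _ s2)) (frame_lin w a (sm v _ s1) (sm v _ s2)).
    ring.
  - move=> f1 f2 s1 s2; apply/funext => x; rewrite /B.
    have s12 g1 g2 : smooth_fun g1 -> smooth_fun g2 -> smooth_fun (fun x : G => g1 x * g2 x).
      by move=> *; exact: smoothM.
    rewrite !(frame_mul _ s1 s2).
    rewrite !(frame_add _ (s12 _ _ (sm _ _ s1) s2) (s12 _ _ s1 (sm _ _ s2))).
    rewrite !(frame_mul _ (sm _ _ s1) s2) !(frame_mul _ s1 (sm _ _ s2)).
    ring.
  - move=> h f' sf; apply/funext => x; rewrite /B.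
    by rewrite !frame_lmul//; exact: sm.
have [u [Hu _]] := bX.2 _ liB.
move=> sf; rewrite /lie_bracket; case: xgetP => [u' _ /(_ f sf) //|] /(_ u) []; move=> f' sf'.
by rewrite -Hu.
Qed.

Definition cD v (f : G -> C) : G -> C :=
  fun x => Complex (D v (fun y => Re (f y)) x) (D v (fun y => Im (f y)) x).

Lemma eq_cD v (f g : G -> C) x : f =1 g -> cD v f x = cD v g x.
Proof. by move=> /funext ->. Qed.

Lemma cDD v (f g : G -> C) x : csmooth f -> csmooth g ->
  cD v (fun y => f y + g y) x = cD v f x + cD v g x.
Proof.
move=> [f1 f2] [g1 g2]; apply: C_eq; rewrite ?ReD ?ImD /=.
  have := congr1 (fun h => h x) (frame_lin v 1 f1 g1); rewrite /= mul1r => <-.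
  by congr (D v _ x); apply/funext => y; rewrite ReD mul1r.
have := congr1 (fun h => h x) (frame_lin v 1 f2 g2); rewrite /= mul1r => <-.
by congr (D v _ x); apply/funext => y; rewrite ImD mul1r.
Qed.

Lemma cDM v (f g : G -> C) x : csmooth f -> csmooth g ->
  cD v (fun y => f y * g y) x = cD v f x * g x + f x * cD v g x.
Proof.
move=> [f1 f2] [g1 g2]; have s := @smoothM _ _ G; apply: C_eq; rewrite ?ReD ?ImD ?ReM ?ImM /=.
  rewrite (_ : (fun y => Re (f y * g y)) = (fun y => -1 * (Im (f y) * Im (g y)) + Re (f y) * Re (g y))); last first.
    by apply/funext => y; rewrite ReM; ring.
  rewrite (frame_lin v (-1) (s _ _ f2 g2) (s _ _ f1 g1)) (frame_mul v f2 g2) (frame_mul v f1 g1).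
  ring.
rewrite (_ : (fun y => Im (f y * g y)) = (fun y => 1 * (Re (f y) * Im (g y)) + Im (f y) * Re (g y))); last first.
  by apply/funext => y; rewrite ImM; ring.
rewrite (frame_lin v 1 (s _ _ f1 g2) (s _ _ f2 g1)) (frame_mul v f1 g2) (frame_mul v f2 g1).
ring.
Qed.

Lemma cD_cst v (a : C) x : cD v (fun=> a) x = 0.
Proof. by rewrite /cD !frame_cst. Qed.

Lemma cDZ v (a : C) (f : G -> C) x : csmooth f -> cD v (fun y => a * f y) x = a * cD v f x.
Proof. by move=> sf; rewrite cDM ?cD_cst ?mul0r ?add0r//; exact: csmooth_cst. Qed.

Lemma cD_sum v (I : Type) (r : seq I) (F : I -> G -> C) x : (forall i, csmooth (F i)) ->
  cD v (fun y => \sum_(i <- r) F i y) x = \sum_(i <- r) cD v (F i) x.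
Proof.
move=> sF; elim: r => [|i r IH].
  by rewrite big_nil -[RHS](cD_cst v 0 x); apply: eq_cD => y; rewrite big_nil.
rewrite big_cons -IH -cDD//; last exact: csmooth_sum.
by apply: eq_cD => y; rewrite big_cons.
Qed.

Lemma cDJ v (f : G -> C) x : csmooth f -> cD v (fun y => (f y)^*) x = (cD v f x)^*.
Proof.
move=> [f1 f2]; apply: C_eq; rewrite ?ReJ ?ImJ /=.
  by congr (D v _ x); apply/funext => y; rewrite ReJ.
have := congr1 (fun h => h x) (frame_lin v (-1) f2 (smooth_cst 0)).
rewrite /= (frame_cst v 0) addr0 mulN1r => <-.
by congr (D v _ x); apply/funext => y; rewrite ImJ; ring.
Qed.

Lemma cD_lmul v (h : G) (f : G -> C) x : csmooth f -> cD v (fun y => f (h * y)%g) x = cD v f (h * x)%g.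
Proof.
move=> [f1 f2]; rewrite /cD; congr Complex.
  by have := congr1 (fun q => q x) (frame_lmul v h f1).
by have := congr1 (fun q => q x) (frame_lmul v h f2).
Qed.

Lemma cD_combo v w (a : R) (f : G -> C) x : cD (a *: v + w) f x = toC a * cD v f x + cD w f x.
Proof. by apply: C_eq; rewrite ?ReD ?ImD ?ReM ?ImM /= frame_combo; ring. Qed.

Lemma cD_bracket v w (f : G -> C) x : csmooth f ->
  cD (lie_bracket X v w) f x = cD v (cD w f) x - cD w (cD v f) x.
Proof. by move=> [f1 f2]; rewrite /cD !bracketE//. Qed.

Lemma cD_const (f : G -> C) : connected [set: G] -> csmooth f ->
  (forall v x, cD v f x = 0) -> forall x, f x = f 1%g.
Proof.
move=> cn [f1 f2] D0 x; apply: C_eq.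
  by apply: (frame_const cn f1) => v y; have := congr1 Re (D0 v y).
by apply: (frame_const cn f2) => v y; have := congr1 Im (D0 v y).
Qed.

Context (cG : compact [set: G]) (haar : probability (borel G) R)
 (haarP : haar_probability haar).

Lemma frame_conv v (phi q : G -> R) : smooth_fun phi -> continuous q ->
  D v (fun g => gint haar (fun x => phi (x^-1 * g)%g * q x)) 1%g =
  gint haar (fun x => D v phi x^-1%g * q x).
Proof.
move=> sphi cq; have [c0 ac0 d0] := atlas_cover (1%g : G).
have [M uM HM] := frame_cdir ac0 d0.
rewrite HM; last exact: conv_smooth.
by rewrite cdir_conv//; apply: eq_gint => x; rewrite -HM.
Qed.

Section Rep.
Context (d : nat) (p : G -> 'M[C]_d) (rp : representation p).

Let sp : forall i j, csmooth (fun x => p x i j).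
Proof. by move=> i j; exact: (rep_smooth cG haarP). Qed.

Definition dp v : 'M[C]_d := \matrix_(i, j) cD v (fun x => p x i j) 1%g.

Lemma rep_D v x i j : cD v (fun y => p y i j) x = \sum_k p x i k * dp v k j.
Proof.
have [p1 pM _] := rp.
rewrite -{1}(mulg1 x) -(cD_lmul v x 1%g (sp i j)).
rewrite (@eq_cD _ _ (fun y => \sum_k p x i k * p y k j)); last by move=> y; rewrite pM mxE.
rewrite cD_sum => [|k]; last exact: csmoothZ.
by apply: eq_bigr => k _; rewrite cDZ// mxE.
Qed.

Lemma rep_DD v w x i j : cD v (cD w (fun y => p y i j)) x = \sum_k p x i k * (dp v *m dp w) k j.
Proof.
rewrite (@eq_cD _ _ (fun y => \sum_k dp w k j * p y i k)); last first.
  by move=> y; rewrite rep_D; apply: eq_bigr => k _; rewrite mulrC.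
rewrite cD_sum => [|k]; last exact: csmoothZ.
rewrite (eq_bigr (fun k => \sum_l p x i l * dp v l k * dp w k j)); last first.
  by move=> k _; rewrite cDZ// rep_D mulrC mulr_suml.
rewrite exchange_big; apply: eq_bigr => l _; rewrite mxE mulr_sumr.
by apply: eq_bigr => k _; rewrite mulrA.
Qed.

Lemma dp_combo v w (a : R) : dp (a *: v + w) = toC a *: dp v + dp w.
Proof. by apply/matrixP => i j; rewrite !mxE cD_combo. Qed.

Lemma rep1_sum (A : 'M[C]_d) i j : \sum_k p 1%g i k * A k j = A i j.
Proof.
have [p1 _ _] := rp; rewrite p1 (bigD1 i)//= big1 ?addr0 ?mxE ?eqxx ?mul1r// => k ki.
by rewrite mxE eq_sym (negPf ki) mul0r.
Qed.

Lemma dp_bracket v w : dp (lie_bracket X v w) = dp v *m dp w - dp w *m dp v.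
Proof.
apply/matrixP => i j; rewrite mxE cD_bracket// !rep_DD !rep1_sum.
by rewrite [RHS]mxE [X in _ = _ + X]mxE.
Qed.

(** Differentiate the unitarity relation [(p x)^t* *m p x = 1] at the identity. *)
Lemma dp_adj v : (forall x, p x^-1%g = (p x)^t*) -> (dp v)^t* = - dp v.
Proof.
move=> U; have [p1 pM _] := rp.
apply/matrixP => i j; apply/eqP; rewrite -subr_eq0 !mxE opprK; apply/eqP.
rewrite -[RHS](cD_cst v (i == j)%:R 1%g).
rewrite [RHS](@eq_cD _ _ (fun x => \sum_k (p x k i)^* * p x k j)); last first.
  move=> x; have := rep_Vmul x rp; rewrite U => /matrixP/(_ i j); rewrite !mxE => <-.
  by apply: eq_bigr => k _; rewrite !mxE.
rewrite cD_sum => [|k]; last by apply: csmoothM => //; exact: csmoothJ.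
have E k : cD v (fun x => (p x k i)^* * p x k j) 1%g =
    (dp v k i)^* * (p 1%g k j) + (p 1%g k i)^* * dp v k j.
  rewrite cDM ?cDJ//; last exact: csmoothJ.
    by rewrite [dp v k i]mxE [dp v k j]mxE.
under eq_bigr do rewrite E; rewrite big_split /=; congr (_ + _).
  rewrite (bigD1 j)//= big1 ?addr0 ?p1 ?mxE ?eqxx ?mulr1// => k kj.
  by rewrite [1%:M k j]mxE (negPf kj) mulr0.
rewrite (bigD1 i)//= big1 ?addr0 ?p1 ?mxE ?eqxx ?conjC1 ?mul1r// => k ki.
by rewrite [1%:M k i]mxE (negPf ki) conjC0 mul0r.
Qed.

End Rep.

Hypothesis cn : connected [set: G].

(** The function [p2 x *m M *m (p1 x)^t*] has vanishing derivative along every left-invariant field,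
    so on a connected group it keeps its value [M] at the identity. This is the passage from Lie
    algebra to group used before every application of Schur's lemma. *)
Lemma commutant d1 d2 (p1 : G -> 'M[C]_d1) (p2 : G -> 'M[C]_d2) (M : 'M[C]_(d2, d1)) :
  unitary_rep p1 -> unitary_rep p2 -> (forall v, M *m dp p1 v = dp p2 v *m M) ->
  intertwines p1 p2 M.
Proof.
move=> [r1 u1] [r2 u2] HM.
have s1 := rep_smooth cG haarP r1; have s2 := rep_smooth cG haarP r2.
pose Psi x := p2 x *m M *m (p1 x)^t*.
have PsiE x i j : Psi x i j = \sum_l \sum_k (M k l) * (p2 x i k * (p1 x j l)^*).
  rewrite mxE; apply: eq_bigr => l _; rewrite !mxE mulr_suml.
  by apply: eq_bigr => k _; ring.
have sk i j k l : csmooth (fun x => p2 x i k * (p1 x j l)^*).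
  by apply: csmoothM => //; exact: csmoothJ.
have sPsi i j : csmooth (fun x => Psi x i j).
  apply: (csmooth_eq (f := fun x => \sum_l \sum_k (M k l) * (p2 x i k * (p1 x j l)^*))).
    by move=> x; rewrite PsiE.
  by apply: csmooth_sum => l; apply: csmooth_sum => k; exact: csmoothZ.
have D0 i j v x : cD v (fun x => Psi x i j) x = 0.
  rewrite (eq_cD _ _ (fun x => PsiE x i j)) cD_sum; last first.
    by move=> l; apply: csmooth_sum => k; exact: csmoothZ.
  transitivity ((p2 x *m dp p2 v *m M *m (p1 x)^t* + p2 x *m M *m (p1 x *m dp p1 v)^t*) i j).
    rewrite [RHS]mxE [X in _ = X + _]mxE [X in _ = _ + X]mxE -big_split /=.
    apply: eq_bigr => l _; rewrite cD_sum => [|k]; last exact: csmoothZ.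
    rewrite [X in _ = X * _ + _]mxE [X in _ = _ + X * _]mxE !mulr_suml -big_split /=.
    apply: eq_bigr => k _; rewrite cDZ// cDM//; last exact: csmoothJ.
    rewrite cDJ// !rep_D//.
    by rewrite !mxE; ring.
  rewrite conjtrM dp_adj// mulNmx mulmxN -(mulmxA (p2 x) M) (mulmxA M) HM !mulmxA subrr.
  by rewrite mxE.
have PsiC x : Psi x = M.
  apply/matrixP => i j; rewrite (cD_const cn (sPsi i j) (D0 i j)) /Psi.
  by have [-> _ _] := r1; have [-> _ _] := r2; rewrite conjtr1 mulmx1 mul1mx.
move=> x; rewrite -{1}(PsiC x) /Psi -u1 -mulmxA rep_Vmul ?mulmx1//.
Qed.

Lemma dp_conj d (p : G -> 'M[C]_d) (S T : 'M[C]_d) v : representation p ->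
  dp (fun x => S *m p x *m T) v = S *m dp p v *m T.
Proof.
move=> rp; have sp := rep_smooth cG haarP rp.
apply/matrixP => i j; rewrite mxE (@eq_cD _ _ (fun x => \sum_l \sum_k (S i k * T l j) * p x k l)).
  rewrite cD_sum => [|l]; last by apply: csmooth_sum => k; exact: csmoothZ.
  rewrite mxE; apply: eq_bigr => l _; rewrite cD_sum => [|k]; last exact: csmoothZ.
  rewrite mxE mulr_suml; apply: eq_bigr => k _; rewrite cDZ// mxE; ring.
move=> x; rewrite mxE; apply: eq_bigr => l _.
by rewrite mxE mulr_suml; apply: eq_bigr => k _; ring.
Qed.

(** The derivative at 1 along [w] of the convolution of [f] with a coefficient can be computed in
    two ways. On [f] it is a Fourier coefficient of the derivative of [f]; on the coefficient it is
    a combination of entries of [dp p w], hence zero. Peter-Weyl then makes the field of [w] vanish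
    on every smooth [f]. *)
Lemma dp_faithful w : (forall d (p : G -> 'M[C]_d), irr p ->
  unitary_rep p -> dp p w = 0) -> w = 0.
Proof.
move=> H; have {}H d (p : G -> 'M[C]_d) : irr p -> dp p w = 0.
  move=> ip; have rp : representation p by case: ip.
  have [S uS up] := unitarize cG haarP rp.
  have := H _ _ (irr_conj uS ip) up; rewrite dp_conj// => /(congr1 (fun A => invmx S *m A *m S)).
  by rewrite mulmx0 mul0mx !mulmxA mulVmx// mul1mx mulmxKV.
apply: frame_eq => f sf; apply/funext => x0.
have -> : D 0 f x0 = 0 by rewrite /frame_vf big1// => i _; rewrite mxE mul0r.
have sDf := frame_smooth w sf.
rewrite -[x0]invgK; move: x0^-1%g; apply: (peter_weyl cG haarP (h := fun x => D w f x^-1%g)).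
  exact: (contC (@lie_inv_continuous _ _ _) (smooth_cont sDf)).
move=> d p ip i j; have rp : representation p by case: ip.
have [c1 c2] := rep_ccont rp i j.
have E : cD w (fun g => cint haar (fun x => toC (f (x^-1 * g)%g) * p x i j)) 1%g =
   cint haar (fun x => toC (D w f x^-1%g) * p x i j).
  apply: C_eq => /=.
    rewrite (_ : (fun y => _) = fun g => gint haar (fun x => f (x^-1 * g)%g * Re (p x i j))).
      by rewrite frame_conv//; apply: eq_gint => x; rewrite ReM Re_toC Im_toC mul0r subr0.
    by apply/funext => g; apply: eq_gint => x; rewrite ReM Re_toC Im_toC mul0r subr0.
  rewrite (_ : (fun y => _) = fun g => gint haar (fun x => f (x^-1 * g)%g * Im (p x i j))).
    by rewrite frame_conv//; apply: eq_gint => x; rewrite ImM Re_toC Im_toC mul0r addr0.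
  by apply/funext => g; apply: eq_gint => x; rewrite ImM Re_toC Im_toC mul0r addr0.
rewrite -E (@eq_cD _ _ (fun g => \sum_l cint haar (fun x => toC (f x^-1%g) * p x l j) * p g i l)).
  have sp := rep_smooth cG haarP rp.
  rewrite cD_sum => [|l]; last exact: csmoothZ.
  rewrite big1// => l _; rewrite cDZ//.
  by have /matrixP/(_ i l) := H _ _ ip; rewrite !mxE => ->; rewrite mulr0.
move=> g; rewrite (rep_conv cG haarP)//; last exact: smooth_cont.
by apply: eq_bigr => l _; rewrite mulrC.
Qed.

(** The difference of [f] translated by [g] and of [f] has zero Fourier coefficients, so Peter-Weyl
    gives [f g = f 1%g] for all smooth [f]; by the Hausdorff property a bump at 1 separates any
    other point. *)
Lemma rep_faithful g : (forall d (p : G -> 'M[C]_d), irr p ->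
  unitary_rep p -> p g = 1%:M) -> g = 1%g.
Proof.
move=> H; have {}H d (p : G -> 'M[C]_d) : irr p -> p g = 1%:M.
  move=> ip; have rp : representation p by case: ip.
  have [S uS up] := unitarize cG haarP rp.
  have := H _ _ (irr_conj uS ip) up => /(congr1 (fun A => invmx S *m A *m S)).
  by rewrite !mulmxA mulVmx// mul1mx mulmxKV// mulmx1 mulVmx.
have Hf (f : G -> R) : smooth_fun f -> f g = f 1%g.
  move=> sf; have cf := smooth_cont sf.
  have ci : continuous (fun x : G => f x^-1%g) by exact: (contC (@lie_inv_continuous _ _ _) cf).
  have cig : continuous (fun x : G => f (x^-1 * g)%g).
    apply: (contC (f := fun x => (x^-1 * g)%g) _ cf).
    by apply: contmul; [apply: continv; exact: contI|exact: contK].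
  have : forall x, f (x^-1 * g)%g - f x^-1%g = 0.
    apply: (peter_weyl cG haarP (h := fun x => f (x^-1 * g)%g - f x^-1%g)); first exact: contB.
    move=> d p ip i j; have rp : representation p by case: ip.
    have pc := rep_ccont rp i j; have cR := @ccont_real R.
    rewrite (@eq_cint _ _ _ haar _ (fun x => toC (f (x^-1 * g)%g) * p x i j +
        (-1) * (toC (f x^-1%g) * p x i j))); last by move=> x; rewrite rmorphB; ring.
    have c1 := ccontM (cR _ _ cig) pc; have c2 := ccontM (cR _ _ ci) pc.
    rewrite cintD//; last exact: ccontZ.
    rewrite cintZ// (rep_conv cG haarP)// H// (bigD1 i)//= big1 ?addr0.
      by rewrite [1%:M i i]mxE eqxx mul1r mulN1r subrr.
    by move=> l li; rewrite [1%:M i l]mxE eq_sym (negPf li) mul0r.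
  by move=> /(_ 1%g)/eqP; rewrite invg1 mul1g subr_eq0 => /eqP.
apply/eqP/negPn/negP => g1.
have haus : hausdorff_space G := lie_hausdorff.
have := haus; rewrite open_hausdorff => /(_ g 1%g g1)[[A B] /= [gA oneB] [oA oB /eqP AB]].
have NB : nbhs (1%g : G) B by apply: open_nbhs_nbhs; split=> //; exact: set_mem.
have [phi [sphi _ phi1 phi0]] := smooth_bump NB.
move: phi1; rewrite -Hf// phi0 ?ltxx// => Bg.
by have : (A `&` B) g; [split => //; exact: set_mem|rewrite AB].
Qed.

End Differential.

Definition dot (R : realType) (n : nat) (v w : 'rV[R]_n) : R := \sum_i v 0 i * w 0 i.

Section Dot.
Context {R : realType} {n : nat}.
Implicit Types v w : 'rV[R]_n.

Lemma dotC v w : dot v w = dot w v.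
Proof. by apply: eq_bigr => i _; rewrite mulrC. Qed.
Lemma dotDl u v w : dot (u + v) w = dot u w + dot v w.
Proof. by rewrite -big_split; apply: eq_bigr => i _; rewrite mxE mulrDl. Qed.
Lemma dotZl (a : R) v w : dot (a *: v) w = a * dot v w.
Proof. by rewrite mulr_sumr; apply: eq_bigr => i _; rewrite mxE mulrA. Qed.
Lemma dotDr u v w : dot u (v + w) = dot u v + dot u w.
Proof. by rewrite dotC dotDl !(dotC u). Qed.
Lemma dotZr (a : R) v w : dot v (a *: w) = a * dot v w.
Proof. by rewrite dotC dotZl dotC. Qed.
Lemma dotNl v w : dot (- v) w = - dot v w.
Proof. by rewrite -scaleN1r dotZl mulN1r. Qed.
Lemma dotNr v w : dot v (- w) = - dot v w.
Proof. by rewrite dotC dotNl dotC. Qed.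
Lemma dot0l v : dot 0 v = 0.
Proof. by rewrite -(scale0r 0) dotZl mul0r. Qed.
Lemma dot0r v : dot v 0 = 0. Proof. by rewrite dotC dot0l. Qed.
Lemma dot_suml (I : Type) (r : seq I) (P : pred I) (F : I -> 'rV[R]_n) w :
  dot (\sum_(i <- r | P i) F i) w = \sum_(i <- r | P i) dot (F i) w.
Proof. by elim/big_rec2: _ => [|i x y _ <-]; rewrite ?dot0l ?dotDl. Qed.
Lemma dot_ge0 v : 0 <= dot v v.
Proof. by apply: sumr_ge0 => i _; rewrite -expr2 sqr_ge0. Qed.
Lemma dot_eq0 v : (dot v v == 0) = (v == 0).
Proof.
apply/eqP/eqP => [h|->]; last exact: dot0l.
apply/rowP => i; have := psumr_eq0P (P := xpredT) _ h => /(_ _ i isT) E.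
have /eqP : v 0 i * v 0 i = 0 by apply: E => j _; rewrite -expr2 sqr_ge0.
by rewrite mulf_eq0 orbb mxE => /eqP.
Qed.
Lemma dot_gt0 v : v != 0 -> 0 < dot v v.
Proof. by move=> v0; rewrite lt_neqAle dot_ge0 andbT eq_sym dot_eq0. Qed.
Lemma dot_delta v i : dot v 'e_i = v 0 i.
Proof.
rewrite /dot (bigD1 i)//= big1 ?addr0 ?mxE ?eqxx ?mulr1// => j ji.
by rewrite mxE (negPf ji) mulr0.
Qed.
Lemma dot_mx v w : (v *m w^T) 0 0 = dot v w.
Proof. by rewrite mxE; apply: eq_bigr => i _; rewrite mxE. Qed.
End Dot.

(** * The Casimir element *)

Section Killing.
Context {R : realType} {n : nat} {G : lieGroupType R n}.
Local Notation C := R[i].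
Context (X : 'I_n -> (G -> R) -> (G -> R)) (bX : lie_basis X).
Local Notation D := (frame_vf X).
Local Notation br := (lie_bracket X).
Local Notation ad := (ad_mx X).
Implicit Types (u v w : 'rV[R]_n).

Lemma bracketC v w : br v w = - br w v.
Proof.
apply: (frame_eq bX) => f sf; apply/funext => x.
rewrite -[- br w v]addr0 -scaleN1r frame_combo !(bracketE bX)//.
by rewrite (_ : D 0 f x = 0) ?addr0 ?mulN1r ?opprB// /frame_vf big1// => i _; rewrite mxE mul0r.
Qed.

Lemma br_lin v (a : R) u w : br v (a *: u + w) = a *: br v u + br v w.
Proof.
apply: (frame_eq bX) => f sf; apply/funext => x.
rewrite frame_combo !(bracketE bX)// frame_combo.
rewrite (_ : D (a *: u + w) f = fun x => a * D u f x + D w f x); last first.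
  by apply/funext => y; rewrite frame_combo.
rewrite (frame_lin bX)//; try exact: (frame_smooth bX).
ring.
Qed.

Lemma brD v u w : br v (u + w) = br v u + br v w.
Proof. by have := br_lin v 1 u w; rewrite !scale1r. Qed.

Lemma br0 v : br v 0 = 0.
Proof. by have := br_lin v (-1) 0 0; rewrite scaler0 addr0 scaleN1r addNr. Qed.

Lemma brZ v (a : R) u : br v (a *: u) = a *: br v u.
Proof. by have := br_lin v a u 0; rewrite br0 !addr0. Qed.

Lemma br_sum v (I : Type) (r : seq I) (P : pred I) (F : I -> 'rV[R]_n) :
  br v (\sum_(i <- r | P i) F i) = \sum_(i <- r | P i) br v (F i).
Proof. by elim/big_rec2: _ => [|i x y _ <-]; rewrite ?br0 ?brD. Qed.

Lemma adE v w : w *m ad v = br v w.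
Proof.
rewrite [in RHS](row_sum_delta w) br_sum; apply/rowP => j; rewrite mxE summxE.
by apply: eq_bigr => i _; rewrite brZ !mxE.
Qed.

Lemma ad_lin (a : R) v w : ad (a *: v + w) = a *: ad v + ad w.
Proof.
apply/row_matrixP => i; rewrite !rowE adE mulmxDr -scalemxAr !adE.
by rewrite bracketC br_lin (bracketC v) (bracketC w) opprD scalerN.
Qed.

Lemma jacobi u v w : br (br u v) w = br u (br v w) - br v (br u w).
Proof.
apply: (frame_eq bX) => f sf; apply/funext => x.
have sm := frame_smooth bX.
rewrite -[in RHS](scale1r (br u (br v w))) -scaleN1r addrC frame_combo scale1r.
have e a b : D (br a b) f = fun x => 1 * D a (D b f) x + (-1 * D b (D a f) x).
  by rewrite (bracketE bX)//; apply/funext => y; ring.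
have E a b c : D (br a (br b c)) f x = D a (D b (D c f)) x - D a (D c (D b f)) x
     - (D b (D c (D a f)) x - D c (D b (D a f)) x).
  rewrite (bracketE bX a (br b c) sf) (bracketE bX b c sf) (bracketE bX b c (sm a _ sf)).
  congr (_ - _).
  rewrite (_ : (fun x => D b (D c f) x - D c (D b f) x) =
     fun x => (-1) * D c (D b f) x + D b (D c f) x).
    by rewrite (frame_lin bX); [ring|do 2 apply: (frame_smooth bX)..].
  by apply/funext => y; ring.
rewrite bracketC -scaleN1r -[-1 *: _]addr0 frame_combo (_ : D 0 f x = 0) ?addr0; last first.
  by rewrite /frame_vf big1// => i _; rewrite mxE mul0r.
rewrite !E; ring.
Qed.

Lemma ad_br v w : ad (br v w) = ad w *m ad v - ad v *m ad w.
Proof.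
apply/row_matrixP => i; rewrite !rowE adE mulmxBr !mulmxA !adE.
exact: jacobi.
Qed.

Hypothesis oX : forall i j : 'I_n, lie_inner X 'e_i 'e_j = (i == j)%:R.

Lemma innerC v w : lie_inner X v w = lie_inner X w v.
Proof. by rewrite /lie_inner /killing mxtrace_mulC. Qed.

Lemma inner_lin (a : R) u v w : lie_inner X (a *: u + v) w = a * lie_inner X u w + lie_inner X v w.
Proof.
rewrite /lie_inner /killing ad_lin mulmxDl -scalemxAl linearD /= linearZ /=; ring.
Qed.

Lemma inner_dot v w : lie_inner X v w = dot v w.
Proof.
have l0 u : lie_inner X 0 u = 0.
  have := inner_lin (-1) 0 0 u; rewrite scaler0 addr0 => E.
  by rewrite E; ring.
have ls (F : 'I_n -> R) (E : 'I_n -> 'rV[R]_n) u :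
    lie_inner X (\sum_i F i *: E i) u = \sum_i F i * lie_inner X (E i) u.
  elim/big_rec2: _ => [|i x y _ <-]; first exact: l0.
  by rewrite inner_lin.
rewrite {1}(row_sum_delta v) ls; apply: eq_bigr => i _; congr (_ * _).
rewrite innerC {1}(row_sum_delta w) ls (bigD1 i)//= big1 ?addr0.
  by rewrite oX eqxx mulr1.
by move=> j ji; rewrite oX (negPf ji) mulr0.
Qed.

(** Invariance of the trace form under the bracket, read in an orthonormal basis. *)
Lemma ad_skew v : (ad v)^T = - ad v.
Proof.
apply/matrixP => i j; apply/eqP; rewrite -subr_eq0 !mxE opprK; apply/eqP.
rewrite -[X in _ + X]dot_delta -[X in X + _]dot_delta -!inner_dot.
rewrite innerC addrC /lie_inner /killing.
rewrite -opprD; apply/eqP; rewrite oppr_eq0; apply/eqP.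
rewrite !ad_br mulmxBl mulmxBr.
move: (ad v) (ad 'e_i) (ad 'e_j) => V I J.
rewrite !raddfB /= -(mulmxA I) -(mulmxA V) (mxtrace_mulC V) -(mulmxA I).
by ring.
Qed.

Context (cG : compact [set: G]) (haar : probability (borel G) R)
 (haarP : haar_probability haar) (cn : connected [set: G]).

Definition casimir d (p : G -> 'M[C]_d) : 'M[C]_d :=
  \sum_i dp X p 'e_i *m dp X p 'e_i.

Section Casimir.
Context (d : nat) (p : G -> 'M[C]_d) (rp : representation p).
Local Notation dp := (dp X p).

Lemma dp0 : dp 0 = 0.
Proof. by have := dp_combo X p 0 0 (-1); rewrite scaler0 addr0 rmorphN1 scaleN1r addNr. Qed.

Lemma dp_sum (F : 'I_n -> R) (E : 'I_n -> 'rV[R]_n) :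
  dp (\sum_i F i *: E i) = \sum_i toC (F i) *: dp (E i).
Proof.
elim/big_rec2: _ => [|i x y _ <-]; first exact: dp0.
by rewrite dp_combo.
Qed.

Lemma dp_row w : dp w = \sum_i toC (w 0 i) *: dp 'e_i.
Proof. by rewrite {1}(row_sum_delta w) dp_sum. Qed.

(** The commutator of the sum of squares with [dp v] expands in the entries of [ad v]. Skewness of
    that matrix cancels the terms in pairs. *)
Lemma casimir_comm v : casimir p *m dp v = dp v *m casimir p.
Proof.
apply/eqP; rewrite -subr_eq0 mulmx_suml mulmx_sumr -sumrB; apply/eqP.
pose A := ad v; pose e i := dp 'e_i.
have br_e i : dp v *m e i - e i *m dp v = \sum_j toC (A i j) *: e j.
  rewrite -(dp_bracket bX cG haarP rp) -adE dp_row; apply: eq_bigr => j _.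
  by rewrite -rowE mxE.
have E i : e i *m e i *m dp v - dp v *m (e i *m e i) =
    - \sum_j toC (A i j) *: (e j *m e i) - \sum_j toC (A i j) *: (e i *m e j).
  transitivity (- ((dp v *m e i - e i *m dp v) *m e i) - e i *m (dp v *m e i - e i *m dp v)).
    move: (dp v) (e i) => V E; rewrite mulmxBl mulmxBr !mulmxA opprB.
    move: (E *m E *m V) (V *m E *m E) (E *m V *m E) => a b c.
    by rewrite opprB (addrC c) -addrA (addrCA c) subrr addr0 addrC.
  rewrite br_e mulmx_suml mulmx_sumr; congr (- _ - _); apply: eq_bigr => j _.
    by rewrite scalemxAl.
  by rewrite scalemxAr.
under eq_bigr do rewrite E; rewrite sumrB sumrN.
rewrite exchange_big /= -opprD -big_split /= big1 ?oppr0// => i _.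
rewrite -big_split big1// => j _ /=.
have -> : A j i = - A i j.
  by have /matrixP/(_ i j) := ad_skew v; rewrite !mxE.
by rewrite rmorphN scaleNr addNr.
Qed.

Hypothesis up : unitary_rep p.

Lemma hs_ge0 (A : 'M[C]_d) : 0 <= \tr (A *m A^t*).
Proof.
apply: sumr_ge0 => i _; rewrite mxE; apply: sumr_ge0 => j _.
by rewrite !mxE mul_conjC_ge0.
Qed.

(** Schur's lemma gives a scalar. It is real and nonpositive because the operators [dp 'e_i] are
    skew-adjoint, so that minus the trace is a sum of squared Hilbert-Schmidt norms. *)
Lemma casimir_scalar : irr p ->
  exists2 c : R, 0 <= c & casimir p = (- toC c)%:M.
Proof.
move=> ip; have [_ d0 _] := ip.
have [a Ha] := schur_scalar ip (commutant bX cG haarP cn up up casimir_comm).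
have E : - \tr (casimir p) = \sum_i \tr (dp 'e_i *m (dp 'e_i)^t*).
  rewrite /casimir (big_morph _ (@mxtraceD C d) (mxtrace0 C d)) -sumrN; apply: eq_bigr => i _.
  by rewrite (dp_adj bX cG haarP rp) ?mulmxN ?linearN//; case: up.
have P : 0 <= - \tr (casimir p) by rewrite E; apply: sumr_ge0 => i _; exact: hs_ge0.
rewrite Ha mxtrace_scalar -mulNrn pmulrn_lge0// in P.
exists (Re (- a)).
  by move: P; rewrite lecE => /andP[_].
rewrite Ha; congr (_%:M); rewrite (_ : toC _ = - a) ?opprK//.
by move: P; rewrite lecE => /andP[/eqP E1 _]; apply: C_eq.
Qed.
End Casimir.

End Killing.

(** The inequality exp(-x) <= k! / x^k at x = (j + 2) s / 2 with k = n + 2 leaves a term of order (j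
    + 2)^-2, dominated by a telescoping difference. The shift from [j] to [j + 2] costs the factor
    [expR s]. *)
Lemma heat_series_bound (R : realType) (n : nat) (s : R) : 0 < s -> exists2 B : R, 0 <= B &
  forall J : nat, \sum_(j < J) expR (- j%:R * s / 2) * (j.+2)%:R ^+ n <= B.
Proof.
move=> s0; pose k := n.+2; pose B := expR s * k`!%:R * (2 / s) ^+ k.
have s20 : 0 <= 2 / s by rewrite divr_ge0// ltW.
have B0 : 0 <= B by rewrite /B mulr_ge0 ?exprn_ge0// mulr_ge0 ?expR_ge0 ?ler0n.
exists B => // J.
have H (j : nat) : expR (- j%:R * s / 2) * (j.+2)%:R ^+ n <= B * ((j.+1)%:R^-1 - (j.+2)%:R^-1).
  have j2 : (0 : R) < (j.+2)%:R by rewrite ltr0n.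
  have j1 : (0 : R) < (j.+1)%:R by rewrite ltr0n.
  have x0 : 0 < (j.+2)%:R * s / 2 by rewrite divr_gt0// mulr_gt0.
  have kf : (0 : R) < k`!%:R by rewrite ltr0n fact_gt0.
  have E1 : ((j.+2)%:R * s / 2) ^+ k / k`!%:R <= expR ((j.+2)%:R * s / 2).
    by apply: le_trans (expR_ge1Dxn n.+1 (ltW x0)); rewrite lerDr.
  have -> : expR (- j%:R * s / 2) = expR s / expR ((j.+2)%:R * s / 2).
    rewrite -expRB; congr expR; by rewrite -[j.+2]addn2 natrD; field.
  have E2 : (expR ((j.+2)%:R * s / 2))^-1 <= k`!%:R * (2 / s) ^+ k * (j.+2)%:R ^- k.
    rewrite -[leRHS]invrK lef_pV2; last 2 first.
    - by rewrite posrE expR_gt0.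
    - by rewrite posrE invr_gt0 divr_gt0 ?exprn_gt0// mulr_gt0// exprn_gt0// divr_gt0.
    apply: le_trans E1; apply: le_of_eq.
    rewrite -mulrA -exprVn -exprMn invfM mulrC -exprVn; congr (_ ^+ _ / _).
    by field; rewrite !gt_eqF.
  rewrite -mulrA; apply: (@le_trans _ _ (expR s * (k`!%:R * (2 / s) ^+ k * (j.+2)%:R ^- k * (j.+2)%:R ^+ n))).
    by rewrite ler_wpM2l ?expR_ge0// ler_wpM2r// exprn_ge0// ltW.
  rewrite (_ : expR s * _ = B * ((j.+2)%:R ^- k * (j.+2)%:R ^+ n)); last by rewrite /B !mulrA.
  rewrite ler_wpM2l//.
  rewrite /k -[n.+2]addn2 exprD invfM mulrAC mulVf ?mul1r ?expf_neq0 ?gt_eqF//.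
  rewrite (_ : _ - _ = ((j.+1)%:R * (j.+2)%:R)^-1); last first.
    rewrite -[j.+2]addn1 natrD; field; rewrite gt_eqF//=.
  by rewrite lef_pV2 ?posrE ?exprn_gt0 ?mulr_gt0// expr2 ler_wpM2r ?(ltW j2)// ler_nat.
apply: (@le_trans _ _ (\sum_(j < J) B * ((j.+1)%:R^-1 - (j.+2)%:R^-1))).
  by apply: ler_sum => j _; exact: H.
rewrite -mulr_sumr ler_piMr//.
have -> : \sum_(j < J) ((j.+1)%:R^-1 - (j.+2)%:R^-1) = 1 - (J.+1)%:R^-1 :> R.
  elim: J => [|J IH]; first by rewrite big_ord0 invr1 subrr.
  by rewrite big_ord_recr /= IH; ring.
by rewrite gerBl invr_ge0.
Qed.

(** * Growth of the dimensions of irreducible representations *)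

Section HS.
Context {R : realType} {d : nat}.
Local Notation C := R[i].
Implicit Types A B : 'M[C]_d.

(** The real part of the Hilbert-Schmidt inner product; a real-valued form allows the mean value
    theorem to be applied to it. *)
Definition rdot A B : R := Re (\tr (A^t* *m B)).

Lemma rdotE A B : rdot A B = \sum_i \sum_j (Re (A j i) * Re (B j i) + Im (A j i) * Im (B j i)).
Proof.
rewrite /rdot Re_sum; apply: eq_bigr => i _; rewrite mxE Re_sum; apply: eq_bigr => j _.
by rewrite !mxE ReM ReJ ImJ; ring.
Qed.

Lemma rdotC A B : rdot A B = rdot B A.
Proof. by rewrite !rdotE; do 2 (apply: eq_bigr => ? _); ring. Qed.

Lemma rdotDr A B1 B2 : rdot A (B1 + B2) = rdot A B1 + rdot A B2.
Proof. by rewrite /rdot mulmxDr mxtraceD ReD. Qed.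

Lemma rdotNr A B : rdot A (- B) = - rdot A B.
Proof. by rewrite /rdot mulmxN raddfN ReN. Qed.

Lemma rdotZr A (a : R) B : rdot A (toC a *: B) = a * rdot A B.
Proof. by rewrite /rdot -scalemxAr mxtraceZ ReM /= mul0r subr0. Qed.

Lemma rdot_sumr A (I : Type) (r : seq I) (F : I -> 'M[C]_d) :
  rdot A (\sum_(i <- r) F i) = \sum_(i <- r) rdot A (F i).
Proof.
elim: r => [|i r IH]; rewrite ?big_nil ?big_cons ?rdotDr ?IH//.
by rewrite /rdot mulmx0 raddf0.
Qed.

Lemma rdot_ge0 A : 0 <= rdot A A.
Proof.
rewrite rdotE; apply: sumr_ge0 => i _; apply: sumr_ge0 => j _.
by rewrite addr_ge0// -expr2 sqr_ge0.
Qed.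

Lemma rdotBB A B : rdot (A - B) (A - B) = rdot A A - 2 * rdot A B + rdot B B.
Proof.
rewrite rdotDr rdotNr !(rdotC (A - B)) !rdotDr !rdotNr (rdotC B A); ring.
Qed.

Lemma rdot_le_of A B : rdot A B = rdot A A -> rdot A A <= rdot B B.
Proof. by move=> E; have := rdot_ge0 (A - B); rewrite rdotBB E; lra. Qed.

Lemma rdot_sum_le m (w : 'I_m -> R) (W : R) (F : 'I_m -> 'M[C]_d) : 0 <= W -> (forall i, `|w i| <= W) ->
  rdot (\sum_i toC (w i) *: F i) (\sum_i toC (w i) *: F i) <= W ^+ 2 * m%:R * \sum_i rdot (F i) (F i).
Proof.
move=> W0 Hw; set S := (X in rdot X X); rewrite {2}/S rdot_sumr.
have E i j : w i * w j * rdot (F j) (F i) <= W ^+ 2 / 2 * (rdot (F i) (F i) + rdot (F j) (F j)).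
  have h1 : `|rdot (F j) (F i)| <= (rdot (F i) (F i) + rdot (F j) (F j)) / 2.
    rewrite ler_norml; have h := rdot_ge0 (F j - F i); rewrite rdotBB in h.
    have h' := rdot_ge0 (F j - - F i); rewrite rdotBB !rdotNr !(rdotC (- _)) !rdotNr in h'.
    move: (rdot (F i) (F i)) (rdot (F j) (F j)) (rdot (F j) (F i)) h h' => x y z h h'.
    by apply/andP; split; lra.
  apply: le_trans (ler_norm _) _; rewrite !normrM.
  apply: (@le_trans _ _ (W * W * ((rdot (F i) (F i) + rdot (F j) (F j)) / 2))).
    by apply: ler_pM => //; exact: ler_pM.
  by apply: le_of_eq; field.
apply: (@le_trans _ _ (\sum_i \sum_j (W ^+ 2 / 2 * (rdot (F i) (F i) + rdot (F j) (F j))))).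
  apply: ler_sum => i _; rewrite rdotZr rdotC /S rdot_sumr mulr_sumr; apply: ler_sum => j _.
  by rewrite rdotZr mulrA rdotC.
apply: le_of_eq.
under eq_bigr do rewrite -mulr_sumr big_split /= sumr_const card_ord.
have alg (a : 'I_m -> R) : \sum_i W ^+ 2 / 2 * (a i *+ m + \sum_j a j) = W ^+ 2 * m%:R * \sum_i a i.
  rewrite -mulr_sumr big_split /= sumr_const card_ord sumrMnl.
  by move: (\sum_i a i) => t; rewrite -(mulr_natr t); field.
exact: alg.
Qed.

End HS.

Section Weyl.
Context {R : realType} {n : nat} {G : lieGroupType R n}.
Local Notation C := R[i].
Context (X : 'I_n -> (G -> R) -> (G -> R)) (bX : lie_basis X) (cG : compact [set: G])
 (haar : probability (borel G) R) (haarP : haar_probability haar).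
Local Notation D := (frame_vf X).

Lemma rep_rdot_D d (p : G -> 'M[C]_d) (B : 'M[C]_d) w x : representation p ->
  smooth_fun (fun x => rdot B (p x)) /\
  D w (fun x => rdot B (p x)) x = rdot B (p x *m dp X p w).
Proof.
move=> rp; have sp := rep_smooth cG haarP rp.
pose F x := \tr (B^t* *m p x).
have FE y : F y = \sum_i \sum_j (B j i)^* * p y j i.
  by apply: eq_bigr => i _; rewrite mxE; apply: eq_bigr => j _; rewrite !mxE.
have sF : csmooth F.
  apply: (csmooth_eq (f := fun y => \sum_i \sum_j (B j i)^* * p y j i)); first by move=> y; rewrite FE.
  by apply: csmooth_sum => i; apply: csmooth_sum => j; exact: csmoothZ.
split; first by case: sF.
have : cD X w F x = \tr (B^t* *m (p x *m dp X p w)).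
  rewrite (eq_cD _ _ _ FE) (cD_sum bX) => [|i]; last first.
    by apply: csmooth_sum => j; exact: csmoothZ.
  apply: eq_bigr => i _; rewrite (cD_sum bX) => [|j]; last exact: csmoothZ.
  rewrite mxE; apply: eq_bigr => j _; rewrite (cDZ bX)// (rep_D bX cG haarP)// !mxE.
  by [].
by move=> /(congr1 Re).
Qed.

(** By unitarity the difference [B] of [p] at two points satisfies |B|^2 = 2 (d - Re tr). The mean
    value theorem for the pairing of [B] with [p] gives an intermediate point where |B|^2 is the
    pairing of [B] with a derivative, so |B| is at most the norm of [dp w]. The squared norms of the
    [dp 'e_i] sum to [cc * d], which leaves a constant [K] independent of the representation. *)
Lemma rep_lip : exists (c : chart R n G) (a : 'rV[R]_n) (r K : R),
  [/\ atlas c, 0 < r, 0 <= K, forall u, `|u - a| < r -> chart_cod c u &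
   forall d (p : G -> 'M[C]_d) (cc : R), unitary_rep p -> casimir X p = (- toC cc)%:M ->
   forall u1 u2, `|u1 - a| < r -> `|u2 - a| < r ->
   d%:R - Re (\tr (p ((chart_inv c u1)^-1 * chart_inv c u2)%g)) <= K * cc * d%:R * `|u2 - u1| ^+ 2].
Proof.
have [c ac dc] := atlas_cover (1%g : G).
have [A [sA HA]] := frame_partials ac dc ac.
have [M uM HM] := cdir_frame ac dc bX.
have [cx ix] := dom_map ac dc; pose a := chart_map c 1%g.
pose S (u : 'rV[R]_n) : R := \sum_k \sum_j `|A u k j|.
have cS : {for a, continuous S}.
  apply: cont_for_sum => k; apply: cont_for_sum => j.
  have cA := Ck_on_cont (sA 0%N k j) cx.
  exact: (cvg_norm cA).
have nS : \forall u \near a, S u < S a + 1.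
  by apply: (cvgr_lt (S a) cS); rewrite ltrDl.
have [r r0 Hr] := (near_normP _ _).1 (filterI nS (near_cod ac cx)).
have S0 : 0 <= S a by do 2 (apply: sumr_ge0 => ? _).
pose M1 : R := \sum_j \sum_i `|M j i|.
have M10 : 0 <= M1 by do 2 (apply: sumr_ge0 => ? _).
pose W0 : R := (S a + 1) * M1.
have W00 : 0 <= W0 by rewrite mulr_ge0// addr_ge0.
(* Radius [r / 3] keeps the segment joining two admissible points within distance [r] of [a]. The
   factor [n] comes from [rdot_sum_le] and the 1/2 from |B|^2 = 2 (d - Re tr). *)
exists c, a, (r / 3), (W0 ^+ 2 * n%:R / 2); split => //.
- by rewrite divr_gt0.
- by rewrite divr_ge0// mulr_ge0// sqr_ge0.
- move=> u ur; have -> : u = a + (u - a) by rewrite addrC subrK.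
  apply: (proj2 (Hr _ _)); apply: lt_trans ur _.
  by lra.
move=> d p cc up Hc u1 u2 u1r u2r; have rp := up.1.
have [p1 pM _] := rp.
set x1 := chart_inv c u1; set x2 := chart_inv c u2.
pose B := p x2 - p x1.
have unit x : rdot (p x) (p x) = d%:R.
  by rewrite /rdot -up.2 rep_Vmul// mxtrace1; elim: (d) => // m IH; rewrite !mulrS ReD IH.
have EB : rdot B B = 2 * (d%:R - Re (\tr (p (x1^-1 * x2)%g))).
  rewrite /B rdotBB !unit rdotC {1}/rdot -up.2 -pM; ring.
pose v := u2 - u1.
have vr : `|v| < r / 3 + r / 3.
  by rewrite /v -(subrKA a); apply: le_lt_trans (ler_normD _ _) _; rewrite ltrD// distrC.
have inr (t : R) : `|t| <= `|1 : R| -> `|u1 + t *: v - a| < r.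
  rewrite normr1 => t1; rewrite addrAC; apply: le_lt_trans (ler_normD _ _) _.
  rewrite (_ : r = r / 3 + (r / 3 + r / 3)); last by field.
  by apply: ltr_leD => //; apply: le_trans (ltW vr); rewrite normrZ ler_piMl.
have inW (t : R) : `|t| <= `|1 : R| ->
    S (u1 + t *: v) < S a + 1 /\ chart_cod c (u1 + t *: v).
  move=> t1; by have := Hr _ (inr t t1); rewrite [a + _]addrC subrK.
have sf := (rep_rdot_D B 0 1%g rp).1.
have [t t1 Et] := @MVT_dir R _ ((fun x => rdot B (p x)) \o chart_inv c : _ -> R^o) u1 v 1
  (fun t t1 => Ck_on_derivable (v := v) (sf c ac 1%N) (inW t t1).2).
move: Et; rewrite scale1r mulr1 (addrC u1) subrK /= -/x1 -/x2 => Et.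
have [St ct] := inW t t1; set u := u1 + t *: v in Et St ct.
pose w := v *m A u *m M.
have Ed : rdot B B = rdot B (p (chart_inv c u) *m dp X p w).
  rewrite {2}/B rdotDr rdotNr Et -(rep_rdot_D B w _ rp).2.
  rewrite derive_partials; last exact: (Ck1_differentiable (open_cod ac) ct (sf c ac 1%N)).
  have -> : D w (fun x => rdot B (p x)) (chart_inv c u) =
     cdir c (v *m A u) (fun x => rdot B (p x)) (chart_inv c u) by rewrite HM.
  pose g j := cdir c 'e_j (fun x => rdot B (p x)) (chart_inv c u).
  have Hk k : 'D_'e_k ((fun x => rdot B (p x)) \o chart_inv c : _ -> R^o) u =
    \sum_j A u k j * g j := HA _ u k sf ct.
  have -> : cdir c (v *m A u) (fun x => rdot B (p x)) (chart_inv c u) =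
    \sum_j (v *m A u) 0 j * g j := cdir_lin ac dc _ _ sf.
  exact: row_comb Hk.
have {Ed} := rdot_le_of (esym Ed).
have -> : rdot (p (chart_inv c u) *m dp X p w) (p (chart_inv c u) *m dp X p w) = rdot (dp X p w) (dp X p w).
  rewrite /rdot conjtrM -mulmxA (mulmxA _ (p _)) -up.2 rep_Vmul// mul1mx//.
have Hw i : `|w 0 i| <= W0 * `|v|.
  rewrite mxE; apply: le_trans (ler_norm_sum _ _ _) _.
  have Hj j : `|(v *m A u) 0 j| <= `|v| * (S a + 1).
    rewrite mxE; apply: le_trans (ler_norm_sum _ _ _) _.
    apply: (@le_trans _ _ (\sum_k `|v| * `|A u k j|)).
      by apply: ler_sum => k _; rewrite normrM ler_wpM2r// coord_le_norm.
    rewrite -mulr_sumr ler_wpM2l//; apply: le_trans (ltW St).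
    by apply: ler_sum => k _; rewrite (bigD1 j)//= lerDl sumr_ge0.
  apply: (@le_trans _ _ (\sum_j `|v| * (S a + 1) * `|M j i|)).
    by apply: ler_sum => j _; rewrite normrM ler_wpM2r.
  rewrite -mulr_sumr (_ : W0 * `|v| = `|v| * (S a + 1) * M1); last by rewrite /W0; ring.
  rewrite ler_wpM2l ?mulr_ge0 ?addr_ge0//.
  by apply: ler_sum => j _; rewrite (bigD1 i)//= lerDl sumr_ge0.
have Vw0 : 0 <= W0 * `|v| by rewrite mulr_ge0.
have Edw : dp X p w = \sum_i toC (w 0 i) *: dp X p 'e_i by exact: dp_row.
rewrite Edw => H; have {}H := le_trans H (rdot_sum_le (fun i => dp X p 'e_i) Vw0 Hw).
have Ec : \sum_i rdot (dp X p 'e_i) (dp X p 'e_i) = cc * d%:R.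
  transitivity (- Re (\tr (casimir X p))).
    rewrite /casimir (big_morph _ (@mxtraceD C d) (mxtrace0 C d)) Re_sum -sumrN.
    apply: eq_bigr => i _; rewrite /rdot (dp_adj bX cG haarP rp) ?mulNmx ?raddfN ?ReN//.
    by case: up.
  rewrite Hc mxtrace_scalar -ReN -mulNrn opprK.
  by elim: (d) => [|m IH]; rewrite ?mulr0n ?mulr0// !mulrS ReD IH mulrDr mulr1.
move: H; rewrite Ec EB exprMn => H.
by rewrite -(ler_pM2l (_ : 0 < 2))//; apply: le_trans H _; apply: le_of_eq; field.
Qed.

Lemma char_orth d1 d2 (p : G -> 'M[C]_d1) (q : G -> 'M[C]_d2) :
  unitary_rep p -> unitary_rep q -> irr p -> irr q ->
  (forall M, intertwines q p M -> M = 0) ->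
  cint haar (fun x => \tr (p x) * (\tr (q x))^*) = 0.
Proof.
move=> up uq ip iq no; have cp := rep_mcont up.1; have cq := rep_mcont uq.1.
rewrite (@eq_cint _ _ _ haar _ (fun x => \sum_i \sum_j p x i i * (q x j j)^*)).
  rewrite cint_sum// => [|i]; last by apply: ccont_sum => j; apply: ccontM => //; exact: ccontJ.
  rewrite big1// => i _; rewrite cint_sum// => [|j]; last by apply: ccontM => //; exact: ccontJ.
  by rewrite big1// => j _; exact: orthogonality.
move=> x; rewrite /mxtrace rmorph_sum mulr_suml; apply: eq_bigr => i _.
by rewrite mulr_sumr.
Qed.

Lemma char_norm d (p : G -> 'M[C]_d) : unitary_rep p -> irr p ->
  cint haar (fun x => \tr (p x) * (\tr (p x))^*) = 1.
Proof.
move=> up ip; have cp := rep_mcont up.1; have [_ d0 _] := ip.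
rewrite (@eq_cint _ _ _ haar _ (fun x => \sum_i \sum_j p x i i * (p x j j)^*)).
  rewrite cint_sum// => [|i]; last by apply: ccont_sum => j; apply: ccontM => //; exact: ccontJ.
  rewrite (eq_bigr (fun=> d%:R^-1)) => [|i _].
    by rewrite sumr_const card_ord -(mulr_natr (d%:R^-1)) mulVf// pnatr_eq0 -lt0n.
  rewrite cint_sum// => [|j]; last by apply: ccontM => //; exact: ccontJ.
  rewrite (bigD1 i)//= big1 ?addr0 => [|j ji].
    by rewrite (orthogonality_self cG haarP)// eqxx mul1r.
  by rewrite (orthogonality_self cG haarP)// eq_sym (negPf ji) mul0r.
move=> x; rewrite /mxtrace rmorph_sum mulr_suml; apply: eq_bigr => i _.
by rewrite mulr_sumr.
Qed.

Definition irr_family (I : finType) (d : I -> nat) (p : forall i, G -> 'M[C]_(d i)) (cc : I -> R) :=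
  [/\ forall i, unitary_rep (p i), forall i, irr (p i),
   forall i, casimir X (p i) = (- toC (cc i))%:M &
   forall i j, i != j -> forall M, intertwines (p i) (p j) M -> M = 0].

(* Let N be the sum of d_i^2 over the i with c_i <= L. The function f, the sum of the
   d_i chi_i, has Re f >= N / 2 on a ball of radius comparable to L^(-1/2) around the
   identity. Polynomially many (in L) translates of that ball cover a fixed open set, while the
   integral of |f|^2 is N. *)
Lemma weyl_bound : exists2 A : R, 0 <= A & forall (I : finType) (d : I -> nat)
  (p : forall i, G -> 'M[C]_(d i)) (cc : I -> R), irr_family p cc -> forall L : nat,
  \sum_(i | cc i <= L%:R) (d i)%:R ^+ 2 <= A * (L.+1)%:R ^+ n.
Proof.
have [c [a [r [K [ac r0 K0 Hr HK]]]]] := rep_lip.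
pose r' := r / 2; have r'0 : 0 < r' by rewrite divr_gt0.
have ca : chart_cod c a by apply: Hr; rewrite subrr normr0.
have [da ia] := cod_inv ac ca.
pose V : set G := [set x | chart_dom c x /\ `|chart_map c x - a| < r'].
have NV : nbhs (chart_inv c a) V.
  have N1 := near_dom ac da.
  have N2 : \forall y \near chart_inv c a, `|chart_map c y - chart_map c (chart_inv c a)| < r'.
    exact: (@cvgr_distC_lt _ _ _ (nbhs (chart_inv c a)) _ _ _ (cont_map ac da) _ r'0).
  rewrite ia in N2.
  exact: filterI N1 N2.
have [phi [sphi phi0 phi1 phiV]] := smooth_bump NV.
have cphi := smooth_cont sphi.
have [B B0 HB] := cont_bounded cG cphi.
have I0 : 0 < gint haar phi by exact: (gint_gt0 cG haarP cphi phi0 phi1).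
set I0' := gint haar phi in I0.
(* With [m = N0 * L.+1] grid steps the mesh [r / m] satisfies K L (r / m)^2 <= 1/2, which keeps the
   real part of each character above half its dimension. This mesh is finer than L^(-1/2) demands,
   but any polynomial growth will do. *)
pose N0 := (Num.bound (2 * K * r ^+ 2)).+1.
have HN0 : 2 * K * r ^+ 2 <= N0%:R ^+ 2.
  have h : 0 <= 2 * K * r ^+ 2 by apply: mulr_ge0; [exact: mulr_ge0|exact: sqr_ge0].
  apply: (@le_trans _ _ N0%:R).
    by apply: ltW; apply: lt_le_trans (archi_boundP h) _; rewrite ler_nat.
  by rewrite -natrX ler_nat -[X in (X <= _)%N]expn1 leq_exp2l// ?(leq_pexp2l)//.
(* [B] and [I0'] are the supremum and the integral of a bump supported in [V]. The 4 is from the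
   lower bound (N / 2)^2 of |f|^2, and [N0 ^ n (L + 1) ^ n] is the number of grid points. *)
exists (4 * B * N0%:R ^+ n / I0').
  by rewrite divr_ge0 ?(ltW I0)// mulr_ge0 ?exprn_ge0// mulr_ge0.
move=> I d p cc [up ip Hc no] L.
pose w i : nat := if cc i <= L%:R then d i else 0%N.
pose f x := \sum_i (w i)%:R * \tr (p i x).
pose N : R := \sum_i (w i)%:R ^+ 2.
have -> : \sum_(i | cc i <= L%:R) (d i)%:R ^+ 2 = N.
  rewrite big_mkcond; apply: eq_bigr => i _; rewrite /w; case: ifP => // _.
  by rewrite expr0n.
have N_ge0 : 0 <= N by apply: sumr_ge0 => i _; exact: sqr_ge0.
have [N00|Nn0] := eqVneq N 0.
  by rewrite N00 mulr_ge0 ?exprn_ge0// divr_ge0 ?(ltW I0)// mulr_ge0 ?exprn_ge0// mulr_ge0.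
have Npos : 0 < N by rewrite lt_neqAle eq_sym Nn0.
have cchi i : ccont (fun x => \tr (p i x)) by apply: mcont_tr; exact: (rep_mcont (up i).1).
have cf : ccont f by apply: ccont_sum => i; exact: ccontZ.
pose F x := Re (f x) ^+ 2 + Im (f x) ^+ 2.
have cF : continuous F.
  by apply: contD; apply: contM; case: cf.
have F0 x : 0 <= F x by rewrite addr_ge0// sqr_ge0.
have IF : gint haar F = N.
  have : cint haar (fun x => f x * (f x)^*) = toC N.
    rewrite (@eq_cint _ _ _ haar _ (fun x => \sum_i \sum_j ((w i)%:R * (w j)%:R) *
        (\tr (p i x) * (\tr (p j x))^*))); last first.
      move=> x; rewrite rmorph_sum mulr_suml; apply: eq_bigr => i _.
      rewrite mulr_sumr; apply: eq_bigr => j _; rewrite rmorphM /= conjC_nat; ring.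
    have cij i j : ccont (fun x => \tr (p i x) * (\tr (p j x))^*).
      by apply: ccontM => //; exact: ccontJ.
    rewrite cint_sum// => [|i]; last by apply: ccont_sum => j; exact: ccontZ.
    rewrite /N rmorph_sum; apply: eq_bigr => i _; rewrite cint_sum// => [|j]; last exact: ccontZ.
    rewrite (bigD1 i)//= big1 ?addr0 => [|j ji].
      by rewrite cintZ// char_norm// mulr1 -expr2 rmorphXn rmorph_nat.
    by rewrite cintZ// char_orth ?mulr0//; exact: no.
  move=> /(congr1 Re) /= <-; apply: eq_gint => x.
  by rewrite ReM ReJ ImJ /F; ring.
pose m := (N0 * L.+1)%N; have m0 : (0 < m)%N by rewrite muln_gt0.
have mR : (0 : R) < m%:R by rewrite ltr0n.
pose ue (e : {ffun 'I_n -> 'I_m}) : 'rV[R]_n := \row_i (a 0 i - r' + r * (e i)%:R / m%:R).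
pose ge e := chart_inv c (ue e).
have ue_in e : `|ue e - a| < r.
  apply: (@le_lt_trans _ _ r'); last by rewrite /r'; lra.
  apply: norm_le_coord; first exact: ltW.
  move=> i; rewrite !mxE (_ : _ - _ = r * (e i)%:R / m%:R - r'); last by ring.
  have e0 : 0 <= r * (e i)%:R / m%:R by rewrite divr_ge0// mulr_ge0// ltW.
  have e1 : r * (e i)%:R / m%:R <= r.
    by rewrite ler_pdivrMr// ler_wpM2l ?(ltW r0)// ler_nat ltnW.
  by rewrite ler_norml /r'; apply/andP; split; move: e0 e1; set z := (_ / m%:R); lra.
have cover x : V x -> exists e, `|chart_map c x - ue e| <= r / m%:R.
  move=> [dx xa]; set u := chart_map c x in xa *.
  pose z i := (u 0 i - a 0 i + r') * m%:R / r.
  have uai i : `|u 0 i - a 0 i| < r'.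
    by apply: le_lt_trans xa; have := coord_le_norm (u - a) i; rewrite !mxE.
  have z0 i : 0 <= z i.
    rewrite divr_ge0 ?(ltW r0)// mulr_ge0//.
    by have := uai i; rewrite ltr_norml => /andP[h _]; lra.
  have z1 i : z i < m%:R.
    rewrite /z ltr_pdivrMr// mulrC ltr_pM2l//.
    by have := uai i; rewrite ltr_norml => /andP[_ h]; move: h; rewrite /r'; lra.
  have zt i := truncn_itv (z0 i).
  have lt i : (Num.truncn (z i) < m)%N.
    by rewrite -(ltr_nat R); apply: le_lt_trans (z1 i); have /andP[] := zt i.
  exists [ffun i => Ordinal (lt i)].
  apply: norm_le_coord; first by rewrite divr_ge0// ltW.
  move=> i; rewrite !mxE ffunE /=.
  have /andP[t1 t2] := zt i; set tr := (Num.truncn (z i)) in t1 t2 *.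
  have -> : u 0 i - (a 0 i - r' + r * tr%:R / m%:R) = r / m%:R * (z i - tr%:R).
    rewrite /z; field; by rewrite !gt_eqF.
  rewrite normrM (ger0_norm (x := r / _)) ?divr_ge0 ?(ltW r0)// ler_piMr ?divr_ge0 ?(ltW r0)//.
  rewrite ger0_norm ?subr_ge0//; move: t2; rewrite -natr1; lra.
have low x e : V x -> `|chart_map c x - ue e| <= r / m%:R -> (N / 2) ^+ 2 <= F ((ge e)^-1 * x)%g.
  move=> [dx xa] xe; have [_ ix] := dom_map ac dx.
  have hq : K * L%:R * (r / m%:R) ^+ 2 <= 2^-1.
    have h1 : 2 * K * r ^+ 2 * L%:R <= N0%:R ^+ 2 * (L.+1)%:R ^+ 2.
      apply: ler_pM => //; first by apply: mulr_ge0; [exact: mulr_ge0|exact: sqr_ge0].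
      by rewrite -natrX ler_nat expnS expn1 (leq_trans (leqnSn L))// leq_pmulr.
    rewrite expr_div_n mulrA ler_pdivrMr ?exprn_gt0// /m natrM exprMn.
    by move: h1; rewrite (_ : 2 * K * r ^+ 2 * L%:R = 2 * (K * L%:R * r ^+ 2)); [lra|ring].
  have hN : N / 2 <= Re (f ((ge e)^-1 * x)%g).
    rewrite /N /f Re_sum mulr_suml; apply: ler_sum => i _.
    rewrite ReM (_ : Re _ = (w i)%:R); last by rewrite -[(w i)%:R](rmorph_nat toC).
    rewrite (_ : Im _ = 0); last by rewrite -[(w i)%:R](rmorph_nat toC).
    rewrite mul0r subr0 /w; case: ifP => ci; last by rewrite expr0n !mul0r.
    rewrite expr2 -mulrA; apply: ler_wpM2l => //.
    have xin : `|chart_map c x - a| < r by apply: lt_trans xa _; rewrite /r'; lra.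
    have := HK _ _ _ (up i) (Hc i) (ue e) (chart_map c x) (ue_in e) xin.
    rewrite ix -/(ge e); set q := Re _ => h.
    have cc0 : K * cc i * (d i)%:R * `|chart_map c x - ue e| ^+ 2 <= (d i)%:R * 2^-1.
      have [cpos|cneg] := leP 0 (cc i); last first.
        apply: (@le_trans _ _ 0); last by rewrite mulr_ge0// invr_ge0.
        by rewrite mulr_le0_ge0 ?sqr_ge0// mulr_le0_ge0// mulr_ge0_le0// ltW.
      rewrite (_ : K * cc i * (d i)%:R * _ = (d i)%:R * (K * cc i * `|chart_map c x - ue e| ^+ 2)); last by ring.
      apply: ler_wpM2l => //.
      apply: le_trans hq; apply: ler_pM; rewrite ?mulr_ge0//.
      - by rewrite ler_wpM2l.
      - by rewrite ler_sqr ?nnegrE// divr_ge0// ltW.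
    by move: h cc0; set z := K * _ * _ * _; lra.
  apply: (@le_trans _ _ (Re (f ((ge e)^-1 * x)%g) ^+ 2)); last by rewrite lerDl sqr_ge0.
  have N2 : 0 <= N / 2 by rewrite divr_ge0.
  by rewrite ler_sqr// nnegrE//; exact: le_trans hN.
have main : I0' <= \sum_(e : {ffun 'I_n -> 'I_m}) 4 * B / N ^+ 2 * N.
  have cFe e : continuous (fun x => F ((ge e)^-1 * x)%g).
    by apply: (contC (f := fun x => ((ge e)^-1 * x)%g) _ cF); exact: cont_lmul.
  have c4 : 0 <= 4 * B / N ^+ 2 by rewrite divr_ge0 ?sqr_ge0// mulr_ge0.
  apply: (@le_trans _ _ (gint haar (fun x => \sum_(e : {ffun 'I_n -> 'I_m}) 4 * B / N ^+ 2 * F ((ge e)^-1 * x)%g))).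
    apply: gint_le => //.
      by apply: cont_sum => e; exact: contZ.
    move=> x; have [Vx|nV] := pselect (V x); last first.
      by rewrite phiV// sumr_ge0// => e _; rewrite mulr_ge0.
    have [e He] := cover x Vx.
    rewrite (bigD1 e)//=; apply: le_trans (_ : B <= _).
      exact: le_trans (ler_norm _) (HB x).
    apply: (@le_trans _ _ (4 * B / N ^+ 2 * F ((ge e)^-1 * x)%g)); last first.
      by rewrite lerDl sumr_ge0// => e' _; rewrite mulr_ge0.
    apply: le_trans (ler_wpM2l c4 (low x e Vx He)).
    by apply: le_of_eq; field.
  rewrite gint_sum// => [|e]; last exact: contZ.
  apply: ler_sum => e _; rewrite gintZ// (gint_lmul cG haarP (ge e)^-1%g cF) IF//.
move: main; rewrite sumr_const card_ffun !card_ord -(mulr_natr (_ * N)) natrX => main.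
rewrite -(ler_pM2r I0) mulrAC divfK ?gt_eqF//.
have -> : 4 * B * N0%:R ^+ n * (L.+1)%:R ^+ n = N * (4 * B / N ^+ 2 * N * m%:R ^+ n).
  rewrite /m natrM exprMn; field.
  by rewrite gt_eqF.
by rewrite ler_wpM2l.
Qed.

(** The eigenvalues are sorted by integer part: in layer [j] the exponential is at most its value at
    [j], and the squared dimensions are counted by [weyl_bound] at level [j + 1]. *)
Lemma weyl_sum (s : R) : 0 < s -> exists2 B : R, 0 <= B & forall (I : finType) (d : I -> nat)
  (p : forall i, G -> 'M[C]_(d i)) (cc : I -> R), irr_family p cc -> (forall i, 0 <= cc i) ->
  \sum_i (d i)%:R ^+ 2 * expR (- cc i * s / 2) <= B.
Proof.
move=> s0; have [A A0 HA] := weyl_bound; have [B B0 HB] := heat_series_bound n s0.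
exists (A * B); first exact: mulr_ge0.
move=> I d p cc fam cc0.
have ct i := truncn_itv (cc0 i).
pose t i := Num.truncn (cc i).
pose J := (\max_i t i).+1.
have tJ i : (t i < J)%N by rewrite ltnS; exact: (leq_bigmax i).
apply: (@le_trans _ _ (\sum_(j < J) expR (- j%:R * s / 2) * (A * (j.+2)%:R ^+ n))); last first.
  rewrite (eq_bigr (fun j : 'I_J => A * (expR (- j%:R * s / 2) * (j.+2)%:R ^+ n))).
    by rewrite -mulr_sumr; apply: ler_wpM2l => //; exact: HB.
  by move=> j _; ring.
apply: (@le_trans _ _ (\sum_(j < J) \sum_(i | t i == j) (d i)%:R ^+ 2 * expR (- j%:R * s / 2))).
  rewrite (exchange_big_dep xpredT)//=; apply: ler_sum => i _.
  rewrite (bigD1 (Ordinal (tJ i)))//= big1 ?addr0.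
    rewrite ler_wpM2l ?sqr_ge0// ler_expR; have /andP[h _] := ct i.
    by rewrite ler_pM2r ?invr_gt0// ler_pM2r// lerN2.
  by move=> j /andP[/eqP E]; case/eqP; apply: val_inj; rewrite /= E.
apply: ler_sum => j _; rewrite -mulr_suml mulrC ler_wpM2l ?expR_ge0//.
apply: le_trans (HA _ _ _ _ fam j.+1).
rewrite [leRHS]big_mkcond [leLHS]big_mkcond; apply: ler_sum => i _.
case: eqP => [E|_]; last by case: ifP => // _; exact: sqr_ge0.
by have /andP[_ h] := ct i; rewrite -/(t i) E in h; rewrite (ltW h).
Qed.

End Weyl.

(** * Roots and highest weights *)

Section ComplexLie.
Context {R : realType} {n : nat} {G : lieGroupType R n}.
Local Notation C := R[i].
Local Notation iC := (Complex 0 1 : C).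
Context (X : 'I_n -> (G -> R) -> (G -> R)) (bX : lie_basis X)
 (oX : forall i j : 'I_n, lie_inner X 'e_i 'e_j = (i == j)%:R).
Local Notation br := (lie_bracket X).
Local Notation ad := (ad_mx X).
Implicit Types (u v w H a b la mu : 'rV[R]_n) (Z W U : 'rV[C]_n).

Definition lie_rep d (rho : 'rV[R]_n -> 'M[C]_d) :=
  [/\ forall (a : R) v w, rho (a *: v + w) = toC a *: rho v + rho w,
    forall v w, rho (br v w) = rho v *m rho w - rho w *m rho v &
    forall v, (rho v)^t* = - rho v].

Definition cext d (rho : 'rV[R]_n -> 'M[C]_d) Z : 'M[C]_d :=
  \sum_k Z 0 k *: rho 'e_k.

Definition adC := cext (fun v => tv (ad v)).
Definition brC Z W := W *m adC Z.
(** The complex bilinear extension of the inner product; the Hermitian one is [cdot Z (cj W)]. *)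
Definition cdot Z W : C := \sum_i Z 0 i * W 0 i.
Definition cj m k (A : 'M[C]_(m, k)) : 'M[C]_(m, k) := map_mx Num.conj A.

Lemma iC2 : iC * iC = -1. Proof. by apply: C_eq; rewrite ?ReM ?ImM /=; ring. Qed.

Lemma iC_neq0 : iC != 0. Proof. by apply/eqP => /(congr1 Im) /= /eqP; rewrite oner_eq0. Qed.

Lemma conjCM (x y : C) : (x * y)^* = x^* * y^*. Proof. exact: rmorphM. Qed.

Lemma conjCD (x y : C) : (x + y)^* = x^* + y^*. Proof. exact: rmorphD. Qed.

Lemma conjC_sum (I : Type) (r : seq I) (P : pred I) (F : I -> C) :
  (\sum_(i <- r | P i) F i)^* = \sum_(i <- r | P i) (F i)^*.
Proof. exact: rmorph_sum. Qed.

Lemma iCJ : iC^* = - iC. Proof. by apply: C_eq; rewrite ?ReJ ?ImJ /= ?oppr0. Qed.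

Lemma toCJ (r : R) : (toC r)^* = toC r. Proof. by apply: C_eq; rewrite ?ReJ ?ImJ /= ?oppr0. Qed.

Lemma toC_eq0 (r : R) : (toC r == 0) = (r == 0).
Proof. by apply/eqP/eqP => [/(congr1 Re)|->]. Qed.

Section Ext.
Variables (d : nat) (rho : 'rV[R]_n -> 'M[C]_d).

Lemma cext_lin (a : C) Z W : cext rho (a *: Z + W) = a *: cext rho Z + cext rho W.
Proof.
rewrite /cext scaler_sumr -big_split; apply: eq_bigr => k _.
by rewrite !mxE scalerDl scalerA.
Qed.

Lemma cext0 : cext rho 0 = 0.
Proof. by rewrite /cext big1// => k _; rewrite mxE scale0r. Qed.

Lemma cextZ (a : C) Z : cext rho (a *: Z) = a *: cext rho Z.
Proof. by have := cext_lin a Z 0; rewrite addr0 cext0 addr0. Qed.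

Lemma cext_sum (I : Type) (r : seq I) (P : pred I) (c : I -> C) (F : I -> 'rV[C]_n) :
  cext rho (\sum_(i <- r | P i) c i *: F i) = \sum_(i <- r | P i) c i *: cext rho (F i).
Proof. by elim/big_rec2: _ => [|i x y _ <-]; rewrite ?cext0 ?cext_lin. Qed.

Hypothesis lin : forall (a : R) v w, rho (a *: v + w) = toC a *: rho v + rho w.

Lemma lrep0 : rho 0 = 0.
Proof. by have := lin (-1) 0 0; rewrite scaler0 addr0 rmorphN1 scaleN1r addNr. Qed.

Lemma cext_real v : cext rho (tv v) = rho v.
Proof.
have ls (F : 'I_n -> R) (E : 'I_n -> 'rV[R]_n) :
    rho (\sum_i F i *: E i) = \sum_i toC (F i) *: rho (E i).
  by elim/big_rec2: _ => [|i x y _ <-]; [exact: lrep0|rewrite lin].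
by rewrite [in RHS](row_sum_delta v) ls; apply: eq_bigr => k _; rewrite mxE.
Qed.

Hypothesis brk : forall v w, rho (br v w) = rho v *m rho w - rho w *m rho v.

Lemma brC_expand Z W : brC Z W = \sum_k \sum_l (Z 0 k * W 0 l) *: tv (br 'e_k 'e_l).
Proof.
rewrite /brC /adC /cext mulmx_sumr; apply: eq_bigr => k _.
rewrite -scalemxAr {1}(row_sum_delta W) mulmx_suml scaler_sumr; apply: eq_bigr => l _.
rewrite -scalemxAl scalerA; congr (_ *: _).
by rewrite -(adE bX) map_mxM /=; congr (_ *m _); apply/rowP => j; rewrite !mxE rmorph_nat.
Qed.

Lemma cext_br Z W : cext rho (brC Z W) = cext rho Z *m cext rho W - cext rho W *m cext rho Z.
Proof.
rewrite brC_expand.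
have -> : cext rho (\sum_k \sum_l (Z 0 k * W 0 l) *: tv (br 'e_k 'e_l)) =
  \sum_k \sum_l (Z 0 k * W 0 l) *: rho (br 'e_k 'e_l).
  under eq_bigr do rewrite -[\sum_l _]scale1r.
  rewrite cext_sum; apply: eq_bigr => k _; rewrite scale1r cext_sum.
  by apply: eq_bigr => l _; rewrite cext_real.
have E Z1 W1 : cext rho Z1 *m cext rho W1 = \sum_k \sum_l (Z1 0 k * W1 0 l) *:
    (rho 'e_k *m rho 'e_l).
  rewrite /cext mulmx_suml; apply: eq_bigr => k _; rewrite mulmx_sumr; apply: eq_bigr => l _.
  by rewrite -scalemxAl -scalemxAr scalerA.
rewrite !E [X in _ - X]exchange_big -sumrB; apply: eq_bigr => k _.
rewrite -sumrB; apply: eq_bigr => l _; rewrite brk scalerBr; congr (_ - _ *: _).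
exact: mulrC.
Qed.

Hypothesis skw : forall v, (rho v)^t* = - rho v.

Lemma cext_adj Z : (cext rho Z)^t* = - cext rho (cj Z).
Proof.
rewrite /cext -sumrN; apply/matrixP => i j; rewrite !mxE summxE conjC_sum summxE.
apply: eq_bigr => k _; have /matrixP/(_ i j) := skw 'e_k; rewrite !mxE => E.
by rewrite conjCM E mulrN.
Qed.
End Ext.

Lemma ad_linC (a : R) v w : tv (ad (a *: v + w)) = toC a *: tv (ad v) + tv (ad w).
Proof. by rewrite (ad_lin bX); apply/matrixP => i j; rewrite !mxE rmorphD rmorphM. Qed.

Lemma adC_real v : adC (tv v) = tv (ad v).
Proof. exact: (cext_real ad_linC). Qed.

(** The matrices [ad] act on rows from the right and so reverse products; transposition turns them
    into a representation on columns, to which the general results on [lie_rep] apply. *)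
Lemma adrep : lie_rep (fun v => (tv (ad v))^T).
Proof.
split.
- by move=> a v w; rewrite ad_linC; apply/matrixP => i j; rewrite !mxE.
- move=> v w; rewrite (ad_br bX) map_mxB !map_mxM -!trmx_mul.
  by apply/matrixP => i j; rewrite !mxE.
- move=> v; apply/matrixP => i j; rewrite !mxE toCJ.
  by have /matrixP/(_ i j) := ad_skew bX oX v; rewrite !mxE => ->; rewrite rmorphN opprK.
Qed.

Lemma adC_tr Z : cext (fun v => (tv (ad v))^T) Z = (adC Z)^T.
Proof.
rewrite /adC /cext; apply/matrixP => i j; rewrite !mxE !summxE.
by apply: eq_bigr => k _; rewrite !mxE.
Qed.

Lemma brC_tr Z W : (brC Z W)^T = cext (fun v => (tv (ad v))^T) Z *m W^T.
Proof. by rewrite /brC trmx_mul adC_tr. Qed.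

Lemma adC_skew Z : (adC Z)^T = - adC Z.
Proof.
rewrite -adC_tr /adC /cext -sumrN; apply: eq_bigr => k _; rewrite -scalerN; congr (_ *: _).
by apply/matrixP => i j; have /matrixP/(_ i j) := ad_skew bX oX 'e_k; rewrite !mxE => ->; rewrite rmorphN.
Qed.

Lemma brC_linr (a : C) Z W U : brC U (a *: Z + W) = a *: brC U Z + brC U W.
Proof. by rewrite /brC mulmxDl scalemxAl. Qed.
Lemma brCZr (a : C) U Z : brC U (a *: Z) = a *: brC U Z.
Proof. by rewrite /brC scalemxAl. Qed.
Lemma brCZl (a : C) U Z : brC (a *: U) Z = a *: brC U Z.
Proof. by rewrite /brC /adC cextZ scalemxAr. Qed.

Lemma brC_real v w : brC (tv v) (tv w) = tv (br v w).
Proof. by rewrite /brC adC_real -map_mxM /= (adE bX). Qed.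

Lemma brCC Z W : brC Z W = - brC W Z.
Proof.
rewrite (brC_expand Z) (brC_expand W) exchange_big -sumrN.
apply: eq_bigr => k _; rewrite -sumrN; apply: eq_bigr => l _.
by rewrite (bracketC bX) map_mxN scalerN mulrC.
Qed.

Lemma brC_jacobi Z W U : brC (brC Z W) U = brC Z (brC W U) - brC W (brC Z U).
Proof.
have [l b _] := adrep; apply: trmx_inj; rewrite raddfB /= !brC_tr.
by rewrite (cext_br l b) mulmxBl !mulmxA.
Qed.

Lemma cj_lin m k (a : C) (A B : 'M[C]_(m, k)) : cj (a *: A + B) = a^* *: cj A + cj B.
Proof. by apply/matrixP => i j; rewrite !mxE conjCD conjCM. Qed.
Lemma cjK m k (A : 'M[C]_(m, k)) : cj (cj A) = A.
Proof. by apply/matrixP => i j; rewrite !mxE conjCK. Qed.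
Lemma cjM m k l (A : 'M[C]_(m, k)) (B : 'M[C]_(k, l)) : cj (A *m B) = cj A *m cj B.
Proof. exact: map_mxM. Qed.
Lemma cjtv v : cj (tv v) = tv v.
Proof. by apply/matrixP => i j; rewrite !mxE toCJ. Qed.

Lemma cj_adC Z : cj (adC Z) = adC (cj Z).
Proof.
rewrite /adC /cext; apply/matrixP => i j; rewrite !mxE !summxE conjC_sum.
by apply: eq_bigr => k _; rewrite !mxE conjCM toCJ.
Qed.

Lemma cj_brC Z W : cj (brC Z W) = brC (cj Z) (cj W).
Proof. by rewrite /brC cjM cj_adC. Qed.

Lemma cdotC Z W : cdot Z W = cdot W Z.
Proof. by apply: eq_bigr => i _; rewrite mulrC. Qed.
Lemma cdot_mx Z W : cdot Z W = (Z *m W^T) 0 0.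
Proof. by rewrite mxE; apply: eq_bigr => i _; rewrite mxE. Qed.
Lemma cdot_linl (a : C) Z W U : cdot (a *: Z + W) U = a * cdot Z U + cdot W U.
Proof.
by rewrite /cdot mulr_sumr -big_split; apply: eq_bigr => i _; rewrite !mxE mulrDl mulrA.
Qed.
Lemma cdot0l U : cdot 0 U = 0.
Proof. by rewrite /cdot big1// => i _; rewrite mxE mul0r. Qed.
Lemma cdotZl (a : C) Z U : cdot (a *: Z) U = a * cdot Z U.
Proof. by have := cdot_linl a Z 0 U; rewrite addr0 cdot0l addr0. Qed.
Lemma cdot_real v w : cdot (tv v) (tv w) = toC (dot v w).
Proof. by rewrite /cdot /dot rmorph_sum; apply: eq_bigr => i _; rewrite !mxE rmorphM. Qed.

Lemma cdot_inv Z U W : cdot (brC Z U) W = - cdot U (brC Z W).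
Proof.
rewrite !cdot_mx /brC trmx_mul adC_skew mulNmx mulmxN mulmxA.
by move: (U *m _ *m _) => A; rewrite [in RHS]mxE opprK.
Qed.

Lemma cdot_ge0 Z : 0 <= cdot Z (cj Z).
Proof. by apply: sumr_ge0 => i _; rewrite mxE mul_conjC_ge0. Qed.

Lemma cdot_eq0 Z : cdot Z (cj Z) = 0 -> Z = 0.
Proof.
move=> h; apply/rowP => i; have := psumr_eq0P (P := xpredT) _ h => /(_ _ i isT) E.
have /eqP : Z 0 i * (Z 0 i)^* = 0.
  by have := E; rewrite mxE; apply => j _; rewrite mxE mul_conjC_ge0.
by rewrite mul_conjC_eq0 mxE => /eqP.
Qed.

Definition reV Z : 'rV[R]_n := map_mx Re Z.
Definition imV Z : 'rV[R]_n := map_mx Im Z.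

Lemma reimV Z : Z = tv (reV Z) + iC *: tv (imV Z).
Proof.
by apply/rowP => i; rewrite !mxE; apply: C_eq; rewrite ?ReD ?ImD ?ReM ?ImM /=; ring.
Qed.

Context (t : {vspace 'rV[R]_n}) (tcomm : forall v w, v \in t -> w \in t -> br v w = 0)
 (tcent : forall v, (forall w, w \in t -> br w v = 0) -> v \in t).

(** Membership in the root space of [a], the root being identified with a vector through the inner
    product. Both [a = 0] and [Z = 0] are allowed. *)
Definition rv a Z := forall H, H \in t -> brC (tv H) Z = (iC * toC (dot a H)) *: Z.

Lemma tC_cent Z : (forall H, H \in t -> brC (tv H) Z = 0) -> reV Z \in t /\ imV Z \in t.
Proof.
move=> HZ.
have E H : H \in t -> br H (reV Z) = 0 /\ br H (imV Z) = 0.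
  move=> Ht; have := HZ H Ht; rewrite {1}(reimV Z) addrC brC_linr !brC_real => E.
  split; apply/rowP => i; have /rowP/(_ i) := E; rewrite !mxE => Ei.
    by have := congr1 Re Ei; rewrite ReD ReM /= => h; lra.
  by have := congr1 Im Ei; rewrite ImD ImM /= => h; lra.
by split; apply: tcent => H Ht; case: (E H Ht).
Qed.

Lemma tC_eq0 Z : reV Z \in t -> imV Z \in t -> (forall H, H \in t -> cdot Z (tv H) = 0) -> Z = 0.
Proof.
move=> rt it Z0.
have E H : H \in t -> dot (reV Z) H = 0 /\ dot (imV Z) H = 0.
  move=> Ht; have := Z0 H Ht; rewrite {1}(reimV Z) addrC cdot_linl !cdot_real => E; split.
    by have := congr1 Re E; rewrite ReD ReM /= => h; lra.
  by have := congr1 Im E; rewrite ImD ImM /= => h; lra.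
have /eqP := (E _ rt).1; rewrite dot_eq0 => /eqP r0.
have /eqP := (E _ it).2; rewrite dot_eq0 => /eqP i0.
by rewrite (reimV Z) r0 i0 !map_mx0 scaler0 addr0.
Qed.

Lemma rv_cj a Z : rv a Z -> rv (- a) (cj Z).
Proof.
move=> h H Ht; rewrite -{1}(cjtv H) -cj_brC h// -[_ *: Z]addr0 cj_lin.
rewrite (_ : cj 0 = 0) ?addr0; last by apply/matrixP => i j; rewrite !mxE conjC0.
by rewrite conjCM iCJ toCJ dotNl rmorphN mulrN mulNr.
Qed.

Lemma rv_br a b Z W : rv a Z -> rv b W -> rv (a + b) (brC Z W).
Proof.
move=> hZ hW H Ht; have := brC_jacobi (tv H) Z W; rewrite hZ// hW// brCZl brCZr.
move=> /eqP; rewrite eq_sym subr_eq => /eqP ->; rewrite -scalerDl -mulrDr.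
by rewrite dotDl rmorphD.
Qed.

Lemma rv0_t Z : rv 0 Z -> reV Z \in t /\ imV Z \in t.
Proof. by move=> h; apply: tC_cent => H Ht; rewrite h// dot0l mulr0 scale0r. Qed.

Lemma tspanC a (k : C) : a \in t -> reV (k *: tv a) \in t /\ imV (k *: tv a) \in t.
Proof.
move=> at_; have -> : reV (k *: tv a) = Re k *: a.
  by apply/rowP => i; rewrite !mxE ReM /= mulr0 subr0.
have -> : imV (k *: tv a) = Im k *: a.
  by apply/rowP => i; rewrite !mxE ImM /= mulr0 add0r.
by split; apply: memvZ.
Qed.

(** The weights of [W] and of the conjugate of [Z] cancel, so the bracket lies in the
    complexification of [t]. Invariance of the form computes its pairing with every element of [t]
    and identifies it as a multiple of [a]. *)
Lemma coroot a Z W : a \in t -> rv a Z -> rv a W ->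
  brC W (cj Z) = (cdot W (cj Z) * iC) *: tv a.
Proof.
move=> at_ hZ hW; set k := cdot _ _.
have h0 : rv 0 (brC W (cj Z)) by rewrite -(subrr a); exact: rv_br (rv_cj hZ).
have [r1 i1] := rv0_t h0; have [r2 i2] := tspanC (k * iC) at_.
apply/eqP; rewrite -subr_eq0; apply/eqP; apply: tC_eq0.
- rewrite (_ : reV _ = reV (brC W (cj Z)) - reV ((k * iC) *: tv a)); first exact: memvB.
  by apply/rowP => i; rewrite !mxE ReD ReN.
- rewrite (_ : imV _ = imV (brC W (cj Z)) - imV ((k * iC) *: tv a)); first exact: memvB.
  by apply/rowP => i; rewrite !mxE ImD ImN.
move=> H Ht; rewrite addrC -scaleN1r cdot_linl cdotZl cdot_real cdot_inv.
rewrite (brCC W) hW// -scaleNr (cdotC (cj Z)) cdotZl -/k.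
by ring.
Qed.

Section LieRep.
Context (d : nat) (rho : 'rV[R]_n -> 'M[C]_d) (rrho : lie_rep rho).
Local Notation rhoC := (cext rho).
Implicit Types x y : 'cV[C]_d.

Let lin : forall (a : R) v w, rho (a *: v + w) = toC a *: rho v + rho w.
Proof. by case: rrho. Qed.
Let brk : forall v w, rho (br v w) = rho v *m rho w - rho w *m rho v.
Proof. by case: rrho. Qed.
Let skw : forall v, (rho v)^t* = - rho v.
Proof. by case: rrho. Qed.

Definition wv la x := forall H, H \in t -> rho H *m x = (iC * toC (dot la H)) *: x.

Definition hd x y : C := (x^t* *m y) 0 0.

Lemma hdE x y : hd x y = \sum_i (x i 0)^* * y i 0.
Proof. by rewrite /hd mxE; apply: eq_bigr => i _; rewrite !mxE. Qed.
Lemma hdJ x y : (hd x y)^* = hd y x.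
Proof. by rewrite !hdE conjC_sum; apply: eq_bigr => i _; rewrite conjCM conjCK mulrC. Qed.
Lemma hd_linr (a : C) x y z : hd z (a *: x + y) = a * hd z x + hd z y.
Proof.
rewrite !hdE mulr_sumr -big_split; apply: eq_bigr => i _.
by rewrite [(a *: x + y) i 0]mxE [(a *: x) i 0]mxE mulrDr mulrCA.
Qed.
Lemma hd0r z : hd z 0 = 0.
Proof. by rewrite hdE big1// => i _; rewrite mxE mulr0. Qed.
Lemma hdZr (a : C) x z : hd z (a *: x) = a * hd z x.
Proof. by have := hd_linr a x 0 z; rewrite addr0 hd0r addr0. Qed.
Lemma hdZl (a : C) x z : hd (a *: x) z = a^* * hd x z.
Proof. by rewrite -hdJ hdZr conjCM hdJ. Qed.
Lemma hd_ge0 x : 0 <= hd x x.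
Proof. by rewrite hdE; apply: sumr_ge0 => i _; rewrite mulrC mul_conjC_ge0. Qed.
Lemma hd_eq0 x : hd x x = 0 -> x = 0.
Proof.
rewrite hdE => h; apply/colP => i; have := psumr_eq0P (P := xpredT) _ h => /(_ _ i isT) E.
have /eqP : (x i 0)^* * x i 0 = 0 by apply: E => j _; rewrite mulrC mul_conjC_ge0.
by rewrite mulrC mul_conjC_eq0 mxE => /eqP.
Qed.
Lemma hd_adj (A : 'M[C]_d) x y : hd (A *m x) y = hd x (A^t* *m y).
Proof. by rewrite /hd conjtrM mulmxA. Qed.

Lemma wv_act a la Z x : rv a Z -> wv la x -> wv (la + a) (rhoC Z *m x).
Proof.
move=> hZ hx H Ht.
have E : rho H *m rhoC Z = rhoC Z *m rho H + (iC * toC (dot a H)) *: rhoC Z.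
  rewrite -cextZ -hZ// (cext_br lin brk) (cext_real lin).
  by rewrite addrC subrK.
rewrite mulmxA E mulmxDl -mulmxA hx// -scalemxAr -scalemxAl -scalerDl.
by rewrite dotDl rmorphD mulrDr.
Qed.

Lemma wv_orth la mu x y : la \in t -> mu \in t -> la != mu -> wv la x -> wv mu y -> hd x y = 0.
Proof.
move=> lt mt lm hx hy; set H := la - mu; have Ht : H \in t by exact: memvB.
have := hd_adj (rho H) x y; rewrite skw hx// mulNmx hy// -scaleNr hdZl hdZr => /eqP.
rewrite conjCM iCJ toCJ -subr_eq0 -mulrBl mulf_eq0 => /orP[|/eqP//].
rewrite !mulNr opprK addrC -mulrBr mulf_eq0 (negPf iC_neq0) /= -rmorphB toC_eq0 -dotNl -dotDl.
by rewrite -oppr_eq0 -dotNl opprB dot_eq0 subr_eq0 (negPf lm).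
Qed.

(* The lowering chain x, Z^c x, ... is finite, which makes 2 <la, a> / <a, a> integral. *)
Lemma sl2 la a Z x : a \in t -> a != 0 -> rv a Z -> cdot Z (cj Z) = 1 -> wv la x -> x != 0 ->
  rhoC Z *m x = 0 -> exists m : nat, 2 * dot la a = m%:R * dot a a.
Proof.
move=> at_ a0 hZ Z1 hx x0 Ex.
pose E := rhoC Z; pose F := rhoC (cj Z).
pose v m := iter m (fun y => F *m y) x.
have wvm m : wv (la - m%:R *: a) (v m).
  elim: m => [|m IH]; first by rewrite scale0r subr0.
  rewrite (_ : la - _ = (la - m%:R *: a) + (- a)); first exact: wv_act (rv_cj hZ) IH.
  by rewrite -addrA -opprD -natr1 scalerDl scale1r.
have EF y mu : wv mu y -> E *m (F *m y) = F *m (E *m y) - toC (dot mu a) *: y.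
  move=> hy; apply/eqP; rewrite addrC -subr_eq !mulmxA -mulmxBl -(cext_br lin brk).
  rewrite (coroot at_ hZ hZ) Z1 mul1r cextZ (cext_real lin) -scalemxAl hy// scalerA.
  by rewrite mulrA iC2 mulN1r scaleNr.
(* Accumulated from the commutators of [E] and [F] along the chain: the step from [v j] contributes
   [dot (la - j a) a]. As the squared norm of [v m.+1] is [c m.+1] times that of [v m], an endless
   chain would need [c] nonnegative forever, while it tends to minus infinity; the end of the chain
   is a zero of [c]. *)
pose c (m : nat) : R := m%:R * dot la a - m%:R * (m%:R - 1) / 2 * dot a a.
have Ev m : E *m v m.+1 = - toC (c m.+1) *: v m.
  elim: m => [|m IH].
    rewrite [v 1%N]/= (EF x _ (wvm 0%N)) [E *m x]Ex mulmx0 sub0r -scaleNr /c scale0r subr0.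
    by congr (- toC _ *: _); rewrite subrr mulr0 mul0r mul0r subr0 mul1r.
  rewrite [v m.+2]/= (EF _ _ (wvm m.+1)) IH -scalemxAr -/(v m.+1) -[F *m v m]/(v m.+1).
  rewrite -scalerBl; congr (_ *: _); apply: C_eq; rewrite ?ReD ?ReN ?ImD ?ImN /=; last by ring.
  by rewrite dotDl dotNl dotZl /c -[m.+2%:R]natr1; field.
have nv m : hd (v m.+1) (v m.+1) = toC (c m.+1) * hd (v m) (v m).
  rewrite [v m.+1 in X in hd X _]/= hd_adj (cext_adj skw) cjK mulNmx Ev.
  by rewrite -scaleNr opprK hdZr.
have [m [vm vm1]] : exists m, v m != 0 /\ v m.+1 = 0.
  apply/not_existsP => Hn.
  have vn m : v m != 0.
    elim: m => // m IH; apply/eqP => E0; exact: (Hn m).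
  have cpos m : 0 <= c m.+1.
    have hp : 0 < hd (v m) (v m).
      by rewrite lt_neqAle hd_ge0 andbT eq_sym; apply: contra (vn m) => /eqP/hd_eq0 ->.
    have := hd_ge0 (v m.+1); rewrite nv pmulr_lge0//.
    by rewrite -[0 in X in X -> _](rmorph0 toC) lecR.
  have aa := dot_gt0 a0.
  pose N := Num.bound (2 * `|dot la a| / dot a a).
  have hN : 2 * `|dot la a| < N%:R * dot a a.
    by rewrite -ltr_pdivrMr//; apply: archi_boundP; rewrite divr_ge0// ?mulr_ge0// ltW.
  have := cpos N; rewrite /c -natr1 addrK.
  have N0 : (0 : R) <= N%:R by [].
  have := ler_norm (dot la a); move: hN aa N0.
  move: (N%:R) (dot la a) (dot a a) `|dot la a| => y u w z; nra.
exists m; have := nv m; rewrite vm1 hd0r => /eqP; rewrite eq_sym mulf_eq0 => /orP[|/eqP/hd_eq0 E0]; last first.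
  by rewrite E0 eqxx in vm.
rewrite toC_eq0 /c -natr1 addrK => /eqP h.
have m1 : (m%:R + 1 : R) != 0 by rewrite natr1 pnatr_eq0.
by apply: (mulfI m1); move: h; move: (m%:R) (dot la a) (dot a a) => y u w; lra.
Qed.

End LieRep.

End ComplexLie.

(** The Gram matrix of any basis of [t] is invertible, which gives the representing vector without
    orthonormalising. *)
Lemma riesz_on (R : realType) (n : nat) (t : {vspace 'rV[R]_n}) (l : 'rV[R]_n -> R) :
  (forall (c : R) v w, v \in t -> w \in t -> l (c *: v + w) = c * l v + l w) ->
  exists2 a, a \in t & forall H, H \in t -> l H = dot a H.
Proof.
move=> lin; pose r := \dim t; pose b := vbasis t.
have bt i : b`_i \in t.
  have [ir|ir] := ltnP i r; last by rewrite nth_default ?mem0v// size_tuple.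
  by apply: vbasis_mem; apply: mem_nth; rewrite size_tuple.
pose B : 'M[R]_(r, n) := \matrix_(i < r) b`_i.
have BE (c : 'rV[R]_r) : c *m B = \sum_i c 0 i *: b`_i.
  by rewrite mulmx_sum_row; apply: eq_bigr => i _; rewrite rowK.
have fB (c : 'rV[R]_r) : c *m B = 0 -> c = 0.
  rewrite BE; have /freeP fr := basis_free (vbasisP t); move/fr => h.
  by apply/rowP => i; rewrite h mxE.
pose M := B *m B^T.
have uM : M \in unitmx.
  rewrite -row_free_unit; apply: inj_row_free => c cM; apply: fB; apply/eqP.
  by rewrite -dot_eq0 -dot_mx trmx_mul mulmxA -(mulmxA c) -/M cM mul0mx mxE.
pose la : 'rV[R]_r := \row_i l b`_i.
have lb (i : 'I_r) : dot (la *m invmx M *m B) b`_i = la 0 i.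
  have -> : b`_i = row i B by rewrite rowK.
  rewrite -dot_mx tr_row; transitivity ((la *m invmx M *m B *m B^T) 0 i).
    by rewrite colE mulmxA -colE mxE.
  by rewrite -(mulmxA _ B) mulmxKV.
exists (la *m invmx M *m B).
  by rewrite BE; apply: memv_suml => i _; apply: memvZ.
move=> H Ht; rewrite (coord_vbasis Ht) -/b; move: (coord b) => k.
have l0 : l 0 = 0.
  have := lin 0 0 0 (mem0v t) (mem0v t); rewrite scaler0 addr0 mul0r add0r.
  have := lin (-1) 0 0 (mem0v t) (mem0v t); rewrite scaler0 addr0 => h _; lra.
suff E (s : seq 'I_r) : l (\sum_(i <- s) k i H *: b`_i) = dot (la *m invmx M *m B) (\sum_(i <- s) k i H *: b`_i).
  exact: E.
elim: s => [|i s IH]; first by rewrite !big_nil l0 dot0r.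
rewrite !big_cons lin ?IH ?dotDr ?dotZr ?lb ?mxE//.
by apply: memv_suml => j _; apply: memvZ.
Qed.

(** A matrix of largest rank whose row space satisfies [Q] already contains every vector satisfying
    [Q]. Subspaces given by predicates thereby gain a basis and a projection. *)
Lemma subspace_mx (F : fieldType) (d : nat) (Q : 'rV[F]_d -> Prop) :
  Q 0 -> (forall a x y, Q x -> Q y -> Q (a *: x + y)) ->
  exists U : 'M[F]_d, forall x, Q x <-> (x <= U)%MS.
Proof.
move=> Q0 Ql.
pose P k := `[< exists U : 'M[F]_d, (forall x, (x <= U)%MS -> Q x) /\ \rank U = k >].
have P0 : P 0%N.
  apply/asboolP; exists 0; rewrite mxrank0; split => // x; rewrite submx0 => /eqP -> //.
have Pb k : P k -> (k <= d)%N by move=> /asboolP[U [_ <-]]; exact: rank_leq_row.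
case: (ex_maxnP (ex_intro _ 0%N P0) Pb) => k /asboolP[U [UQ rU]] kmax.
exists U => x; split; last exact: UQ.
move=> Qx; apply/negPn/negP => nx.
have : P (\rank (U + x)%MS).
  apply/asboolP; exists (U + x)%MS; split => // y /sub_addsmxP[[u1 u2] /= ->].
  rewrite [u2]mx11_scalar mul_scalar_mx addrC; apply: Ql => //.
  by apply: UQ; exact: submxMl.
move=> /kmax; rewrite -rU leqNgt => /negP; apply.
apply: rank_ltmx; rewrite ltmxE addsmxSl /=; apply: contra nx => h.
exact: submx_trans (addsmxSr _ _) h.
Qed.

Section Roots.
Context {R : realType} {n : nat} {G : lieGroupType R n}.
Local Notation C := R[i].
Local Notation iC := (Complex 0 1 : C).
Context (X : 'I_n -> (G -> R) -> (G -> R)) (bX : lie_basis X)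
 (oX : forall i j : 'I_n, lie_inner X 'e_i 'e_j = (i == j)%:R).
Local Notation br := (lie_bracket X).
Local Notation ad := (ad_mx X).
Local Notation brC := (brC X).
Implicit Types (u v w H a b la mu : 'rV[R]_n) (Z W U : 'rV[C]_n).
Context (t : {vspace 'rV[R]_n}) (tcomm : forall v w, v \in t -> w \in t -> br v w = 0)
 (tcent : forall v, (forall w, w \in t -> br w v = 0) -> v \in t).
Local Notation rv := (rv X t).
Local Notation adr := (fun v => (tv (ad v))^T).
Local Notation wv := (wv t).

(** The operators of [t] commute, so they are unitarily triangularizable together; skew-adjointness
    turns triangular into diagonal with imaginary entries, and Riesz representation turns each
    diagonal entry into a weight. *)
Lemma weight_basis d (rho : 'rV[R]_n -> 'M[C]_d) : lie_rep X rho ->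
  exists (P : 'M[C]_d) (la : 'I_d -> 'rV[R]_n),
  P \is unitarymx /\ forall k, la k \in t /\ wv rho (la k) (row k P)^T.
Proof.
move=> [lin brk skw].
have comm v w : v \in t -> w \in t -> rho v *m rho w = rho w *m rho v.
  move=> vt wt; apply/eqP; rewrite -subr_eq0 -brk tcomm//; apply/eqP.
  exact: (lrep0 lin).
pose As := [seq (rho b)^T | b <- vbasis t].
have cAs : {in As &, forall A B, comm_mx A B}.
  move=> A B /mapP[v vt ->] /mapP[w wt ->]; rewrite /comm_mx -!trmx_mul.
  by rewrite comm//; exact: vbasis_mem.
have [P uP /allP trig] := cotrigonalization cAs.
have PP := unitarymxP uP.
pose T H := P *m (rho H)^T *m P^t*.
have skT H : (T H)^t* = - T H.
  have hA : (rho H)^T^t* = - (rho H)^T.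
    by have /matrixP E := skw H; apply/matrixP => i j; have := E j i; rewrite !mxE.
  by rewrite /T !conjtrM trmxCK hA mulNmx mulmxN mulmxA.
have diagB b : b \in (vbasis t : seq _) -> forall i j, i != j -> T b i j = 0.
  move=> bt.
  have tr : is_trig_mx (T b).
    have /trig : (rho b)^T \in As by apply: map_f.
    by rewrite /= /similar_to /= conjymx.
  have lt (i j : 'I_d) : (i < j)%N -> T b i j = 0 by move/is_trig_mxP: tr; apply.
  move=> i j; rewrite -val_eqE neq_ltn => /orP[|ji]; first exact: lt.
  have /matrixP/(_ i j) := skT b; rewrite [X in X = _]mxE [X in X^*]mxE [X in _ = X]mxE (lt _ _ ji) conjC0 => /eqP.
  by rewrite eq_sym oppr_eq0 => /eqP.
have Tlin (c : R) v w : T (c *: v + w) = toC c *: T v + T w.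
  by rewrite /T lin linearD linearZ /= mulmxDr mulmxDl -scalemxAr -scalemxAl.
have T0 : T 0 = 0 by rewrite /T (lrep0 lin) trmx0 mulmx0 mul0mx.
have Tsum (I : Type) (r : seq I) (c : I -> R) (F : I -> 'rV[R]_n) :
    T (\sum_(i <- r) c i *: F i) = \sum_(i <- r) toC (c i) *: T (F i).
  by elim: r => [|i r IH]; rewrite ?big_nil ?big_cons ?T0 ?Tlin ?IH.
have diag H : H \in t -> forall i j, i != j -> T H i j = 0.
  move=> Ht i j ij; rewrite (coord_vbasis Ht) Tsum summxE big1// => k _.
  by rewrite mxE diagB ?mulr0//; apply: mem_nth; rewrite size_tuple.
have reT H k : Re (T H k k) = 0.
  have /matrixP/(_ k k) := skT H; rewrite [X in X = _]mxE [X in X^*]mxE [X in _ = X]mxE.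
  by move=> /(congr1 Re); rewrite ReJ ReN => h; lra.
have ex k : exists2 a, a \in t & forall H, H \in t -> Im (T H k k) = dot a H.
  apply: riesz_on => c v w _ _; rewrite Tlin mxE [X in X + _]mxE; move: (T v k k) (T w k k) => y z.
  by rewrite ImD ImM /=; ring.
have [la Hla] := choice (fun k => (let: ex_intro2 a h1 h2 := ex k in ex_intro _ a (conj h1 h2))).
exists P, la; split=> // k; have [lt Hl] := Hla k; split => // H Ht.
have E : P *m (rho H)^T = T H *m P.
  rewrite /T -mulmxA (_ : P^t* *m P = 1%:M) ?mulmx1//.
  by apply: mulmx1C.
apply: trmx_inj; rewrite trmx_mul trmxK -row_mul E [RHS]linearZ /= trmxK.
apply/rowP => j; rewrite !mxE (bigD1 k)//= big1 ?addr0 => [|l lk]; last first.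
  by rewrite diag ?mul0r// eq_sym.
congr (_ * _); apply: C_eq; rewrite ?ReM ?ImM /=.
  by rewrite reT; ring.
by rewrite Hl//; ring.
Qed.

Lemma wv_ad a Z : wv adr a Z^T <-> rv a Z.
Proof.
split=> h H Ht; have E := h H Ht.
  apply: trmx_inj; rewrite linearZ /= -E /brC adC_real//.
  by rewrite trmx_mul.
by rewrite -trmx_mul -(adC_real bX) -/(brC _ _) E linearZ.
Qed.

(** Roots as vectors of [t]. The normalisation of the root vector for the Hermitian norm removes the
    scalar from the sl2 relations. *)
Definition rt a := [/\ a \in t, a != 0 & exists2 Z, cdot Z (cj Z) = 1 & rv a Z].

Lemma rt_of a Z : a \in t -> a != 0 -> Z != 0 -> rv a Z -> rt a.
Proof.
move=> at_ a0 Z0 hZ; split=> //.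
have zz : cdot Z (cj Z) != 0 by apply: contra Z0 => /eqP/cdot_eq0 ->.
pose c := (sqrtC (cdot Z (cj Z)))^-1.
exists (c *: Z).
  have cr : c^* = c.
    by apply/CrealP; rewrite realV ger0_real// sqrtC_ge0 cdot_ge0.
  have -> : cj (c *: Z) = c *: cj Z by apply/rowP => i; rewrite !mxE conjCM cr.
  have s0 : sqrtC (cdot Z (cj Z)) != 0 by rewrite sqrtC_eq0.
  have E2 := sqrtCK (cdot Z (cj Z)).
  rewrite cdotZl cdotC cdotZl (cdotC (cj Z)) /c; move: s0 E2; move: (sqrtC _) => s s0 <-.
  by rewrite expr2; field.
move=> H Ht; rewrite brCZr hZ// !scalerA; congr (_ *: _); exact: mulrC.
Qed.

Lemma rtN a : rt a -> rt (- a).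
Proof.
move=> [at_ a0 [Z Z1 hZ]]; split; [by rewrite memvN|by rewrite oppr_eq0|].
by exists (cj Z); [rewrite cjK cdotC|exact: rv_cj].
Qed.

(* A second root vector W orthogonal to Z would be a highest vector of weight of
   negative coroot value for the sl2 of Z. *)
Lemma rv_uniq a Z W : rt a -> rv a Z -> rv a W -> cdot Z (cj Z) = 1 -> cdot W (cj Z) = 0 -> W = 0.
Proof.
move=> [at_ a0 _] hZ hW Z1 WZ; apply/eqP/negPn/negP => W0.
have Wt0 : W^T != 0 by apply: contra W0 => /eqP h; rewrite -[W]trmxK h trmx0.
have hN : - a \in t by rewrite memvN.
have hN0 : - a != 0 by rewrite oppr_eq0.
have hZc : cdot (cj Z) (cj (cj Z)) = 1 by rewrite cjK cdotC.
have hk : cext adr (cj Z) *m W^T = 0.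
  by rewrite -(brC_tr X) (brCC bX) (coroot bX oX tcent at_ hZ hW) WZ mul0r scale0r oppr0 trmx0.
have [m] := sl2 bX oX tcent (adrep bX oX) hN hN0 (rv_cj hZ) hZc ((wv_ad a W).2 hW) Wt0 hk.
rewrite dotNr dotNl dotNr opprK => h; have := dot_gt0 a0; have : (0 : R) <= m%:R by [].
by move: h; move: (m%:R) (dot a a) => y z; nra.
Qed.

(** If the root vectors commuted, the one for [b] would be a highest vector for the sl2 of [a],
    which forces [dot a b] to be nonnegative. *)
Lemma rt_add a b : rt a -> rt b -> dot a b < 0 -> a + b != 0 -> rt (a + b).
Proof.
move=> [at_ a0 [Z Z1 hZ]] [bt b0 [W W1 hW]] ab ab0.
apply: (@rt_of _ (brC Z W)) => //; [exact: memvD| |exact: rv_br].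
apply/eqP => E.
have W0 : W^T != 0.
  apply/eqP => h; move: W1; rewrite -[W]trmxK h trmx0 cdot0l => /eqP.
  by rewrite eq_sym oner_eq0.
have hk : cext adr Z *m W^T = 0 by rewrite -(brC_tr X) E trmx0.
have [m] := sl2 bX oX tcent (adrep bX oX) at_ a0 hZ Z1 ((wv_ad b W).2 hW) W0 hk.
rewrite dotC => h; have := dot_gt0 a0; have : (0 : R) <= m%:R by [].
by move: h ab; move: (m%:R) (dot a a) (dot a b) => y z u; nra.
Qed.

Context (pos : 'rV[R]_n -> Prop) (pos_rt : forall a, pos a -> rt a)
 (pos_or : forall a, rt a -> pos a \/ pos (- a)) (pos_anti : forall a, pos a -> ~ pos (- a))
 (pos_add : forall a b, pos a -> pos b -> rt (a + b) -> pos (a + b)).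

(** A set of positive roots is given by closure under addition, and this lemma supplies the missing
    half-space. In a vanishing sum some term has negative product with the first one; their sum is
    again a positive root, and merging the two shortens the list. *)
Lemma pos_sum_neq0 (L : seq 'rV[R]_n) : (forall a, a \in L -> pos a) -> \sum_(a <- L) a = 0 -> L = [::].
Proof.
move: {2}(size L).+1 (ltnSn (size L)) => m; elim: m L => // m IH [//|a L] /= sL pL S0.
exfalso; have pa : pos a by apply: pL; rewrite mem_head.
have [at_ a0 _] := pos_rt pa.
have : exists2 b, b \in L & dot a b < 0.
  apply/not_exists2P => Hn.
  have : 0 <= \sum_(b <- L) dot a b.
    rewrite big_seq; apply: sumr_ge0 => b bL; rewrite leNgt; apply/negP => h.
    by case: (Hn b).
  have := S0; rewrite big_cons => /(congr1 (dot a)); rewrite dotDr dot0r dotC dot_suml.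
  under [in X in _ -> X]eq_bigr do rewrite dotC.
  have := dot_gt0 a0; lra.
move=> [b bL ab]; have pb : pos b by apply: pL; rewrite inE bL orbT.
have ab0 : a + b != 0.
  by apply/eqP => /eqP; rewrite addr_eq0 => /eqP E; apply: (pos_anti pb); rewrite -E.
have pab : pos (a + b) by apply: pos_add => //; exact: rt_add (pos_rt pa) (pos_rt pb) ab ab0.
have := IH ((a + b) :: rem b L).
rewrite /= size_rem// prednK ?(leq_ltn_trans _ sL)//; last by case: (L) bL.
move=> /(_ _ _ _) H; have : (a + b) :: rem b L = [::]; last by [].
apply: H.
- by case: (L) bL sL.
- move=> c; rewrite inE => /orP[/eqP -> //|/mem_rem cL]; apply: pL.
  by rewrite inE cL orbT.
- by move: S0; rewrite !big_cons (perm_big _ (perm_to_rem bL)) big_cons addrA.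
Qed.

Definition psum mu := exists2 L : seq 'rV[R]_n, (forall a, a \in L -> pos a) & mu = \sum_(a <- L) a.

Lemma psum0 : psum 0.
Proof. by exists [::]; rewrite ?big_nil. Qed.

Lemma psumD mu nu : psum mu -> psum nu -> psum (mu + nu).
Proof.
move=> [L1 p1 ->] [L2 p2 ->]; exists (L1 ++ L2); last by rewrite big_cat.
by move=> a; rewrite mem_cat => /orP[/p1|/p2].
Qed.

Lemma psum_pos a : pos a -> psum a.
Proof. by move=> pa; exists [:: a]; rewrite ?big_seq1// => b; rewrite inE => /eqP ->. Qed.

Lemma psum_t mu : psum mu -> mu \in t.
Proof.
move=> [L pL ->]; rewrite big_seq; apply: memv_suml => a aL.
by have [] := pos_rt (pL a aL).
Qed.

Lemma psum_anti mu nu : psum mu -> psum nu -> mu + nu = 0 -> mu = 0.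
Proof.
move=> [L1 p1 ->] [L2 p2 ->]; rewrite -big_cat => /pos_sum_neq0 E.
have : L1 ++ L2 = [::] by apply: E => a; rewrite mem_cat => /orP[/p1|/p2].
by case: L1 {p1 E} => // _; rewrite big_nil.
Qed.

Lemma psum_neq0 a mu : pos a -> psum mu -> a + mu != 0.
Proof.
move=> pa pm; apply/eqP => /(psum_anti (psum_pos pa) pm) a0.
by have [_ /eqP] := pos_rt pa.
Qed.

Section Rep.
Context (d : nat) (rho : 'rV[R]_n -> 'M[C]_d) (rrho : lie_rep X rho).
Local Notation rhoC := (cext rho).
Implicit Types x y : 'cV[C]_d.

Let lin : forall (a : R) v w, rho (a *: v + w) = toC a *: rho v + rho w.
Proof. by case: rrho. Qed.
Let brk : forall v w, rho (br v w) = rho v *m rho w - rho w *m rho v.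
Proof. by case: rrho. Qed.
Let skw : forall v, (rho v)^t* = - rho v.
Proof. by case: rrho. Qed.

Definition highest_vec la x :=
  [/\ x != 0, la \in t, wv rho la x & forall a Z, pos a -> rv a Z -> rhoC Z *m x = 0].

(* Otherwise raising repeatedly gives infinitely many distinct weights (sums of positive
   roots do not vanish), while weight vectors of distinct weights are orthogonal. *)
Lemma exists_highest : (0 < d)%N -> exists la x, highest_vec la x.
Proof.
move=> d0; apply/not_existsP => Hn.
pose W := ('rV[R]_n * 'cV[C]_d)%type.
pose ok (q : W) := [/\ q.2 != 0, q.1 \in t & wv rho q.1 q.2].
have next (q : W) : exists q' : W, ok q -> ok q' /\ exists2 a, pos a & q'.1 = q.1 + a.
  have [okq|nok] := pselect (ok q); last by exists q => /nok.
  have [x0 qt hq] := okq.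
  have : exists a Z, [/\ pos a, rv a Z & rhoC Z *m q.2 != 0].
    apply/not_existsP => Hn2; apply: (Hn q.1); exists q.2; split => // a Z pa hZ.
    by apply/eqP/negPn/negP => h; apply: (Hn2 a); exists Z.
  move=> [a [Z [pa hZ E]]]; exists (q.1 + a, rhoC Z *m q.2) => _; split; last by exists a.
  split => //=; first by apply: memvD => //; have [] := pos_rt pa.
  exact: (wv_act bX rrho hZ hq).
have [f Hf] := choice next.
have [P [la0 [uP HP]]] := weight_basis rrho.
pose k0 : 'I_d := Ordinal d0.
pose q0 : W := (la0 k0, (row k0 P)^T).
have ok0 : ok q0.
  have [lt hl] := HP k0; split => //=.
  apply/eqP => E; have : row k0 P *m P^t* = 0 by rewrite -[row k0 P]trmxK E trmx0 mul0mx.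
  rewrite -row_mul (unitarymxP uP) => /rowP/(_ k0); rewrite !mxE eqxx => /eqP.
  by rewrite oner_eq0.
pose q m := iter m f q0.
have okq m : ok (q m) by elim: m => //= m IH; case: (Hf _ IH).
have step i m : exists2 mu, psum mu & (q (i + m).+1).1 = (q i).1 + mu /\ mu != 0.
  elim: m => [|m [mu pm [E m0]]].
    have [_ [a pa E]] := Hf _ (okq i); exists a; first exact: psum_pos.
    by rewrite addn0 /= E; split=> //; have [] := pos_rt pa.
  have [_ [a pa E']] := Hf _ (okq (i + m).+1).
  exists (a + mu); first exact: psumD (psum_pos pa) pm.
  rewrite addnS; change (q (i + m).+2) with (f (q (i + m).+1)); rewrite E' E; split; last exact: psum_neq0.
  by rewrite -addrA (addrC mu).
have dist i j : (i < j)%N -> (q i).1 != (q j).1.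
  move=> ij; have [mu _ [E m0]] := step i (j - i.+1)%N.
  rewrite (_ : j = (i + (j - i.+1)).+1); last by rewrite -addSn subnKC.
  by rewrite E -subr_eq0 opprD addrA subrr sub0r oppr_eq0.
have orth i j : (i < j)%N -> hd (q i).2 (q j).2 = 0.
  move=> ij; have [_ t1 h1] := okq i; have [_ t2 h2] := okq j.
  have := dist _ _ ij; move: t1 t2 h1 h2; case: (q i) (q j) => [a x] [b y] /= t1 t2 h1 h2 ne.
  exact: (wv_orth rrho t1 t2 ne h1 h2).
pose M : 'M[C]_(d.+1, d) := \matrix_(i < d.+1) ((q i).2)^T.
have : row_free M.
  apply: inj_row_free => c Hc; apply/rowP => i; rewrite mxE.
  have := congr1 (fun v : 'rV[C]_d => v *m ((q i).2^T)^t*) Hc.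
  rewrite /= mul0mx (mulmx_sum_row c) mulmx_suml => /matrixP/(_ 0 0); rewrite summxE [RHS]mxE.
  rewrite (bigD1 i)//= big1 ?addr0.
    rewrite rowK -scalemxAl mxE => /eqP; rewrite mulf_eq0 => /orP[/eqP -> //|/eqP E].
    have [x0 _ _] := okq i; case/eqP: x0; apply: hd_eq0.
    by rewrite hdE -[RHS]E mxE; apply: eq_bigr => k _; rewrite !mxE mulrC.
  move=> j ji; rewrite rowK -scalemxAl mxE (_ : (_ *m _) 0 0 = hd (q i).2 (q j).2); last first.
    by rewrite hdE mxE; apply: eq_bigr => k _; rewrite !mxE mulrC.
  have [ij|ij] := ltnP i j; first by rewrite orth// mulr0.
  have ij' : (j < i)%N by rewrite ltn_neqAle ij andbT; exact: ji.
  by rewrite -hdJ orth ?conjC0 ?mulr0.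
rewrite /row_free => /eqP rk; have := rank_leq_col M; rewrite rk ltnn//.
Qed.

Context (P : 'M[C]_n) (av : 'I_n -> 'rV[R]_n) (uP : P \is unitarymx)
 (HP : forall k, av k \in t /\ rv (av k) (row k P)).

(** The rows of [P] are a unitary basis of weight vectors of the adjoint representation. This
    trichotomy of their weights is the triangular decomposition into lowering, torus and raising
    parts. *)
Lemma root_cases k : [\/ av k = 0, pos (av k) | pos (- av k)].
Proof.
have [->|a0] := eqVneq (av k) 0; first by constructor 1.
have [at_ ha] := HP k.
have r0 : row k P != 0.
  apply/eqP => E; have : row k P *m P^t* = 0 by rewrite E mul0mx.
  rewrite -row_mul (unitarymxP uP) => /rowP/(_ k); rewrite !mxE eqxx => /eqP.
  by rewrite oner_eq0.
have [h|h] := pos_or (rt_of at_ a0 r0 ha); first by constructor 2.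
by constructor 3.
Qed.

Lemma P_decomp Z : Z = \sum_k (Z *m P^t*) 0 k *: row k P.
Proof. by rewrite -mulmx_sum_row mulmxKtV. Qed.

Context (la : 'rV[R]_n) (x0 : 'cV[C]_d) (hx0 : highest_vec la x0).

(** Vectors reached from the highest one by lowering operators alone; the first index records by how
    much the weight has dropped. *)
Inductive word : 'rV[R]_n -> 'cV[C]_d -> Prop :=
| word0 : word 0 x0
| wordS b Z s y : pos b -> rv (- b) Z -> word s y -> word (b + s) (rhoC Z *m y).

Inductive wspan : 'cV[C]_d -> Prop :=
| wspan0 : wspan 0
| wspanS c s y z : word s y -> wspan z -> wspan (c *: y + z).

Lemma word_wv s y : word s y -> psum s /\ wv rho (la - s) y.
Proof.
elim=> {s y} [|b Z s y pb hZ _ [ps hy]].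
  by split; [exact: psum0|rewrite subr0; case: hx0].
split; first exact: psumD (psum_pos pb) ps.
by rewrite opprD addrCA addrC; exact: (wv_act bX rrho hZ hy).
Qed.

Lemma word_top s y : word s y -> s = 0 -> y = x0.
Proof.
case=> // b Z s' y' pb hZ w E; have [ps _] := word_wv w.
by have := psum_neq0 pb ps; rewrite E eqxx.
Qed.

Lemma wspan_lin c y z : wspan y -> wspan z -> wspan (c *: y + z).
Proof.
elim=> {y} [|c' s y y' wy _ IH] wz; first by rewrite scaler0 add0r.
by rewrite scalerDr scalerA -addrA; apply: (wspanS _ wy); exact: IH.
Qed.

Lemma wspan_word s y : word s y -> wspan y.
Proof. by move=> wy; have := wspanS 1 wy wspan0; rewrite scale1r addr0. Qed.

Lemma wspanD y z : wspan y -> wspan z -> wspan (y + z).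
Proof. by move=> wy wz; have := wspan_lin 1 wy wz; rewrite scale1r. Qed.

Lemma wspanZ c y : wspan y -> wspan (c *: y).
Proof. by move=> wy; have := wspan_lin c wy wspan0; rewrite addr0. Qed.

Lemma wspan_neg b Z y : pos b -> rv (- b) Z -> wspan y -> wspan (rhoC Z *m y).
Proof.
move=> pb hZ; elim=> {y} [|c s y z wy _ IH]; first by rewrite mulmx0; exact: wspan0.
by rewrite mulmxDr -scalemxAr; apply: (wspanS _ _ IH); exact: (wordS pb hZ wy).
Qed.

(** Stability under the whole Lie algebra, by induction on the word with [Z] arbitrary: moving [Z]
    past the outermost lowering operator leaves a bracket acting on a shorter word. On the highest
    vector itself, torus elements act by scalars and raising operators by zero. *)
Lemma wspan_word_act s y : word s y -> forall Z, wspan (rhoC Z *m y).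
Proof.
elim=> {s y} [|b F s y pb hF wy IH] Z; rewrite (P_decomp Z) cext_sum mulmx_suml.
  elim/big_rec: _ => [|k u _ wu]; first exact: wspan0.
  rewrite -scalemxAl; apply: wspan_lin => //; have [at_ hk] := HP k.
  have [_ lt hl tp] := hx0.
  have [a0|pa|pa] := root_cases k.
  - have h0 : rv 0 (row k P) by rewrite -a0.
    have [r1 i1] := rv0_t bX tcent h0.
    rewrite (reimV (row k P)) addrC cext_lin mulmxDl -scalemxAl !(cext_real lin) hl// hl//.
    rewrite scalerA; apply: wspan_lin; first exact: wspan_word word0.
    by apply: wspanZ; exact: wspan_word word0.
  - by rewrite (tp _ _ pa hk); exact: wspan0.
  - by apply: (wspan_neg pa); [rewrite opprK|exact: wspan_word word0].
elim/big_rec: _ => [|k u _ wu]; first exact: wspan0.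
rewrite -scalemxAl; apply: wspan_lin => //; set Zk := row k P.
have E : rhoC Zk *m (rhoC F *m y) = rhoC F *m (rhoC Zk *m y) + rhoC (brC Zk F) *m y.
  by rewrite (cext_br bX lin brk) mulmxBl !mulmxA addrC subrK.
by rewrite E; apply: wspanD; [exact: wspan_neg hF (IH _)|exact: IH].
Qed.

Lemma wspan_act Z y : wspan y -> wspan (rhoC Z *m y).
Proof.
elim=> {y} [|c s y z wy _ IH]; first by rewrite mulmx0; exact: wspan0.
by rewrite mulmxDr -scalemxAr; apply: wspan_lin IH; exact: wspan_word_act wy Z.
Qed.

Lemma wspan_real v y : wspan y -> wspan (rho v *m y).
Proof. by move=> wy; rewrite -(cext_real lin); exact: wspan_act. Qed.

Lemma wspan_orth y : (forall s (w : 'cV[C]_d), word s w -> hd y w = 0) -> forall z, wspan z -> hd y z = 0.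
Proof.
move=> hy z; elim=> {z} [|c s w z ww _ IH]; first exact: hd0r.
by rewrite hd_linr IH (hy _ _ ww) mulr0 addr0.
Qed.

Hypothesis full : forall y, wspan y.

(** Weight vectors of distinct weights are orthogonal. A vector whose weight is not of the form [la]
    minus a sum of positive roots would be orthogonal to all words, hence to itself. *)
Lemma weight_le mu y : mu \in t -> y != 0 -> wv rho mu y -> psum (la - mu).
Proof.
move=> mt y0 hy; apply: contrapT => np; case/eqP: y0; apply: hd_eq0.
apply: wspan_orth (full y) => s w ww; have [ps hw] := word_wv ww.
have [_ lt _ _] := hx0.
apply: (wv_orth rrho mt _ _ hy hw).
  by apply: memvB => //; exact: psum_t.
by apply/eqP => E; apply: np; rewrite E opprB addrC subrK.
Qed.

End Rep.

End Roots.

(** * Highest weights of irreducible representations and the value of the Casimir element *)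

Section HighestWeight.
Context {R : realType} {n : nat} {G : lieGroupType R n}.
Local Notation C := R[i].
Local Notation iC := (Complex 0 1 : C).
Context (X : 'I_n -> (G -> R) -> (G -> R)) (bX : lie_basis X)
 (oX : forall i j : 'I_n, lie_inner X 'e_i 'e_j = (i == j)%:R).
Local Notation br := (lie_bracket X).
Local Notation ad := (ad_mx X).
Local Notation brC := (brC X).
Implicit Types (u v w H a b la mu : 'rV[R]_n) (Z W U : 'rV[C]_n).

(** [Pi] is the orthogonal projection: for skew-adjoint operators the orthogonal complement of an
    invariant subspace is invariant, so the projection commutes with them. *)
Lemma invariant_proj d (rho : 'rV[R]_n -> 'M[C]_d) (Q : 'cV[C]_d -> Prop) :
  (forall v, (rho v)^t* = - rho v) -> Q 0 -> (forall (a : C) x y, Q x -> Q y -> Q (a *: x + y)) ->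
  (forall v x, Q x -> Q (rho v *m x)) ->
  exists Pi : 'M[C]_d, [/\ forall v, Pi *m rho v = rho v *m Pi,
  forall x, Q (Pi *m x) & forall x, Q x -> Pi *m x = x].
Proof.
move=> skw Q0 Ql Qr.
have [U HU] : exists U : 'M[C]_d, forall x : 'rV[C]_d, Q x^T <-> (x <= U)%MS.
  apply: subspace_mx; first by rewrite trmx0.
  by move=> a x y Qx Qy; rewrite linearP /=; exact: Ql.
pose V := schmidt (row_base U).
have VU : (V :=: U)%MS := eqmx_trans (eqmx_schmidt_free (row_base_free U)) (eq_row_base U).
have VV : V *m V^t* = 1%:M by apply/unitarymxP/schmidt_unitarymx/rank_leq_col.
have QV (x : 'cV[C]_d) : Q x <-> (x^T <= V)%MS by rewrite VU -HU trmxK.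
have inv v : (V *m (rho v)^T <= V)%MS.
  apply/row_subP => i; rewrite row_mul -[row i V]trmxK -trmx_mul; apply/QV; apply: Qr.
  by apply/QV; rewrite trmxK; exact: row_sub.
pose A v := V *m (rho v)^T *m V^t*.
have VA v : V *m (rho v)^T = A v *m V.
  have /submxP[D E] := inv v; rewrite /A E -!mulmxA (mulmxA V) VV mul1mx//.
have sT v : ((rho v)^T)^t* = - (rho v)^T.
  have /matrixP E := skw v; apply/matrixP => i j; have := E j i; rewrite !mxE => ->.
  by [].
have As v : (A v)^t* = - A v.
  by rewrite /A !conjtrM trmxCK sT mulNmx mulmxN mulmxA.
clearbody A.
have VA' v : (rho v)^T *m V^t* = V^t* *m A v.
  have := congr1 (fun M => M^t*) (VA v); rewrite !conjtrM sT As mulNmx mulmxN.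
  by move/oppr_inj.
exists (V^t* *m V)^T; split.
- move=> v; apply: trmx_inj; rewrite trmx_mul [RHS]trmx_mul !trmxK.
  by rewrite mulmxA VA' -mulmxA -VA mulmxA.
- by move=> x; apply/QV; rewrite trmx_mul trmxK mulmxA submxMl.
- move=> x /QV/submxP[D E]; apply: trmx_inj; rewrite trmx_mul trmxK E.
  by rewrite -mulmxA (mulmxA V) VV mul1mx.
Qed.

Context (cG : compact [set: G]) (haar : probability (borel G) R)
 (haarP : haar_probability haar) (cn : connected [set: G]).
Local Notation dp := (dp X).

Lemma dp_lie_rep d (p : G -> 'M[C]_d) : unitary_rep p -> lie_rep X (dp p).
Proof.
move=> [rp up]; split.
- by move=> a v w; exact: dp_combo.
- exact: (dp_bracket bX cG haarP rp).
- by move=> v; exact: (dp_adj bX cG haarP rp).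
Qed.

(** The projection onto the subspace commutes with the group, so by Schur's lemma it is a scalar,
    and it fixes a nonzero vector. *)
Lemma invariant_total d (p : G -> 'M[C]_d) (Q : 'cV[C]_d -> Prop) :
  unitary_rep p -> irr p ->
  Q 0 -> (forall (a : C) x y, Q x -> Q y -> Q (a *: x + y)) ->
  (forall v x, Q x -> Q (dp p v *m x)) -> (exists2 x, x != 0 & Q x) -> forall x, Q x.
Proof.
move=> up ip Q0 Ql Qr [x0 nx0 Qx0] x; have [_ _ skw] := dp_lie_rep up.
have [Pi [Pc PQ Pid]] := invariant_proj skw Q0 Ql Qr.
have [a E] := schur_scalar ip (commutant bX cG haarP cn up up Pc).
suff a1 : a = 1 by have := PQ x; rewrite E a1 mul1mx.
have := Pid _ Qx0; rewrite E mul_scalar_mx => /eqP.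
rewrite -subr_eq0 -{2}[x0]scale1r -scalerBl scaler_eq0 (negPf nx0) orbF subr_eq0.
by move/eqP.
Qed.

Lemma intertwines_trace d1 d2 (p1 : G -> 'M[C]_d1) (p2 : G -> 'M[C]_d2) (M : 'M[C]_(d2, d1)) :
  irr p1 -> irr p2 ->
  intertwines p1 p2 M -> M != 0 -> forall x, \tr (p1 x) = \tr (p2 x).
Proof.
move=> i1 i2 iM M0 x; have [E rM] := schur i1 i2 iM M0; move: E p2 i2 M rM iM {M0}.
case: d2 / => p2 i2 M rM iM; have uM : M \in unitmx by rewrite -row_full_unit /row_full rM.
have -> : p2 x = M *m p1 x *m invmx M by rewrite iM mulmxK.
by rewrite mxtrace_mulC mulmxA mulVmx// mul1mx.
Qed.

Context (t : {vspace 'rV[R]_n}) (tcomm : forall v w, v \in t -> w \in t -> br v w = 0)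
 (tcent : forall v, (forall w, w \in t -> br w v = 0) -> v \in t).
Local Notation rv := (rv X t).
Local Notation adr := (fun v => (tv (ad v))^T).
Local Notation wv := (wv t).
Local Notation rt := (rt X t).
Context (pos : 'rV[R]_n -> Prop) (pos_rt : forall a, pos a -> rt a)
 (pos_or : forall a, rt a -> pos a \/ pos (- a)) (pos_anti : forall a, pos a -> ~ pos (- a))
 (pos_add : forall a b, pos a -> pos b -> rt (a + b) -> pos (a + b)).
Local Notation psum := (psum pos).
Local Notation hvec := (highest_vec X t pos).
Context (P : 'M[C]_n) (av : 'I_n -> 'rV[R]_n) (uP : P \is unitarymx)
 (HP : forall k, av k \in t /\ rv (av k) (row k P)).

Lemma highest_full d (p : G -> 'M[C]_d) la x0 : unitary_rep p -> irr p ->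
  hvec (dp p) la x0 -> forall y, wspan X t pos (dp p) x0 y.
Proof.
move=> up ip hx0; have rr := dp_lie_rep up; apply: (invariant_total up ip).
- exact: wspan0.
- by move=> a x y; exact: wspan_lin.
- by move=> v x; exact: (wspan_real bX tcent pos_or rr uP HP hx0).
- by exists x0; [case: hx0|exact/wspan_word/word0].
Qed.

Lemma highest_le d (p : G -> 'M[C]_d) la x0 mu y : unitary_rep p -> irr p ->
  hvec (dp p) la x0 -> mu \in t -> y != 0 -> wv (dp p) mu y -> psum (la - mu).
Proof.
move=> up ip hx0; exact: (weight_le bX pos_rt (dp_lie_rep up) hx0 (highest_full up ip hx0)).
Qed.

Lemma highest_dominant d (p : G -> 'M[C]_d) la x0 a : unitary_rep p ->
  hvec (dp p) la x0 -> pos a -> exists m : nat, 2 * dot la a = m%:R * dot a a.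
Proof.
move=> up [x00 lt hx tp] pa; have [at_ a0 [Z Z1 hZ]] := pos_rt pa.
exact: (sl2 bX oX tcent (dp_lie_rep up) at_ a0 hZ Z1 hx x00 (tp _ _ pa hZ)).
Qed.

Lemma rows_orth k l : cdot (row k P) (cj (row l P)) = (k == l)%:R.
Proof.
have /matrixP/(_ k l) := unitarymxP uP; rewrite !mxE => <-.
by apply: eq_bigr => i _; rewrite !mxE.
Qed.

Lemma row_neq0 k : row k P != 0.
Proof.
by apply/eqP => E; have := rows_orth k k; rewrite E cdot0l eqxx => /eqP; rewrite eq_sym oner_eq0.
Qed.

Lemma parseval Z : cdot Z (cj Z) = \sum_k cdot Z (cj (row k P)) * cdot (row k P) (cj Z).
Proof.
have E : P^t* *m P = 1%:M by apply: mulmx1C; exact: unitarymxP.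
rewrite cdot_mx -[X in (X *m _) 0 0]mulmx1 -E mulmxA -mulmxA mxE; apply: eq_bigr => k _.
congr (_ * _); rewrite ?cdot_mx !mxE; apply: eq_bigr => i _; rewrite !mxE//.
Qed.

(** A root vector for [- a] is orthogonal to the rows of every other weight; if no row had weight
    [- a], it would vanish. *)
Lemma pos_av a : pos a -> exists k, av k = - a.
Proof.
move=> pa; have [at_ a0 [Z Z1 hZ]] := rtN (pos_rt pa).
apply/not_existsP => Hn.
suff Z0 : Z = 0 by move/eqP: Z1; rewrite Z0 cdot0l eq_sym oner_eq0.
rewrite (P_decomp uP Z) big1// => k _; have [kt hk] := HP k.
have ne : av k != - a by apply/eqP; exact: Hn.
have := wv_orth (adrep bX oX) kt at_ ne ((wv_ad bX t _ _).2 hk) ((wv_ad bX t _ _).2 hZ).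
move=> h; rewrite (_ : (Z *m P^t*) 0 k = 0) ?scale0r// -h hdE mxE; apply: eq_bigr => i _.
by rewrite !mxE mulrC.
Qed.

Lemma av_inj k l : pos (- av k) -> av k = av l -> k = l.
Proof.
move=> pk E; apply/eqP/negPn/negP => kl; have [_ hk] := HP k; have [_ hl] := HP l.
have rk : rt (av k) by rewrite -[av k]opprK; exact: rtN (pos_rt pk).
case/eqP: (row_neq0 l); apply: (rv_uniq bX oX tcent rk hk).
- by rewrite E.
- by rewrite rows_orth eqxx.
- by rewrite rows_orth eq_sym (negPf kl).
Qed.

(** Enumerates the positive roots through the rows of negative weight, each once because root spaces
    are lines. These are the rows whose Casimir terms must be reordered in [casimir_highest], so the
    sums match term by term. *)
Definition pos_seq := [seq - av k | k <- enum 'I_n & `[< pos (- av k) >]].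

Lemma mem_pos_seq a : a \in pos_seq <-> pos a.
Proof.
split=> [/mapP[k]|pa]; first by rewrite mem_filter => /andP[/asboolP pk _] ->.
have [k E] := pos_av pa; apply/mapP; exists k; last by rewrite E opprK.
by rewrite mem_filter mem_enum andbT; apply/asboolP; rewrite E opprK.
Qed.

Lemma pos_seq_uniq : uniq pos_seq.
Proof.
rewrite map_inj_in_uniq; first exact/filter_uniq/enum_uniq.
move=> k l.
rewrite !mem_filter => /andP[/asboolP pk _] _ /oppr_inj; exact: av_inj.
Qed.

Lemma tdot_root H Z a : H \in t -> a \in t -> a != 0 -> rv a Z -> cdot (tv H) Z = 0.
Proof.
move=> Ht at_ a0 hZ; have := cdot_inv bX oX (tv a) (tv H) Z.
rewrite (brC_real bX) tcomm// hZ// raddf0 cdot0l cdotC cdotZl cdotC => /eqP.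
rewrite eq_sym oppr_eq0 !mulf_eq0 (negPf iC_neq0) toC_eq0 dot_eq0 (negPf a0) /=.
by move/eqP.
Qed.

Lemma casimir_unitary d (rho : 'rV[R]_n -> 'M[C]_d) :
  \sum_i rho 'e_i *m rho 'e_i =
  \sum_k cext rho (cj (row k P)) *m cext rho (row k P).
Proof.
pose r i := rho 'e_i.
transitivity (\sum_k \sum_i \sum_j ((P k i)^* * P k j) *: (r i *m r j)); last first.
  apply: eq_bigr => k _; rewrite /cext mulmx_suml; apply: eq_bigr => i _.
  rewrite mulmx_sumr; apply: eq_bigr => j _.
  by rewrite -scalemxAl -scalemxAr scalerA !mxE.
rewrite exchange_big; apply: eq_bigr => i _; rewrite exchange_big /=.
have E : P^t* *m P = 1%:M by apply: mulmx1C; exact: unitarymxP.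
rewrite (bigD1 i)//= [X in _ + X]big1 ?addr0 => [|j ji].
  rewrite -scaler_suml (_ : \sum_k _ = 1) ?scale1r//.
  have /matrixP/(_ i i) := E; rewrite !mxE eqxx => E1; rewrite -[RHS]/(true%:R : C) -E1.
  by apply: eq_bigr => k _; rewrite !mxE.
rewrite -scaler_suml (_ : \sum_k _ = 0) ?scale0r//.
have /matrixP/(_ i j) := E; rewrite !mxE eq_sym (negPf ji) => E1; rewrite -[RHS]/(false%:R : C) -E1.
by apply: eq_bigr => k _; rewrite !mxE.
Qed.

(** In the basis [P], rows of weight zero contribute [dot la la] by Parseval and raising rows kill
    [x0]. A lowering row must be exchanged with its conjugate, and the coroot left by the commutator
    contributes [dot la a]. *)
Lemma casimir_highest d (p : G -> 'M[C]_d) la x0 : unitary_rep p -> hvec (dp p) la x0 ->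
  casimir X p *m x0 = - toC (dot la la + \sum_(a <- pos_seq) dot la a) *: x0.
Proof.
move=> up [_ lt hx tp]; have rr := dp_lie_rep up; have [lin brk skw] := rr.
rewrite /casimir casimir_unitary mulmx_suml.
pose c k : C := (if av k == 0 then cdot (tv la) (cj (row k P)) * cdot (row k P) (cj (tv la)) else 0) +
  (if `[< pos (- av k) >] then toC (dot la (- av k)) else 0).
have term k : cext (dp p) (cj (row k P)) *m cext (dp p) (row k P) *m x0 = - c k *: x0.
  have [kt hk] := HP k; have hck := rv_cj hk; set Z := row k P in hk hck *; rewrite /c.
  have root0 W : rv 0 W -> cext (dp p) W *m x0 = (iC * cdot (tv la) W) *: x0.
    move=> hW; have [r1 i1] := rv0_t bX tcent hW.
    rewrite (reimV W) addrC cext_lin mulmxDl -scalemxAl !(cext_real lin) hx// hx//.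
    rewrite scalerA -scalerDl; congr (_ *: _).
    rewrite [in RHS]cdotC cdot_linl !(cdotC _ (tv la)) !cdot_real; ring.
  have nn a : a == 0 -> `[< pos a >] = false.
    by move=> /eqP ->; apply/asboolP => /pos_rt[_ /eqP].
  case: (root_cases pos_or uP HP k) => [a0|pk|pk].
  - rewrite a0 eqxx nn ?oppr0// addr0.
    rewrite -/Z in hk *; rewrite a0 in hk hck; rewrite oppr0 in hck.
    rewrite -mulmxA (root0 _ hk) -scalemxAr (root0 _ hck) scalerA; congr (_ *: _).
    rewrite cjtv (cdotC Z); move: (cdot _ Z) (cdot _ (cj Z)) => y z.
    by transitivity (iC * iC * (y * z)); [ring|rewrite iC2; ring].
  - have [_ /negPf -> _] := pos_rt pk; rewrite -mulmxA (tp _ _ pk hk) mulmx0.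
    have -> : `[< pos (- av k) >] = false by apply/asboolP; exact: pos_anti.
    by rewrite addr0 oppr0 scale0r.
  - have [_ n0 _] := pos_rt pk; rewrite oppr_eq0 in n0; rewrite (negPf n0) add0r.
    rewrite (asboolT pk).
    have E := cext_br bX lin brk (cj Z) Z.
    have -> : cext (dp p) (cj Z) *m cext (dp p) Z = cext (dp p) (brC (cj Z) Z) + cext (dp p) Z *m cext (dp p) (cj Z).
      by rewrite E subrK.
    rewrite mulmxDl -(mulmxA (cext _ Z)) (tp _ _ pk hck) mulmx0 addr0.
    rewrite (brCC bX) (coroot bX oX tcent kt hk hk) rows_orth eqxx mul1r -scaleNr cextZ.
    rewrite -scalemxAl (cext_real lin) hx// scalerA; congr (_ *: _).
    by rewrite mulrA mulNr iC2 opprK mul1r dotNr rmorphN opprK.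
under eq_bigr do rewrite term; rewrite -scaler_suml; congr (_ *: _).
rewrite sumrN; congr (- _); rewrite big_split rmorphD /=; congr (_ + _).
  rewrite -cdot_real -[X in _ = cdot _ X](cjtv la) parseval; apply: eq_bigr => k _.
  have [//|a0] := eqVneq (av k) 0; have [kt hk] := HP k.
  by rewrite cjtv (cdotC (row k P)) (tdot_root lt kt a0 hk) mulr0.
rewrite -big_mkcond /= rmorph_sum big_map big_filter big_enum_cond /=.
by apply: eq_bigl => k; rewrite ?andbT.
Qed.

Lemma highest_casimir d (p : G -> 'M[C]_d) la x0 (c : R) : unitary_rep p -> hvec (dp p) la x0 ->
  casimir X p = (- toC c)%:M -> c = dot la la + \sum_(a <- pos_seq) dot la a.
Proof.
move=> up hx E; have := casimir_highest up hx; rewrite E mul_scalar_mx => /eqP.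
have [x00 _ _ _] := hx.
rewrite -subr_eq0 -scalerBl scaler_eq0 (negPf x00) orbF -opprB opprK oppr_eq0 addrC subr_eq0.
by move=> /eqP/(congr1 Re).
Qed.

(* The cyclic span of (x1, x2) in the direct sum is the graph of an isomorphism. *)
Lemma highest_unique d1 d2 (p1 : G -> 'M[C]_d1) (p2 : G -> 'M[C]_d2) la x1 x2 :
  unitary_rep p1 -> unitary_rep p2 ->
  irr p1 -> irr p2 ->
  hvec (dp p1) la x1 -> hvec (dp p2) la x2 -> forall x, \tr (p1 x) = \tr (p2 x).
Proof.
move=> up1 up2 ip1 ip2 hx1 hx2 g; apply: contrapT => ntr.
have zero M : intertwines p1 p2 M -> M = 0.
  move=> iM; apply/eqP/negPn/negP => M0; apply: ntr; exact: intertwines_trace iM M0 g.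
have zero' M : intertwines p2 p1 M -> M = 0.
  move=> iM; apply/eqP/negPn/negP => M0; apply: ntr; apply/esym; exact: intertwines_trace iM M0 g.
have [l1 b1 s1] := dp_lie_rep up1; have [l2 b2 s2] := dp_lie_rep up2.
pose rho v := block_mx (dp p1 v) 0 0 (dp p2 v).
have rr : lie_rep X rho.
  split.
  - by move=> a v w; rewrite /rho l1 l2 scale_block_mx add_block_mx !scaler0 !addr0.
  - move=> v w; rewrite /rho b1 b2 !mulmx_block !mulmx0 !mul0mx !addr0 !add0r.
    by rewrite opp_block_mx add_block_mx !oppr0 !addr0.
  - move=> v; rewrite /rho tr_block_mx map_block_mx s1 s2 opp_block_mx !trmx0 !oppr0.
    by rewrite !(map_mx0 (Num.conj : {rmorphism C -> C})).
have rhoC Z (y1 : 'cV[C]_d1) (y2 : 'cV[C]_d2) :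
    cext rho Z *m col_mx y1 y2 = col_mx (cext (dp p1) Z *m y1) (cext (dp p2) Z *m y2).
  rewrite /cext !mulmx_suml; elim/big_rec3: _ => [|k a b c _ ->]; first by rewrite col_mx0.
  rewrite -!scalemxAl mul_block_col !mul0mx addr0 add0r scale_col_mx add_col_mx//.
pose x0 := col_mx x1 x2.
have hx0 : hvec rho la x0.
  have [n1 lt h1 t1] := hx1; have [n2 _ h2 t2] := hx2; split => //.
  - by rewrite col_mx_eq0 (negPf n1).
  - by move=> H Ht; rewrite /x0 mul_block_col !mul0mx addr0 add0r h1// h2// scale_col_mx.
  - by move=> a Z pa hZ; rewrite rhoC (t1 _ _ pa hZ) (t2 _ _ pa hZ) col_mx0.
have [_ _ skr] := rr.
(* With all intertwiners zero, the projection onto the cyclic span is block diagonal and its first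
   block is scalar. As it fixes [x0], that scalar is 1, so the span contains [col_mx x1 0]. *)
have [Pi [Pc PQ Pid]] := invariant_proj skr (wspan0 _ _ _ _ _)
   (fun (a : C) x y => @wspan_lin _ _ _ _ _ _ _ _ _ a x y)
   (fun v x => wspan_real bX tcent pos_or rr uP HP hx0 v (y := x)).
have [A [B [D [F EPi]]]] : exists A B D F, Pi = block_mx A B D F.
  by exists (ulsubmx Pi), (ursubmx Pi), (dlsubmx Pi), (drsubmx Pi); rewrite submxK.
have blk v : A *m dp p1 v = dp p1 v *m A /\ B *m dp p2 v = dp p1 v *m B /\
   D *m dp p1 v = dp p2 v *m D /\ F *m dp p2 v = dp p2 v *m F.
  have := Pc v; rewrite EPi /rho !mulmx_block !mulmx0 !mul0mx !addr0 !add0r.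
  by move=> /eq_block_mx[-> -> -> ->].
have B0 : B = 0 by apply/zero'/(commutant bX cG haarP cn up2 up1) => v; case: (blk v) => _ [].
have D0 : D = 0 by apply/zero/(commutant bX cG haarP cn up1 up2) => v; case: (blk v) => _ [_ []].
have [a Ea] : exists a : C, A = a%:M.
  by apply: schur_scalar ip1 _; apply: (commutant bX cG haarP cn up1 up1) => v; case: (blk v).
have [n1 lt h1 t1] := hx1; have [n2 _ h2 t2] := hx2.
have A1 : a = 1.
  have := Pid _ (wspan_word (word0 X t pos rho x0)); rewrite EPi B0 D0 /x0 mul_block_col !mul0mx addr0 add0r.
  move=> /eq_col_mx[+ _]; rewrite Ea mul_scalar_mx => /eqP.
  by rewrite -subr_eq0 -{2}[x1]scale1r -scalerBl scaler_eq0 (negPf n1) orbF subr_eq0 => /eqP.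
have Qx : wspan X t pos rho x0 (col_mx x1 0).
  have := PQ (col_mx x1 0); rewrite EPi B0 D0 Ea A1 mul_block_col !mul0mx mul1mx !mulmx0 !addr0.
  by [].
have hd00 : hd x0 x0 != 0 by apply/eqP => /hd_eq0 E; have [/eqP] := hx0.
(* [y] is the part of [col_mx x1 0] orthogonal to [x0]. It has weight [la], and the only word of
   that weight is [x0], so [y] is orthogonal to the whole span that contains it. *)
pose k := hd x0 (col_mx x1 0) / hd x0 x0.
pose y := (- k) *: x0 + col_mx x1 0.
have Qy : wspan X t pos rho x0 y by apply: wspan_lin => //; exact/wspan_word/word0.
have hx1' : wv rho la (col_mx x1 0).
  by move=> H Ht; rewrite mul_block_col !mul0mx mulmx0 !addr0 h1// scale_col_mx scaler0.
have hy : wv rho la y.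
  have [_ _ h0 _] := hx0.
  by move=> H Ht; rewrite /y mulmxDr -scalemxAr h0// hx1'// scalerDr !scalerA mulrC.
have y0 : y = 0.
  apply: hd_eq0; apply: wspan_orth Qy => s w ww; have [ps hw] := word_wv bX rr hx0 ww.
  have [s0|s0] := eqVneq s 0.
    rewrite (word_top bX oX tcent pos_rt pos_anti pos_add rr hx0 ww s0) -hdJ /y hd_linr.
    by rewrite mulNr divfK// addNr conjC0.
  apply: (wv_orth rr lt _ _ hy hw); first by apply: memvB => //; exact: psum_t pos_rt _ ps.
  by rewrite -subr_eq0 opprB addrC subrK.
have : y = col_mx ((1 - k) *: x1) (- k *: x2).
  by rewrite /y /x0 scale_col_mx add_col_mx addr0 scalerBl scale1r scaleNr addrC.
rewrite y0 => /esym/eqP; rewrite col_mx_eq0 !scaler_eq0 (negPf n1) (negPf n2) !orbF oppr_eq0.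
by move=> /andP[/eqP E /eqP k0]; move/eqP: E; rewrite k0 subr0 oner_eq0.
Qed.

End HighestWeight.

(** * One-parameter subgroups and maximal tori *)

Section ComplexDerivative.
Context {R : realType}.
Local Notation C := R[i].
Local Notation iC := (Complex 0 1 : C).

Definition cderiv (u : R -> C) (s : R) (d : C) :=
  is_derive (s : R^o) 1 (fun r : R^o => Re (u r) : R^o) (Re d) /\
  is_derive (s : R^o) 1 (fun r : R^o => Im (u r) : R^o) (Im d).

Lemma cderiv_eq u s d d' : cderiv u s d -> d = d' -> cderiv u s d'.
Proof. by move=> h <-. Qed.

Lemma cderiv_ext u v s d : (forall r, u r = v r) -> cderiv u s d -> cderiv v s d.
Proof. by move=> /funext ->. Qed.

Lemma cderiv_cst a s : cderiv (fun=> a) s 0.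
Proof. by split; exact: is_derive_cst. Qed.

Lemma cderivD u v s d e : cderiv u s d -> cderiv v s e -> cderiv (fun r => u r + v r) s (d + e).
Proof.
move=> [a b] [a' b']; split.
  have := is_deriveD a a'; rewrite ReD; congr (is_derive _ _ _ _); apply/funext => r.
  by rewrite ReD.
have := is_deriveD b b'; rewrite ImD; congr (is_derive _ _ _ _); apply/funext => r.
by rewrite ImD.
Qed.

Lemma cderivM u v s d e : cderiv u s d -> cderiv v s e ->
  cderiv (fun r => u r * v r) s (d * v s + u s * e).
Proof.
move=> [a b] [a' b']; split.
  have h := is_deriveB (is_deriveM a a') (is_deriveM b b').
  have -> : (fun r : R^o => Re (u r * v r) : R^o) =
    (fun r : R^o => Re (u r) : R^o) * (fun r : R^o => Re (v r) : R^o) -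
    (fun r : R^o => Im (u r) : R^o) * (fun r : R^o => Im (v r) : R^o).
    by apply/funext => r; rewrite ReM.
  apply: is_derive_eq h _; rewrite ReD !ReM /GRing.scale /=; ring.
have h := is_deriveD (is_deriveM a b') (is_deriveM b a').
have -> : (fun r : R^o => Im (u r * v r) : R^o) =
    (fun r : R^o => Re (u r) : R^o) * (fun r : R^o => Im (v r) : R^o) +
    (fun r : R^o => Im (u r) : R^o) * (fun r : R^o => Re (v r) : R^o).
  by apply/funext => r; rewrite ImM.
apply: is_derive_eq h _; rewrite ImD !ImM /GRing.scale /=; ring.
Qed.

Lemma cderivZr u (a : C) s d : cderiv u s d -> cderiv (fun r => u r * a) s (d * a).
Proof.
by move=> h; apply: cderiv_eq (cderivM h (cderiv_cst a s)) _; rewrite mulr0 addr0.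
Qed.

Lemma cderiv_sum (I : Type) (l : seq I) (u : I -> R -> C) (d : I -> C) s :
  (forall i, cderiv (u i) s (d i)) ->
  cderiv (fun r => \sum_(i <- l) u i r) s (\sum_(i <- l) d i).
Proof.
move=> h; elim: l => [|i l IH].
  rewrite big_nil; apply: cderiv_ext (cderiv_cst 0 s) => r; by rewrite big_nil.
rewrite big_cons; apply: cderiv_ext (cderivD (h i) IH) => r; by rewrite big_cons.
Qed.

Lemma cderivJ u s d : cderiv u s d -> cderiv (fun r => (u r)^*) s d^*.
Proof.
move=> [a b]; split; first by rewrite ReJ; move: a; congr (is_derive _ _ _ _); apply/funext => r; rewrite ReJ.
have := is_deriveN b; rewrite ImJ; congr (is_derive _ _ _ _); apply/funext => r.
by rewrite ImJ.
Qed.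

Lemma cderiv0_cst u : (forall s, cderiv u s 0) -> forall s r, u s = u r.
Proof.
move=> h s r; apply: C_eq.
  by apply: (@is_derive_0_is_cst R (fun r => Re (u r))) => x; case: (h x).
by apply: (@is_derive_0_is_cst R (fun r => Im (u r))) => x; case: (h x).
Qed.

Lemma cderiv_uniq u s d e : cderiv u s d -> cderiv u s e -> d = e.
Proof.
move=> [a b] [a' b']; apply: C_eq.
  by rewrite -(@derive_val _ _ _ _ _ _ _ a) -(@derive_val _ _ _ _ _ _ _ a').
by rewrite -(@derive_val _ _ _ _ _ _ _ b) -(@derive_val _ _ _ _ _ _ _ b').
Qed.

Definition cis (c s : R) : C := Complex (cos (c * s)) (sin (c * s)).

Lemma cis0 c : cis c 0 = 1.
Proof. by rewrite /cis mulr0 cos0 sin0. Qed.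

Lemma cisVr c s : cis c s * (cis c s)^* = 1.
Proof.
apply: C_eq; rewrite ?ReM ?ImM ?ReJ ?ImJ /=; last by ring.
by rewrite mulrN opprK -!expr2 cos2Dsin2.
Qed.

Lemma cderiv_cis c s : cderiv (cis c) s (iC * toC c * cis c s).
Proof.
have d : is_derive (s : R^o) 1 (fun r : R^o => c * r : R^o) c.
  have := @is_deriveZ _ _ _ (id : R^o -> R^o) c (s : R^o) 1 1 (@is_derive_id _ _ _ _).
  by rewrite [c *: _]mulr1.
split.
  have := @is_derive1_comp R cos (fun r => c * r) s _ _ (is_derive_cos _) d.
  by move=> h; apply: is_derive_eq h _; rewrite !ReM !ImM /=; ring.
have := @is_derive1_comp R sin (fun r => c * r) s _ _ (is_derive_sin _) d.
by move=> h; apply: is_derive_eq h _; rewrite !(ImM, ReM) /=; ring.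
Qed.

End ComplexDerivative.

Section IntegralCurve.
Context {R : realType} {n : nat} {G : lieGroupType R n}.
Local Notation C := R[i].
Local Notation iC := (Complex 0 1 : C).
Context (X : 'I_n -> (G -> R) -> (G -> R)) (bX : lie_basis X) (cG : compact [set: G])
 (haar : probability (borel G) R) (haarP : haar_probability haar).
Local Notation dp := (dp X).
Implicit Types (v w : 'rV[R]_n) (gam : R -> G).

Definition icurve v gam := forall f, smooth_fun f -> forall s : R,
  is_derive (s : R^o) 1 (f \o gam : R^o -> R^o) (frame_vf X v f (gam s)).

Lemma ops_icurve v gam : one_parameter_subgroup X v gam -> icurve v gam.
Proof. by case. Qed.

Lemma icurve_shift v gam (r : R) : icurve v gam -> icurve v (fun s => gam (r + s)).
Proof.
move=> h f sf s.
have d : is_derive (s : R^o) 1 (fun x : R^o => r + x : R^o) 1.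
  have := is_deriveD (is_derive_cst (r : R^o) (s : R^o) 1) (is_derive_id (s : R^o) (1 : R^o)).
  by rewrite add0r.
have := @is_derive1_comp R (f \o gam) (fun x => r + x) s _ _ (h f sf (r + s)) d.
by rewrite mulr1.
Qed.

Lemma ops_scale v gam r : one_parameter_subgroup X v gam ->
  one_parameter_subgroup X (r *: v) (fun s => gam (r * s)).
Proof.
move=> [g0 gc gd]; split; first by rewrite mulr0.
  by move=> s; apply: (continuous_comp (f := fun x : R => r * x)); [exact: mulrl_continuous|exact: gc].
move=> f sf s.
have d : is_derive (s : R^o) 1 (fun x : R^o => r * x : R^o) r.
  have := @is_deriveZ _ _ _ (id : R^o -> R^o) r (s : R^o) 1 1 (@is_derive_id _ _ _ _).
  by rewrite [r *: _]mulr1.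
have := @is_derive1_comp R (f \o gam) (fun x => r * x) s _ _ (gd f sf (r * s)) d.
move=> h; apply: is_derive_eq h _.
have -> : r *: v = r *: v + 0 by rewrite addr0.
rewrite frame_combo mulrC /frame_vf [X in _ = _ + X]big1 ?addr0// => i _.
by rewrite mxE mul0r.
Qed.

Lemma icurve_cderiv v gam (F : G -> C) s : icurve v gam -> csmooth F ->
  cderiv (fun r => F (gam r)) s (cD X v F (gam s)).
Proof. by move=> h [s1 s2]; split; exact: h. Qed.

Lemma icurve_rep v gam d (p : G -> 'M[C]_d) s i j : icurve v gam -> representation p ->
  cderiv (fun r => p (gam r) i j) s ((p (gam s) *m dp p v) i j).
Proof.
move=> h rp; apply: cderiv_eq (icurve_cderiv s h (rep_smooth cG haarP rp i j)) _.
by rewrite (rep_D bX cG haarP rp) mxE.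
Qed.

Lemma cderiv_mulmx m k l (A : R -> 'M[C]_(m, k)) (B : R -> 'M[C]_(k, l)) s
  (A' : 'M[C]_(m, k)) (B' : 'M[C]_(k, l)) :
  (forall i j, cderiv (fun r => A r i j) s (A' i j)) ->
  (forall i j, cderiv (fun r => B r i j) s (B' i j)) ->
  forall i j, cderiv (fun r => (A r *m B r) i j) s ((A' *m B s + A s *m B') i j).
Proof.
move=> hA hB i j.
have h := cderiv_sum (index_enum _) (fun q : 'I_k => cderivM (hA i q) (hB q j)).
apply: cderiv_eq; first by apply: cderiv_ext h => r; rewrite mxE.
by rewrite !mxE -big_split.
Qed.

Lemma mx_cderiv0 m k (A : R -> 'M[C]_(m, k)) :
  (forall s i j, cderiv (fun r => A r i j) s 0) -> forall s r, A s = A r.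
Proof. by move=> h s r; apply/matrixP => i j; apply: (@cderiv0_cst R (fun r => A r i j)). Qed.

(** The derivative contains the commutator of [M] with [dp p v], because unitarity makes the second
    factor contribute with the opposite sign. *)
Lemma icurve_conj v gam1 gam2 d (p : G -> 'M[C]_d) (M : 'M[C]_d) s r : icurve v gam1 -> icurve v gam2 ->
  unitary_rep p -> M *m dp p v = dp p v *m M ->
  p (gam1 s) *m M *m (p (gam2 s))^t* = p (gam1 r) *m M *m (p (gam2 r))^t*.
Proof.
move=> h1 h2 [rp up] cM.
apply: (@mx_cderiv0 _ _ (fun s => p (gam1 s) *m M *m (p (gam2 s))^t*)) => {s r} s i j.
have dM a b : cderiv (fun=> M a b) s ((0 : 'M[C]_d) a b) by rewrite mxE; exact: cderiv_cst.
have d1 := cderiv_mulmx (fun a b => icurve_rep s a b h1 rp) dM.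
have d2 a b : cderiv (fun r => (p (gam2 r))^t* a b) s ((p (gam2 s) *m dp p v)^t* a b).
  have := cderivJ (icurve_rep s b a h2 rp); rewrite [X in _ -> cderiv _ _ X]mxE [X in _ -> cderiv _ _ X^*]mxE.
  by apply: cderiv_ext => r; rewrite !mxE.
apply: cderiv_eq (cderiv_mulmx d1 d2 i j) _.
rewrite conjtrM (dp_adj bX cG haarP rp)// mulmx0 addr0 mulNmx mulmxN.
have -> : p (gam1 s) *m dp p v *m M = p (gam1 s) *m M *m dp p v by rewrite -!mulmxA cM.
by rewrite !mulmxA subrr mxE.
Qed.

(** Uniqueness of integral curves up to a left factor: with [M = 1] the quotient is constant in each
    irreducible unitary representation, and these separate points. *)
Lemma icurve_quot v gam1 gam2 s r : icurve v gam1 -> icurve v gam2 ->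
  (gam1 s * (gam2 s)^-1 = gam1 r * (gam2 r)^-1)%g.
Proof.
move=> h1 h2; set x := (_ * _)%g; set y := (_ * _)%g.
suff : (x * y^-1 = 1)%g by move=> /(congr1 (fun z => z * y)%g); rewrite mulgVK mul1g.
apply: (rep_faithful cG haarP) => d p ip up; have [[p1 pM _] pV] := up.
have E := @icurve_conj v gam1 gam2 d p 1%:M s r h1 h2 up.
have {}E : p x = p y by rewrite /x /y !pM !pV; have := E ltac:(by rewrite mul1mx mulmx1); rewrite !mulmx1.
by rewrite pM E -pM mulgV.
Qed.

Lemma ops_add v gam s r : one_parameter_subgroup X v gam -> (gam (s + r) = gam s * gam r)%g.
Proof.
move=> og; have [g0 _ _] := og; have h := ops_icurve og.
have := icurve_quot r 0 (@icurve_shift v gam s h) h.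
by rewrite addr0 g0 invg1 mulg1 => <-; rewrite mulgVK.
Qed.

Lemma ops_commute v gam d (p : G -> 'M[C]_d) (M : 'M[C]_d) s : one_parameter_subgroup X v gam ->
  unitary_rep p -> M *m dp p v = dp p v *m M -> p (gam s) *m M = M *m p (gam s).
Proof.
move=> og up cM; have [g0 _ _] := og; have h := ops_icurve og.
have := icurve_conj s 0 h h up cM; have [rp up'] := up; have [p1 _ _] := rp.
rewrite g0 p1 mul1mx conjtr1 mulmx1 -up' => E; rewrite -[in RHS]E.
by rewrite -!mulmxA rep_Vmul// mulmx1.
Qed.

(** One direction differentiates at time 0; for the other, the product of the conjugate exponential
    with [p (gam s) *m x] has zero derivative. *)
Lemma ops_weight v gam d (p : G -> 'M[C]_d) (x : 'cV[C]_d) (c : R) :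
  one_parameter_subgroup X v gam -> representation p ->
  (forall s, p (gam s) *m x = cis c s *: x) <-> dp p v *m x = (iC * toC c) *: x.
Proof.
move=> og rp; have [g0 _ _] := og; have h := ops_icurve og; have [p1 _ _] := rp.
have dx a b s : cderiv (fun=> x a b) s ((0 : 'cV[C]_d) a b) by rewrite mxE; exact: cderiv_cst.
have dpx s := cderiv_mulmx (fun a b => icurve_rep s a b h rp) (fun a b => dx a b s).
split=> E.
  apply/colP => i; have D1 := dpx 0 i 0.
  have D2 : cderiv (fun r => (p (gam r) *m x) i 0) 0 (iC * toC c * x i 0).
    have := cderivZr (x i 0) (cderiv_cis c 0); rewrite cis0 mulr1.
    by apply: cderiv_ext => r; rewrite E mxE.
  have : (p (gam 0) *m dp p v *m x) i 0 = iC * toC c * x i 0.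
    by rewrite mulmx0 addr0 in D1; exact: cderiv_uniq D1 D2.
  by rewrite g0 p1 mul1mx => ->; rewrite mxE.
move=> s; have K r : ((cis c r)^* *: (p (gam r) *m x)) = x.
  transitivity ((cis c 0)^* *: (p (gam 0) *m x)); last by rewrite cis0 conjC1 scale1r g0 p1 mul1mx.
  apply: (@mx_cderiv0 _ _ (fun r => (cis c r)^* *: (p (gam r) *m x))) => {}r i j.
  rewrite (ord1 j).
  have := cderivM (cderivJ (cderiv_cis c r)) (dpx r i 0).
  have Ei : (p (gam r) *m dp p v *m x) i 0 = iC * toC c * (p (gam r) *m x) i 0.
    by rewrite -mulmxA E -scalemxAr mxE.
  rewrite mulmx0 addr0 Ei.
  move=> H; apply: cderiv_eq; first by apply: cderiv_ext H => q; rewrite [RHS]mxE.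
  by rewrite !conjCM iCJ toCJ; ring.
by rewrite -{2}(K s) scalerA cisVr scale1r.
Qed.

Lemma ops_br0 v w g1 g2 : one_parameter_subgroup X v g1 -> one_parameter_subgroup X w g2 ->
  (forall s r, g1 s * g2 r = g2 r * g1 s)%g -> lie_bracket X v w = 0.
Proof.
move=> o1 o2 cm; apply: (dp_faithful bX cG haarP) => d p ip up; have [rp _] := up.
have [_ pM _] := rp.
have der M u gam (A B : 'M[C]_d) : one_parameter_subgroup X u gam ->
    (forall s, p (gam s) *m M = M *m p (gam s)) -> dp p u *m M = M *m dp p u.
  move=> og E; have [g0 _ _] := og; have h := ops_icurve og; have [p1 _ _] := rp.
  apply/matrixP => i j.
  have dM a b : cderiv (fun=> M a b) 0 ((0 : 'M[C]_d) a b) by rewrite mxE; exact: cderiv_cst.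
  have dP a b := icurve_rep 0 a b h rp.
  have D1 := cderiv_mulmx dP dM i j; have D2 := cderiv_mulmx dM dP i j.
  have D3 : cderiv (fun r => (p (gam r) *m M) i j) 0 ((0 *m p (gam 0) + M *m (p (gam 0) *m dp p u)) i j).
    by apply: cderiv_ext D2 => r; rewrite E.
  by have := cderiv_uniq D1 D3; rewrite g0 p1 !mul1mx mul0mx addr0 add0r.
rewrite (dp_bracket bX cG haarP rp); apply/eqP; rewrite subr_eq0; apply/eqP.
apply: (der _ _ g1 0 0 o1) => s; apply/esym; apply: (der _ _ g2 0 0 o2) => r.
by rewrite -!pM cm.
Qed.

End IntegralCurve.

Lemma ultra_fmap (T U : Type) (f : T -> U) (F : set_system T) :
  UltraFilter F -> UltraFilter (f @ F).
Proof.
move=> uF; have pF : ProperFilter F by apply: ultra_proper.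
split; first exact: fmap_proper_filter.
move=> H pH sub; apply/seteqP; split => A//; last exact: sub.
move=> HA; have [//|Fc] := in_ultra_setVsetC (f @^-1` A) uF.
have : H (~` A) by apply: sub.
move=> HAc; have := @filter_ex _ H pH _ (filterI HA HAc); rewrite setICr => -[]//.
Qed.

Lemma is_derive_of_quadratic (R : realType) (f : R -> R) (s d L : R) :
  (forall h, `|h| <= 1 -> `|f (s + h) - f s - h * d| <= L * h ^+ 2) ->
  is_derive (s : R^o) 1 (f : R^o -> R^o) d.
Proof.
move=> H.
have L0 : 0 <= L.
  have := H 1; rewrite normr1 expr1n mulr1 => /(_ (lexx _)); exact: le_trans.
suff E : h^-1 *: (f (h *: (1 : R^o) + s) - f s) @[h --> (0 : R)^'] --> (d : R^o).
  by apply: DeriveDef; [apply/cvg_ex; exists d|exact/cvg_lim].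
apply/cvgrPdist_le => e e0; rewrite near_withinE.
apply: (proj2 (@near_normP R R^o 0 _)); exists (Num.min 1 (e / (L + 1))).
  by rewrite lt_min ltr01 divr_gt0// ltr_wpDl.
move=> h; rewrite add0r lt_min => /andP[h1 he] h0.
have h0' : 0 < `|h| by rewrite normr_gt0.
have := H h (ltW h1); rewrite /GRing.scale /= mulr1 (addrC h) => B.
rewrite distrC -(ler_pM2l h0') -normrM mulrBr mulrA mulfV// mul1r.
apply: le_trans B _; rewrite -real_normK ?num_real// expr2 mulrCA ler_pM2l//.
apply: le_trans (_ : (L + 1) * `|h| <= _); first by rewrite ler_wpM2r// lerDl.
by rewrite mulrC -ler_pdivlMr ?ltr_wpDl// ltW.
Qed.

Section OneParameter.
Context {R : realType} {n : nat} {G : lieGroupType R n} (X : 'I_n -> (G -> R) -> (G -> R))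
 (bX : lie_basis X) (cG : compact [set: G]).
Local Notation D := (frame_vf X).
Implicit Types (f : G -> R) (u v w : 'rV[R]_n).

Lemma frame_bound w f x (K : R) : (forall i, `|X i f x| <= K) ->
  `|D w f x| <= `|w| * (n%:R * K).
Proof.
move=> H; apply: le_trans (ler_norm_sum _ _ _) _.
apply: le_trans (ler_sum _ (_ : forall i : 'I_n, true -> _ <= `|w| * K)) _.
  by move=> i _; rewrite normrM ler_pM// coord_le_norm.
by rewrite sumr_const card_ord -[leLHS]mulr_natl mulrCA.
Qed.

Lemma smooth_bounds f : smooth_fun f -> exists2 K : R, 0 <= K & forall i x, `|X i f x| <= K.
Proof.
move=> sf.
have ex (i : 'I_n) : exists K, 0 <= K /\ forall x, `|X i f x| <= K.
  have [|K K0 HK] := cont_bounded cG (f := X i f); last by exists K.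
  by apply: smooth_cont; case: bX => /(_ i)[h _ _ _] _; exact: h.
have [K HK] := choice ex.
exists (\sum_i K i); first by apply: sumr_ge0 => i _; case: (HK i).
move=> i x; have [_ h] := HK i; apply: le_trans (h x) _.
by rewrite (bigD1 i)//= lerDl; apply: sumr_ge0 => j _; case: (HK j).
Qed.

Lemma mulmx_norm u (M : 'M[R]_n) : `|u *m M| <= `|u| * \sum_i \sum_k `|M k i|.
Proof.
have S0 : 0 <= \sum_i \sum_k `|M k i| by do 2 (apply: sumr_ge0 => ? _).
apply: norm_le_coord; first by rewrite mulr_ge0.
move=> i; rewrite mxE; apply: le_trans (ler_norm_sum _ _ _) _.
apply: (@le_trans _ _ (`|u| * \sum_k `|M k i|)).
  by rewrite mulr_sumr; apply: ler_sum => k _; rewrite normrM ler_wpM2r// coord_le_norm.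
rewrite ler_wpM2l// [leRHS](bigD1 i)//= lerDl.
by apply: sumr_ge0 => j _; apply: sumr_ge0.
Qed.

Context (c : chart R n G) (ac : atlas c) (dc : chart_dom c 1%g) (B : 'M[R]_n)
 (HB : forall w f x, smooth_fun f -> cdir c w f x = D (w *m B) f x).
Let a := chart_map c 1%g.
Let ca : chart_cod c a. Proof. by have [] := dom_map ac dc. Qed.
Let ia : chart_inv c a = 1%g. Proof. by have [] := dom_map ac dc. Qed.

Lemma frame_partials_unit : exists A : 'rV[R]_n -> 'M[R]_n, [/\ A a = 1%:M,
  forall i j, {for a, continuous (fun u => A u i j)} &
  forall f u v, smooth_fun f -> chart_cod c u ->
  'D_v (f \o chart_inv c : _ -> R^o) u = D (v *m A u *m B) f (chart_inv c u)].
Proof.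
have [A [sA HA]] := frame_partials ac dc ac.
have HD f u v : smooth_fun f -> chart_cod c u ->
    'D_v (f \o chart_inv c : _ -> R^o) u = cdir c (v *m A u) f (chart_inv c u).
  move=> sf cu; rewrite derive_partials; last exact: (Ck1_differentiable (open_cod ac) cu (sf c ac 1%N)).
  have Hk k := HA f u k sf cu; have := cdir_lin ac dc (v *m A u) (chart_inv c u) sf.
  move=> ->.
  exact: row_comb Hk.
exists A; split.
- apply/row_matrixP => k; rewrite !rowE mulmx1; apply/eqP; rewrite -subr_eq0; apply/eqP.
  apply: (cdir_inj ac dc) => f sf; set e := delta_mx 0 k.
  have E : cdir c e f 1%g = cdir c (e *m A a) f 1%g.
    rewrite -{2}ia -HD// /cdir; congr ('D_e _ a); apply/funext => u /=; by rewrite mul1g.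
  have Es (x y : 'rV[R]_n) j : (x - y) 0 j = x 0 j - y 0 j by rewrite !mxE.
  rewrite (cdir_lin ac dc)//; under eq_bigr => j _ do rewrite Es mulrBl.
  by rewrite sumrB -!(cdir_lin ac dc)// E subrr.
- by move=> i j; exact: (Ck_on_cont (sA 0%N i j) ca).
- by move=> f u v sf cu; rewrite HD// HB.
Qed.

(** A first-order expansion of right multiplication near the identity. Its uniformity in [x] allows
    errors to be summed along products of many small elements. *)
Lemma first_order f (e : R) : smooth_fun f -> 0 < e ->
  \forall v \near (0 : 'rV[R]_n), forall x,
  `|f (x * chart_inv c (a + v))%g - f x - D (v *m B) f x| <= e * `|v|.
Proof.
move=> sf e0; have [A [Aa cA HA]] := frame_partials_unit.
have [K K0 HK] := smooth_bounds sf.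
pose N := \sum_i \sum_k `|B k i|; have N0 : 0 <= N by do 2 (apply: sumr_ge0 => ? _).
(* [n * K] weighs the deviation of the coefficient matrix from its value at the identity, [N * n]
   the displacement of the base point; the final 1 makes [T] positive. *)
pose T := n%:R * K + N * n%:R + 1.
have T0 : 0 < T by rewrite ltr_wpDl// addr_ge0// mulr_ge0.
pose de := e / T; have de0 : 0 < de by rewrite divr_gt0.
pose S (u : 'rV[R]_n) : R := \sum_i \sum_k `|(A u *m B - B) k i|.
have cS : {for a, continuous S}.
  apply: cont_for_sum => i; apply: cont_for_sum => k.
  have -> : (fun u => `|(A u *m B - B) k i|) = (fun u => `|\sum_l A u k l * B l i - B k i|).
    by apply/funext => u; rewrite !mxE.
  have c1 : {for a, continuous (fun u => \sum_l A u k l * B l i)}.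
    apply: (cont_for_sum (F := fun l u => A u k l * B l i)) => l.
    exact: (cvgM (cA k l) (cvg_cst _)).
  have c2 : {for a, continuous (fun u => \sum_l A u k l * B l i - B k i)}.
    exact: (cvgB c1 (cvg_cst _)).
  exact: (cvg_norm c2).
have Sa : S a = 0.
  by rewrite /S; apply: big1 => i _; apply: big1 => k _; rewrite Aa mul1mx subrr mxE normr0.
have n1 : \forall u \near a, S u < de by apply: (cvgr_lt (S a) cS); rewrite Sa.
have n2 i : \forall u \near a, forall x, `|X i f x - X i f (x * chart_inv c u)%g| <= de.
  have cX : continuous (X i f) by apply: smooth_cont; case: bX => /(_ i)[h _ _ _] _; exact: h.
  have := @cont_unif _ _ _ cG _ (fun q => X i f (q.2 * chart_inv c q.1)%g) a _ de0.
  move=> h; have : \forall t \near a, forall y,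
      `|X i f (y * chart_inv c a)%g - X i f (y * chart_inv c t)%g| <= de.
    apply: h => y; apply: (continuous_comp (f := fun q => (q.2 * chart_inv c q.1)%g)); last exact: cX.
    apply: (continuous_comp (f := fun q => (q.2, chart_inv c q.1)) (g := fun q => (q.1 * q.2)%g)); last first.
      exact: lie_mul_continuous.
    apply: cvg_pair; first exact: cvg_snd.
    apply: (continuous_comp (f := fst)); first exact: cvg_fst.
    exact: (cont_inv ac ca).
  by apply: filterS => u hu x; have := hu x; rewrite ia mulg1.
have n2' : \forall u \near a, forall i x, `|X i f x - X i f (x * chart_inv c u)%g| <= de.
  exact: filter_forall n2.
have [r r0 Hr] := (near_normP _ _).1 (filterI (near_cod ac ca) (filterI n1 n2')).
apply/near_normP; exists r => // v; rewrite add0r => vr x.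
have inr (t : R) : `|t| <= `|1 : R| -> `|t *: v| < r.
  by rewrite normr1 normrZ => t1; apply: le_lt_trans vr; rewrite ler_piMl.
have sfx := smooth_lmul x sf.
have [t t1 Et] := @MVT_dir R _ ((fun y => f (x * y)%g) \o chart_inv c : _ -> R^o) a v 1
  (fun t t1 => Ck_on_derivable (v := v) (sfx c ac 1%N) (Hr _ (inr t t1)).1).
move: Et; rewrite scale1r mulr1 /= -/a ia mulg1 => ->.
have [ct [St Xt]] := Hr _ (inr t t1); set u := a + t *: v in ct St Xt *.
rewrite HA// (frame_lmul bX)//; set y := (x * chart_inv c u)%g.
set w := v *m A u *m B.
have -> : D w f y - D (v *m B) f x =
    D (w - v *m B) f y - \sum_i (v *m B) 0 i * (X i f x - X i f y).
  rewrite /frame_vf -!sumrB; apply: eq_bigr => i _; rewrite [(w - _) 0 i]mxE [(- (v *m B)) 0 i]mxE.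
  ring.
apply: le_trans (ler_normB _ _) _.
have Bw : `|w - v *m B| <= `|v| * de.
  rewrite /w -mulmxA -mulmxBr; apply: le_trans (mulmx_norm _ _) _.
  by rewrite ler_wpM2l// ltW.
have B1 : `|D (w - v *m B) f y| <= `|v| * de * (n%:R * K).
  apply: le_trans (frame_bound _ (fun i => HK i y)) _.
  by rewrite ler_wpM2r// mulr_ge0.
have B2 : `|\sum_i (v *m B) 0 i * (X i f x - X i f y)| <= `|v| * N * (n%:R * de).
  apply: le_trans (ler_norm_sum _ _ _) _.
  apply: le_trans (ler_sum _ (_ : forall i : 'I_n, true -> _ <= `|v| * N * de)) _.
    move=> i _; rewrite normrM; apply: (ler_pM (normr_ge0 _) (normr_ge0 _) _ (Xt i x)).
    exact: le_trans (coord_le_norm _ _) (mulmx_norm _ _).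
  by rewrite sumr_const card_ord -[leLHS]mulr_natl mulrCA.
apply: le_trans (lerD B1 B2) _.
have -> : `|v| * de * (n%:R * K) + `|v| * N * (n%:R * de) = (de * `|v|) * (n%:R * K + N * n%:R) by ring.
have -> : e * `|v| = (de * `|v|) * T by rewrite /de; field; rewrite gt_eqF.
by apply: ler_wpM2l; [rewrite mulr_ge0// ltW|rewrite /T lerDl].
Qed.

Lemma first_lipschitz f : smooth_fun f -> exists2 L : R, 0 <= L &
  \forall v \near (0 : 'rV[R]_n), forall x, `|f (x * chart_inv c (a + v))%g - f x| <= L * `|v|.
Proof.
move=> sf; have [K K0 HK] := smooth_bounds sf.
pose N := \sum_i \sum_k `|B k i|; have N0 : 0 <= N by do 2 (apply: sumr_ge0 => ? _).
exists (1 + N * (n%:R * K)); first by rewrite addr_ge0// !mulr_ge0.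
apply: filterS (first_order sf ltr01) => v h x.
have -> : f (x * chart_inv c (a + v))%g - f x =
  (f (x * chart_inv c (a + v))%g - f x - D (v *m B) f x) + D (v *m B) f x by ring.
apply: le_trans (ler_normD _ _) _; rewrite mulrDl; apply: lerD; first exact: h.
apply: le_trans (frame_bound _ (fun i => HK i x)) _.
rewrite (_ : N * _ * _ = `|v| * N * (n%:R * K)); last by ring.
by rewrite ler_wpM2r ?mulr_ge0// mulmx_norm.
Qed.

Definition zpow (x : G) (z : int) : G :=
  match z with Posz k => (x ^+ k)%g | Negz k => ((x ^+ k.+1)^-1)%g end.

Lemma zpowD x z (k : nat) : zpow x (z + k%:Z) = (zpow x z * x ^+ k)%g.
Proof.
elim: k => [|k IH]; first by rewrite addr0 expg0 mulg1.
rewrite expgSr mulgA -IH -addn1 PoszD addrA; move: (z + k%:Z) => {IH}y.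
case: y => [m|m]; first by rewrite -PoszD addn1 /= expgSr.
case: m => [|m]; first by rewrite /= expg1 mulVg.
rewrite (_ : Negz m.+1 + 1 = Negz m); last by rewrite !NegzE; lia.
by rewrite /= [in RHS]expgS invgM mulgVK.
Qed.

(** The error estimate of Euler's method with step [e]: a local error [e * eta] at each step, and a
    slope [g] that drifts by at most [L * e] per step. *)
Lemma telescope_bound (F g : nat -> R) (e eta L : R) (m : nat) : 0 <= e -> 0 <= eta -> 0 <= L ->
  (forall j, `|F j.+1 - F j - e * g j| <= e * eta) -> (forall j, `|g j.+1 - g j| <= L * e) ->
  `|F m - F 0%N - m%:R * e * g 0%N| <= m%:R * e * eta + (m%:R * e) ^+ 2 * L.
Proof.
move=> e0 eta0 L0 HF Hg.
have Hg' j : `|g j - g 0%N| <= j%:R * e * L.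
  elim: j => [|j IH]; first by rewrite subrr normr0 !mul0r.
  have -> : g j.+1 - g 0%N = (g j.+1 - g j) + (g j - g 0%N) by ring.
  apply: le_trans (ler_normD _ _) _; apply: le_trans (lerD (Hg j) IH) _.
  by rewrite -natr1 le_eqVlt; apply/orP; left; apply/eqP; ring.
elim: m => [|m IH]; first by rewrite !mul0r !subrr normr0 expr0n /= mul0r addr0.
have -> : F m.+1 - F 0%N - m.+1%:R * e * g 0%N =
  (F m.+1 - F m - e * g m) + (F m - F 0%N - m%:R * e * g 0%N) + e * (g m - g 0%N).
  by rewrite -natr1; ring.
apply: le_trans (ler_normD _ _) _.
apply: le_trans (lerD (le_trans (ler_normD _ _) (lerD (HF m) IH)) (_ : _ <= e * (m%:R * e * L))) _.
  by rewrite normrM ger0_norm// ler_wpM2l.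
rewrite -natr1 -subr_ge0.
have -> : (m%:R + 1) * e * eta + ((m%:R + 1) * e) ^+ 2 * L -
  (e * eta + (m%:R * e * eta + (m%:R * e) ^+ 2 * L) + e * (m%:R * e * L)) =
  (m%:R + 1) * e ^+ 2 * L by ring.
by rewrite !mulr_ge0// ?addr_ge0// exprn_ge0.
Qed.

Lemma smooth_cont_of (gam : R -> G) :
  (forall f, smooth_fun f -> continuous (f \o gam)) -> continuous gam.
Proof.
move=> H s A nA; have [phi [sphi phi0 phis phiA]] := smooth_bump nA.
have := H _ sphi s; move/(cvgr_gt (phi (gam s))) => /(_ _ phis); apply: filterS => r /= hr.
by apply: contrapT => nAr; move: hr; rewrite (phiA _ nAr) ltxx.
Qed.

(* gam s is the limit of y_k ^ floor(s / eps_k) along the ultrafilter: elements y_k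
   tending to 1 in the direction om generate a one-parameter subgroup in the limit. *)
Lemma limit_ops (U : set_system nat) (y : nat -> G) (v : nat -> 'rV[R]_n) (eps : nat -> R)
  (om : 'rV[R]_n) : UltraFilter U ->
  (forall k, 0 < eps k) -> eps @ U --> 0 -> v @ U --> (0 : 'rV[R]_n) ->
  (\forall k \near U, y k = chart_inv c (a + v k)) ->
  (fun k => (eps k)^-1 *: v k) @ U --> om ->
  exists2 gam, one_parameter_subgroup X (om *m B) gam &
  forall S : set G, closed S -> (forall k z, S (zpow (y k) z)) -> forall s, S (gam s).
Proof.
move=> uU eps0 epsl vl yE oml; have pU : ProperFilter U by apply: ultra_proper.
pose m s k := Num.floor (s / eps k).
pose E s k := zpow (y k) (m s k).
have exg s : exists g : G, E s @ U --> g.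
  have := cG; rewrite compact_ultra => /(_ (E s @ U) (ultra_fmap (E s) uU) filterT) [g [_ hg]].
  by exists g.
have [gam Hg] := choice exg.
have conv f s : continuous f -> (fun k => f (E s k)) @ U --> f (gam s).
  by move=> cf; exact: (cvg_comp _ _ (Hg s) (cf (gam s))).
set w := om *m B.
pose N := \sum_i \sum_k `|B k i|; have N0 : 0 <= N by do 2 (apply: sumr_ge0 => ? _).
(* Euler's estimate for the powers of [y k] between the times [s] and [s + h], passed to the limit
   in [k]. The local error [eta] is then sent to 0 and only the quadratic term remains. *)
have step f : smooth_fun f -> exists2 L : R, 0 <= L & forall s h, 0 <= h ->
    `|f (gam (s + h)) - f (gam s) - h * D w f (gam s)| <= h ^+ 2 * L.
  move=> sf; have [K K0 HK] := smooth_bounds sf.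
  have sD := frame_smooth bX w sf; have [L1 L10 HL] := first_lipschitz sD.
  pose W := `|om| + 1; have W0 : 0 < W by rewrite ltr_wpDl.
  exists (L1 * W); first by rewrite mulr_ge0// ltW.
  move=> s h h0.
  have bound eta : 0 < eta -> `|f (gam (s + h)) - f (gam s) - h * D w f (gam s)| <= h * eta + h ^+ 2 * (L1 * W).
    move=> eta0.
    (* [W] bounds the length of [v k] relative to [eps k], and [N * (n * K)] the effect of replacing
       the direction of [v k] by its limit; the two errors of one step then add up to
       [eps k * eta]. *)
    pose de := eta / (W + N * (n%:R * K)).
    have T0 : 0 < W + N * (n%:R * K) by rewrite ltr_pwDl// !mulr_ge0.
    have de0 : 0 < de by rewrite divr_gt0.
    have near1 := vl _ (first_order sf de0).
    have near2 := vl _ HL.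
    have near3 : \forall k \near U, `|om - (eps k)^-1 *: v k| < de by move/cvgrPdist_lt : (oml); apply.
    have near4 : \forall k \near U, `|om - (eps k)^-1 *: v k| < 1 by move/cvgrPdist_lt : (oml); apply.
    pose j k := m (s + h) k - m s k.
    have jh k : `|(j k)%:~R * eps k - h| <= eps k.
      have e0 := eps0 k.
      have /andP[a1 a2] := floor_itv (s / eps k); have /andP[b1 b2] := floor_itv ((s + h) / eps k).
      rewrite -/(m s k) -/(m (s + h) k) in a1 a2 b1 b2.
      rewrite ler_pdivlMr// in a1; rewrite ltr_pdivrMr// intrD mulrDl mul1r in a2.
      rewrite ler_pdivlMr// in b1; rewrite ltr_pdivrMr// intrD mulrDl mul1r in b2.
      rewrite /j intrB mulrBl; move: ((m s k)%:~R * eps k) ((m (s + h) k)%:~R * eps k) a1 a2 b1 b2 => A1 A2 *.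
      rewrite ler_norml; apply/andP; split; lra.
    have j0 k : 0 <= j k.
      rewrite /j subr_ge0; apply: le_floor; rewrite ler_pM2r ?invr_gt0//; lra.
    have EE k : E (s + h) k = (E s k * y k ^+ `|j k|)%g.
      by rewrite /E -zpowD; congr (zpow _ _); have := j0 k; rewrite /j; lia.
    have jn k : (j k)%:~R = (`|j k|%N)%:R :> R by rewrite pmulrn gez0_abs.
    have jl : (fun k => (j k)%:~R * eps k) @ U --> h.
      move/cvgrPdist_le : (epsl) => epsl2; apply/cvgrPdist_le => e e0; have := epsl2 e e0.
      apply: filterS => k; rewrite sub0r normrN => ek; rewrite distrC; apply: le_trans (jh k) _.
      by apply: le_trans ek; exact: ler_norm.
    have lhs : (fun k => `|f (E (s + h) k) - f (E s k) - (j k)%:~R * eps k * D w f (E s k)|) @ U -->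
        `|f (gam (s + h)) - f (gam s) - h * D w f (gam s)|.
      apply: cvg_norm; apply: cvgB; first by apply: cvgB; apply: conv; exact: smooth_cont.
      by apply: cvgM => //; apply: conv; exact: smooth_cont.
    have rhs : (fun k => (j k)%:~R * eps k * eta + ((j k)%:~R * eps k) ^+ 2 * (L1 * W)) @ U -->
        h * eta + h ^+ 2 * (L1 * W).
      apply: cvgD; first by apply: cvgM => //; exact: cvg_cst.
      by apply: cvgM; last exact: cvg_cst; rewrite !expr2; apply: cvgM.
    apply: ler_cvg_to lhs rhs _.
    near=> k.
    have e0 := eps0 k.
    have yk : y k = chart_inv c (a + v k) by near: k.
    have n1 : forall x, `|f (x * chart_inv c (a + v k))%g - f x - D (v k *m B) f x| <= de * `|v k|.
      by near: k.
    have n2 : forall x, `|D w f (x * chart_inv c (a + v k))%g - D w f x| <= L1 * `|v k| by near: k.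
    have n3 : `|om - (eps k)^-1 *: v k| < de by near: k.
    have n4 : `|om - (eps k)^-1 *: v k| < 1 by near: k.
    have vE : v k = eps k *: ((eps k)^-1 *: v k) by rewrite scalerA mulfV ?scale1r// gt_eqF.
    have vW : `|v k| <= eps k * W.
      rewrite vE normrZ gtr0_norm// ler_pM2l//.
      have -> : (eps k)^-1 *: v k = om - (om - (eps k)^-1 *: v k) by rewrite opprB addrC subrK.
      by apply: le_trans (ler_normB _ _) _; rewrite lerD2l ltW.
    rewrite EE jn.
    pose F i := f (E s k * y k ^+ i)%g; pose g i := D w f (E s k * y k ^+ i)%g.
    have := @telescope_bound F g (eps k) eta (L1 * W) `|j k|%N (ltW e0) (ltW eta0).
    rewrite /F /g expg0 mulg1; apply.
    - by rewrite mulr_ge0// ltW.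
    - move=> i; rewrite expgSr mulgA; set x := (E s k * y k ^+ i)%g; rewrite yk.
      have -> : f (x * chart_inv c (a + v k))%g - f x - eps k * D w f x =
        (f (x * chart_inv c (a + v k))%g - f x - D (v k *m B) f x) + D ((v k - eps k *: om) *m B) f x.
        have -> : (v k - eps k *: om) *m B = (- eps k) *: w + v k *m B.
          by rewrite mulmxBl -scalemxAl scaleNr addrC.
        by rewrite frame_combo; ring.
      apply: le_trans (ler_normD _ _) _.
      have B2 : `|D ((v k - eps k *: om) *m B) f x| <= eps k * de * N * (n%:R * K).
        apply: le_trans (frame_bound _ (fun i => HK i x)) _.
        rewrite ler_wpM2r ?mulr_ge0//; apply: le_trans (mulmx_norm _ _) _.
        rewrite ler_wpM2r// {1}vE -scalerBr normrZ gtr0_norm// ler_pM2l//.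
        by rewrite distrC ltW.
      apply: le_trans (lerD (n1 x) B2) _.
      have B3 : de * `|v k| <= de * (eps k * W) by rewrite ler_wpM2l// ltW.
      apply: le_trans (lerD B3 (lexx _)) _.
      rewrite (_ : eps k * eta = eps k * (de * (W + N * (n%:R * K)))).
        by apply: le_of_eq; ring.
      by rewrite /de divfK// gt_eqF.
    - move=> i; rewrite expgSr mulgA; set x := (E s k * y k ^+ i)%g; rewrite yk; apply: le_trans (n2 _) _.
      by rewrite -mulrA [W * _]mulrC ler_wpM2l.
  apply/ler_addgt0Pr => e e0.
  apply: le_trans (bound (e / (h + 1)) _) _; first by rewrite divr_gt0// ltr_wpDl.
  rewrite addrC lerD2l mulrA ler_pdivrMr ?ltr_wpDl// mulrDr mulr1 mulrC lerDl ltW//.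
have gd f : smooth_fun f -> forall s : R, is_derive (s : R^o) 1 (f \o gam : R^o -> R^o) (D w f (gam s)).
  move=> sf s; have [L L0 HL] := step f sf.
  have sD := frame_smooth bX w sf; have [K K0 HK] := smooth_bounds sD.
  have [L' L'0 HL'] := step _ sD.
  pose K2 := `|w| * (n%:R * K).
  have K20 : 0 <= K2 by rewrite !mulr_ge0.
  apply: (@is_derive_of_quadratic R (f \o gam) s _ (L + K2 + L')) => h h1.
  have [h0|h0] := leP 0 h.
    apply: le_trans (HL s h h0) _; rewrite mulrC ler_wpM2r ?sqr_ge0// -addrA lerDl addr_ge0//.
  (* For negative [h] the number of steps would be negative. The estimate is applied forward from
     [s + h] instead, and the slope at [s + h] is compared with the one at [s]. *)
  pose s' := s + h; have h0' : 0 <= - h by lra.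
  have h1' : - h <= 1 by move: h1; rewrite ltr0_norm.
  have S1 := HL s' (- h) h0'; have S2 := HL' s' (- h) h0'.
  rewrite /s' addrK -/s' sqrrN in S1 S2.
  have S3 : `|D w (D w f) (gam s')| <= K2 := frame_bound _ (fun i => HK i (gam s')).
  have S4 : `|D w f (gam s) - D w f (gam s')| <= - h * (K2 + L').
    have -> : D w f (gam s) - D w f (gam s') =
      (D w f (gam s) - D w f (gam s') - - h * D w (D w f) (gam s')) + - h * D w (D w f) (gam s') by ring.
    apply: le_trans (ler_normD _ _) _; rewrite normrM (ger0_norm h0').
    have : h ^+ 2 * L' <= - h * L'.
      by rewrite ler_wpM2r// expr2 -mulrNN ler_piMl.
    have : - h * `|D w (D w f) (gam s')| <= - h * K2 by rewrite ler_wpM2l.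
    move: S2; rewrite mulrDr; lra.
  have -> : (f \o gam) (s + h) - (f \o gam) s - h * D w f (gam s) =
    - (f (gam s) - f (gam s') - - h * D w f (gam s')) - h * (D w f (gam s) - D w f (gam s')).
    rewrite /s' /=; ring.
  apply: le_trans (ler_normB _ _) _; rewrite normrN normrM (ltr0_norm h0).
  have S5 : - h * `|D w f (gam s) - D w f (gam s')| <= - h * (- h * (K2 + L')) by rewrite ler_wpM2l.
  apply: le_trans (lerD S1 S5) _.
  by apply: le_of_eq; ring.
exists gam.
  split; last exact: gd.
    have := Hg 0; rewrite (_ : E 0 = fun=> 1%g); last first.
      by apply/funext => k; rewrite /E /m mul0r floor0 /= expg0.
    by move=> h; apply: (cvg_unique _ h); [exact: lie_hausdorff|exact: cvg_cst].
  apply: smooth_cont_of => f sf s; have [ds _] := gd f sf s.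
  by apply/differentiable_continuous/derivable1_diffP.
move=> S cS HS s; apply: (closed_cvg S cS _ (gam s) (Hg s)).
by apply: nearW => k; exact: HS.
Unshelve. all: by end_near.
Qed.

End OneParameter.

Lemma cvg_seq_sum (R : realType) (T I : Type) (U : set_system T) (r : seq I) (h : I -> T -> R) (l : I -> R) :
  Filter U -> (forall i, h i @ U --> l i) ->
  (fun k => \sum_(i <- r) h i k) @ U --> \sum_(i <- r) l i.
Proof.
move=> FU H; elim: r => [|i r IH].
  by rewrite big_nil (_ : (fun _ => _) = fun=> 0); [exact: cvg_cst|apply/funext => k; rewrite big_nil].
rewrite big_cons (_ : (fun _ => _) = fun k => h i k + \sum_(j <- r) h j k); first exact: cvgD.
by apply/funext => k; rewrite big_cons.
Qed.

(** * Maximal tori and the centralizer of their Lie algebra *)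

Section Torus.
Context {R : realType} {n : nat} {G : lieGroupType R n}.
Local Notation C := R[i].
Context (X : 'I_n -> (G -> R) -> (G -> R)) (bX : lie_basis X) (cG : compact [set: G])
 (haar : probability (borel G) R) (haarP : haar_probability haar).
Local Notation D := (frame_vf X).
Local Notation br := (lie_bracket X).
Local Notation dp := (dp X).
Local Notation ops := (one_parameter_subgroup X).
Implicit Types (f : G -> R) (u v w : 'rV[R]_n).

(** Along such an ultrafilter every sequence in a compact space converges. A single one serves all
    times [s] at once, which a choice of subsequence for each time would not. *)
Lemma eventually_ultra : exists2 U : set_system nat, UltraFilter U & \oo `<=` U.
Proof. by have [U [uU sU]] := ultraFilterLemma (F := \oo) _; exists U. Qed.

Lemma ops_exists v : exists gam, ops v gam.
Proof.
have [c ac dc] := atlas_cover (1%g : G); have [B uB HB] := cdir_frame ac dc bX.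
have [U uU sU] := eventually_ultra; have pU : ProperFilter U by apply: ultra_proper.
(* [B] translates chart directions into coordinates in the basis [X], so the limit of the powers has
   direction [om *m B = v]. *)
pose om := v *m invmx B; pose eps (k : nat) : R := k.+1%:R^-1.
have epsl : eps @ U --> 0.
  by apply: cvg_trans (cvg_fmap2 sU) _; exact: cvg_harmonic.
have [gam og _] := @limit_ops _ _ _ X bX cG c ac dc B HB U
  (fun k => chart_inv c (chart_map c 1%g + eps k *: om)) (fun k => eps k *: om) eps om uU
  (fun k => ltac:(by rewrite /eps invr_gt0)) epsl
  ltac:(by rewrite -[X in _ --> X](scale0r om); apply: cvgZr_tmp) ltac:(by apply: nearW)
  ltac:(by apply: cvg_near_cst; apply: nearW => k; rewrite scalerA mulVf ?scale1r// /eps invr_eq0).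
by exists gam; move: og; rewrite /om mulmxKV.
Qed.

Lemma closed_commute d (p : G -> 'M[C]_d) (M : 'M[C]_d) : representation p ->
  closed [set x | p x *m M = M *m p x].
Proof.
move=> rp; have mc := rep_mcont rp.
have -> : [set x | p x *m M = M *m p x] =
    \bigcap_(q in [set: 'I_d * 'I_d]) ((fun x => complex.Re ((p x *m M - M *m p x) q.1 q.2)) @^-1` [set 0] `&`
      (fun x => complex.Im ((p x *m M - M *m p x) q.1 q.2)) @^-1` [set 0]).
  apply/seteqP; split=> x; first by move=> E q _ /=; rewrite E subrr mxE.
  move=> H; apply/eqP; rewrite -subr_eq0; apply/eqP/matrixP => i j; rewrite [RHS]mxE.
  by have [] := H (i, j) Logic.I => a b; apply: C_eq.
have cc i j : ccont (fun x => (p x *m M - M *m p x) i j).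
  have h1 := mcontM mc (mcont_cst _ M) i j; have h2 := mcontM (mcont_cst _ M) mc i j.
  apply: ccont_eq (ccontD h1 (ccontZ (-1) h2)) => x.
  by rewrite [RHS]mxE [X in _ = _ + X]mxE mulN1r.
apply: closed_bigI => q _; have [c1 c2] := cc q.1 q.2.
apply: closedI; apply: closed_comp => [x _|]; [exact: c1|exact: closed_eq|exact: c2|exact: closed_eq].
Qed.

Context (T : set G) (HT : maximal_torus T) (t : {vspace 'rV[R]_n}) (Ht : lie_algebra_of X T t).

Let T1e : T 1%g. Proof. by case: HT => -[]. Qed.
Let Tcpt : compact T. Proof. by case: HT => -[]. Qed.
Let TV x y : T x -> T y -> T (x * y^-1)%g. Proof. by case: HT => -[_ h _ _ _] _; exact: h. Qed.
Let TC x y : T x -> T y -> (x * y = y * x)%g. Proof. by case: HT => -[_ _ h _ _] _; exact: h. Qed.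
Let Tcon : connected T. Proof. by case: HT => -[]. Qed.
Let Tcl : closed T. Proof. by apply: compact_closed => //; exact: lie_hausdorff. Qed.

Lemma torus_comm v w : v \in t -> w \in t -> br v w = 0.
Proof.
move=> /Ht[g1 o1 T1] /Ht[g2 o2 T2]; apply: (ops_br0 bX cG haarP o1 o2) => s r.
exact: TC.
Qed.

Lemma sub_zpow (S : set G) x z : S 1%g -> (forall x y, S x -> S y -> S (x * y^-1)%g) ->
  S x -> S (zpow x z).
Proof.
move=> S1 SV Sx; have Vx y : S y -> S y^-1%g by move=> Sy; rewrite -[(y^-1)%g]mul1g; exact: SV.
have Sk k : S (x ^+ k)%g.
  elim: k => [|k IH]; first by rewrite expg0.
  by rewrite expgSr -[X in (_ * X)%g]invgK; apply: SV => //; exact: Vx.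
by case: z => k /=; [exact: Sk|exact/Vx/Sk].
Qed.

Lemma br0_dp v w d (p : G -> 'M[C]_d) : representation p -> br v w = 0 ->
  dp p v *m dp p w = dp p w *m dp p v.
Proof.
move=> rp E; apply/eqP; rewrite -subr_eq0 -(dp_bracket bX cG haarP rp) E; apply/eqP.
exact: dp0.
Qed.

Section Centralizer.
Context (v : 'rV[R]_n) (vt : forall w, w \in t -> br w v = 0).

(** The elements of the torus that fix [v] under the adjoint action, tested in the irreducible
    unitary representations. *)
Let T1 := [set x | T x /\ forall d (p : G -> 'M[C]_d), irr p ->
  unitary_rep p -> p x *m dp p v = dp p v *m p x].

Lemma fixing_closed : closed T1.
Proof.
apply/closure_id/seteqP; split; first exact: subset_closure.
move=> x cx; split.
  by apply: Tcl; apply: closureS cx => y [].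
move=> d p ip up; have [rp _] := up; have cl := closed_commute (M := dp p v) rp.
by apply: cl; apply: closureS cx => y [_ h]; exact: h.
Qed.

Lemma fixing1 : T1 1%g.
Proof. by split=> // d p ip [[p1 _ _] _]; rewrite p1 mul1mx mulmx1. Qed.

Lemma fixingV x y : T1 x -> T1 y -> T1 (x * y^-1)%g.
Proof.
move=> [Tx hx] [Ty hy]; split; first exact: TV.
move=> d p ip up; have [rp _] := up; have [_ pM _] := rp.
rewrite pM -mulmxA.
have -> : p y^-1%g *m dp p v = dp p v *m p y^-1%g.
  have := hy d p ip up; move: (rep_mulV y rp) (rep_Vmul y rp); move: (p y) (p y^-1%g) => A B E1 E2 E.
  by rewrite -[B *m _]mulmx1 -E1 !mulmxA -(mulmxA B) -E !mulmxA E2 mul1mx.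
by rewrite !mulmxA hx.
Qed.

(* By connectedness T has points outside T1 with phi < e; y minimizes phi over the
   T1-coset of such a point. *)
Lemma torus_critical (phi : G -> R) (e : R) : smooth_fun phi -> 0 < e ->
  (exists2 x, T x & ~ T1 x) -> phi 1%g = 0 ->
  exists y, [/\ T y, ~ T1 y, phi y < e & forall w, w \in t -> D w phi y = 0].
Proof.
move=> sphi e0 [x0 Tx0 nx0] phi1; have cphi := smooth_cont sphi.
have T1M x y : T1 x -> T1 y -> T1 (x * y)%g.
  move=> h1 h2; rewrite -[y]invgK; apply: fixingV => //; rewrite -[(y^-1)%g]mul1g; apply: fixingV => //; exact: fixing1.
have : exists x, [/\ T x, ~ T1 x & phi x < e].
  apply: contrapT => Hn; apply: nx0.
  suff -> : T1 = T by [].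
  apply: Tcon; first by exists 1%g; exact: fixing1.
    exists (\bigcup_(y in T1) [set x | phi (y^-1 * x)%g < e]).
      apply: bigcup_open => y _.
      have c : continuous (fun x => phi (y^-1 * x)%g).
        by move=> x; apply: continuous_comp; [exact: cont_lmul|exact: cphi].
      by apply: (open_comp (f := fun x => phi (y^-1 * x)%g) (D := [set r | r < e])) => [x _|]; [exact: c|exact: open_lt].
    apply/seteqP; split=> x.
      by move=> hx; split; [case: hx|exists x => //=; rewrite mulVg phi1].
    move=> [Tx [y hy /= hphi]]; have -> : x = (y * (y^-1 * x))%g by rewrite mulgA mulgV mul1g.
    apply: T1M => //; apply: contrapT => nh; apply: Hn; exists (y^-1 * x)%g; split => //.
    have -> : (y^-1 * x = x * y^-1)%g; last by apply: TV => //; case: hy.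
    apply: TC => //; rewrite -[(y^-1)%g]mul1g; apply: TV => //; by case: hy.
  by exists T1; [exact: fixing_closed|rewrite setIidr// => x []].
move=> [x [Tx nx phix]].
have T1cpt : compact T1 by apply: subclosed_compact fixing_closed cG _.
have T1n : T1 !=set0 by exists 1%g; exact: fixing1.
have [|z] := @compact_EVT_min _ R (fun z => phi (x * z)%g) T1 T1n T1cpt.
  by apply: continuous_subspaceT => z; apply: continuous_comp; [exact: cont_lmul|exact: cphi].
rewrite inE => zT1 zmin; exists (x * z)%g; split.
- rewrite -[z]invgK; apply: TV => //; rewrite -[(z^-1)%g]mul1g; apply: TV => //; by case: zT1.
- by move=> h; apply: nx; have := fixingV h zT1; rewrite mulgK.
- by apply: le_lt_trans (zmin 1%g _) _; [rewrite inE; exact: fixing1|rewrite mulg1].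
move=> w wt; have [gam og Tg] := (Ht w).1 wt; have [g0 _ gd] := og.
have T1g s : T1 (gam s).
  split; first exact: Tg.
  move=> d p ip up; apply: (ops_commute bX cG haarP s og up).
  by apply: br0_dp; [case: up|rewrite bracketC// vt// oppr0].
have dr (s : R) : is_derive (s : R^o) 1 ((fun q => phi (x * z * q)%g) \o gam : R^o -> R^o)
    (D w (fun q => phi (x * z * q)%g) (gam s)).
  by apply: gd; exact: smooth_lmul.
have m0 : is_derive (0 : R^o) 1 ((fun q => phi (x * z * q)%g) \o gam : R^o -> R^o) 0.
  apply: (@derive1_at_min R _ (-1) 1 0) => [||| s _].
  - lra.
  - by move=> s _; have [] := dr s.
  - by rewrite in_itv /=; lra.
  - rewrite /= g0 mulg1 -mulgA; apply: zmin; rewrite inE; exact: T1M.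
have := dr 0; rewrite g0 (frame_lmul bX)// mulg1 => dr0.
by rewrite -(@derive_val _ _ _ _ _ _ _ dr0) (@derive_val _ _ _ _ _ _ _ m0).
Qed.

(* At y_k -> 1 the t-derivatives of phi, the sum of the F_j ^+ 2, vanish. The limit
   direction w of the y_k lies in t and satisfies \sum_j (D_w F_j)^2 = 0 at 1, although F
   is an immersion there. *)
Lemma torus_fixes x d (p : G -> 'M[C]_d) : T x -> irr p ->
  unitary_rep p -> p x *m dp p v = dp p v *m p x.
Proof.
move=> Tx ip up; suff : T1 x by case=> _; apply.
apply: contrapT => nx.
have [c ac dc] := atlas_cover (1%g : G); have [B uB HB] := cdir_frame ac dc bX.
have [F [sF F1 F0 FD]] := coord_family ac dc.
have [ca ia] := dom_map ac dc; set a := chart_map c 1%g in ca ia.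
pose phi x := \sum_j F j x * F j x.
have sphi : smooth_fun phi by apply: smooth_sum => j _; exact: smoothM.
have phi1 : phi 1%g = 0 by apply: big1 => j _; rewrite F1 mul0r.
have ex (k : nat) := torus_critical sphi (e := k.+1%:R^-1) ltac:(by rewrite invr_gt0) (ex_intro2 _ _ x Tx nx) phi1.
have [y Hy] := choice ex.
have [U uU sU] := eventually_ultra; have pU : ProperFilter U by apply: ultra_proper.
have phiy : (fun k => phi (y k)) @ U --> 0.
  have h : (fun k : nat => k.+1%:R^-1 : R) @ U --> 0 by apply: cvg_trans (cvg_fmap2 sU) _; exact: cvg_harmonic.
  apply: (squeeze_cvgr _ (cvg_cst 0) h); apply: nearW => k; have [_ _ hk _] := Hy k.
  by apply/andP; split; [apply: sumr_ge0 => j _; rewrite -expr2 sqr_ge0|exact: ltW].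
have yl : y @ U --> (1%g : G).
  have := cG; rewrite compact_ultra => /(_ (y @ U) (ultra_fmap y uU) filterT) [g [_ hg]].
  suff <- : g = 1%g by [].
  have pg : phi g = 0.
    have cp : continuous phi := smooth_cont sphi.
    have h := cvg_comp _ _ hg (cp g).
    exact: (cvg_unique _ h phiy).
  apply: F0 => j; move: pg => /eqP; rewrite psumr_eq0 => [|i _]; last by rewrite -expr2 sqr_ge0.
  by move=> /allP/(_ j); rewrite mem_index_enum mulf_eq0 orbb => /(_ isT)/eqP.
pose vk k := chart_map c (y k) - a.
have vl : vk @ U --> (0 : 'rV[R]_n).
  rewrite -(subrr a); apply: cvgB; last exact: cvg_cst.
  exact: (cvg_comp _ _ yl (cont_map ac dc)).
have ndom : \forall k \near U, chart_dom c (y k) by exact: (yl _ (near_dom ac dc)).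
have yE : \forall k \near U, y k = chart_inv c (a + vk k).
  apply: filterS ndom => k dk; have [_ <-] := dom_map ac dk.
  by rewrite /vk addrC subrK; have [_ ->] := dom_map ac dk.
have v0 : \forall k \near U, vk k != 0.
  apply: filterS yE => k Ek; apply/eqP => E; have [_ + _ _] := Hy k; apply.
  by rewrite Ek E addr0 ia; exact: fixing1.
(* The first branch only keeps [eps] positive. Eventually [vk k] is nonzero, since the identity
   belongs to [T1] and [y k] does not. *)
pose eps k := if vk k == 0 then k.+1%:R^-1 else `|vk k|.
have eps0 k : 0 < eps k by rewrite /eps; case: eqP => // /eqP; rewrite normr_gt0.
have epsE : \forall k \near U, eps k = `|vk k| by apply: filterS v0 => k /negPf h; rewrite /eps h.
have epsl : eps @ U --> 0.
  have h : (fun k => `|vk k|) @ U --> 0 by rewrite -(@normr0 _ 'rV[R]_n); exact: cvg_norm.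
  by apply: cvg_trans h; apply: near_eq_cvg; apply: filterS epsE.
pose wk k := (eps k)^-1 *: vk k.
have nw : \forall k \near U, `|wk k| = 1.
  near=> k; have v0k : vk k != 0 by near: k.
  have ek : eps k = `|vk k| by near: k.
  by rewrite /wk ek normrZ normfV normr_id mulVf// normr_eq0.
have [om [_ oml]] : [set u | `|u - 0| <= 1 :> R] `&` [set q | wk @ U --> q] !=set0.
  have := @compact_cube R n 0 1 ler01; rewrite compact_ultra; apply; first exact: ultra_fmap.
  by apply: filterS nw => k /= h; rewrite subr0 h.
have om1 : `|om| = 1.
  have h1 : (fun k => `|wk k|) @ U --> `|om| by exact: (cvg_norm oml).
  have h2 : (fun k => `|wk k|) @ U --> (1 : R) by apply: cvg_near_cst.
  by apply: (cvg_unique _ h1 h2).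
have [gam og Hgam] := limit_ops bX cG ac dc HB uU eps0 epsl vl yE oml.
have wt : om *m B \in t.
  apply/Ht; exists gam => // s; apply: Hgam => // k z; apply: sub_zpow => //.
  by have [] := Hy k.
set w := om *m B in wt.
have lim j : (fun k => F j (y k) / eps k) @ U --> D w (F j) 1%g.
  have l2 : (fun k => D (wk k *m B) (F j) 1%g) @ U --> D w (F j) 1%g.
    rewrite -HB// (cdir_lin ac dc)//.
    have -> : (fun k => D (wk k *m B) (F j) 1%g) =
        (fun k => \sum_i wk k 0 i * cdir c 'e_i (F j) 1%g).
      by apply/funext => k; rewrite -HB// (cdir_lin ac dc).
    apply: cvg_seq_sum => i; apply: cvgM; last exact: cvg_cst.
    exact: (cvg_comp _ _ oml (@coord_continuous _ _ _ 0 i _)).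
  suff l1 : (fun k => F j (y k) / eps k - D (wk k *m B) (F j) 1%g) @ U --> 0.
    have l3 : (fun k => (F j (y k) / eps k - D (wk k *m B) (F j) 1%g) + D (wk k *m B) (F j) 1%g) @ U -->
        0 + D w (F j) 1%g by exact: cvgD.
    rewrite add0r in l3; rewrite (_ : (fun k => F j (y k) / eps k) = (fun k =>
        (F j (y k) / eps k - D (wk k *m B) (F j) 1%g) + D (wk k *m B) (F j) 1%g))//.
    by apply/funext => k; rewrite subrK.
  apply/cvgr0Pnorm_le => e e0.
  have := vl _ (first_order bX cG ac dc HB (sF j) e0) => nf.
  near=> k; have ek : eps k = `|vk k| by near: k.
  have yk : y k = chart_inv c (a + vk k) by near: k.
  have : forall x, `|F j (x * chart_inv c (a + vk k))%g - F j x - D (vk k *m B) (F j) x| <= e * `|vk k|.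
    by near: k.
  move=> /(_ 1%g); rewrite mul1g -yk F1 subr0 -ek => h.
  have e0k := eps0 k.
  have -> : F j (y k) / eps k - D (wk k *m B) (F j) 1%g = (F j (y k) - D (vk k *m B) (F j) 1%g) / eps k.
    rewrite mulrBl; congr (_ - _); rewrite /wk -scalemxAl -[_ *: _]addr0 frame_combo mulrC.
    by rewrite [X in _ + X]big1 ?addr0// => i _; rewrite mxE mul0r.
  by rewrite normrM normfV (gtr0_norm e0k) ler_pdivrMr.
have lim2 j : (fun k => D w (F j) (y k)) @ U --> D w (F j) 1%g.
  apply: cvg_comp yl _; apply: smooth_cont; exact: frame_smooth.
have tot : (fun k => \sum_j F j (y k) / eps k * D w (F j) (y k)) @ U --> \sum_j D w (F j) 1%g * D w (F j) 1%g.
  by apply: cvg_seq_sum => j; exact: cvgM.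
have Dphi z : D w phi z = 2 * \sum_j F j z * D w (F j) z.
  have S (l : seq (option 'I_n)) : D w (fun x => \sum_(j <- l) F j x * F j x) z = 2 * \sum_(j <- l) F j z * D w (F j) z.
    elim: l => [|j l IH].
      rewrite big_nil mulr0 -[RHS](congr1 (fun f => f z) (frame_cst bX w 0)); congr (D w _ z).
      by apply/funext => q; rewrite big_nil.
    have -> : (fun x => \sum_(i <- j :: l) F i x * F i x) = (fun x => F j x * F j x + \sum_(i <- l) F i x * F i x).
      by apply/funext => q; rewrite big_cons.
    rewrite (frame_add bX) ?IH ?(frame_mul bX) ?big_cons//; first by ring.
      exact: smoothM.
    by apply: smooth_sum => i _; exact: smoothM.
  exact: S.
have z0 k : \sum_j F j (y k) / eps k * D w (F j) (y k) = 0.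
  have [_ _ _ /(_ w wt)] := Hy k; rewrite Dphi => h.
  have -> : \sum_j F j (y k) / eps k * D w (F j) (y k) = (eps k)^-1 * \sum_j F j (y k) * D w (F j) (y k).
    by rewrite mulr_sumr; apply: eq_bigr => j _; ring.
  by move/eqP: h; rewrite mulf_eq0 pnatr_eq0 /= => /eqP ->; rewrite mulr0.
have : \sum_j D w (F j) 1%g * D w (F j) 1%g = 0.
  have tot0 : (fun k => \sum_j F j (y k) / eps k * D w (F j) (y k)) @ U --> (0 : R).
    by apply: cvg_near_cst; exact: nearW.
  by apply: (cvg_unique _ tot tot0).
move=> /eqP; rewrite psumr_eq0 => [|i _]; last by rewrite -expr2 sqr_ge0.
move=> /allP H; have om0 : om = 0.
  apply: FD => j; rewrite HB//; have := H j; rewrite mem_index_enum mulf_eq0 orbb.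
  by move=> /(_ isT)/eqP.
by move/eqP: om1; rewrite om0 normr0 eq_sym oner_eq0.
Unshelve. all: by end_near.
Qed.

End Centralizer.

Lemma commutant_closed (q : G) : closed [set z | (z * q = q * z)%g].
Proof.
have -> : [set z | (z * q = q * z)%g] = (fun z => (z * q * (q * z)^-1)%g) @^-1` [set 1%g].
  apply/seteqP; split=> z /= E; first by rewrite E mulgV.
  by have := congr1 (fun r => r * (q * z))%g E; rewrite mulgVK mul1g.
apply: closed_comp => [z _|]; last first.
  by apply: accessible_closed_set1; apply: hausdorff_accessible; exact: lie_hausdorff.
apply: contmul; first exact: cont_rmul.
by apply: continv; exact: cont_lmul.
Qed.

(** The one-parameter subgroup of [v] commutes with the torus by [torus_fixes]. The closure of their
    product is again a torus, so by maximality it is [T], and the subgroup lies in it. *)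
Lemma torus_self_centralizing v : (forall w, w \in t -> br w v = 0) -> v \in t.
Proof.
move=> vt; have [gam og] := ops_exists v; apply/Ht; exists gam => //.
have [g0 gc _] := og.
have cm s x : T x -> (gam s * x = x * gam s)%g.
  move=> Tx; set y := (gam s * x)%g; set z := (x * _)%g.
  suff : (y * z^-1 = 1)%g by move=> /(congr1 (fun q => q * z)%g); rewrite mulgVK mul1g.
  apply: (rep_faithful cG haarP) => d p ip up; have [rp _] := up; have [_ pM _] := rp.
  have E : p y = p z.
    rewrite /y /z !pM; apply: (ops_commute bX cG haarP s og up).
    by apply: (torus_fixes vt Tx ip up).
  by rewrite pM E rep_mulV.
have gadd s r := ops_add bX cG haarP s r og.
have ginv s : ((gam s)^-1 = gam (- s))%g.
  have := gadd s (- s); rewrite subrr g0 => E.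
  by rewrite -[LHS]mulg1 E mulKg.
pose S := [set (x * gam s)%g | x in T & s in [set: R]].
have ST x : T x -> S x by move=> Tx; exists x => //; exists 0 => //; rewrite g0 mulg1.
have SV x y : S x -> S y -> S (x * y^-1)%g.
  move=> [x1 Tx1 [s1 _ <-]] [x2 Tx2 [s2 _ <-]]; exists (x1 * x2^-1)%g; first exact: TV.
  exists (s1 - s2) => //; rewrite gadd invgM -ginv.
  have Tv : T (x2^-1)%g by rewrite -[(x2^-1)%g]mul1g; exact: TV.
  by rewrite ginv (cm _ _ Tv) !mulgA -(mulgA x1 (gam s1)) cm// !mulgA.
have SC x y : S x -> S y -> (x * y = y * x)%g.
  move=> [x1 Tx1 [s1 _ <-]] [x2 Tx2 [s2 _ <-]].
  rewrite !mulgA -(mulgA x1) cm// -(mulgA x2) cm// !mulgA (TC Tx1 Tx2) -!mulgA.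
  by rewrite -!gadd addrC.
(* [S] is a union of connected sets containing the torus: each is [T] together with one translate of
   the curve that meets it. *)
have Scon : connected S.
  have -> : S = \bigcup_(x in T) (T `|` [set (x * gam s)%g | s in [set: R]]).
    apply/seteqP; split=> q; first by move=> [x Tx [s _ <-]]; exists x => //; right; exists s.
    move=> [x Tx [/ST //|[s _ <-]]]; by exists x => //; exists s.
  apply: bigcup_connected; first by exists 1%g => x Tx; left.
  move=> x Tx; apply: connectedU => //; first by exists x; split=> //; exists 0; rewrite// g0 mulg1.
  apply: connected_continuous_connected; last first.
    by apply: continuous_subspaceT => s; apply: continuous_comp; [exact: gc|exact: cont_lmul].
  have -> : [set: R] = [set` `]-oo, +oo[ ] by rewrite set_itvE.
  exact/connected_intervalP/interval_is_interval.
have [_ mx] := HT; have E : closure S = T; last first.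
  by move=> s; rewrite -E; apply: subset_closure; exists 1%g => //; exists s; rewrite// mul1g.
apply: mx; last by move=> x /ST; exact: subset_closure.
split.
- by apply: subset_closure; exact: ST.
- move=> x y cx cy A nA.
  have c : {for (x, y), continuous (fun q : G * G => (q.1 * q.2^-1)%g)}.
    apply: (contmul (f := fst) (h := fun q : G * G => (q.2^-1)%g)); first exact: cont1.
    by apply: continv; exact: cont2.
  have [[P Q] /= [nP nQ] PQ] := c _ nA.
  have [x' [Sx' Px']] := cx _ nP; have [y' [Sy' Qy']] := cy _ nQ.
  by exists (x' * y'^-1)%g; split; [exact: SV|apply: (PQ (x', y'))].
- move=> x y cx cy.
  have clos1 q : S q -> closure S `<=` [set z | (z * q = q * z)%g].
    move=> Sq; rewrite ((closure_id _).1 (@commutant_closed q)); apply: closureS => z Sz; exact: SC.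
  suff : [set z | (z * x = x * z)%g] y by move=> /= ->.
  rewrite ((closure_id _).1 (@commutant_closed x)); apply: closureS cy => z Sz.
  by have /= -> := clos1 z Sz x cx.
- by apply: subclosed_compact cG _; first exact: closed_closure.
- exact: connected_closure.
Qed.

End Torus.

(** * Dictionary between the linear forms of the statement and vectors of [t] *)

Section Dictionary.
Context {R : realType} {n : nat} {G : lieGroupType R n}.
Local Notation C := R[i].
Local Notation iC := (Complex 0 1 : C).
Context (X : 'I_n -> (G -> R) -> (G -> R)) (bX : lie_basis X)
 (oX : forall i j : 'I_n, lie_inner X 'e_i 'e_j = (i == j)%:R) (cG : compact [set: G])
 (haar : probability (borel G) R) (haarP : haar_probability haar) (cn : connected [set: G])
 (T : set G) (HT : maximal_torus T) (t : {vspace 'rV[R]_n}) (Ht : lie_algebra_of X T t).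
Local Notation br := (lie_bracket X).
Local Notation dp := (dp X).
Local Notation rv := (rv X t).
Local Notation rt := (rt X t).
Local Notation wv := (wv t).
Implicit Types (la mu al : dual t) (a b : 'rV[R]_n).

Definition vec la : 'rV[R]_n := vsval (sharp X la).

Lemma dot_inj a b : a \in t -> b \in t -> (forall H, H \in t -> dot a H = dot b H) -> a = b.
Proof.
move=> at_ bt E; apply/eqP; rewrite -subr_eq0 -dot_eq0 dotDl dotNl E ?subrr//.
exact: memvB.
Qed.

Lemma vec_t la : vec la \in t.
Proof. exact: subvsP. Qed.

Lemma vecE la (H : subvs_of t) : la H = dot (vec la) (vsval H).
Proof.
have [a at_ Ha] : exists2 a, a \in t & forall H, H \in t -> la (vsproj t H) = dot a H.
  apply: riesz_on => c v w _ _; by rewrite !linearP.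
have := @xgetPex _ (0 : subvs_of t) [set h | forall x : subvs_of t, la x = lie_inner X (vsval h) (vsval x)].
rewrite /vec /sharp => ->; first by rewrite (inner_dot bX oX).
exists (vsproj t a) => x /=; rewrite (inner_dot bX oX) vsprojK// -Ha ?subvsP//.
by rewrite vsvalK.
Qed.

Lemma vecP la a : a \in t -> (forall H : subvs_of t, la H = dot a (vsval H)) -> vec la = a.
Proof.
move=> at_ E; apply: dot_inj => // [|H Ht']; first exact: vec_t.
by have := vecE la (vsproj t H); rewrite vsprojK// => <-; rewrite E vsprojK.
Qed.

Lemma vec_inj la mu : vec la = vec mu -> la = mu.
Proof. by move=> E; apply/lfunP => H; rewrite !vecE E. Qed.

Lemma vecD la mu : vec (la + mu) = vec la + vec mu.
Proof.
by apply: vecP => [|H]; [apply: memvD; exact: vec_t|rewrite add_lfunE dotDl !vecE].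
Qed.

Lemma vecN la : vec (- la) = - vec la.
Proof. by apply: vecP => [|H]; [rewrite memvN; exact: vec_t|rewrite opp_lfunE dotNl !vecE]. Qed.

Lemma vec0 : vec 0 = 0.
Proof. by apply: vecP => [|H]; [exact: mem0v|rewrite zero_lfunE dot0l]. Qed.

Lemma vecZ (c : R) la : vec (c *: la) = c *: vec la.
Proof. by apply: vecP => [|H]; [apply: memvZ; exact: vec_t|rewrite scale_lfunE dotZl !vecE]. Qed.

Lemma vec_sum (I : Type) (r : seq I) (F : I -> dual t) : vec (\sum_(i <- r) F i) = \sum_(i <- r) vec (F i).
Proof. by elim: r => [|i r IH]; rewrite ?big_nil ?vec0// !big_cons vecD IH. Qed.

Lemma vec_surj a : a \in t -> exists la, vec la = a.
Proof.
move=> at_; pose h (H : subvs_of t) : R^o := dot a (vsval H).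
have hl : linear h by move=> c u v; rewrite /h linearP /= dotDr dotZr.
pose hh := HB.pack h (GRing.isLinear.Build _ _ _ _ h hl) : {linear subvs_of t -> R^o}.
by exists (linfun hh); apply: vecP => // H; rewrite lfunE.
Qed.

Lemma dual_inner_dot la mu : dual_inner X la mu = dot (vec la) (vec mu).
Proof. exact: inner_dot. Qed.

Let tcomm : forall v w, v \in t -> w \in t -> br v w = 0.
Proof. by move=> v w; exact: (torus_comm bX cG haarP HT Ht). Qed.
Let tcent : forall v, (forall w, w \in t -> br w v = 0) -> v \in t.
Proof. exact: (torus_self_centralizing bX cG haarP HT Ht). Qed.

Lemma root_rt al : is_root X al <-> rt (vec al).
Proof.
have E (Z : 'rV[C]_n) : (forall H : subvs_of t,
    Z *m tv (ad_mx X (vsval H)) = (0 +i* al H)%C *: Z) <-> rv (vec al) Z.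
  have ic (c : R) : iC * toC c = Complex 0 c.
    by apply: C_eq; rewrite ?ReM ?ImM /=; ring.
  split=> h H => [Ht'|].
    have := h (vsproj t H); rewrite vsprojK// vecE vsprojK// -(adC_real bX) => hh.
    by rewrite /brC hh ic.
  by have := h (vsval H) (subvsP H); rewrite /brC (adC_real bX) ic -vecE.
split=> [[a0 [Z Z0 hZ]]|[at_ a0 [Z Z1 hZ]]].
  apply: (rt_of (vec_t al) _ Z0); last exact/E.
  by apply: contra a0 => /eqP h; apply/eqP/vec_inj; rewrite h vec0.
split; first by apply: contra a0 => /eqP ->; rewrite vec0.
exists Z; last exact/E.
by apply/eqP => h; move: Z1; rewrite h cdot0l => /eqP; rewrite eq_sym oner_eq0.
Qed.

Lemma weight_wv d (p : G -> 'M[C]_d) la : representation p ->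
  is_weight X p la <-> exists2 x : 'cV[C]_d, x != 0 & wv (dp p) (vec la) x.
Proof.
move=> rp; split=> [[x x0 hx]|[x x0 hx]]; exists x => //.
  move=> H Ht'; have [gam og] := ops_exists bX cG H.
  apply/(ops_weight bX cG haarP _ _ og rp) => s.
  (* The definition of a weight speaks only of time 1; applied to [s *: H] it gives the action at
     time [s]. *)
  have og' : one_parameter_subgroup X (vsval (vsproj t (s *: H))) (fun r => gam (s * r)).
    rewrite vsprojK ?memvZ//; exact: ops_scale.
  have := hx _ _ og'; rewrite mulr1 vecE vsprojK ?memvZ// dotZr mulrC.
  by move=> ->.
move=> H gam og; have := (ops_weight bX cG haarP x (dot (vec la) (vsval H)) og rp).2 (hx _ (subvsP H)) 1.
by move=> ->; rewrite /cis mulr1 vecE.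
Qed.

Lemma weight_conj d (p q : G -> 'M[C]_d) (S : 'M[C]_d) la : S \in unitmx ->
  (forall x, q x = S *m p x *m invmx S) -> is_weight X p la -> is_weight X q la.
Proof.
move=> uS E [x x0 hx]; exists (S *m x).
  by apply: contra x0 => /eqP h; rewrite -[x](mulKmx uS) h mulmx0.
by move=> H gam og; rewrite E -!mulmxA mulKmx// (hx _ _ og) -scalemxAr.
Qed.

Context (Sigma : set (dual t)) (HSigma : positive_roots X Sigma).

Definition posv a := exists2 al, Sigma al & vec al = a.

Let pos_rt : forall a, posv a -> rt a.
Proof. by move=> a [al Sal <-]; apply/root_rt; case: HSigma => h _ _ _; exact: h. Qed.
Let pos_or : forall a, rt a -> posv a \/ posv (- a).
Proof.
move=> a ra; have [at_ _ _] := ra; have [al E] := vec_surj at_; rewrite -E in ra *.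
case: HSigma => _ h _ _; have [h1|h1] := h al ((root_rt al).2 ra); first by left; exists al.
by right; exists (- al); rewrite// vecN.
Qed.
Let pos_anti : forall a, posv a -> ~ posv (- a).
Proof.
move=> a [al Sal <-] [be Sbe]; rewrite -vecN => /vec_inj E.
by case: HSigma => _ _ h _; apply: (h al) => //; rewrite -E.
Qed.
Let pos_add : forall a b, posv a -> posv b -> rt (a + b) -> posv (a + b).
Proof.
move=> a b [al Sal <-] [be Sbe <-]; rewrite -vecD => /root_rt ra.
by exists (al + be) => //; case: HSigma => _ _ _; apply.
Qed.

Local Notation hvec := (highest_vec X t posv).

Lemma root_basis : exists (P : 'M[C]_n) (av : 'I_n -> 'rV[R]_n),
  P \is unitarymx /\ forall k, av k \in t /\ rv (av k) (row k P).
Proof.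
have [P [av [uP HP]]] := weight_basis tcomm (adrep bX oX).
exists P, av; split => // k; have [kt hk] := HP k; split => //; exact/(wv_ad bX).
Qed.

(** The set of positive roots is finite because every root occurs among the weights of the adjoint
    representation. The last clause makes sums over it computable in any weight basis. *)
Lemma Sigma_seq : exists l : seq (dual t), [/\ uniq l, forall al, al \in l <-> Sigma al &
  forall (P : 'M[C]_n) av, P \is unitarymx -> (forall k, av k \in t /\ rv (av k) (row k P)) ->
  perm_eq (map vec l) (pos_seq posv av)].
Proof.
have [P [av [uP HP]]] := root_basis.
have mem := mem_pos_seq bX oX pos_rt uP HP.
have ex a : exists la, posv a -> Sigma la /\ vec la = a.
  by have [[al h1 h2]|np] := pselect (posv a); [exists al|exists 0].
have [g Hg] := choice ex.
pose l := map g (pos_seq posv av).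
have vl : map vec l = pos_seq posv av.
  rewrite /l -map_comp -[RHS]map_id; apply/eq_in_map => a /mem/Hg[_ E]//.
have ml al : al \in l <-> Sigma al.
  split=> [/mapP[a /mem/Hg[h _] -> //]|h]; apply/mapP; exists (vec al); first by apply/mem; exists al.
  by apply: vec_inj; have [_ ->] := Hg (vec al) (ex_intro2 _ _ al h erefl).
exists l; split => //.
  by apply: (map_uniq (f := vec)); rewrite vl; exact: (pos_seq_uniq bX oX tcent pos_rt uP HP).
move=> P' av' uP' HP'; rewrite vl; apply: uniq_perm.
- exact: (pos_seq_uniq bX oX tcent pos_rt uP HP).
- exact: (pos_seq_uniq bX oX tcent pos_rt uP' HP').
have mem' := mem_pos_seq bX oX pos_rt uP' HP'.
by move=> a; apply/idP/idP => h; [exact/mem'/mem|exact/mem/mem'].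
Qed.

Lemma fsum_Sigma (V : nmodType) (l : seq (dual t)) (F : dual t -> V) : uniq l ->
  (forall al, al \in l <-> Sigma al) -> \sum_(al \in Sigma) F al = \sum_(al <- l) F al.
Proof.
move=> ul ml; have E : Sigma = [set` l] by apply/seteqP; split=> al /ml.
by rewrite [in LHS]E -fsbig_seq.
Qed.

(** Bridges two encodings of nonnegative integral combinations: lists with repetition, suited to
    merging roots, and multiplicity functions. *)
Lemma psum_mult (l : seq (dual t)) mu : uniq l -> (forall al, al \in l <-> Sigma al) ->
  psum posv (vec mu) <-> exists m : dual t -> nat, mu = \sum_(al \in Sigma) (al *+ m al).
Proof.
move=> ul ml; split=> [[L pL E]|[m ->]]; last first.
  rewrite (fsum_Sigma _ ul ml) vec_sum.
  have : forall al, al \in l -> Sigma al by move=> al /ml.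
  elim: l {ul ml} => [|al l IH] hl; first by rewrite big_nil; exact: psum0.
  rewrite big_cons; apply: psumD; last by apply: IH => be bl; apply: hl; rewrite inE bl orbT.
  have Sal : Sigma al by apply: hl; rewrite mem_head.
  elim: (m al) => [|k IHk]; first by rewrite mulr0n vec0; exact: psum0.
  by rewrite mulrS vecD; apply: psumD IHk; apply: psum_pos; exists al.
have [m Hm] : exists m : dual t -> nat, mu = \sum_(al <- l) (al *+ m al).
  elim: L mu pL E => [|b L IH] mu pL E.
    have -> : mu = 0 by apply: vec_inj; rewrite E big_nil vec0.
    by exists (fun=> 0%N); rewrite big1// => al _; rewrite mulr0n.
  have [al Sal Eb] := pL b (mem_head _ _).
  have [m Hm] := IH (mu - al) (fun c cL => pL c (ltac:(by rewrite inE cL orbT)))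
    ltac:(by rewrite vecD vecN E big_cons Eb addrC addrA addNr add0r).
  exists (fun be => (m be + (be == al))%N).
  rewrite -[mu](subrK al) Hm; under [RHS]eq_bigr do rewrite mulrnDr.
  rewrite big_split /=; congr (_ + _).
  rewrite (bigD1_seq al)//=; last exact/ml.
  by rewrite eqxx big1 ?addr0// => be /negPf ->.
by exists m; rewrite (fsum_Sigma _ ul ml).
Qed.

(** A raised vector, if nonzero, would have weight [la + al], so that [- al] would be a sum of
    positive roots. Conversely, all weights of the representation spanned by lowering words lie
    below [la]. *)
Lemma highest_hvec d (p : G -> 'M[C]_d) la : unitary_rep p -> irr p ->
  highest_weight X Sigma p la <-> exists x, hvec (dp p) (vec la) x.
Proof.
move=> up ip; have [rp _] := up; have [l [ul ml _]] := Sigma_seq.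
have [P [av [uP HP]]] := root_basis.
split=> [[wla Hmu]|[x hx]].
  have [x x0 hx] := (weight_wv la rp).1 wla; exists x; split => //; first exact: vec_t.
  move=> a Z pa hZ; apply/eqP/negPn/negP => n0; have [al Sal Ea] := pa.
  have hw := wv_act bX (dp_lie_rep bX cG haarP up) hZ hx.
  have : is_weight X p (la + al) by apply/(weight_wv _ rp); exists (cext (dp p) Z *m x); rewrite// vecD Ea.
  move=> /Hmu/(psum_mult _ ul ml).2; rewrite opprD addrA subrr add0r vecN Ea => ps.
  by have := psum_neq0 bX oX tcent pos_rt pos_anti pos_add pa ps; rewrite subrr eqxx.
have [x0 _ hw _] := hx; split; first by apply/(weight_wv _ rp); exists x.
move=> mu /(weight_wv _ rp)[y y0 hy]; apply/(psum_mult _ ul ml); rewrite vecD vecN.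
exact: (highest_le bX cG haarP cn tcent pos_rt pos_or uP HP up ip hx (vec_t mu) y0 hy).
Qed.

Lemma highest_conj d (p q : G -> 'M[C]_d) (S : 'M[C]_d) la : S \in unitmx ->
  (forall x, q x = S *m p x *m invmx S) -> highest_weight X Sigma p la -> highest_weight X Sigma q la.
Proof.
move=> uS E [w Hmu]; split; first exact: weight_conj uS E w.
move=> mu wm; apply: Hmu; apply: (weight_conj (S := invmx S)) wm; rewrite ?unitmx_inv// => x.
by rewrite invmxK E !mulmxA mulVmx// mul1mx -mulmxA mulVmx// mulmx1.
Qed.

Lemma unitary_model d (p : G -> 'M[C]_d) : irr p ->
  exists q : G -> 'M[C]_d, [/\ unitary_rep q, irr q,
  forall x, \tr (q x) = \tr (p x) &
  forall la, highest_weight X Sigma p la -> highest_weight X Sigma q la].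
Proof.
move=> ip; have [rp _ _] := ip; have [S uS up] := unitarize cG haarP rp.
exists (fun x => S *m p x *m invmx S); split => //.
- exact: irr_conj.
- by move=> x; rewrite mxtrace_mulC mulmxA mulVmx// mul1mx.
- by move=> la; exact: (highest_conj uS).
Qed.

Definition casimir_value la : R := dual_normsq X (la + rho Sigma) - dual_normsq X (rho Sigma).

Lemma casimir_valueE d (p : G -> 'M[C]_d) la : unitary_rep p -> irr p ->
  highest_weight X Sigma p la ->
  0 <= casimir_value la /\ casimir X p = (- toC (casimir_value la))%:M.
Proof.
move=> up ip /(highest_hvec la up ip)[x hx]; have [rp _] := up.
have [c c0 Hc] := casimir_scalar bX oX cG haarP cn rp up ip.
suff -> : casimir_value la = c by [].
have [P [av [uP HP]]] := root_basis; have [l [ul ml pl]] := Sigma_seq.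
rewrite (highest_casimir bX oX cG haarP tcomm tcent pos_rt pos_or pos_anti uP HP up hx Hc).
rewrite -(perm_big _ (pl P av uP HP)) big_map.
have -> : \sum_(al <- l) dot (vec la) (vec al) = 2 * dot (vec la) (vec (rho Sigma)).
  rewrite /rho vecZ (fsum_Sigma _ ul ml) vec_sum dotZr mulrA divff// mul1r dotC dot_suml.
  by apply: eq_bigr => al _; rewrite dotC.
rewrite /casimir_value /dual_normsq !dual_inner_dot vecD !dotDl !dotDr (dotC (vec (rho Sigma)) (vec la)).
ring.
Qed.

Lemma highest_weight_uniq d (p : G -> 'M[C]_d) la mu : unitary_rep p -> irr p ->
  highest_weight X Sigma p la -> highest_weight X Sigma p mu -> la = mu.
Proof.
move=> up ip [w1 h1] [w2 h2]; have [l [ul ml _]] := Sigma_seq.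
have /(psum_mult _ ul ml).2 p1 := h1 _ w2; have /(psum_mult _ ul ml).2 p2 := h2 _ w1.
apply: vec_inj; apply/eqP; rewrite -subr_eq0 -vecN -vecD; apply/eqP.
apply: (psum_anti bX oX tcent pos_rt pos_anti pos_add p1 p2).
by rewrite -vecD addrA subrK subrr vec0.
Qed.

Local Notation idim := (irrep_dim X Sigma).
Local Notation ichar := (irrep_char X Sigma).

(** The series sees a representation only through its dimension and character, so the chosen one may
    be replaced by a unitary conjugate. *)
Lemma irrep_cases la : idim la = 0%N \/
  exists p : G -> 'M[C]_(idim la), [/\ unitary_rep p, irr p,
  highest_weight X Sigma p la & forall g, \tr (p g) = ichar la g].
Proof.
rewrite /irrep_dim /irrep_char /irrep; case: pselect => [ex|nex]; last by left.
right; case: (cid ex) => -[d p] /= [ip hw].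
by have [q [uq iq tq hq]] := unitary_model ip; exists q; split => //; exact: hq.
Qed.

Lemma irrep_distinct la mu (p : G -> 'M[C]_(idim la)) (q : G -> 'M[C]_(idim mu)) M :
  unitary_rep p -> unitary_rep q ->
  irr p -> irr q ->
  highest_weight X Sigma p la -> highest_weight X Sigma q mu -> la != mu ->
  intertwines p q M -> M = 0.
Proof.
move: (idim la) (idim mu) p q M => d1 d2 p q M up uq ip iq hp hq ne iM.
apply/eqP/negPn/negP => M0; case/eqP: ne; have [E rM] := schur ip iq iM M0.
move: E q uq iq hq M iM rM {M0}; case: d2 / => q uq iq hq M iM rM.
have uM : M \in unitmx by rewrite -row_full_unit /row_full rM.
apply: (highest_weight_uniq uq iq) hq; apply: (highest_conj uM) hp => x.
by rewrite iM mulmxK.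
Qed.

(** A highest vector exists and its weight is dominant by the sl2 argument. The representation
    chosen for that weight may differ from [p], but it has the same character by uniqueness. *)
Lemma irrep_complete d (p : G -> 'M[C]_d) : unitary_rep p -> irr p ->
  exists la, [/\ dominant_integral X Sigma la, idim la = d, forall g, \tr (p g) = ichar la g &
  casimir X p = (- toC (casimir_value la))%:M].
Proof.
move=> up ip; have [rp d0 _] := ip.
have [a [x hx]] := exists_highest bX oX tcomm tcent pos_rt pos_anti pos_add (dp_lie_rep bX cG haarP up) d0.
have [_ at_ _ _] := hx; have [la Ela] := vec_surj at_; rewrite -{a}Ela in hx at_.
have hw : highest_weight X Sigma p la by apply/highest_hvec => //; exists x.
have [E0|[q [uq iq hq tq]]] := irrep_cases la.
  exfalso; move: E0; rewrite /irrep_dim /irrep; case: pselect => [ex|nex _].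
    by case: (cid ex) => -[k q] /= [[_ k0 _] _] E; rewrite E in k0.
  by apply: nex; exists (existT (fun d => G -> 'M[C]_d) d p).
have tr : forall g, \tr (p g) = ichar la g.
  have [P [av [uP HP]]] := root_basis.
  have [y hy] := (highest_hvec la uq iq).1 hq => g; rewrite -tq.
  exact: (highest_unique bX oX cG haarP cn tcent pos_rt pos_or pos_anti pos_add uP HP up uq ip iq hx hy).
exists la; split => //.
- move=> al Sal; rewrite !dual_inner_dot.
  have pa : posv (vec al) by exists al.
  have [m E] := highest_dominant bX oX cG haarP tcent pos_rt up hx pa.
  have [_ a0 _] := pos_rt pa.
  by exists m; rewrite E mulfK// dot_eq0.
- have := tr 1%g; rewrite /irrep_char; have [p1 _ _] := rp; rewrite p1 mxtrace1.
  have [[q1 _ _] _] := uq.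
  rewrite -/(ichar la 1%g) -tq q1 mxtrace1 => /eqP.
  by rewrite eqr_nat => /eqP ->.
- by have [_] := casimir_valueE up ip hw.
Qed.

End Dictionary.

Lemma measurable_posneg (R : realType) :
  measurable_fun setT (fun x : R => Num.max x 0) /\
  measurable_fun setT (fun x : R => Num.max (- x) 0).
Proof. by split; apply: measurable_maxr => //; exact: measurableT_comp. Qed.

Lemma posneg_parts (R : realType) (x : R) :
  x = Num.max x 0 - Num.max (- x) 0 /\ `|x| = Num.max x 0 + Num.max (- x) 0.
Proof.
have [h|h] := leP 0 x.
  by rewrite ger0_norm// [Num.max (- x) _]max_r ?oppr_le0// subr0 addr0.
by rewrite ltr0_norm// [Num.max (- x) _]max_l ?oppr_ge0 ?ltW// sub0r opprK add0r.
Qed.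

(** * Dynkin's formula *)

Section NormalMoment.
Variable R : realType.
Context (sg : R) (sg0 : 0 < sg).

Lemma normal_pdf_even (x : R) : normal_pdf 0 sg (- x) = normal_pdf 0 sg x.
Proof. by rewrite normal_pdfE ?gt_eqF// /normal_fun !subr0 sqrrN. Qed.

Lemma ge0_integral_normal (f : measurableTypeR R -> \bar R) :
  measurable_fun setT f -> (forall x, 0 <= f x)%E ->
  (\int[normal_prob 0 sg]_x f x = \int[leb]_x (f x * (normal_pdf 0 sg x)%:E))%E.
Proof.
move=> mf f0.
have dom := normal_prob_dominates 0 sg.
rewrite -(Radon_Nikodym_SigmaFinite.change_of_variables dom)//.
apply: ae_eq_integral => //.
- apply: emeasurable_funM => //; apply: (measurable_int leb).
  exact: Radon_Nikodym_SigmaFinite.f_integrable.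
- apply: emeasurable_funM => //; apply/measurable_EFinP; exact: measurable_normal_pdf.
- apply: ae_eqe_mul2l; apply: integral_ae_eq => //.
  + exact: Radon_Nikodym_SigmaFinite.f_integrable.
  + by apply/measurable_EFinP; exact: measurable_normal_pdf.
  + by move=> E _ mE; rewrite -Radon_Nikodym_SigmaFinite.f_integral.
Qed.

(** Half of the Gaussian exponent absorbs the factor |x|: with y = x^2 / (4 sg^2) one has |x| <= sg
    (1 + y) <= sg exp(y). What remains is a Gaussian of twice the variance, which is integrable. *)
Lemma abs_normal_pdf_le (x : R) :
  `|x| * normal_pdf 0 sg x <=
  sg * normal_peak sg / normal_peak (sg * Num.sqrt 2)
  * normal_pdf 0 (sg * Num.sqrt 2) x.
Proof.
have s2 : 0 < sg * Num.sqrt 2 by rewrite mulr_gt0 ?sqrtr_gt0.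
have pk := normal_peak_gt0 (lt0r_neq0 s2).
rewrite !normal_pdfE ?gt_eqF// [leRHS]mulrA mulfVK ?gt_eqF//.
rewrite mulrCA [sg * _]mulrC -mulrA ler_wpM2l ?normal_peak_ge0//.
rewrite /normal_fun !subr0 exprMn sqr_sqrtr//.
set y := x ^+ 2 / (sg ^+ 2 * 4).
have -> : - x ^+ 2 / (sg ^+ 2 *+ 2) = - y - y.
  by rewrite /y -mulr_natr; field; rewrite gt_eqF.
have -> : - x ^+ 2 / (sg ^+ 2 * 2 *+ 2) = - y.
  by rewrite /y -mulr_natr; field; rewrite gt_eqF.
rewrite expRD mulrA ler_wpM2r ?expR_ge0// expRN ler_pdivrMr ?expR_gt0//.
have h : 1 + y <= expR y by apply: expR_ge1Dx.
have hx : `|x| <= sg * (1 + y).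
  rewrite /y -subr_ge0.
  have -> : sg * (1 + x ^+ 2 / (sg ^+ 2 * 4)) - `|x| = sg * (1 - `|x| / (2 * sg)) ^+ 2.
    have -> : x ^+ 2 = `|x| ^+ 2 by rewrite real_normK ?num_real.
    by field; rewrite gt_eqF.
  by rewrite mulr_ge0 ?sqr_ge0// ltW.
by apply: (le_trans hx); rewrite ler_wpM2l// ltW.
Qed.

Lemma abs_normal_pdf_fin :
  (\int[leb]_x (`|x| * normal_pdf 0 sg x)%:E < +oo)%E.
Proof.
have s2 : 0 < sg * Num.sqrt 2 by rewrite mulr_gt0 ?sqrtr_gt0.
set K := sg * normal_peak sg / normal_peak (sg * Num.sqrt 2).
have K0 : 0 <= K by rewrite /K !(mulr_ge0, invr_ge0, normal_peak_ge0)// ltW.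
have mp (s : R) := measurable_normal_pdf 0 s : measurable_fun setT _.
have ma : measurable_fun setT (fun x : R => `|x| * normal_pdf 0 sg x).
  by apply: measurable_funM => //; exact: normr_measurable.
apply: (@le_lt_trans _ _ (\int[leb]_x (K%:E * (normal_pdf 0 (sg * Num.sqrt 2) x)%:E)))%E.
  apply: ge0_le_integral => //.
  - by move=> x _; rewrite lee_fin mulr_ge0// normal_pdf_ge0.
  - exact/measurable_EFinP.
  - by apply: measurable_funeM; apply/measurable_EFinP; exact: mp.
  - by move=> x _; rewrite -EFinM lee_fin abs_normal_pdf_le.
rewrite ge0_integralZl//; last first.
- by move=> x _; rewrite lee_fin normal_pdf_ge0.
- by apply/measurable_EFinP; exact: mp.
by rewrite integral_normal_pdf mule1 ltry.
Qed.

(** The centred normal law has mean zero, stated through nonnegative parts: evenness of the density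
    makes the full absolute moment twice that of the positive part. *)
Lemma normal_parts :
  (\int[normal_prob 0 sg]_x (Num.max x 0)%:E =
   \int[normal_prob 0 sg]_x (Num.max (- x) 0)%:E)%E /\
  (\int[normal_prob 0 sg]_x (Num.max x 0)%:E < +oo)%E.
Proof.
have mp := measurable_normal_pdf 0 sg : measurable_fun setT _.
have [mm mn] := measurable_posneg R.
rewrite !ge0_integral_normal; first last.
- by move=> x; rewrite lee_fin le_max lexx orbT.
- exact/measurable_EFinP.
- by move=> x; rewrite lee_fin le_max lexx orbT.
- exact/measurable_EFinP.
set f := fun x => Num.max x 0 * normal_pdf 0 sg x.
set g := fun x => Num.max (- x) 0 * normal_pdf 0 sg x.
have f0 x : 0 <= f x by rewrite mulr_ge0 ?normal_pdf_ge0// le_max lexx orbT.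
have g0 x : 0 <= g x by rewrite mulr_ge0 ?normal_pdf_ge0// le_max lexx orbT.
have mf : measurable_fun setT f by apply: measurable_funM.
have mg : measurable_fun setT g by apply: measurable_funM.
have fg x : `|x| * normal_pdf 0 sg x = f x + g x.
  by rewrite /f /g -mulrDl; case: (posneg_parts x) => _ ->.
have efg : (\int[leb]_x (`|x| * normal_pdf 0 sg x)%:E =
    \int[leb]_x (f x)%:E + \int[leb]_x (g x)%:E)%E.
  rewrite -ge0_integralD//; last 4 first.
  - by move=> x _; rewrite lee_fin.
  - exact/measurable_EFinP.
  - by move=> x _; rewrite lee_fin.
  - exact/measurable_EFinP.
  by apply: eq_integral => x _; rewrite fg EFinD.
have sym : (\int[leb]_x (`|x| * normal_pdf 0 sg x)%:E = 2%:E * \int[leb]_x (f x)%:E)%E.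
  rewrite ge0_symfun_integralT; first last.
  - by move=> x /=; rewrite normrN normal_pdf_even.
  - by move=> x; apply: cvgM; [apply: cvg_norm; exact: cvg_id|apply: continuous_normal_pdf; rewrite gt_eqF].
  - by move=> x; rewrite mulr_ge0// normal_pdf_ge0.
  congr (_ * _)%E; rewrite integral_mkcond; apply: eq_integral => x _.
  rewrite patchE; case: ifPn; rewrite ?inE ?notin_setE/= => h.
    by rewrite /f max_l// ger0_norm.
  by rewrite /f max_r ?mul0r// leNgt; apply/negP => /ltW.
have fin := abs_normal_pdf_fin.
have i0 (h : R -> R) : (forall x, 0 <= h x) -> (0 <= \int[leb]_x (h x)%:E)%E.
  by move=> h0; apply: integral_ge0 => x _; rewrite lee_fin.
have lf : (\int[leb]_x (f x)%:E < +oo)%E by apply: le_lt_trans fin; rewrite efg leeDl// i0.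
have lg : (\int[leb]_x (g x)%:E < +oo)%E by apply: le_lt_trans fin; rewrite efg leeDr// i0.
split.
  under eq_integral do rewrite -EFinM.
  under [RHS]eq_integral do rewrite -EFinM.
  have fi := i0 _ f0; have gi := i0 _ g0.
  move: efg; rewrite sym -/(f _) -/(g _).
  rewrite -[X in (_ * X)%E]fineK ?ge0_fin_numE// -[X in (_ + X)%E]fineK ?ge0_fin_numE//.
  rewrite -[X in (X + _)%E]fineK ?ge0_fin_numE// -EFinM -EFinD => -[] h.
  rewrite -[LHS]fineK ?ge0_fin_numE// -[RHS]fineK ?ge0_fin_numE//; congr EFin.
  by move: h; rewrite /f /g; lra.
by under eq_integral do rewrite -EFinM.
Qed.

End NormalMoment.

Section Increment.
Context {R : realType} {d : measure_display} {Omega : measurableType d}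
 (P : probability Omega R) (F : set (set Omega)) (D : Omega -> R) (sg : R) (sg0 : 0 < sg)
 (FS : sigma_algebra setT F) (FM : F `<=` measurable) (mD : measurable_fun setT D).
Hypothesis ind : forall C (A : set R), F C -> measurable A ->
  P (C `&` D @^-1` A) = (P C * normal_prob 0 sg A)%E.

(* The law of [\1_C * D] is the mixture of N(0, sg^2) and of the Dirac mass at 0. *)
Lemma indep_ge0_integral (C : set Omega) (g : R -> R) :
  F C -> measurable_fun setT g -> (forall x, 0 <= g x) -> g 0 = 0 ->
  (\int[P]_w (g (\1_C w * D w))%:E =
   P C * \int[normal_prob 0 sg]_x (g x)%:E)%E.
Proof.
move=> FC mg g0 g00.
have mC : measurable C by exact: FM.
pose Z w : measurableTypeR R := \1_C w * D w.
have mZ : measurable_fun setT Z by apply: measurable_funM.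
have c0 : 0 <= fine (P C) by rewrite fine_ge0.
have c1 : 0 <= fine (P (~` C)) by rewrite fine_ge0.
have PC : P C = (fine (P C))%:E by rewrite fineK// fin_num_measure.
pose m1 : {measure set (measurableTypeR R) -> \bar R} := mscale (NngNum c0) (normal_prob 0 sg).
pose m2 : {measure set (measurableTypeR R) -> \bar R} := mscale (NngNum c1) (dirac (0 : measurableTypeR R)).
transitivity (\int[pushforward P Z]_x (g x)%:E)%E.
  rewrite ge0_integral_pushforward//; first exact/measurable_EFinP.
  by move=> x _; rewrite lee_fin.
transitivity (\int[measure_add m1 m2]_x (g x)%:E)%E.
  apply: eq_measure_integral => A mA _.
  rewrite -[LHS]/(P (Z @^-1` A)).
  transitivity (m1 A + m2 A)%E; last by rewrite -[RHS]/(measure_add m1 m2 A) measure_addE.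
  rewrite /m1 /m2 /= /mscale/=.
  rewrite -PC -(ind FC mA).
  have -> : Z @^-1` A = (C `&` D @^-1` A) `|` (~` C `&` [set w | A 0]).
    apply/seteqP; split=> w /=; rewrite /Z.
      case: (pselect (C w)) => h; first by rewrite indicE mem_set// mul1r; left.
      by rewrite indicE memNset// mul0r; right.
    case=> -[h k]; first by rewrite indicE mem_set// mul1r.
    by rewrite indicE memNset// mul0r.
  rewrite measureU//; first last.
  - by apply/seteqP; split=> w//= [[a _] [b _]].
  - apply: measurableI; first exact: measurableC.
    have [h|h] := pselect (A 0).
      by rewrite (_ : [set _ | _] = setT)//; apply/seteqP; split.
    by rewrite (_ : [set _ | _] = set0)//; apply/seteqP; split.
  - by apply: measurableI => //; rewrite -[X in measurable X]setTI; exact: mD.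
  congr (_ + _)%E; rewrite diracE.
  have fc : P (~` C) \is a fin_num by rewrite fin_num_measure//; exact: measurableC.
  have [h|h] := pselect (A 0).
    rewrite mem_set// mule1 fineK//; congr (P _).
    by apply/seteqP; split=> w//= [].
  rewrite memNset// mule0 (_ : _ `&` _ = set0) ?measure0//.
  by apply/seteqP; split=> w//= [].
rewrite ge0_integral_measure_add//; last first.
- exact/measurable_EFinP.
- by move=> x _; rewrite lee_fin.
rewrite !ge0_integral_mscale//; try by move=> x _; rewrite lee_fin.
- by rewrite integral_dirac//= ?diracT ?g00 ?mule0 ?adde0 -?PC//; exact/measurable_EFinP.
- exact/measurable_EFinP.
- exact/measurable_EFinP.
Qed.

Lemma increment_event (C : set Omega) : F C ->
  P.-integrable setT (fun w => (\1_C w * D w)%:E) /\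
  (\int[P]_w (\1_C w * D w)%:E = 0)%E.
Proof.
move=> FC.
have mC : measurable C by exact: FM.
have [eq fin] := normal_parts sg0.
set W : Omega -> R := fun w => \1_C w * D w.
have mW : measurable_fun setT W by apply: measurable_funM.
have [mm mn] := measurable_posneg R.
have hp : (\int[P]_w (Num.max (W w) 0)%:E =
   P C * \int[normal_prob 0 sg]_x (Num.max x 0)%:E)%E.
  by apply: (indep_ge0_integral FC mm) => [x|]; rewrite ?maxxx// le_max lexx orbT.
have hn : (\int[P]_w (Num.max (- W w) 0)%:E =
   P C * \int[normal_prob 0 sg]_x (Num.max x 0)%:E)%E.
  rewrite eq; apply: (indep_ge0_integral FC mn) => [x|]; rewrite ?oppr0 ?maxxx// le_max lexx orbT.
  done.
have fp : (P C * \int[normal_prob 0 sg]_x (Num.max x 0)%:E < +oo)%E.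
  apply: lte_mul_pinfty => //; first by rewrite fin_num_measure.
have ip : P.-integrable setT (fun w => (Num.max (W w) 0)%:E).
  apply/integrableP; split; first by apply/measurable_EFinP; apply: measurableT_comp mm mW.
  rewrite (eq_integral (fun w => (Num.max (W w) 0)%:E)) ?hp// => w _.
  by rewrite gee0_abs// lee_fin le_max lexx orbT.
have in_ : P.-integrable setT (fun w => (Num.max (- W w) 0)%:E).
  apply/integrableP; split; first by apply/measurable_EFinP; apply: measurableT_comp mn mW.
  rewrite (eq_integral (fun w => (Num.max (- W w) 0)%:E)) ?hn// => w _.
  by rewrite gee0_abs// lee_fin le_max lexx orbT.
have WE w : (W w)%:E = ((Num.max (W w) 0)%:E - (Num.max (- W w) 0)%:E)%E.
  by rewrite -EFinB; congr EFin; case: (posneg_parts (W w)).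
split.
  by apply: eq_integrable (integrableB _ ip in_) => // w _; rewrite WE.
under eq_integral do rewrite WE.
by rewrite integralB// hp hn subee// ge0_fin_numE// mule_ge0// integral_ge0// => x _; rewrite lee_fin le_max lexx orbT.
Qed.

(** The sum counts the positive integers not exceeding [x], so it is the integer part of [x]. *)
Lemma layer_cake (N : nat) (x : R) : 0 <= x <= N%:R ->
  `|\sum_(k < N) \1_[set y : R | k.+1%:R <= y] x - x| <= 1.
Proof.
elim: N => [|N IH] /andP[x0 xN]; first by rewrite big_ord0; move: xN; rewrite ler_norml; lra.
rewrite big_ord_recr/=; have [h|h] := leP x N%:R.
  rewrite [\1_[set y : R | N.+1%:R <= y] x]indicE memNset.
    by rewrite addr0 IH// x0.
  by apply/negP; rewrite /= -ltNge (le_lt_trans h)// ltr_nat.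
rewrite (eq_bigr (fun=> 1)); last first.
  by move=> k _; rewrite indicE mem_set//= (le_trans _ (ltW h))// ler_nat.
rewrite sumr_const card_ord.
move: xN; rewrite -[N.+1]addn1 natrD => xN.
by rewrite indicE ler_norml; case: (x \in _) => /=; apply/andP; split; lra.
Qed.

(** Independence is available for events only. The layer-cake sum of [m.+1 * (c + K)] approximates
    [c] within [1 / m.+1] by combinations of indicators of events of [F], for each of which the mean
    is zero. *)
Lemma increment_mean (c : Omega -> R) (K : R) :
  meas_wrt F c -> (forall w, `|c w| <= K) ->
  P.-integrable setT (fun w => (c w * D w)%:E) /\
  (\int[P]_w (c w * D w)%:E = 0)%E.
Proof.
move=> Fc cK.
have mc : measurable_fun setT c by move=> _ A mA; rewrite setTI; apply: FM; exact: Fc.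
have FT : F setT by case: FS => F0 FC _; by rewrite -(setD0 setT); exact: FC.
have [iD1 eD1] := increment_event FT.
have iD : P.-integrable setT (fun w => (D w)%:E).
  by apply: eq_integrable iD1 => // w _; rewrite indicT mul1r.
have eD : (\int[P]_w (D w)%:E = 0)%E.
  by rewrite -[RHS]eD1; apply: eq_integral => w _; rewrite indicT mul1r.
have iMb (b : Omega -> R) (L : R) : measurable_fun setT b -> (forall w, `|b w| <= L) ->
    P.-integrable setT (fun w => (b w * D w)%:E).
  move=> mb bL; apply: (@le_integrable _ _ _ P setT measurableT _ (fun w => (L * D w)%:E)).
  - by apply/measurable_EFinP; apply: measurable_funM.
  - move=> w _; rewrite /= lee_fin !normrM ler_wpM2r// (le_trans (bL w))//.
    exact: ler_norm.
  - under [X in _.-integrable _ X]eq_fun do rewrite EFinM.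
    exact: integrableZl.
have ic := iMb c K mc cK; split => //.
pose A := (\int[P]_w `|(D w)%:E|)%E.
have Afin : A \is a fin_num.
  by rewrite ge0_fin_numE ?integral_ge0//; case/integrableP: iD.
pose c' w := c w + K.
have key (m : nat) : (`|\int[P]_w (c w * D w)%:E| <= (m.+1%:R^-1)%:E * A)%E.
  have [N hN] : exists N : nat, m.+1%:R * (2 * K) <= N%:R :> R.
    by exists (Num.truncn (m.+1%:R * (2 * K))).+1; apply/ltW; exact: truncnS_gt.
  pose Ck (k : nat) : set Omega := [set w | k.+1%:R <= m.+1%:R * c' w].
  have FCk k : F (Ck k).
    have -> : Ck k = c @^-1` [set x | k.+1%:R <= m.+1%:R * (x + K)] by [].
    apply: Fc; rewrite -[X in measurable X]setTI.
    by apply: (measurable_fun_le measurableT); [exact: measurable_cst|apply: measurable_funM => //; exact: measurable_funD].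
  pose cm w := m.+1%:R^-1 * \sum_(k < N) \1_(Ck k) w - K.
  have m0 : 0 < m.+1%:R :> R by rewrite ltr0n.
  have cmE w : `|c w - cm w| <= m.+1%:R^-1.
    have h : 0 <= m.+1%:R * c' w <= N%:R.
      move: (cK w); rewrite ler_norml => /andP[h1 h2]; apply/andP; split.
        by apply: mulr_ge0; [exact: ltW|rewrite /c'; lra].
      by apply: le_trans hN; rewrite (ler_wpM2l (ltW m0))// /c'; lra.
    have := layer_cake h; rewrite -[X in `|X - _|]/(\sum_(k < N) \1_(Ck k) w).
    set S := \sum_(k < N) _ => hS.
    have -> : c w - cm w = - (m.+1%:R^-1 * (S - m.+1%:R * c' w)).
      by rewrite /cm /c' -/S; field; rewrite gt_eqF.
    rewrite normrN normrM (ger0_norm (x := _^-1)) ?invr_ge0 ?(ltW m0)//.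
    by rewrite ger_pMr ?invr_gt0.
  have mCk k : measurable (Ck k) by exact: FM.
  have mcm : measurable_fun setT cm.
    apply: measurable_funB => //; apply: measurable_funM => //.
    by apply: measurable_sum => k; exact: measurable_indic.
  have cmb w : `|cm w| <= K + m.+1%:R^-1.
    have -> : cm w = c w - (c w - cm w) by ring.
    by rewrite (le_trans (ler_normB _ _))// lerD.
  have icm := iMb cm _ mcm cmb.
  have ecm : (\int[P]_w (cm w * D w)%:E = 0)%E.
    transitivity (\int[P]_w (\sum_(k < N) (m.+1%:R^-1)%:E * (\1_(Ck k) w * D w)%:E
        - K%:E * (D w)%:E))%E.
      apply: eq_integral => w _; rewrite /cm mulrBl EFinB EFinM EFinM; congr (_ - _)%E.
      by rewrite -!EFinM mulr_sumr mulr_suml -sumEFin; apply: eq_bigr => k _; rewrite -EFinM mulrA.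
    rewrite integralB//; last 2 first.
    - apply: integrable_sum => // k _; apply: integrableZl => //.
      by have [] := increment_event (FCk k).
    - exact: integrableZl.
    rewrite integralZl// eD mule0 sube0 integral_sum//; last first.
      move=> k; apply: integrableZl => //.
      by have [] := increment_event (FCk k).
    by apply: big1 => k _; have [i e] := increment_event (FCk k); rewrite integralZl// e mule0.
  have -> : (\int[P]_w (c w * D w)%:E = \int[P]_w ((c w - cm w) * D w)%:E)%E.
    rewrite -[LHS]sube0 -ecm -integralB//; apply: eq_integral => w _.
    by rewrite [((c w - _) * _)]mulrBl EFinB.
  apply: le_trans (le_abse_integral _ _ _) _ => //.
    by apply/measurable_EFinP; apply: measurable_funM => //; exact: measurable_funB.
  rewrite -ge0_integralZl//; last first.
    by apply: measurableT_comp => //; exact/measurable_EFinP.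
  apply: ge0_le_integral => //.
  - apply: measurableT_comp => //; apply/measurable_EFinP; apply: measurable_funM => //; exact: measurable_funB.
  - by apply: measurable_funeM; apply: measurableT_comp => //; exact/measurable_EFinP.
  - by move=> w _; rewrite -EFinM lee_fin normrM ler_wpM2r.
have fI : (\int[P]_w (c w * D w)%:E)%E \is a fin_num by exact: integrable_fin_num.
apply/eqP; rewrite -abse_eq0; move: key; rewrite -(fineK Afin) -(fineK fI) abse_EFin => key.
have a0 : 0 <= fine A by rewrite fine_ge0// integral_ge0.
apply/eqP; congr EFin; apply/eqP; rewrite eq_le normr_ge0 andbT.
apply/ler_addgt0Pr => e e0; rewrite add0r.
pose m := Num.truncn (fine A / e).
have hm : fine A / e < m.+1%:R by exact: truncnS_gt.
apply: le_trans (_ : m.+1%:R^-1 * fine A <= _).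
  by have := key m; rewrite -EFinM lee_fin.
rewrite mulrC ler_pdivrMr ?ltr0n// mulrC -ler_pdivrMr//; exact: ltW.
Qed.

End Increment.

Section Ito.
Context {R : realType} {d : measure_display} {Omega : measurableType d}
 (P : probability Omega R) (n : nat) (F : R -> set (set Omega)) (B : 'I_n -> R -> Omega -> R)
 (HF : is_filtration F) (HB : standard_brownian_motion P F B).

Lemma sp_integral_mean (phi : simple_process (R := R) (Omega := Omega)) (s : R) (i : 'I_n) :
  is_simple_process F s phi ->
  P.-integrable setT (fun w => (sp_integral phi (B i) w)%:E) /\
  (\int[P]_w (sp_integral phi (B i) w)%:E = 0)%E.
Proof.
case: HF HB => HF1 HF2 [HB1 HB2 HB3] [t0 ts hj].
have tj j : (j <= sp_size phi)%N -> 0 <= sp_time phi j.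
  elim: j => [|j IH] hj'; first by rewrite t0.
  by have [h _ _] := hj j hj'; exact: le_trans (IH (ltnW hj')) h.
have mB r : 0 <= r -> measurable_fun setT (B i r).
  by move=> r0 _ A mA; rewrite setTI; apply: (HF1 _ r0).2; apply: HB1.
have step j : (j < sp_size phi)%N ->
    P.-integrable setT (fun w => (sp_coef phi j w *
       (B i (sp_time phi j.+1) w - B i (sp_time phi j) w))%:E) /\
    (\int[P]_w (sp_coef phi j w *
       (B i (sp_time phi j.+1) w - B i (sp_time phi j) w))%:E = 0)%E.
  move=> jm; have [h1 h2 [K hK]] := hj j jm.
  have r0 := tj j (ltnW jm); have r1 := tj j.+1 jm.
  (* Partition points may coincide, whereas the independence clause concerns only strictly
     increasing times; such a step contributes zero. *)
  move: h1; rewrite le_eqVlt => /orP[/eqP<-|h1].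
    have e : (fun w => (sp_coef phi j w * (B i (sp_time phi j) w - B i (sp_time phi j) w))%:E)
        = (fun=> 0%E) :> (Omega -> \bar R).
      by apply/funext => w; rewrite subrr mulr0.
    by rewrite e; split; [exact: integrable0|rewrite integral0].
  have sg0 : 0 < Num.sqrt (sp_time phi j.+1 - sp_time phi j) by rewrite sqrtr_gt0 subr_gt0.
  have [FS FM] := HF1 _ r0.
  apply: (increment_mean sg0 FS FM _ _ h2 hK).
  - by apply: measurable_funB; exact: mB.
  - move=> C A FC mA.
    (* Constraining a single component extracts its independence and law from the joint statement
       for all components. *)
    pose A' (k : 'I_n) : set R := if k == i then A else setT.
    have mA' k : measurable (A' k) by rewrite /A'; case: ifP.
    have := HB3 _ _ r0 h1 C A' FC mA'.
    rewrite (bigD1 i)//= big1 ?mulr1 => [|k ki]; last first.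
      by rewrite /A' (negbTE ki) probability_setT.
    rewrite mule1 {2}/A' eqxx => <-; congr (P _).
    apply/seteqP; split=> w [Cw Aw]; split=> //.
      by move=> k; rewrite /A'; case: eqP => [->|].
    by have := Aw i; rewrite /A' eqxx.
rewrite /sp_integral; under eq_integral do rewrite -sumEFin.
split.
  under eq_fun do rewrite -sumEFin.
  by apply: integrable_sum => // k _; have [] := step k (ltn_ord k).
rewrite integral_sum//.
  by apply: big1 => k _; have [] := step k (ltn_ord k).
by move=> k; have [] := step k (ltn_ord k).
Qed.

(* L^2 convergence of the simple integrals is used through |x| <= e + x^2 / e. *)
Lemma ito_mean (H : R -> Omega -> R) (s : R) (i : 'I_n) (I : Omega -> R) :
  ito_integral P F (B i) H s I ->
  P.-integrable setT (fun w => (I w)%:E) /\ (\int[P]_w (I w)%:E = 0)%E.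
Proof.
case=> mI [phi [hphi _ hI]].
pose J k := sp_integral (phi k) (B i).
have iJ k : P.-integrable setT (fun w => (J k w)%:E).
  by have [] := sp_integral_mean i (hphi k).
have eJ k : (\int[P]_w (J k w)%:E = 0)%E by have [] := sp_integral_mean i (hphi k).
have mJ k : measurable_fun setT (J k) by apply/measurable_EFinP; exact: measurable_int (iJ k).
have small (e : R) : 0 < e -> exists k, (\int[P]_w (((I w - J k w) ^+ 2)%:E) < e%:E)%E.
  move=> e0; have := hI => /fine_cvgP[hf hc].
  move/cvgrPdist_lt : hc => /(_ e e0) hc.
  have [N _ hN] := filterI hf hc.
  exists N; have [/= fN cN] := hN N (leqnn N).
  move: fN cN; rewrite unlock => fN; rewrite sub0r normrN => cN.
  by rewrite -(fineK fN) lte_fin (le_lt_trans (ler_norm _) cN).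
have mIJ k : measurable_fun setT (fun w => I w - J k w) by exact: measurable_funB.
have mS k : measurable_fun setT (fun w => ((I w - J k w) ^+ 2)%:E).
  by apply/measurable_EFinP; exact: measurable_funX.
have bnd (e x : R) : 0 < e -> `|x| <= e + e^-1 * x ^+ 2.
  move=> e0; have -> : x ^+ 2 = `|x| ^+ 2 by rewrite real_normK ?num_real.
  have : 0 <= e^-1 * (e - `|x|) ^+ 2 by rewrite mulr_ge0 ?sqr_ge0// invr_ge0 ltW.
  have -> : e^-1 * (e - `|x|) ^+ 2 = e - 2 * `|x| + e^-1 * `|x| ^+ 2 by field; rewrite gt_eqF.
  have := normr_ge0 x; lra.
have key (e : R) : 0 < e -> exists k, (\int[P]_w `|(I w - J k w)%:E| <= (e + e)%:E)%E.
  move=> e0; have [k hk] := small (e * e) (mulr_gt0 e0 e0); exists k.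
  apply: (@le_trans _ _ (\int[P]_w (e%:E + e^-1%:E * ((I w - J k w) ^+ 2)%:E)))%E.
    apply: ge0_le_integral => //.
    - by apply: measurableT_comp => //; exact/measurable_EFinP.
    - by apply: emeasurable_funD => //; exact: measurable_funeM.
    - by move=> w _; rewrite abse_EFin -EFinM -EFinD lee_fin bnd.
  rewrite ge0_integralD//; last 3 first.
  - by move=> w _; rewrite lee_fin ltW.
  - by move=> w _; rewrite -EFinM lee_fin mulr_ge0 ?sqr_ge0// invr_ge0 ltW.
  - exact: measurable_funeM.
  have -> : (\int[P]__ e%:E = e%:E)%E.
    by have := expectation_cst P e; rewrite unlock.
  rewrite EFinD leeD2l// ge0_integralZl//; last 2 first.
  - by move=> w _; rewrite lee_fin sqr_ge0.
  - by rewrite lee_fin invr_ge0 ltW.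
  rewrite -[e in leRHS](mulKf (lt0r_neq0 e0)) EFinM lee_wpmul2l ?lee_fin ?invr_ge0 ?(ltW e0)//.
  exact: ltW.
have iD k : (\int[P]_w `|(I w - J k w)%:E| < +oo)%E -> P.-integrable setT (fun w => (I w - J k w)%:E).
  by move=> h; apply/integrableP; split => //; exact/measurable_EFinP.
have iI : P.-integrable setT (fun w => (I w)%:E).
  have [k hk] := key 1 ltr01.
  have h : P.-integrable setT (fun w => ((I w - J k w)%:E + (J k w)%:E)%E).
    by apply: integrableD => //; apply: iD; apply: le_lt_trans hk _; rewrite ltry.
  by apply: eq_integrable h => // w _; rewrite -EFinD subrK.
split => //.
have fI : (\int[P]_w (I w)%:E)%E \is a fin_num by exact: integrable_fin_num.
rewrite -(fineK fI); congr EFin; apply/eqP; rewrite -normr_eq0 eq_le normr_ge0 andbT.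
apply/ler_addgt0Pr => e e0; rewrite add0r.
have e20 : 0 < e / 2 by rewrite divr_gt0.
have [k hk] := key _ e20.
rewrite -lee_fin -abse_EFin fineK//.
have -> : (\int[P]_w (I w)%:E = \int[P]_w (I w - J k w)%:E)%E.
  by rewrite -[LHS]sube0 -(eJ k) -integralB//; apply: eq_integral => w _; rewrite EFinB.
apply: le_trans (le_abse_integral _ _ _) _ => //; first exact/measurable_EFinP.
by apply: (le_trans hk); rewrite -splitr.
Qed.

End Ito.

Section PathPrimitive.
Variable R : realType.
Context (g : R -> R) (K : R) (gc : {within `[0, +oo[, continuous g})
 (gK : forall r, `|g r| <= K).
Let prim x : R := \int[leb]_(r in [set` `[0%R : R, x]]) g r.

Lemma path_integrable x : leb.-integrable [set` `[0%R : R, x]] (EFin \o g).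
Proof.
apply: continuous_compact_integrable; first exact: segment_compact.
apply: continuous_subspaceW gc => y /=; rewrite !in_itv/= => /andP[-> _].
by [].
Qed.

Lemma prim_lipschitz x y : 0 <= x -> 0 <= y -> `|prim y - prim x| <= K * `|y - x|.
Proof.
wlog xy : x y / x <= y.
  move=> H x0 y0; have [h|/ltW h] := leP x y; first exact: H.
  by rewrite distrC (distrC y); exact: H.
move=> x0 _.
have iy := path_integrable y.
rewrite /prim Rintegral_itvB//.
have ixy : leb.-integrable [set` `]x, y]] (EFin \o g).
  apply: integrableS iy => // r /=; rewrite !in_itv/= => /andP[h ->]; rewrite andbT.
  by rewrite (le_trans x0)// ltW.
apply: (le_trans (le_normr_Rintegral _ ixy)) => //.
rewrite (ger0_norm (x := y - x)) ?subr_ge0//.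
have le : leb [set` `]x, y]] = (y - x)%:E.
  rewrite lebesgue_measure_itv/= lte_fin; case: ltgtP xy => //= -> _.
  by rewrite subrr.
have -> : K * (y - x) = \int[leb]_(r in [set` `]x, y]]) K.
  rewrite Rintegral_cst//; congr (_ * _); rewrite -[LHS]/(fine (y - x)%:E).
  by congr fine; symmetry; exact: le.
apply: le_Rintegral => //.
- by move/integrable_norm : ixy.
- apply/integrableP; split; first exact: measurable_cst.
  have -> : (\int[leb]_(r in [set` `]x, y]]) `|(cst K r)%:E| = `|K|%:E * leb [set` `]x, y]])%E.
    by rewrite -integral_cst.
  by rewrite le -EFinM ltry.
Qed.

Lemma prim_quotient s (z : R^nat) : 0 < s -> (forall k, z k != 0) -> z k @[k --> \oo] --> (0 : R) ->
  (z k)^-1 * (prim `|z k + s| - prim s) @[k --> \oo] --> g s.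
Proof.
move=> s0 z0 zc.
have s1 : s < s + 1 by rewrite ltrDl.
have gs : {for s, continuous g}.
  have : {within [set` `]0%R : R, +oo[], continuous g}.
    by apply: continuous_subspaceW gc => r /=; rewrite !in_itv/= !andbT => /ltW.
  rewrite continuous_open_subspace; last exact: interval_open.
  by apply; rewrite inE/= in_itv/= s0.
have [dF eF] := @continuous_FTC1_closed R g 0 s (s + 1) s1 (path_integrable (s + 1)) s0 gs.

have : (fun h => h^-1 *: (prim (h *: 1 + s) - prim s)) @ (0 : R)^' --> g s.
  by move: dF eF; rewrite derive1E /derivable /derive => h <-.
move/cvgr_dnbhsP => /(_ z (conj z0 zc)); apply: cvg_trans; apply: near_eq_cvg; near=> k.
rewrite /= /GRing.scale/= mulr1 (ger0_norm (x := z k + s))//.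
have : `|z k| < s by rewrite -[z k]subr0 distrC; near: k; move/cvgrPdist_lt : zc; exact.
by rewrite ltr_norml; lra.
Unshelve. all: by end_near. Qed.

End PathPrimitive.

Lemma Rintegral_sum {d : measure_display} {T : measurableType d} {R : realType}
  (mu : {measure set T -> \bar R}) (D : set T) (I : Type) (r : seq I) (F : I -> T -> R) :
  measurable D -> (forall i, mu.-integrable D (EFin \o F i)) ->
  \int[mu]_(x in D) (\sum_(i <- r) F i x) = \sum_(i <- r) \int[mu]_(x in D) F i x.
Proof.
move=> mD iF; elim: r => [|i r IH].
  rewrite big_nil; under eq_Rintegral do rewrite big_nil.
  by rewrite /Rintegral integral0.
rewrite big_cons -IH -RintegralD//.
  by apply: eq_Rintegral => x _; rewrite big_cons.
apply: (eq_integrable mD (fun x => \sum_(i <- r) (F i x)%:E)%E).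
  by move=> x _; rewrite /= -sumEFin.
by apply: integrable_sum => // j _; exact: iF.
Qed.

Section Dynkin.
Context {R : realType} {n : nat} {G : lieGroupType R n}
 {d : measure_display} {Omega : measurableType d}
 (X : 'I_n -> (G -> R) -> (G -> R)) (P : probability Omega R) (xi : R -> Omega -> G)
 (bX : lie_basis X) (cG : compact [set: G]) (HB : group_brownian_motion P X xi).
Local Notation path_cont g w :=
  {within [set` `[0%R : R, +oo[], continuous (fun s => g (xi s w))}.

Lemma bm_measurable s : 0 <= s -> measurable_fun setT (xi s : Omega -> borel G).
Proof.
case: HB => F [B [[HF _] hxi _ _]] s0 _ A mA; rewrite setTI.
by apply: (HF.1 _ s0).2; exact: hxi.
Qed.

Lemma bm_cont_measurable (f : G -> R) s : continuous f -> 0 <= s ->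
  measurable_fun setT (fun w => f (xi s w)).
Proof.
move=> cf s0; have mf := cont_measurable cf; have mx := bm_measurable s0.
exact: (measurableT_comp mf mx).
Qed.

Lemma bm_integrable (f : G -> R) s : continuous f -> 0 <= s ->
  P.-integrable setT (fun w => (f (xi s w))%:E).
Proof.
move=> cf s0; have [K K0 hK] := cont_bounded cG cf.
apply: measurable_bounded_integrable => //.
- by rewrite (le_lt_trans (probability_le1 P measurableT)) ?ltry.
- exact: bm_cont_measurable.
- by exists K; split; [exact: num_real|move=> M KM w _; rewrite /= (le_trans (hK _))// ltW].
Qed.

Lemma bm_path (f : G -> R) : continuous f ->
  {ae P, forall w, path_cont f w}.
Proof.
move=> cf; case: HB => F [B [_ _ h _]]; apply: filterS h => w [_ h1] x.
by apply: continuous_comp; [exact: h1|exact: cf].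
Qed.

(** [V] is built from the random variables of Ito's formula already known to be integrable. The time
    integral merely agrees with it almost surely, so its measurability in [w] never has to be
    addressed. *)
Lemma dynkin_ae (f : G -> R) s : smooth_fun f -> 0 <= s ->
  exists V : Omega -> R,
  [/\ P.-integrable setT (EFin \o V),
      \int[P]_w V w = f 1%g - \int[P]_w f (xi s w) &
      {ae P, forall w, V w = - (2^-1 * \sum_(i < n)
         \int[leb]_(r in [set` `[0%R : R, s]]) (X i (X i f) (xi r w)))}].
Proof.
move=> sf s0; case: HB => F [B [[HF HBm] _ _ hf]].
have [I [hI ae]] := hf f sf s s0.
have cf : continuous f := smooth_cont sf.
have hm i := ito_mean HF HBm (hI i).
have ifx := bm_integrable cf s0.
have iS : P.-integrable setT (EFin \o (fun w => \sum_(i < n) I i w)).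
  apply: (eq_integrable measurableT (fun w => \sum_(i < n) (I i w)%:E)%E).
    by move=> w _; rewrite /= -sumEFin.
  by apply: integrable_sum => // i _; have [] := hm i.
have ic (a : R) : P.-integrable setT (EFin \o (fun=> a) : Omega -> \bar R).
  exact: finite_measure_integrable_cst.
have i1 : P.-integrable setT (EFin \o (fun w => f 1%g + \sum_(i < n) I i w)).
  exact: eq_integrable (integrableD measurableT (ic (f 1%g)) iS).
exists (fun w => f 1%g + \sum_(i < n) I i w - f (xi s w)); split.
- exact: eq_integrable (integrableB measurableT i1 ifx).
- rewrite RintegralB// RintegralD// Rintegral_sum//; last by move=> i; have [] := hm i.
  rewrite big1 ?addr0 => [|i _]; last by rewrite /Rintegral; have [_ ->] := hm i.
  congr (_ - _); have := expectation_cst P (f 1%g); rewrite unlock => h.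
  by rewrite /Rintegral h.
- by apply: filterS ae => w ->; ring.
Qed.

Section Eigenfunction.
Context (f : G -> R) (c : R) (sf : smooth_fun f)
 (fc : forall x, \sum_(i < n) X i (X i f) x = - c * f x).
Let F w s : R := \int[leb]_(r in [set` `[0%R : R, s]]) f (xi r w).

Lemma dynkin_eigen_ae s : 0 <= s ->
  exists V : Omega -> R,
  [/\ P.-integrable setT (EFin \o V),
      \int[P]_w V w = f 1%g - \int[P]_w f (xi s w) &
      {ae P, forall w, V w = c / 2 * F w s}].
Proof.
move=> s0; have [V [iV eV aV]] := dynkin_ae sf s0; exists V; split=> //.
have sX i g : smooth_fun g -> smooth_fun (X i g) by case: bX => /(_ i)[h _ _ _] _; exact: h.
have cXX i : continuous (X i (X i f)) by exact: smooth_cont (sX i _ (sX i f sf)).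
have aX : {ae P, forall w, forall i : 'I_n,
    path_cont (X i (X i f)) w}.
  by apply: filter_forall => i; exact: bm_path (cXX i).
have aF := bm_path (smooth_cont sf).
near=> w.
have -> : V w = - (2^-1 * \sum_(i < n)
    \int[leb]_(r in [set` `[0%R : R, s]]) (X i (X i f) (xi r w))) by near: w.
have hX : forall i : 'I_n,
    path_cont (X i (X i f)) w by near: w.
have hF : path_cont f w by near: w.
rewrite -Rintegral_sum//; last by move=> i; exact: (path_integrable (hX i)).
have -> : \int[leb]_(r in [set` `[0%R : R, s]]) (\sum_i X i (X i f) (xi r w)) =
    \int[leb]_(r in [set` `[0%R : R, s]]) (- c * f (xi r w)).
  by apply: eq_Rintegral => r _; rewrite fc.
rewrite RintegralZl//; last exact: (path_integrable hF).
by rewrite /F; field.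
Unshelve. all: by end_near. Qed.

(* [`|r|] makes v defined on both sides of every s, at no cost for s > 0. *)
Let v (r : R) : R := \int[P]_w f (xi `|r| w).

Lemma eigen_lipschitz : exists K, forall r, `|v r - f 1%g| <= K * `|r|.
Proof.
have [K K0 hK] := cont_bounded cG (smooth_cont sf).
exists (`|c / 2| * K) => r; have [V [iV eV aV]] := dynkin_eigen_ae (normr_ge0 r).
rewrite /v distrC -eV; apply: (le_trans (le_normr_Rintegral _ iV)) => //.
set L := _ * `|r|.
have L0 : 0 <= L by rewrite /L !mulr_ge0.
have aL : {ae P, forall w, `|V w| <= L}.
  have aF := bm_path (smooth_cont sf); near=> w.
  have -> : V w = c / 2 * F w `|r| by near: w.
  have hF : path_cont f w by near: w.
  rewrite normrM /L -mulrA ler_wpM2l//.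
  have := prim_lipschitz hF (fun r => hK (xi r w)) (lexx 0) (normr_ge0 r).
  by rewrite subr0 normr_id set_itv1 Rintegral_set1 subr0.
have mV : measurable_fun setT V by apply/measurable_EFinP; case/integrableP : iV.
have h : (\int[P]_w `|(V w)%:E| <= L%:E)%E.
  have <- : (\int[P]_w L%:E = L%:E)%E by have := expectation_cst P L; rewrite unlock.
  apply: ae_ge0_le_integral => //.
  - by apply: measurableT_comp => //; exact/measurable_EFinP.
  - by apply: filterS aL => w h _; rewrite abse_EFin lee_fin.
have fin : (\int[P]_w `|(V w)%:E|)%E \is a fin_num.
  by rewrite ge0_fin_numE ?integral_ge0//; apply: le_lt_trans h _; rewrite ltry.
by rewrite -lee_fin /Rintegral fineK.
Unshelve. all: by end_near. Qed.

(** The fundamental theorem of calculus is applied path by path to the time integral, and dominated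
    convergence takes the limit of the expected difference quotients, which the bound of [f]
    dominates. *)
Lemma eigen_derive s : 0 < s -> is_derive (s : R^o) 1 (v : R^o -> R^o) (- (c / 2) * v s).
Proof.
move=> s0; have [K K0 hK] := cont_bounded cG (smooth_cont sf).
suff H : (fun h => h^-1 *: (v (h *: 1 + s) - v s)) @ (0 : R)^' --> - (c / 2) * v s.
  have dv : derivable (v : R^o -> R^o) s 1 by apply/cvg_ex; exists (- (c / 2) * v s).
  apply: DeriveDef => //; exact/cvg_lim.
(* Along a sequence of increments only countably many almost sure identities have to hold
   together. *)
apply/cvgr_dnbhsP => z [z0 zc].
have [V0 [iV0 eV0 aV0]] := dynkin_eigen_ae (ltW s0).
have /choice[V hV] : forall k : nat, exists V : Omega -> R,
    [/\ P.-integrable setT (EFin \o V),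
        \int[P]_w V w = f 1%g - \int[P]_w f (xi `|z k + s| w) &
        {ae P, forall w, V w = c / 2 * F w `|z k + s|}].
  by move=> k; exact: dynkin_eigen_ae (normr_ge0 _).
have aV : {ae P, forall w, forall k, V k w = c / 2 * F w `|z k + s|}.
  by apply: ae_foralln => k; have [] := hV k.
have aF := bm_path (smooth_cont sf).
pose q k w := (z k)^-1 * (V k w - V0 w).
have iq k : P.-integrable setT (EFin \o q k).
  have [iV _ _] := hV k.
  apply: (eq_integrable measurableT (fun w => ((z k)^-1)%:E * ((V k w)%:E - (V0 w)%:E))%E).
    by move=> w _; rewrite /= /q EFinM EFinB.
  by apply: integrableZl => //; exact: integrableB.
have ig : P.-integrable setT (fun w => (c / 2 * f (xi s w))%:E).
  apply: (eq_integrable measurableT (fun w => (c / 2)%:E * (f (xi s w))%:E)%E).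
    by move=> w _; rewrite EFinM.
  by apply: integrableZl => //; exact: bm_integrable (smooth_cont sf) (ltW s0).
have eq k : \int[P]_w q k w = - ((z k)^-1 * (v (z k + s) - v s)).
  have [iV eV _] := hV k.
  rewrite /q RintegralZl//; last first.
    exact: eq_integrable (integrableB measurableT iV iV0).
  by rewrite RintegralB// eV eV0 /v (gtr0_norm s0); ring.
have [_ _ lim] : [/\ P.-integrable setT (fun w => (c / 2 * f (xi s w))%:E),
   [sequence \int[P]_w `|(q k w)%:E - (c / 2 * f (xi s w))%:E|]_k @ \oo --> 0 &
   [sequence \int[P]_w (q k w)%:E]_k @ \oo --> \int[P]_w (c / 2 * f (xi s w))%:E]%E.
  apply: (dominated_convergence measurableT (g := fun=> (`|c / 2| * K)%:E)) => //.
  - by move=> k; exact: measurable_int (iq k).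
  - exact: measurable_int ig.
  - near=> w => _.
    have hk : forall k, V k w = c / 2 * F w `|z k + s| by near: w.
    have h0 : V0 w = c / 2 * F w s by near: w.
    have hF : path_cont f w by near: w.
    apply: cvg_EFin; first exact: nearW.
    have := prim_quotient hF s0 z0 zc => /(cvgZr (k := c / 2)).
    apply: cvg_trans; apply: near_eq_cvg; near=> k.
    by rewrite /= /q hk h0 -[LHS]/(c / 2 * ((z k)^-1 * (F w `|z k + s| - F w s))); ring.
  - exact: finite_measure_integrable_cst.
  - near=> w => k _.
    have hk : forall k, V k w = c / 2 * F w `|z k + s| by near: w.
    have h0 : V0 w = c / 2 * F w s by near: w.
    have hF : path_cont f w by near: w.
    rewrite abse_EFin lee_fin /q hk h0 -mulrBr mulrCA normrM ler_wpM2l//.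
    rewrite normrM normfV ler_pdivrMl ?normr_gt0//.
    have := prim_lipschitz hF (fun r => hK (xi r w)) (ltW s0) (normr_ge0 (z k + s)).
    move=> h; apply: (le_trans h); rewrite mulrC ler_wpM2r//.
    have := ler_dist_dist (z k + s) s; rewrite addrK (gtr0_norm s0).
    by [].
have fl := integrable_fin_num measurableT ig.
have hl : fine (\int[P]_w (q k w)%:E)%E @[k --> \oo] --> fine (\int[P]_w (c / 2 * f (xi s w))%:E)%E.
  by apply: fine_cvg; rewrite fineK.
have -> : - (c / 2) * v s = - fine (\int[P]_w (c / 2 * f (xi s w))%:E)%E.
  rewrite -[fine _]/(\int[P]_w (c / 2 * f (xi s w))) RintegralZl//.
    by rewrite /v (gtr0_norm s0) mulNr.
  exact: bm_integrable (smooth_cont sf) (ltW s0).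
apply: cvg_trans (cvgN hl); apply: near_eq_cvg; near=> k.
by rewrite -[LHS]/(- (\int[P]_w q k w)) eq opprK /GRing.scale/= mulr1.
Unshelve. all: by end_near. Qed.

(** The product of [v] with the inverse exponential has zero derivative at positive times;
    [eigen_lipschitz] supplies the continuity at 0 that links it to the initial value. *)
Lemma dynkin_eigen s : 0 <= s ->
  \int[P]_w f (xi s w) = f 1%g * expR (- c * s / 2).
Proof.
move=> s0.
have [K hK] := eigen_lipschitz.
pose u r := v r * expR (c / 2 * r).
have de r : is_derive (r : R^o) 1 ((fun r => expR (c / 2 * r)) : R^o -> R^o) (c / 2 * expR (c / 2 * r)).
  have dg : is_derive (r : R^o) 1 ((fun r => c / 2 * r) : R^o -> R^o) (c / 2).
    by apply: (is_derive_eq (is_deriveZ (c / 2) (is_derive_id (r : R^o) 1))); rewrite /GRing.scale/= mulr1.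
  by apply: (is_derive_eq (is_derive1_comp (is_derive_expR _) dg)); rewrite mulrC.
have du r : 0 < r -> is_derive (r : R^o) 1 (u : R^o -> R^o) 0.
  move=> r0; have dv := eigen_derive r0.
  apply: (is_derive_eq (is_deriveM dv (de r))).
  by rewrite /GRing.scale/=; ring.
have v0 : v 0 = f 1%g.
  by apply/eqP; rewrite -subr_eq0 -normr_eq0 eq_le normr_ge0 andbT (le_trans (hK 0))// normr0 mulr0.
have cv r : 0 <= r -> {for r, continuous v}.
  rewrite le_eqVlt => /orP[/eqP<-|r0].
    apply/cvgrPdist_lt => e e0.
    have K1 : 0 < `|K| + 1 by rewrite ltr_wpDl.
    near=> t; rewrite v0 distrC; apply: le_lt_trans (hK t) _.
    apply: (@le_lt_trans _ _ ((`|K| + 1) * `|t|)).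
      by rewrite ler_wpM2r// (le_trans (ler_norm K))// lerDl.
    rewrite -ltr_pdivlMl// -[t]subr0 -normrN opprB mulrC; near: t.
    by apply: (@cvgr_dist_lt _ R); [exact: cvg_id|rewrite divr_gt0].
  have dv := eigen_derive r0.
  by apply: differentiable_continuous; apply/derivable1_diffP; case: dv.
have cu : {within [set` `[0%R : R, s]], continuous u}.
  apply: continuous_in_subspaceT => r; rewrite inE/= in_itv/= => /andP[r0 _].
  apply: cvgM; first exact: cv.
  have ce : {for r, continuous (fun r => expR (c / 2 * r))}.
    by apply: differentiable_continuous; apply/derivable1_diffP; case: (de r).
  exact: ce.
have du' r : r \in `]0, s[ -> is_derive (r : R^o) 1 (u : R^o -> R^o) 0.
  by rewrite in_itv/= => /andP[r0 _]; exact: du.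
have [r _ hr] := MVT_segment s0 du' cu.
move: hr; rewrite mul0r => /subr0_eq; rewrite /u v0 mulr0 expR0 mulr1.
rewrite /v (ger0_norm s0) => <-.
rewrite -mulrA -expRD -[LHS]mulr1; congr (_ * _).
by rewrite (_ : _ + _ = 0) ?expR0//; field.
Unshelve. all: by end_near. Qed.

End Eigenfunction.
End Dynkin.

(** * The heat kernel *)

Section Density.
Context {R : realType} {n : nat} {G : lieGroupType R n} (cG : compact [set: G]).
Implicit Types m : probability (borel G) R.

Lemma cont_min (a : R) (f : G -> R) : continuous f -> continuous (fun x => Num.min a (f x)).
Proof. by move=> cf x; apply: continuous_min; [exact: cvg_cst|exact: cf]. Qed.

Lemma open_cozero (f : G -> R) : continuous f -> open [set x : G | 0 < f x :> R].
Proof.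
move=> cf; rewrite (_ : [set x | _] = f @^-1` [set y | 0 < y])//.
by apply: open_comp => [x _|]; [exact: cf|exact: open_gt].
Qed.

(** The truncations [min 1 (k f)] tend to the indicator of the set where [f] is positive, which
    brings cozero sets within reach of integrals of continuous functions. *)
Lemma cozero_limit m (w f : G -> R) : continuous w -> (forall x, 0 <= w x) ->
  continuous f -> (forall x, 0 <= f x) ->
  (gint m (fun x => Num.min 1 (k%:R * f x) * w x))%:E @[k --> \oo] -->
  (\int[m]_(x in [set x : borel G | (0 < f x)%R]) (w x)%:E)%E.
Proof.
move=> cw w0 cf f0.
have cfk (k : nat) : continuous (fun x => k%:R * f x).
  by move=> x; apply: cvgM; [exact: cvg_cst|exact: cf].
have cgk (k : nat) : continuous (fun x => Num.min 1 (k%:R * f x) * w x).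
  by move=> x; apply: cvgM; [exact: cont_min|exact: cw].
have mU : measurable ([set x : G | 0 < f x] : set (borel G)).
  by apply: measurable_open; exact: open_cozero.
rewrite integral_mkcond; under eq_fun do rewrite gintE//.
have b01 (k : nat) x : 0 <= Num.min 1 (k%:R * f x) <= 1.
  by rewrite le_min ler01 mulr_ge0//= ge_min lexx.
have [] := dominated_convergence (mu := m) (D := setT) measurableT
   (f_ := fun k (x : borel G) => (Num.min 1 (k%:R * f x) * w x)%:E)
   (f := (fun x : borel G => (w x)%:E) \_ [set x : borel G | 0 < f x])
   (g := fun x : borel G => (w x)%:E).
- by move=> k; apply/measurable_EFinP; exact: cont_measurable.
- apply/(measurable_restrict _ mU measurableT); rewrite setTI.
  by apply/measurable_EFinP; apply: measurable_funTS; exact: cont_measurable.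
- apply: aeW => x _; rewrite patchE; case: ifPn => h.
    apply: cvg_near_cst; near=> k; congr EFin; rewrite min_l ?mul1r//.
    have fx : 0 < f x by rewrite inE in h.
    rewrite -ler_pdivrMr// div1r; near: k; exact: nbhs_infty_ger.
  have fx : f x = 0.
    by apply/eqP; rewrite eq_le f0 andbT leNgt; apply: contra h => h; rewrite inE.
  by apply: cvg_near_cst; near=> k; rewrite fx mulr0 min_r ?ler01// mul0r.
- exact: cont_integrable.
- apply: aeW => x k _; rewrite abse_EFin lee_fin normrM (ger0_norm (w0 x)).
  by rewrite ler_piMl// ger0_norm; have /andP[] := b01 k x.
- by [].
Unshelve. all: by end_near. Qed.

(* The sets [0 < f] with f >= 0 continuous form a pi-system generating the Borel sets. *)
Lemma density_of_gint mu m (S : G -> R) : continuous S -> (forall x, 0 <= S x) ->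
  (forall f, continuous f -> gint mu f = gint m (fun x => f x * S x)) ->
  forall A : set (borel G), measurable A -> mu A = (\int[m]_(x in A) (S x)%:E)%E.
Proof.
move=> cS S0 HS.
pose E : set (set (borel G)) := [set A | exists f : G -> R,
  [/\ continuous f, forall x, 0 <= f x & A = [set x | 0 < f x]]].
have c1 : continuous (fun _ : G => 1 : R) by move=> x; exact: cvg_cst.
have mS : measurable_fun setT (fun x : borel G => (S x)%:E).
  by apply/measurable_EFinP; exact: cont_measurable.
have iS := cont_integrable cG m cS.
have fS A : measurable A -> (\int[m]_(x in A) (S x)%:E)%E \is a fin_num.
  by move=> mA; apply: integrable_fin_num => //; exact: integrableS iS.
(* Testing with the constant function 1 shows that the density has total mass one; complements rely
   on this. *)
have one : (1 = \int[m]_x (S x)%:E)%E.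
  rewrite -gintE// -[1%E]/(1%:E) -(gint_cst mu 1) HS//.
  by congr EFin; apply: eq_gint => x; rewrite mul1r.
have EP A : E A -> mu A = (\int[m]_(x in A) (S x)%:E)%E.
  case=> f [cf f0 ->].
  have L1 := cozero_limit (m := m) cS S0 cf f0.
  have L2 := cozero_limit (m := mu) c1 (fun=> ler01) cf f0.
  have := L2; rewrite integral_cst; last first.
    by apply: measurable_open; exact: open_cozero.
  rewrite mul1e => L3; apply: (cvg_unique _ L3) => //.
  apply: cvg_trans L1; apply: near_eq_cvg; near=> k.
  rewrite HS.
    by congr EFin; apply: eq_gint => x; rewrite mulr1.
  move=> x; apply: cvgM; last exact: cvg_cst.
  by apply: cont_min => y; apply: cvgM; [exact: cvg_cst|exact: cf].
have mE : @measurable _ (borel G) = <<s E>>.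
  apply/seteqP; split.
    apply: smallest_sub; first exact: smallest_sigma_algebra.
    move=> U oU.
    have [B cB [Bo Bb]] := @lie_second_countable R n G.
    (* Base sets that fit into a cozero set inside [U]. Numbering them by the injection [code]
       exhibits [U] as a countable union of cozero sets. *)
    pose D := [set V | B V /\ exists A, [/\ E A, V `<=` A & A `<=` U]].
    have cD : countable D by apply: (sub_countable _ cB); apply: subset_card_le => V [].
    have /countable_injP[code ci] := cD.
    have /choice[A hA] : forall k : nat, exists A : set (borel G),
        [/\ A = set0 \/ E A, A `<=` U & forall V, D V -> code V = k -> V `<=` A].
      move=> k; have [[V [DV cV]]|nV] := pselect (exists V, D V /\ code V = k).
        have [_ [A [EA VA AU]]] := DV; exists A; split; [by right|by []|].
        by move=> W DW cW; rewrite -(ci V W) ?inE// cV cW.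
      by exists set0; split=> [|//|W DW cW]; [left|exfalso; apply: nV; exists W].
    have -> : U = \bigcup_k A k.
      apply/seteqP; split; last by move=> x [k _ Ax]; have [_ AU _] := hA k; exact: AU.
      move=> x Ux; have [f [sf f0 fx fU]] := smooth_bump (open_nbhs_nbhs (conj oU Ux)).
      have cf := smooth_cont sf.
      have nf : nbhs x [set y | 0 < f y :> R].
        by apply: open_nbhs_nbhs; split=> //; exact: open_cozero.
      have [V [BV Vx] Vf] := Bb x _ nf.
      have DV : D V.
        split=> //; exists [set y | 0 < f y :> R]; split=> //; first by exists f.
        move=> y /= fy; apply: contrapT => nU; move: fy; rewrite (fU y nU) ltxx.
        by [].
      by exists (code V) => //; have [_ _ h] := hA (code V); exact: h DV erefl _ Vx.
    rewrite -[<<s E>>]/(@measurable _ (g_sigma_algebraType E)).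
    apply: bigcupT_measurable => k; have [[->|EA] _ _] := hA k; first exact: measurable0.
    exact: sub_sigma_algebra.
  apply: smallest_sub; first exact: sigma_algebra_measurable.
  by move=> A [f [cf f0 ->]]; apply: measurable_open; exact: open_cozero.
move=> A; rewrite mE; move: A.
apply: (@dynkin_induction _ (borel G) E
  (fun A => mu A = (\int[m]_(x in A) (S x)%:E)%E) mE) => //.
- move=> A B [f [cf f0 ->]] [g [cg g0 ->]]; exists (fun x => f x * g x); split.
  + by move=> x; apply: cvgM; [exact: cf|exact: cg].
  + by move=> x; rewrite mulr_ge0.
  + apply/seteqP; split=> x /=; first by case=> *; rewrite mulr_gt0.
    move=> h; split; rewrite lt_neqAle ?f0 ?g0 andbT eq_sym; apply/eqP => h0; move: h; rewrite h0 ?mul0r ?mulr0 ltxx.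
    by [].
    by [].
- by rewrite probability_setT.
- move=> A mA PA; rewrite probability_setC// PA one -(setUv A) ge0_integral_setU//=; last 4 first.
  + exact: measurableC.
  + by rewrite setUv.
  + by move=> x _; rewrite lee_fin.
  + by apply/disj_setPCl.
  by rewrite addeAC subee ?add0e// fS.
- move=> F mF tF HF.
  rewrite ge0_integral_bigcup//; last 2 first.
  + by apply: measurable_funTS.
  + by move=> x _; rewrite lee_fin.
  rewrite measure_semi_bigcup//; last exact: bigcupT_measurable.
  apply: eq_eseriesr => k _; exact: HF.
Unshelve. all: by end_near. Qed.

End Density.

Lemma big_fsub (I : choiceType) (V : nmodType) (A0 A : {fset I}) (Q : pred I) (F : I -> V) :
  (A0 `<=` A)%fset ->
  \sum_(i <- A | Q i) F i = \sum_(i <- A0 | Q i) F i + \sum_(i <- (A `\` A0)%fset | Q i) F i.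
Proof.
move=> sA; rewrite -big_cat /=; apply: perm_big; apply: uniq_perm.
- exact: fset_uniq.
- rewrite cat_uniq !fset_uniq andbT /=; apply/hasPn => x; rewrite inE => /andP[].
  by [].
- move=> x; rewrite mem_cat in_fsetD; have [xA0|] := boolP (x \in A0) => //=.
  exact: (fsubsetP sA).
Qed.

(** The Weierstrass test along finite subsets: a finite set nearly attaining the supremum of the
    dominating sums controls the tail for all [t] at once. *)
Lemma uniform_sum (R : realType) (I : choiceType) (D : set I) (T : Type)
  (a : T -> I -> R) (b : I -> R) (B : R) :
  (forall i, 0 <= b i) -> (forall t i, `|a t i| <= b i) ->
  (forall A : {fset I}, \sum_(i <- A | i \in D) b i <= B) ->
  exists S : T -> R, forall e, 0 < e -> exists A0 : {fset I}, forall A : {fset I},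
  (A0 `<=` A)%fset -> forall t, `|S t - \sum_(i <- A | i \in D) a t i| <= e.
Proof.
move=> b0 ab bB.
have tf : ProperFilter (@summability.totally I) by exact: summability.totally_filter.
pose V (A : {fset I}) := \sum_(i <- A | i \in D) b i.
pose W t (A : {fset I}) := \sum_(i <- A | i \in D) a t i.
have hs : has_sup (range V).
  by split; [exists (V fset0), fset0|exists B => _ [A _ <-]; exact: bB].
have tail e : 0 < e -> exists A0 : {fset I}, forall A, (A0 `<=` A)%fset ->
    forall t, `|W t A - W t A0| <= e.
  move=> e0; have [_ [A0 _ <-] hA0] := sup_adherent e0 hs.
  exists A0 => A sA t; rewrite /W (big_fsub _ _ sA) addrAC subrr add0r.
  apply: (le_trans (ler_norm_sum _ _ _)).
  apply: (@le_trans _ _ (V A - V A0)).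
    by rewrite /V (big_fsub _ _ sA) addrAC subrr add0r; apply: ler_sum => i _.
  have : V A <= sup (range V) by apply: ub_le_sup; [case: hs|exists A].
  lra.
have cv t : cvg (W t @ @summability.totally I).
  apply/cauchy_cvgP; apply: cauchy_exP => e e0.
  have e20 : 0 < e / 2 by rewrite divr_gt0.
  have [A0 hA0] := tail _ e20.
  exists (W t A0); exists A0 => // A /= sA; rewrite /ball/= distrC.
  by apply: le_lt_trans (hA0 A sA t) _; rewrite gtr_pMr// invf_lt1// ltr1n.
exists (fun t => lim (W t @ @summability.totally I)) => e e0.
have e30 : 0 < e / 3 by rewrite divr_gt0.
have [A0 hA0] := tail _ e30; exists A0 => A sA t.
have := cv t => /cvgrPdist_lt/(_ _ e30) [A1 _ hA1].
have := hA1 (A `|` A1)%fset (fsubsetUr _ _).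
have := hA0 (A `|` A1)%fset (fsubset_trans sA (fsubsetUl _ _)) t.
have := hA0 A sA t; rewrite -/(W t A).
set x := W t _; set y := W t A0; set z := W t _; set l := lim _.
rewrite !ler_norml ltr_norml => /andP[h1 h2] /andP[h3 h4] /andP[h5 h6].
by apply/andP; split; lra.
Qed.

Lemma has_sum_uniform (R : realType) (I : choiceType) (D : set I) (a : I -> R) (l : R) :
  (forall e, 0 < e -> exists A0 : {fset I}, forall A : {fset I},
  (A0 `<=` A)%fset -> `|l - \sum_(i <- A | i \in D) a i| <= e) -> has_sum D a l.
Proof.
have tf : ProperFilter (@summability.totally I) by exact: summability.totally_filter.
move=> H; apply/cvgrPdist_le => e e0; have [A0 hA0] := H e e0.
by exists A0.
Qed.

Section Uniform.
Context {R : realType} {n : nat} {G : lieGroupType R n} (cG : compact [set: G])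
 (haar : probability (borel G) R) (haarP : haar_probability haar).
Local Notation C := R[i].

Lemma cint_real (m : probability (borel G) R) (f : G -> R) :
  cint m (fun x => toC (f x)) = toC (gint m f).
Proof. by apply: C_eq => //=; rewrite gint_cst. Qed.

Lemma cont_uniform (S : G -> R) :
  (forall e, 0 < e -> exists2 F : G -> R, continuous F & forall x, `|S x - F x| <= e) ->
  continuous S.
Proof.
move=> H x; apply/cvgrPdist_lt => e e0.
have e30 : 0 < e / 3 by rewrite divr_gt0.
have [F cF hF] := H _ e30; near=> y.
have h1 := hF x; have h2 := hF y.
have h3 : `|F x - F y| < e / 3 by near: y; move: (cF x) => /cvgrPdist_lt; exact.
have -> : S x - S y = (S x - F x) + (F x - F y) - (S y - F y) by ring.
apply: (le_lt_trans (ler_normB _ _)); apply: (le_lt_trans (lerD (ler_normD _ _) (lexx _))).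
lra.
Unshelve. all: by end_near. Qed.

(** The integral against [h] is already equal to [c] for arbitrarily good uniform approximations of
    [Q], so it equals [c] in the limit. *)
Lemma cint_uniform (m : probability (borel G) R) (Q h : G -> C) (c : C) :
  ccont Q -> ccont h ->
  (forall e, 0 < e -> exists F : G -> C, [/\ ccont F, forall x, `|Re (Q x) - Re (F x)| <= e,
   forall x, `|Im (Q x) - Im (F x)| <= e & cint m (fun x => F x * h x) = c]) ->
  cint m (fun x => Q x * h x) = c.
Proof.
move=> cQ ch H.
have [K1 K10 hK1] := cont_bounded cG ch.1; have [K2 K20 hK2] := cont_bounded cG ch.2.
have small (x y : R) : (forall e, 0 < e -> `|x - y| <= e * (K1 + K2)) -> x = y.
  move=> h'; apply/eqP; rewrite -subr_eq0 -normr_le0; apply/ler_addgt0Pr => e e0.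
  have k0 : 0 < K1 + K2 + 1 by rewrite ltr_wpDl// addr_ge0.
  rewrite add0r; apply: (le_trans (h' (e / (K1 + K2 + 1)) _)); first by rewrite divr_gt0.
  by rewrite -mulrA ger_pMr// mulrC ler_pdivrMr// mul1r lerDl.
apply: C_eq; apply: small => e e0; have [F [cF h1 h2 <-]] := H e e0 => /=;
  have [a1 a2] := ccontM cQ ch; have [b1 b2] := ccontM cF ch.
  rewrite -gintB//; apply: (gint_norm_le cG); first exact: contB.
  move=> x; rewrite !ReM.
  have -> : Re (Q x) * Re (h x) - Im (Q x) * Im (h x) - (Re (F x) * Re (h x) - Im (F x) * Im (h x))
    = (Re (Q x) - Re (F x)) * Re (h x) - (Im (Q x) - Im (F x)) * Im (h x) by ring.
  apply: (le_trans (ler_normB _ _)); rewrite !normrM mulrDr.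
  by rewrite lerD// ler_pM.
rewrite -gintB//; apply: (gint_norm_le cG); first exact: contB.
move=> x; rewrite !ImM.
have -> : Re (Q x) * Im (h x) + Im (Q x) * Re (h x) - (Re (F x) * Im (h x) + Im (F x) * Re (h x))
  = (Im (Q x) - Im (F x)) * Re (h x) + (Re (Q x) - Re (F x)) * Im (h x) by ring.
apply: (le_trans (ler_normD _ _)); rewrite !normrM mulrDr.
by rewrite lerD// ler_pM.
Qed.

Lemma peter_weyl_unitary (h : G -> R) : continuous h ->
  (forall d (q : G -> 'M[C]_d), unitary_rep q -> irr q ->
   forall i j, cint haar (fun x => toC (h x) * q x i j) = 0) ->
  forall x, h x = 0.
Proof.
move=> ch H; apply: (peter_weyl cG haarP ch) => d p ip i j.
have [rp _ _] := ip; have [S uS up] := unitarize cG haarP rp.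
set q := fun x => S *m p x *m invmx S in up.
have iq : irr q by exact: irr_conj.
have cq k l : ccont (fun x => toC (h x) * q x k l).
  by apply: ccontM; [exact: ccont_real|exact: rep_ccont up.1 k l].
rewrite (eq_cint haar (g := fun x => \sum_k \sum_l (invmx S i k * S l j) * (toC (h x) * q x k l))).
  rewrite cint_sum//; last by move=> k; apply: ccont_sum => l; exact: ccontZ.
  apply: big1 => k _; rewrite cint_sum//; last by move=> l; exact: ccontZ.
  by apply: big1 => l _; rewrite cintZ// H// mulr0.
move=> x; have -> : p x = invmx S *m q x *m S.
  by rewrite /q !mulmxA mulVmx// mul1mx -mulmxA mulVmx// mulmx1.
rewrite mxE mulr_sumr exchange_big; apply: eq_bigr => l _.
rewrite mxE mulr_suml mulr_sumr; apply: eq_bigr => k _.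
by ring.
Qed.

Lemma conj_unitary d (q : G -> 'M[C]_d) : unitary_rep q -> unitary_rep (fun x => map_mx Num.conj (q x)).
Proof.
move=> [[q1 qM qc] qV]; split; last first.
  by move=> x; rewrite qV; apply/matrixP => i j; rewrite !mxE.
split.
- by rewrite q1 map_mx1.
- by move=> x y; rewrite qM map_mxM.
- move=> i j; have [c1 c2] := qc i j; split.
    by under eq_fun do rewrite mxE ReJ.
  by under eq_fun do rewrite mxE ImJ; move=> x; apply: cvgN; exact: c2.
Qed.

Lemma conj_irreducible d (q : G -> 'M[C]_d) : unitary_rep q -> irr q ->
  irr (fun x => map_mx Num.conj (q x)).
Proof.
move=> uq [rq d0 iq]; split=> // [|U HU]; first exact: (conj_unitary uq).1.
have := iq (map_mx Num.conj U); rewrite mxrank_map; apply => x.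
have -> : map_mx Num.conj U *m (q x)^T = map_mx Num.conj (U *m (map_mx Num.conj (q x))^T).
  rewrite map_mxM; congr (_ *m _).
  by apply/matrixP => i j; rewrite !mxE /= conjCK.
by rewrite map_submx; exact: HU.
Qed.

(* Peter-Weyl is applied to x |-> \int f (y x) (mu - S haar)(dy), whose Fourier
   coefficients vanish by Fubini. *)
Lemma gint_determined (mu : probability (borel G) R) (S : G -> R) : continuous S ->
  (forall d (q : G -> 'M[C]_d), unitary_rep q -> irr q ->
   forall i j, cint haar (fun x => toC (S x) * q x i j) = cint mu (fun x => q x i j)) ->
  forall f, continuous f -> gint mu f = gint haar (fun x => f x * S x).
Proof.
move=> cS H f cf.
pose h x := gint mu (fun y => f (y * x)%g) - gint haar (fun y => f (y * x)%g * S y).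
have cf2 : continuous (fun z : G * G => f (z.2 * z.1)%g).
  move=> z; apply: (@continuous_comp _ _ _ (fun z : G * G => (z.2 * z.1)%g) f); last exact: cf.
  by apply: contmul => z'; [exact: cvg_snd|exact: cvg_fst].
have cS2 : continuous (fun z : G * G => S z.2).
  by move=> z; apply: continuous_comp; [exact: cvg_snd|exact: cS].
have cfS : continuous (fun z : G * G => f (z.2 * z.1)%g * S z.2).
  by move=> z; apply: cvgM; [exact: cf2|exact: cS2].
have c1 := cont_param cG (mu := mu) cf2; have c2 := cont_param cG (mu := haar) cfS.
have ch : continuous h by move=> x; apply: cvgB; [exact: c1|exact: c2].
suff h0 : h 1%g = 0.
  have := h0; rewrite /h => /subr0_eq.
  rewrite (eq_gint mu (h := f)); last by move=> y; rewrite mulg1.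
  by move=> ->; apply: eq_gint => y; rewrite mulg1.
apply: (peter_weyl_unitary ch) => d q uq iq i j.
have rc := rep_ccont uq.1.
pose c k := cint haar (fun x => toC (f x) * q x k j).
have inner y : cint haar (fun x => toC (f (y * x)%g) * q x i j) = \sum_k c k * (q y k i)^*.
  rewrite -(cint_lmul cG haarP y^-1%g).
    rewrite (eq_cint haar (g := fun x => \sum_k (q y k i)^* * (toC (f x) * q x k j))).
      rewrite (cint_sum cG)//; last first.
        by move=> k; apply: ccontZ; apply: ccontM; [exact: ccont_real|exact: rc].
      apply: eq_bigr => k _; rewrite [RHS]mulrC -(cintZ cG); first by [].
      by apply: ccontM; [exact: ccont_real|exact: rc].
    move=> x; rewrite mulgA mulgV mul1g; have [_ qM _] := uq.1.
    rewrite qM uq.2 mxE mulr_sumr; apply: eq_bigr => k _.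
    by rewrite !mxE mulrCA.
  apply: ccontM; last exact: rc.
  by apply: ccont_real; exact: (cont_slice1 (y := y) cf2).
have qf m : cint m (fun y => cint haar (fun x => toC (f (y * x)%g) * q x i j)) =
    \sum_k c k * (cint m (fun y => q y k i))^*.
  rewrite (eq_cint m (g := fun y => \sum_k c k * (q y k i)^*))//.
  rewrite (cint_sum cG); last by move=> k; apply: ccontZ; apply: ccontJ; exact: rc.
  apply: eq_bigr => k _; rewrite (cintZ cG); last by apply: ccontJ; exact: rc.
  by rewrite (cintJ cG)//; exact: rc.
pose F1 (z : G * G) : C := toC (f (z.2 * z.1)%g) * q z.1 i j.
pose F2 (z : G * G) : C := toC (f (z.2 * z.1)%g * S z.2) * q z.1 i j.
have cq2 : ccont (fun z : G * G => q z.1 i j).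
  by apply: (ccont_comp (h := fst) (f := fun x => q x i j)); [move=> z; exact: cvg_fst|exact: rc].
have cF1 : ccont F1 by apply: ccontM => //; exact: ccont_real.
have cF2 : ccont F2 by apply: ccontM => //; exact: ccont_real.
have hE x : toC (h x) * q x i j =
    cint mu (fun y => F1 (x, y)) + (-1) * cint haar (fun y => F2 (x, y)).
  have e1 : cint mu (fun y => F1 (x, y)) = q x i j * toC (gint mu (fun y => f (y * x)%g)).
    rewrite -cint_real -(cintZ cG); last by apply: ccont_real; exact: (cont_slice2 (x := x) cf2).
    by apply: eq_cint => y; rewrite mulrC.
  have e2 : cint haar (fun y => F2 (x, y)) = q x i j * toC (gint haar (fun y => f (y * x)%g * S y)).
    rewrite -cint_real -(cintZ cG); last by apply: ccont_real; exact: (cont_slice2 (x := x) cfS).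
    by apply: eq_cint => y; rewrite mulrC.
  by rewrite e1 e2 /h rmorphB /=; ring.
rewrite (eq_cint haar hE) (cintD cG); last 2 first.
- exact: ccont_param.
- by apply: ccontZ; exact: ccont_param.
rewrite (cintZ cG); last exact: ccont_param.
rewrite !(cint_fubini cG)// qf.
rewrite (eq_cint haar (g := fun y => \sum_k c k * (toC (S y) * q y k i)^*)); last first.
  move=> y; rewrite (eq_cint haar (g := fun x => toC (S y) * (toC (f (y * x)%g) * q x i j))).
    rewrite (cintZ cG); last first.
      apply: ccontM; last exact: rc.
      by apply: ccont_real; exact: (cont_slice1 (y := y) cf2).
    rewrite inner mulr_sumr; apply: eq_bigr => k _; rewrite rmorphM /= mulrCA; congr (_ * (_ * _)).
    by apply: C_eq; rewrite ?ReJ ?ImJ//= oppr0.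
  by move=> x; rewrite /F2 /= rmorphM /= [X in X * _]mulrC -mulrA.
have cSq k : ccont (fun y => toC (S y) * q y k i).
  by apply: ccontM; [exact: ccont_real|exact: rc].
rewrite (cint_sum cG); last by move=> k; apply: ccontZ; exact: ccontJ.
rewrite mulN1r; apply/eqP; rewrite subr_eq0; apply/eqP; apply: eq_bigr => k _.
rewrite (cintZ cG); last exact: ccontJ.
by rewrite (cintJ cG)// H.
Qed.

End Uniform.

(** * The law of the Brownian motion and its Fourier series *)

Section Heat.
Context {R : realType} {n : nat} {G : lieGroupType R n} (X : 'I_n -> (G -> R) -> (G -> R))
 (bX : lie_basis X) (oX : forall i j : 'I_n, lie_inner X 'e_i 'e_j = (i == j)%:R)
 (cG : compact [set: G]) (haar : probability (borel G) R) (haarP : haar_probability haar)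
 (cn : connected [set: G]).
Local Notation C := R[i].

Section BrownianLaw.
Context {d : measure_display} {Omega : measurableType d}
 (P : probability Omega R) (xi : R -> Omega -> G) (HB : group_brownian_motion P X xi).

Lemma bm_law s : 0 <= s -> exists mu : probability (borel G) R,
  (forall A, mu A = P (xi s @^-1` A)) /\
  forall f : G -> R, continuous f -> gint mu f = \int[P]_w f (xi s w).
Proof.
move=> s0; have mx := bm_measurable HB s0.
pose xm := isMeasurableFun.Build _ _ _ _ (xi s : Omega -> borel G) mx.
pose xf : {mfun Omega >-> borel G} := HB.pack (xi s : Omega -> borel G) xm.
exists (distribution P xf); split=> // f cf.
rewrite /gint /Rintegral integral_distribution//.
  by apply/measurable_EFinP; exact: cont_measurable.
exact: (bm_integrable cG HB cf s0).
Qed.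

Lemma bm_rep (mu : probability (borel G) R) s m (p : G -> 'M[C]_m) (c : R) : 0 <= s ->
  (forall f : G -> R, continuous f -> gint mu f = \int[P]_w f (xi s w)) ->
  representation p -> casimir X p = (- toC c)%:M ->
  forall i j, cint mu (fun x => p x i j) = (i == j)%:R * toC (expR (- c * s / 2)).
Proof.
move=> s0 Hmu rp cas i j.
have [sR sI] := rep_smooth cG haarP rp i j.
have lap x : \sum_k cD X 'e_k (cD X 'e_k (fun y => p y i j)) x = - toC c * p x i j.
  transitivity (\sum_l p x i l * (casimir X p) l j).
    under eq_bigr do rewrite (rep_DD bX cG haarP rp).
    rewrite exchange_big; apply: eq_bigr => l _.
    by rewrite -mulr_sumr /casimir summxE.
  rewrite cas (bigD1 j)//= big1 => [|l lj]; last by rewrite mxE (negbTE lj) mulr0n mulr0.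
  by rewrite mxE eqxx mulr1n addr0 mulrC.
have frame (f : G -> R) k : frame_vf X 'e_k f = X k f.
  by apply/funext => x; rewrite frame_delta.
have lR x : \sum_(k < n) X k (X k (fun y => Re (p y i j))) x = - c * Re (p x i j).
  have := congr1 Re (lap x); rewrite Re_sum ReM /= oppr0 mul0r subr0 => <-.
  by apply: eq_bigr => k _; rewrite /cD /= !frame.
have lI x : \sum_(k < n) X k (X k (fun y => Im (p y i j))) x = - c * Im (p x i j).
  have := congr1 Im (lap x); rewrite Im_sum ImM /= oppr0 mul0r addr0 => <-.
  by apply: eq_bigr => k _; rewrite /cD /= !frame.
have p1 : p 1%g i j = (i == j)%:R by case: rp => -> _ _; rewrite mxE.
have [cR cI] := rep_ccont rp i j.
apply: C_eq => /=.
  rewrite Hmu// (dynkin_eigen bX cG HB sR lR s0) p1.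
  by rewrite ReM /=; case: (i == j); rewrite /= ?mul1r ?mul0r ?subr0 ?mulr0 ?subr0.
rewrite Hmu// (dynkin_eigen bX cG HB sI lI s0) p1.
by rewrite ImM /=; case: (i == j); rewrite /= ?mul1r ?mul0r ?addr0 ?mulr0 ?addr0.
Qed.

End BrownianLaw.

Lemma unitary_diag m (p : G -> 'M[C]_m) x i : unitary_rep p ->
  `|Re (p x i i)| <= 1 /\ `|Im (p x i i)| <= 1.
Proof.
move=> [rp up].
have := rep_mulV x rp; rewrite up => /matrixP/(_ i i); rewrite !mxE eqxx => /(congr1 Re).
rewrite Re_sum (bigD1 i)//= => h.
have h1 : Re (p x i i) ^+ 2 + Im (p x i i) ^+ 2 <= 1.
  move: h; rewrite !mxE ReM ReJ ImJ mulrN opprK -!expr2 => h.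
  rewrite -[leRHS]h lerDl; apply: sumr_ge0 => k _.
  by rewrite !mxE ReM ReJ ImJ mulrN opprK -!expr2 addr_ge0 ?sqr_ge0.
have a0 := sqr_ge0 (Re (p x i i)); have b0 := sqr_ge0 (Im (p x i i)).
split; rewrite -(expr_le1 (n := 2))// -normrX ger0_norm//; lra.
Qed.

Context (T : set G) (HT : maximal_torus T) (t : {vspace 'rV[R]_n}) (Ht : lie_algebra_of X T t)
 (Sigma : set (dual t)) (HSigma : positive_roots X Sigma) (s : R) (s0 : 0 < s).
Local Notation idim := (irrep_dim X Sigma).
Local Notation ichar := (irrep_char X Sigma).
Local Notation cv := (casimir_value X Sigma).
Local Notation heat := (heat_term X Sigma s).
Local Notation dom := (dominant_integral X Sigma).
Let e la : R := expR (- cv la * s / 2).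
Implicit Types (la mu : dual t) (g : G).

Lemma heatE la g : heat g la = toC ((idim la)%:R * e la) * ichar la g.
Proof. by rewrite /heat_term rmorphM /= rmorph_nat mulrAC. Qed.

Lemma heat_bound la g : `|Re (heat g la)| <= (idim la)%:R ^+ 2 * e la /\
  `|Im (heat g la)| <= (idim la)%:R ^+ 2 * e la.
Proof.
have h0 : 0 <= (idim la)%:R * e la by rewrite mulr_ge0 ?expR_ge0.
have [d0|[p [up _ _ hp]]] := irrep_cases X cG haarP Sigma la.
  by rewrite heatE d0 mul0r rmorph0 mul0r normr0 expr0n mul0r.
have -> : (idim la)%:R ^+ 2 * e la = (idim la)%:R * e la * (idim la)%:R by ring.
rewrite heatE -hp; set a := (idim la)%:R * e la in h0 *.
rewrite ReM ImM !Re_toC !Im_toC !mul0r subr0 addr0 !(normrM a) (ger0_norm h0).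
have b (f : C -> R) : (forall I (r : seq I) (P : pred I) (F : I -> C),
    f (\sum_(i <- r | P i) F i) = \sum_(i <- r | P i) f (F i)) ->
    (forall i, `|f (p g i i)| <= 1) -> `|f (\tr (p g))| <= (idim la)%:R.
  move=> fs fb; rewrite /mxtrace fs; apply: (le_trans (ler_norm_sum _ _ _)).
  by apply: (le_trans (ler_sum _ (fun i _ => fb i))); rewrite sumr_const card_ord.
by split; rewrite ler_wpM2l//; apply: b => [I r Q F|i]; rewrite ?Re_sum ?Im_sum//; have [] := unitary_diag g i up.
Qed.

Lemma heat_ccont la : ccont (fun g => heat g la).
Proof.
apply: (ccont_eq (f := fun g => toC ((idim la)%:R * e la) * ichar la g)).
  by move=> g; rewrite heatE.
have [d0|[p [up _ _ hp]]] := irrep_cases X cG haarP Sigma la.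
  apply: (ccont_eq (f := fun=> 0)); last exact: ccont_cst.
  by move=> g; rewrite d0 mul0r rmorph0 mul0r.
apply: ccontZ; apply: (ccont_eq hp); apply: mcont_tr; exact: rep_mcont up.1.
Qed.

(** Weights with [idim] zero contribute nothing. The remaining ones in [A] form a finite family of
    inequivalent irreducible representations, and [weyl_sum] bounds all such families alike. *)
Lemma heat_summable : exists B : R, forall A : {fset dual t},
  \sum_(la <- A | la \in dom) (idim la)%:R ^+ 2 * e la <= B.
Proof.
have [B _ HB] := weyl_sum bX cG haarP s0; exists B => A.
have b0 la : 0 <= (idim la)%:R ^+ 2 * e la by rewrite mulr_ge0 ?sqr_ge0 ?expR_ge0.
pose J := [fset la in A | idim la != 0%N]%fset.
have HJ (i : J) : exists p : G -> 'M[C]_(idim (val i)),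
    [/\ unitary_rep p, irr p & highest_weight X Sigma p (val i)].
  have : idim (val i) != 0%N by have := valP i; rewrite !inE => /andP[].
  have [->//|[p [up ip hp _]] _] := irrep_cases X cG haarP Sigma (val i).
  by exists p.
pose p i := projT1 (cid (HJ i)).
have pP i : [/\ unitary_rep (p i), irr (p i) &
    highest_weight X Sigma (p i) (val i)] by exact: projT2 (cid (HJ i)).
apply: (@le_trans _ _ (\sum_(la <- A | idim la != 0%N) (idim la)%:R ^+ 2 * e la)).
  rewrite [leLHS]big_mkcond [leRHS]big_mkcond; apply: ler_sum => la _.
  have [d0|] := eqVneq (idim la) 0%N; first by rewrite d0 expr0n mul0r; case: ifP.
  by move=> _ /=; case: ifP.
rewrite big_fset_condE -/J big_seq_fsetE /=.
apply: (HB J (fun i => idim (val i)) p (fun i => cv (val i))).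
  split.
  - by move=> i; have [] := pP i.
  - by move=> i; have [] := pP i.
  - move=> i; have [u ii h] := pP i.
    by have [] := casimir_valueE bX oX cG haarP cn HT Ht HSigma u ii h.
  - move=> i j ij M iM; have [u1 i1 h1] := pP i; have [u2 i2 h2] := pP j.
    by apply: (irrep_distinct bX oX cG haarP HT Ht HSigma u1 u2 i1 i2 h1 h2 _ iM); rewrite (inj_eq val_inj).
move=> i; have [u ii h] := pP i.
by have [] := casimir_valueE bX oX cG haarP cn HT Ht HSigma u ii h.
Qed.

Lemma heat_fourier (A : {fset dual t}) m (q : G -> 'M[C]_m) mu : unitary_rep q ->
  irr q -> dom mu -> idim mu = m ->
  (forall g, \tr (q g) = ichar mu g) -> mu \in A ->
  forall i j, cint haar (fun g => (\sum_(la <- A | la \in dom) heat g la) * (q g i j)^*) =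
  (i == j)%:R * toC (e mu).
Proof.
move=> uq iq dmu dm trq muA i j.
have [_ m0 _] := iq.
have cq : ccont (fun g => (q g i j)^*) by apply: ccontJ; exact: rep_ccont uq.1 i j.
have cI la : ccont (fun g => heat g la * (q g i j)^*) by apply: ccontM => //; exact: heat_ccont.
rewrite (eq_cint haar (g := fun g => \sum_(la <- [seq la <- A | la \in dom]) heat g la * (q g i j)^*)); last first.
  by move=> g; rewrite big_filter mulr_suml.
rewrite (cint_sum cG)// (bigD1_seq mu)/=; last 2 first.
- by rewrite mem_filter muA andbT; apply/asboolP.
- by apply: filter_uniq; exact: fset_uniq.
rewrite big1_seq ?addr0; last first.
  move=> la /andP[lamu _].
  have [d0|[p [up ip hp trp]]] := irrep_cases X cG haarP Sigma la.
    rewrite (eq_cint haar (g := fun=> 0)) ?cint_cst// => g.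
    by rewrite heatE d0 mul0r rmorph0 !mul0r.
  have [dmu0|[p' [up' ip' hp' trp']]] := irrep_cases X cG haarP Sigma mu.
    by have := m0; rewrite -[m in (0 < m)%N]dm dmu0.
  (* [q] has the character of the representation chosen for [mu]. A nonzero intertwiner from [q] to
     [p] would equate this character with that of [p], although the two are orthogonal and of norm
     1. *)
  have nz M : intertwines q p M -> M = 0.
    move=> iM; apply/eqP/negPn/negP => M0.
    have tr := intertwines_trace iq ip iM M0.
    have z : cint haar (fun x => \tr (p x) * (\tr (p' x))^*) = 0.
      apply: (char_orth cG haarP up up' ip ip') => N.
      by apply: (irrep_distinct bX oX cG haarP HT Ht HSigma up' up ip' ip hp' hp); rewrite eq_sym.
    have := char_norm cG haarP up' ip'.
    rewrite (eq_cint haar (g := fun x => \tr (p x) * (\tr (p' x))^*)) ?z => [/esym/eqP|x].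
      by rewrite oner_eq0.
    by rewrite -tr trp' trq.
  rewrite (eq_cint haar (g := fun g => \sum_k toC ((idim la)%:R * e la) * (p g k k * (q g i j)^*))); last first.
    by move=> g; rewrite heatE -trp /mxtrace -mulrA mulr_suml mulr_sumr.
  have cp k : ccont (fun g => p g k k * (q g i j)^*) by apply: ccontM => //; exact: (rep_ccont up.1 k k).
  rewrite (cint_sum cG); last by move=> k; exact: ccontZ.
  by apply: big1 => k _; rewrite (cintZ cG)// (orthogonality cG haarP up uq ip iq nz) mulr0.
rewrite (eq_cint haar (g := fun g => \sum_k toC ((idim mu)%:R * e mu) * (q g k k * (q g i j)^*))); last first.
  by move=> g; rewrite heatE -trq /mxtrace -mulrA mulr_suml mulr_sumr.
have cp k : ccont (fun g => q g k k * (q g i j)^*) by apply: ccontM => //; exact: (rep_ccont uq.1 k k).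
rewrite (cint_sum cG); last by move=> k; exact: ccontZ.
rewrite (bigD1 i)//= big1 ?addr0 => [|k ki]; last first.
  by rewrite (cintZ cG)// (orthogonality_self cG haarP uq iq) (negbTE ki) mul0r mulr0.
rewrite (cintZ cG)// (orthogonality_self cG haarP uq iq) eqxx /= dm rmorphM /= rmorph_nat.
have mz : (m%:R : C) != 0 by rewrite pnatr_eq0 -lt0n.
by field.
Qed.

(* The conjugate of an irreducible representation is irreducible, so the Fourier
   coefficients against q and against its conjugate are both known; this forces the
   imaginary part S' of the sum to vanish. *)
Lemma heat_kernel (mu : probability (borel G) R) :
  (forall m (p : G -> 'M[C]_m) (c : R), representation p -> casimir X p = (- toC c)%:M ->
   forall i j, cint mu (fun x => p x i j) = (i == j)%:R * toC (expR (- c * s / 2))) ->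
  exists S : G -> R, [/\ continuous S, forall x, 0 <= S x,
  forall g, has_csum dom (fun la => heat g la) (toC (S g)) &
  forall f : G -> R, continuous f -> gint mu f = gint haar (fun x => f x * S x)].
Proof.
move=> Hmu; have [B HB] := heat_summable.
have b0 la : 0 <= (idim la)%:R ^+ 2 * e la by rewrite mulr_ge0 ?sqr_ge0 ?expR_ge0.
have [S HS] := uniform_sum b0 (fun g la => (heat_bound la g).1) HB.
have [S' HS'] := uniform_sum b0 (fun g la => (heat_bound la g).2) HB.
pose F (A : {fset dual t}) g : C := \sum_(la <- A | la \in dom) heat g la.
have cF A : ccont (F A).
  apply: (ccont_eq (f := fun g => \sum_(la <- [seq la <- A | la \in dom]) heat g la)).
    by move=> g; rewrite big_filter.
  by apply: ccont_sum => la; exact: heat_ccont.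
have cS : continuous S.
  apply: cont_uniform => r r0; have [A0 hA] := HS r r0.
  exists (fun g => Re (F A0 g)); first exact: (cF A0).1.
  by move=> x; rewrite Re_sum; exact: hA.
have cS' : continuous S'.
  apply: cont_uniform => r r0; have [A0 hA] := HS' r r0.
  exists (fun g => Im (F A0 g)); first exact: (cF A0).2.
  by move=> x; rewrite Im_sum; exact: hA.
pose Q g : C := Complex (S g) (S' g).
have cQ : ccont Q by [].
have four m (q : G -> 'M[C]_m) : unitary_rep q -> irr q ->
    forall i j, cint haar (fun g => Q g * (q g i j)^*) = cint mu (fun g => (q g i j)^*).
  move=> uq iq i j.
  have [la [dla idla trla cas]] := irrep_complete bX oX cG haarP cn HT Ht HSigma uq iq.
  have cq := rep_ccont uq.1 i j.
  rewrite (cintJ cG)// (Hmu _ _ _ uq.1 cas).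
  have -> : ((i == j)%:R * toC (expR (- cv la * s / 2)))^* = (i == j)%:R * toC (e la) :> C.
    by apply: C_eq; rewrite ?ReJ ?ImJ /e; case: (i == j); rewrite ?mul1r ?mul0r//= oppr0.
  apply: (cint_uniform cG cQ (ccontJ cq)) => r r0.
  have [A1 h1] := HS r r0; have [A2 h2] := HS' r r0.
  pose A := (la |` (A1 `|` A2))%fset.
  have s1 : (A1 `<=` A)%fset by apply: (fsubset_trans (fsubsetUl A1 A2)); exact: fsubsetUr.
  have s2 : (A2 `<=` A)%fset by apply: (fsubset_trans (fsubsetUr A1 A2)); exact: fsubsetUr.
  exists (F A); split.
  - exact: cF.
  - by move=> x; rewrite Re_sum; exact: h1.
  - by move=> x; rewrite Im_sum; exact: h2.
  - by apply: heat_fourier => //; rewrite !inE eqxx.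
have four1 m (q : G -> 'M[C]_m) : unitary_rep q -> irr q ->
    forall i j, cint haar (fun g => Q g * q g i j) = cint mu (fun g => q g i j).
  move=> uq iq i j.
  have := four _ _ (conj_unitary uq) (conj_irreducible uq iq) i j.
  rewrite (eq_cint haar (g := fun g => Q g * q g i j)); last by move=> g; rewrite mxE /= conjCK.
  by move=> ->; apply: eq_cint => g; rewrite mxE /= conjCK.
have four2 m (q : G -> 'M[C]_m) : unitary_rep q -> irr q ->
    forall i j, cint haar (fun g => (Q g)^* * q g i j) = cint mu (fun g => q g i j).
  move=> uq iq i j; have cq := rep_ccont uq.1 i j.
  have := congr1 Num.conj (four _ _ uq iq i j).
  rewrite -!(cintJ cG); last 2 first.
  - exact: ccontJ.
  - by apply: ccontM => //; exact: ccontJ.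
  rewrite (eq_cint haar (g := fun g => (Q g)^* * q g i j)); last by move=> g; rewrite rmorphM /= conjCK.
  by move=> ->; apply: eq_cint => g; rewrite conjCK.
have S'0 : forall x, S' x = 0.
  apply: (peter_weyl_unitary cG haarP cS') => m q uq iq i j.
  have cq := rep_ccont uq.1 i j.
  (* The imaginary part is (Q - conj Q) / (2i), and the coefficients of [Q] and of its conjugate
     agree. *)
  rewrite (eq_cint haar (g := fun g => Complex 0 (- 2^-1) * (Q g * q g i j) +
      Complex 0 2^-1 * ((Q g)^* * q g i j))).
    rewrite (cintD cG); last 2 first.
    - by apply: ccontZ; apply: ccontM.
    - by apply: ccontZ; apply: ccontM => //; exact: ccontJ.
    rewrite !(cintZ cG); last 2 first.
    - by apply: ccontM => //; exact: ccontJ.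
    - by apply: ccontM.
    rewrite four1// four2// -mulrDl (_ : _ + _ = 0) ?mul0r//.
    by apply: C_eq; rewrite ?ReD ?ImD /= ?addr0// addNr.
  move=> g; rewrite !mulrA -mulrDl; congr (_ * _).
  by apply: C_eq; rewrite ?(ReD, ImD, ReM, ImM, ReJ, ImJ) /=; field.
have fS m (q : G -> 'M[C]_m) : unitary_rep q -> irr q ->
    forall i j, cint haar (fun x => toC (S x) * q x i j) = cint mu (fun x => q x i j).
  move=> uq iq i j; rewrite -four1//; apply: eq_cint => g; congr (_ * _).
  by rewrite /Q S'0.
have gS := gint_determined cG haarP cS fS.
exists S; split=> //.
(* The negative part of [S] serves as test function: its integral against [mu] is nonnegative, yet
   equal to minus the integral of its square, so it vanishes identically. *)
- have cm : continuous (fun x => Num.max (- S x) 0).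
    rewrite (_ : (fun x => _) = fun x => - Num.min 0 (S x)).
      by move=> x; apply: cvgN; exact: cont_min.
    by apply/funext => x; rewrite oppr_min oppr0 maxC.
  have cm2 : continuous (fun x => Num.max (- S x) 0 ^+ 2).
    by move=> x; apply: cvgM; exact: cm.
  have z : gint haar (fun x => Num.max (- S x) 0 ^+ 2) = 0.
    apply/eqP; rewrite eq_le; apply/andP; split; last by apply: gint_ge0 => x; exact: sqr_ge0.
    have := gS _ cm.
    have -> : gint haar (fun x => Num.max (- S x) 0 * S x) = - gint haar (fun x => Num.max (- S x) 0 ^+ 2).
      rewrite -mulN1r -(gintZ cG)//; apply: eq_gint => x.
      by have [h|h] := leP 0 (- S x); ring.
    move=> h; rewrite -oppr_ge0 -h; apply: gint_ge0 => x.
    by rewrite le_max lexx orbT.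
  move=> x; have /eqP := gint_eq0 cG haarP cm2 (fun x => sqr_ge0 _) z x.
  rewrite sqrf_eq0 => /eqP h; rewrite -oppr_le0 -h.
  by rewrite le_max lexx.
- move=> g; split=> /=; apply: has_sum_uniform => r r0.
    by have [A0 h] := HS r r0; exists A0 => A sA; exact: h.
  by have [A0 h] := HS' r r0; exists A0 => A sA; have := h A sA g; rewrite S'0.
Qed.

End Heat.

Theorem proposition2 (R : realType) (n : nat) (G : lieGroupType R n)
    (Gcompact : compact [set: G]) (Gconnected : connected [set: G])
    (Gsc : simply_connected R G)
    (X : 'I_n -> (G -> R) -> (G -> R)) (HX : orthonormal_basis X)
    (T : set G) (HT : maximal_torus T)
    (t : {vspace 'rV[R]_n}) (Ht : lie_algebra_of X T t)
    (Sigma : set (dual t)) (HSigma : positive_roots X Sigma)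
    (haar : probability (borel G) R) (Hhaar : haar_probability haar)
    (d : measure_display) (Omega : measurableType d) (P : probability Omega R)
    (Pkill : R -> {measure set Omega -> \bar R}) (xi : R -> Omega -> G)
    (Hxi : wrapped_brownian_motion P X (2^-1 * dual_normsq X (rho Sigma))
             Pkill xi)
    (s : R) (s_gt0 : 0 < s) :
  exists p : G -> R,
    [/\ forall g, has_csum (dominant_integral X Sigma)
                    (heat_term X Sigma s g) (real_complex R (p g)),
        measurable_fun [set: borel G] (p : borel G -> R),
        forall A : set (borel G), measurable A ->
          P (xi s @^-1` A) = (\int[haar]_(g in A) (p g)%:E)%E &
        forall f : G -> R, smooth_fun f ->
          ('E_P[fun w => f (xi s w)] = \int[haar]_g (f g * p g)%:E)%E].
Proof.
have [bX oX] := HX; have [HB _] := Hxi; have s0 := ltW s_gt0.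
have [mu [muP muE]] := bm_law Gcompact HB s0.
have [S [cS S0 sumS gS]] := heat_kernel bX oX Gcompact Hhaar Gconnected HT Ht HSigma s_gt0
  (fun m p c rp cas => bm_rep bX Gcompact Hhaar HB s0 muE rp cas).
exists S; split.
- by move=> g; exact: sumS.
- exact: cont_measurable.
- by move=> A mA; rewrite -muP; exact: density_of_gint gS A mA.
- move=> f sf; have cf := smooth_cont sf.
  have cfS : continuous (fun g => f g * S g) by move=> g; apply: cvgM; [exact: cf|exact: cS].
  rewrite -(gintE Gcompact haar cfS) -gS// muE// unlock /Rintegral fineK//.
  by apply: integrable_fin_num => //; exact: (bm_integrable Gcompact HB cf s0).
Qed.
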